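(* Let $T>0$, $\alpha\in(0,1)$, and let $n,m,d\ge1$. There is an integer $k\ge1$ such that the following holds. Let $b:[0,T]\times\mathbb{R}^n\to\mathbb{R}^n$, $\sigma:[0,T]\times\mathbb{R}^n\to\mathbb{R}^{n\times d}$, $\psi:[0,T]\times\mathbb{R}^n\times\mathbb{R}^n\to\mathbb{R}^m$ and $g:\Delta[0,T]\times\mathbb{R}^n\times\mathbb{R}^n\times\mathbb{R}^m\times\mathbb{R}^{m\times d}\to\mathbb{R}^m$ be bounded and $k$ times continuously differentiable in all variables with bounded derivatives up to order $k$, and suppose there is $\bar\sigma>0$ such that $$|\sigma(s,x)^\top\xi|^2\ge\bar\sigma|\xi|^2,\qquad\forall(s,x,\xi)\in[0,T]\times\mathbb{R}^n\times\mathbb{R}^n.$$ Then the system $$\begin{cases}\Theta_s(t,s,\xi,x)+\frac12\sigma(s,x)^\top\Theta_{xx}(t,s,\xi,x)\sigma(s,x)+\Theta_x(t,s,\xi,x)b(s,x)\\ \qquad+g\big(t,s,\xi,x,\Theta(s,s,x,x),\Theta_x(t,s,\xi,x)\sigma(s,x)\big)=0,\quad(t,s,\xi,x)\in\Delta[0,T]\times\mathbb{R}^n\times\mathbb{R}^n,\\ \Theta(t,T,\xi,x)=\psi(t,\xi,x),\quad(t,\xi,x)\in[0,T]\times\mathbb{R}^n\times\mathbb{R}^n,\end{cases}$$ admits a unique classical solution $\Theta$ with $\Theta(t,\cdot,\xi,\cdot)\in C^{1+\frac\alpha2,2+\alpha}([t,T]\times\mathbb{R}^n)$ for every $(t,\xi)\in[0,T)\times\mathbb{R}^n$,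 and for some constant $K>0$, $$\sup_{(t,\xi)\in[0,T]\times\mathbb{R}^n}|\Theta(t,\cdot,\xi,\cdot)|^{(2+\alpha)}_{[t,T]\times\mathbb{R}^n}\le K\Big(1+\sup_{(t,\xi)\in[0,T]\times\mathbb{R}^n}|\psi(t,\xi,\cdot)|^{(2+\alpha)}_{\mathbb{R}^n}\Big).$$ Moreover, if $\widehat\Theta$ is the solution of the same system with $(\psi,g)$ replaced by a pair $(\widehat\psi,\widehat g)$ satisfying the same hypotheses (with the same $b,\sigma$), then for some constant $K>0$, $$\sup_{(t,\xi)\in[0,T]\times\mathbb{R}^n}|\Theta(t,\cdot,\xi,\cdot)-\widehat\Theta(t,\cdot,\xi,\cdot)|^{(2+\alpha)}_{[t,T]\times\mathbb{R}^n}\le K\sup_{(t,\xi)\in[0,T]\times\mathbb{R}^n}\Big(|\psi(t,\xi,\cdot)-\widehat\psi(t,\xi,\cdot)|^{(2+\alpha)}_{\mathbb{R}^n}+|g(t,\cdot,\xi,\cdot)-\widehat g(t,\cdot,\xi,\cdot)|^{(\alpha)}_{[t,T]\times\mathbb{R}^n}\Big),$$ where, on the right-hand side, $$g(t,s,\xi,x)=g\big(t,s,\xi,x,\Theta(s,s,x,x),\Theta_x(t,s,\xi,x)\sigma(s,x)\big),\quad \widehat g(t,s,\xi,x)=\widehat g\big(t,s,\xi,x,\Theta(s,s,x,x),\Theta_x(t,s,\xi,x)\sigma(s,x)\big)$$ for $(t,s,\xi,x)\in\Delta[0,T]\times\mathbb{R}^n\times\mathbb{R}^n$.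
   Context: $\Delta[0,T]=\{(t,s)\in[0,T]^2:0\le t\le s\le T\}$. For $\Theta=(\Theta^1,\dots,\Theta^m)^\top$ and $\sigma=(\sigma_1,\dots,\sigma_d)$ (columns), $\sigma^\top\Theta_{xx}\sigma\in\mathbb{R}^m$ has $i$-th component $\sum_{k=1}^d\sigma_k^\top\Theta^i_{xx}\sigma_k$; $\Theta_x$ is the Jacobian in the last variable and $\Theta_s$ the derivative in the second variable. A classical solution is a function having the derivatives appearing in the equation, continuous in $(s,x)$ for each $(t,\xi)$, and satisfying the equations pointwise. Hölder norms: for a (scalar or vector valued) function $\varphi$ on $[S,T]\times\mathbb{R}^n$ and $\alpha\in(0,1)$, put $|\varphi|^{(0)}=\|\varphi\|_{L^\infty([S,T]\times\mathbb{R}^n)}$, $|\varphi|^{(1)}=|\varphi|^{(0)}+|\varphi_x|^{(0)}$, $|\varphi|^{(2)}=|\varphi|^{(1)}+|\varphi_s|^{(0)}+|\varphi_{xx}|^{(0)}$; for $\beta\in(0,1)$ $$\langle\varphi\rangle_s^{(\beta)}=\sup_{s\ne s',\,x}\frac{|\varphi(s,x)-\varphi(s',x)|}{|s-s'|^\beta},\qquad \langle\varphi\rangle_x^{(\alpha)}=\sup_{s,\;0<|x-x'|\le1}\frac{|\varphi(s,x)-\varphi(s,x')|}{|x-x'|^\alpha},$$ $\langle\varphi\rangle^{(\alpha)}=\langle\varphi\rangle_s^{(\alpha/2)}+\langle\varphi\rangle_x^{(\alpha)}$, $|\varphi|^{(\alpha)}=|\varphi|^{(0)}+\langle\varphi\rangle^{(\alpha)}$,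 and $$|\varphi|^{(2+\alpha)}=|\varphi|^{(2)}+\langle\varphi_s\rangle^{(\alpha)}+\langle\varphi_{xx}\rangle^{(\alpha)}+\langle\varphi_x\rangle_s^{(\frac{1+\alpha}2)}.$$ A subscript such as $[S,T]\times\mathbb{R}^n$ indicates the domain; for functions $h$ of $x\in\mathbb{R}^n$ only, $|h|^{(2+\alpha)}_{\mathbb{R}^n}$ is the same quantity with $h$ regarded as independent of $s$. $C^{1+\frac\alpha2,2+\alpha}([S,T]\times\mathbb{R}^n)$ is the set of $\varphi$ with $|\varphi|^{(2+\alpha)}_{[S,T]\times\mathbb{R}^n}<\infty$. *)

(* Defs.v *)
From HB Require Import structures.
From mathcomp Require Import all_boot all_order all_algebra.
From mathcomp Require Import all_classical all_reals all_analysis.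
Set Implicit Arguments.
Unset Strict Implicit.
Unset Printing Implicit Defensive.
Import Order.TTheory GRing.Theory Num.Theory.
Import numFieldNormedType.Exports.

Local Open Scope classical_set_scope.
Local Open Scope ring_scope.

(* Euclidean (Frobenius) norm; the norm `|A| of the library on matrices is the
   maximum norm. *)
Definition enorm (R : realType) (p q : nat) (A : 'M[R]_(p, q)) : R :=
  Num.sqrt (\sum_(i < p) \sum_(j < q) A i j ^+ 2).

Definition Delta (R : realType) (T : R) : set (R * R) :=
  [set p | [/\ 0 <= p.1, p.1 <= p.2 & p.2 <= T]].

(* [Cb k D f]: f is bounded and k times continuously differentiable on the
   set D, with bounded derivatives up to order k. The set D is meant to be
   convex with nonempty interior: the derivatives are taken in the interior,
   and they have to extend to bounded continuous functions on D. Ranging over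
   all directions v amounts to ranging over the coordinate directions, and
   iterating gives all the mixed partial derivatives. *)
Fixpoint Cb (R : realType) (V W : normedModType R) (k : nat) (D : set V)
    (f : V -> W) : Prop :=
  [/\ {within D, continuous f}, [bounded f x | x in D] &
      if k is k'.+1 then
        forall v : V, exists2 f' : V -> W,
          (forall x, D° x -> is_derive x v f (f' x)) & Cb k' D f'
      else True].

Section SpaceDerivatives.
Variables (R : realType) (n m : nat).
Implicit Types (h : 'cV[R]_n -> 'cV[R]_m) (x : 'cV[R]_n).

Definition dir (j : 'I_n) : 'cV[R]_n := delta_mx j 0.

Definition jac h x : 'M[R]_(m, n) :=
  \matrix_(i < m, j < n) 'D_(dir j) h x i 0.

(* Hessian matrix of the i-th component of h. *)
Definition hess h x (i : 'I_m) : 'M[R]_n :=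
  \matrix_(j < n, l < n) 'D_(dir j) ('D_(dir l) h) x i 0.

(* All the second derivatives of h, the i-th row being the vectorized Hessian
   of the i-th component; its Frobenius norm is the Euclidean norm of the
   family of all second derivatives. *)
Definition d2 h x : 'M[R]_(m, n * n) := \matrix_(i < m) mxvec (hess h x i).

(* The vector written sigma^T h_xx sigma. *)
Definition quad (d : nat) (A : 'M[R]_(n, d)) h x : 'cV[R]_m :=
  \col_(i < m) \sum_(l < d) ((col l A)^T *m hess h x i *m col l A) 0 0.

Definition derivable2 h x : Prop :=
  (forall j, derivable h x (dir j)) /\
  (forall j l, derivable ('D_(dir l) h) x (dir j)).

End SpaceDerivatives.

Section TimeDerivative.
Variables (R : realType) (W : normedModType R).

Definition dquot (f : R -> W) (s s' : R) : W := (s' - s)^-1 *: (f s' - f s).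

(* Derivative at s relative to the interval [S, T], hence one-sided at the end
   points when S < T. When S = T there is no time variable, and f is regarded
   as independent of it: derivability is vacuous, and the derivative is 0. *)
Definition derivable_in (S T : R) (f : R -> W) (s : R) : Prop :=
  cvg (dquot f s @ within `[S, T] s^').

Definition derive_in (S T : R) (f : R -> W) (s : R) : W :=
  if S < T then lim (dquot f s @ within `[S, T] s^') else 0.

End TimeDerivative.

Section HolderNorms.
Variables (R : realType) (n : nat).
Local Open Scope ereal_scope.

(* Supremum of a set of nonnegative values, equal to 0 for the empty set. *)
Definition nnsup (A : set \bar R) : \bar R := ereal_sup (0 |` A).

Section Seminorms.
Variables (p q : nat) (S T : R) (phi : R -> 'cV[R]_n -> 'M[R]_(p, q)).

(* For the continuous functions to which it is applied, the supremum over
   [S, T] x R^n is the L^oo norm if S < T; if S = T, it is the one of a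
   function of x alone. *)
Definition norm_sup : \bar R :=
  nnsup [set r | exists (s : R) (x : 'cV[R]_n),
    s \in `[S, T] /\ r = (enorm (phi s x))%:E].

Definition holder_s (beta : R) : \bar R :=
  nnsup [set r | exists (s s' : R) (x : 'cV[R]_n),
    [/\ s \in `[S, T], s' \in `[S, T], s != s' &
        r = (enorm (phi s x - phi s' x) / `|s - s'| `^ beta)%:E]].

Definition holder_x (alpha : R) : \bar R :=
  nnsup [set r | exists (s : R) (x x' : 'cV[R]_n),
    [/\ s \in `[S, T], (0 < enorm (x - x') <= 1)%R &
        r = (enorm (phi s x - phi s x') / enorm (x - x') `^ alpha)%:E]].

Definition holder (alpha : R) : \bar R :=
  holder_s (alpha / 2) + holder_x alpha.

Definition norm_holder (alpha : R) : \bar R := norm_sup + holder alpha.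

End Seminorms.

Section Norms.
Variables (m : nat) (S T : R) (phi : R -> 'cV[R]_n -> 'cV[R]_m).

Definition fs (s : R) (x : 'cV[R]_n) : 'cV[R]_m := derive_in S T (phi^~ x) s.
Definition fx (s : R) (x : 'cV[R]_n) : 'M[R]_(m, n) := jac (phi s) x.
Definition fxx (s : R) (x : 'cV[R]_n) : 'M[R]_(m, n * n) := d2 (phi s) x.

Definition norm_1 : \bar R := norm_sup S T phi + norm_sup S T fx.

Definition norm_2 : \bar R := norm_1 + norm_sup S T fs + norm_sup S T fxx.

Definition norm_2holder (alpha : R) : \bar R :=
  norm_2 + holder S T fs alpha + holder S T fxx alpha
  + holder_s S T fx ((1 + alpha) / 2).

Definition has_derivatives : Prop :=
  forall s x, s \in `[S, T] ->
    derivable_in S T (phi^~ x) s /\ derivable2 (phi s) x.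

(* The class C^(1 + alpha/2, 2 + alpha)([S, T] x R^n). *)
Definition C2holder (alpha : R) : Prop :=
  has_derivatives /\ norm_2holder alpha < +oo.

End Norms.

(* Norm of a function of x only, seen as a function on [0, 1] x R^n that does
   not depend on s. *)
Definition norm_2holder_x (m : nat) (h : 'cV[R]_n -> 'cV[R]_m) (alpha : R) :
    \bar R :=
  norm_2holder 0 1 (fun _ => h) alpha.

End HolderNorms.

Section System.
Variables (R : realType) (n m d : nat) (T : R).

Definition smooth_b (k : nat) (b : R -> 'cV[R]_n -> 'cV[R]_n) : Prop :=
  Cb k [set p : R * 'cV[R]_n | p.1 \in `[0, T]] (fun p => b p.1 p.2).

Definition smooth_sigma (k : nat) (sigma : R -> 'cV[R]_n -> 'M[R]_(n, d)) :
    Prop :=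
  Cb k [set p : R * 'cV[R]_n | p.1 \in `[0, T]] (fun p => sigma p.1 p.2).

Definition smooth_psi (k : nat) (psi : R -> 'cV[R]_n -> 'cV[R]_n -> 'cV[R]_m) :
    Prop :=
  Cb k [set p : R * 'cV[R]_n * 'cV[R]_n | p.1.1 \in `[0, T]]
    (fun p => let: (t, xi, x) := p in psi t xi x).

Definition smooth_g (k : nat)
    (g : R -> R -> 'cV[R]_n -> 'cV[R]_n -> 'cV[R]_m -> 'M[R]_(m, d) -> 'cV[R]_m) :
    Prop :=
  Cb k [set p : R * R * 'cV[R]_n * 'cV[R]_n * 'cV[R]_m * 'M[R]_(m, d) |
         let: (t, s, _, _, _, _) := p in Delta T (t, s)]
    (fun p => let: (t, s, xi, x, y, z) := p in g t s xi x y z).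

Definition elliptic (sigma : R -> 'cV[R]_n -> 'M[R]_(n, d)) : Prop :=
  exists2 sbar : R, 0 < sbar &
    forall (s : R) (x xi : 'cV[R]_n), s \in `[0, T] ->
      sbar * enorm xi ^+ 2 <= enorm ((sigma s x)^T *m xi) ^+ 2.

Variables (b : R -> 'cV[R]_n -> 'cV[R]_n) (sigma : R -> 'cV[R]_n -> 'M[R]_(n, d)).
Variables (psi : R -> 'cV[R]_n -> 'cV[R]_n -> 'cV[R]_m)
  (g : R -> R -> 'cV[R]_n -> 'cV[R]_n -> 'cV[R]_m -> 'M[R]_(m, d) -> 'cV[R]_m).
Implicit Types Theta : R -> R -> 'cV[R]_n -> 'cV[R]_n -> 'cV[R]_m.

(* Theta(t, ., xi, .) *)
Definition slice Theta (t : R) (xi : 'cV[R]_n) : R -> 'cV[R]_n -> 'cV[R]_m :=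
  fun s x => Theta t s xi x.

(* g(t, ., xi, .) evaluated along Theta. *)
Definition along Theta (t : R) (xi : 'cV[R]_n) : R -> 'cV[R]_n -> 'cV[R]_m :=
  fun s x =>
    g t s xi x (Theta s s x x) (fx (slice Theta t xi) s x *m sigma s x).

(* The equation involves the derivative in s of Theta(t, ., xi, .), a function
   on [t, T]; hence the point t = s = T of Delta, where that interval is
   reduced to a point, carries the terminal condition only. *)
Definition classical_solution Theta : Prop :=
  [/\ (forall (t : R) (xi : 'cV[R]_n), t \in `[0, T] ->
        let phi := slice Theta t xi in
        let D := [set p : R * 'cV[R]_n | p.1 \in `[t, T]] in
        [/\ has_derivatives t T phi,
            {within D, continuous (fun p => phi p.1 p.2)},
            {within D, continuous (fun p => fs t T phi p.1 p.2)},
            {within D, continuous (fun p => fx phi p.1 p.2)} &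
            {within D, continuous (fun p => fxx phi p.1 p.2)}]),
      (forall t s xi x, Delta T (t, s) -> t < T ->
        let phi := slice Theta t xi in
        fs t T phi s x + 2^-1 *: quad (sigma s x) (phi s) x
        + fx phi s x *m b s x + along Theta t xi s x = 0) &
      (forall (t : R) (xi x : 'cV[R]_n), t \in `[0, T] ->
        Theta t T xi x = psi t xi x)].

Definition regular_solution (alpha : R) Theta : Prop :=
  classical_solution Theta /\
  (forall t xi, 0 <= t < T -> C2holder t T (slice Theta t xi) alpha).

(* Supremum over (t, xi) in [0, T] x R^n. *)
Definition sup_txi (F : R -> 'cV[R]_n -> \bar R) : \bar R :=
  ereal_sup [set r | exists (t : R) (xi : 'cV[R]_n),
    t \in `[0, T] /\ r = F t xi].

End System.

(* Main.v *)
Require Import Defs.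
From HB Require Import structures.
From mathcomp Require Import all_boot all_order all_algebra.
From mathcomp Require Import all_classical all_reals all_analysis.
From mathcomp Require Import ring lra.
Set Implicit Arguments.
Unset Strict Implicit.
Unset Printing Implicit Defensive.
Import Order.TTheory GRing.Theory Num.Theory.
Import numFieldNormedType.Exports.

Local Open Scope classical_set_scope.
Local Open Scope ring_scope.

(** The constants of both estimates may depend on everything quantified before
    them. Hence it suffices to construct, for all admissible data, a solution
    whose slices have uniformly bounded norms, and to prove uniqueness: if the
    right-hand side of the stability estimate is positive, any bound of the
    left-hand side is enough, and if it vanishes, then Theta solves the second
    system as well, so that both solutions coincide.

    Existence. With h = r ^+ 2, the solution is the limit of the explicit scheme
      u(s - h) = E u(s, Y) + h g(s, q, u(s, diagonal), r^-1 E (eps u(s, Y))),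
      Y = q + h b + r sigma eps,
    where q = (xi, x), Y moves only x, and eps is uniformly distributed on the
    2d vectors +- sqrt d e_j, so that it has mean 0 and covariance 1. Since
    |E (eps u(Y))| is at most the standard deviation of u(Y), the square of a
    step is at most E |u(Y)|^2 (1 + O(h)) + O(h): the gradient term is absorbed
    by the variance in E |X|^2 = |E X|^2 + Var X. The same computation bounds
    the derivatives up to order 3, uniformly in h; for those of order 2, the
    square of the gradient is added with a large weight, as in Bernstein's
    method. All limits are taken along one ultrafilter.

    Uniqueness. On each slice the difference of two solutions satisfies the
    scheme up to an error o(h) per step. The same estimate of one step shows
    that, if its square is at most Q expR (lam (T - s)) on the diagonal, then it
    is at most half of that on all slices, in particular on the diagonal. *)

(** * Finite averages and the one-step energy estimate *)

(** The equation on the slice [(t, xi)] contains the values of the solution at (s, s, x, x), so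
    differentiating it brings in derivatives in xi. Therefore xi is treated as a state variable that
    does not move, and every energy runs over the derivatives in (xi, x) jointly. Of t only a
    Lipschitz bound is needed. The orders form a chain. At order 1 the constant of the step estimate
    involves no bound of derivatives. At order 2 it involves those of order 1, but a term quadratic
    in the fluctuations of the gradient appears, and this is the true obstacle. At order 3
    everything is linear again. Order 3 is enough: bounded third derivatives make the first
    derivatives Lipschitz in time, interpolation makes the second ones Hoelder of exponent 1/2 in
    time, and the time derivative inherits this exponent. Such bounds dominate the norms for every
    alpha in (0, 1). The data need four bounded derivatives because third derivatives are
    characterized by quadratic Taylor remainders. *)

Lemma le_of_eq (R : realType) (x y : R) : x = y -> x <= y.
Proof. by move=> ->. Qed.

Section Sums.
Variables (R : realType) (B : finType).
Implicit Types (a b : B -> R).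

Lemma sum_sqr_ge0 a : 0 <= \sum_i a i ^+ 2.
Proof. by apply: sumr_ge0 => i _; apply: sqr_ge0. Qed.

Lemma sum_CS a b :
  (\sum_i a i * b i) ^+ 2 <= (\sum_i a i ^+ 2) * (\sum_i b i ^+ 2).
Proof.
set A := \sum_i a i ^+ 2; set C := \sum_i b i ^+ 2; set P := \sum_i a i * b i.
have H x y : 0 <= x ^+ 2 * A + x * y * P *+ 2 + y ^+ 2 * C.
  have -> : x ^+ 2 * A + x * y * P *+ 2 + y ^+ 2 * C
      = \sum_i (x * a i + y * b i) ^+ 2.
    rewrite /A /P /C mulr2n !mulr_sumr -!big_split /=.
    by apply: eq_bigr => i _; ring.
  exact: sum_sqr_ge0.
have A0 : 0 <= A by exact: sum_sqr_ge0.
have C0 : 0 <= C by exact: sum_sqr_ge0.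
(* The points [(C, - P)] and [(P, - A)] give the inequality multiplied by C and by A; the point
   [(1, - P)] settles the case where both vanish. *)
have := H C (- P); have := H P (- A); have := H 1 (-P); have := H 1 P.
have [->|Cn0] := eqVneq C 0.
  have [->|An0] := eqVneq A 0; first by nra.
  have : 0 < A by rewrite lt_neqAle eq_sym An0.
  by nra.
have : 0 < C by rewrite lt_neqAle eq_sym Cn0.
by nra.
Qed.

Lemma sqr_sum_le a : (\sum_i a i) ^+ 2 <= #|B|%:R * \sum_i a i ^+ 2.
Proof.
have := sum_CS (fun=> 1) a.
rewrite expr1n sumr_const -/(#|B|) => H.
by apply: le_trans H; rewrite [X in _ <= X ^+ 2](eq_bigr a)// => i _; rewrite mul1r.
Qed.

Lemma sum_le_const a (c : R) : (forall i, a i <= c) -> \sum_i a i <= #|B|%:R * c.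
Proof.
by move=> H; rewrite mulr_natl -sumr_const; apply: ler_sum => i _; apply: H.
Qed.

Lemma norm_sum_le_const a (c : R) : (forall i, `|a i| <= c) -> `|\sum_i a i| <= #|B|%:R * c.
Proof. by move=> H; apply: le_trans (ler_norm_sum _ _ _) (sum_le_const H). Qed.

Lemma le_sum_sqr a i : a i ^+ 2 <= \sum_j a j ^+ 2.
Proof.
by rewrite (bigD1 i)//= lerDl; apply: sumr_ge0 => j _; exact: sqr_ge0.
Qed.

Lemma le_sum_term a i : (forall j, 0 <= a j) -> a i <= \sum_j a j.
Proof. by move=> a0; rewrite (bigD1 i)//= lerDl; apply: sumr_ge0 => j _. Qed.

End Sums.

Section Average.
Variables (R : realType) (G : finType).
Hypothesis G0 : (0 < #|G|)%N.
Implicit Types (X Y : G -> R).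

Definition avg X : R := #|G|%:R^-1 * \sum_g X g.

Let n0 : (#|G|%:R : R) != 0. Proof. by rewrite pnatr_eq0 -lt0n. Qed.
Let n_gt0 : 0 < (#|G|%:R : R). Proof. by rewrite ltr0n. Qed.

Lemma eq_avg X Y : X =1 Y -> avg X = avg Y.
Proof. by move=> XY; rewrite /avg (eq_bigr Y). Qed.

Lemma avgD X Y : avg (fun g => X g + Y g) = avg X + avg Y.
Proof. by rewrite /avg big_split mulrDr. Qed.

Lemma avgZ c X : avg (fun g => c * X g) = c * avg X.
Proof. by rewrite /avg -mulr_sumr mulrCA. Qed.

Lemma avgZr c X : avg (fun g => X g * c) = avg X * c.
Proof. by rewrite /avg -mulr_suml mulrA. Qed.

Lemma avgB X Y : avg (fun g => X g - Y g) = avg X - avg Y.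
Proof. by rewrite /avg sumrB mulrBr. Qed.

Lemma avg_cst c : avg (fun=> c) = c.
Proof. by rewrite /avg sumr_const -[c *+ _]mulr_natr mulrCA mulVf ?mulr1. Qed.

Lemma avg_sum (J : finType) (X : J -> G -> R) :
  avg (fun g => \sum_j X j g) = \sum_j avg (X j).
Proof. by rewrite /avg exchange_big /= mulr_sumr. Qed.

Lemma ler_avg X Y : (forall g, X g <= Y g) -> avg X <= avg Y.
Proof. by move=> XY; rewrite ler_pM2l ?invr_gt0//; apply: ler_sum. Qed.

Lemma avg_ge0 X : (forall g, 0 <= X g) -> 0 <= avg X.
Proof. by move=> X0; rewrite -(avg_cst 0); apply: ler_avg. Qed.

Lemma avg_le X c : (forall g, X g <= c) -> avg X <= c.
Proof. by move=> Xc; rewrite -[leRHS]avg_cst; apply: ler_avg. Qed.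

Lemma ler_norm_avg X : `|avg X| <= avg (fun g => `|X g|).
Proof.
rewrite /avg normrM (ger0_norm (_ : 0 <= _^-1)) ?invr_ge0//.
by apply: ler_wpM2l; [rewrite invr_ge0 | exact: ler_norm_sum].
Qed.

Lemma norm_avg_le X c : (forall g, `|X g| <= c) -> `|avg X| <= c.
Proof. by move=> H; apply: le_trans (ler_norm_avg _) (avg_le H). Qed.

Lemma avg_CS X Y :
  avg (fun g => X g * Y g) ^+ 2 <= avg (fun g => X g ^+ 2) * avg (fun g => Y g ^+ 2).
Proof.
rewrite /avg exprMn [leRHS]mulrACA -[X in _ <= X * _]expr2.
by apply: ler_wpM2l; [exact: sqr_ge0 | exact: sum_CS].
Qed.

Definition vr X : R := avg (fun g => (X g - avg X) ^+ 2).
Definition sd X : R := Num.sqrt (vr X).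

Lemma vr_ge0 X : 0 <= vr X.
Proof. by apply: avg_ge0 => g; apply: sqr_ge0. Qed.

Lemma sd_ge0 X : 0 <= sd X.
Proof. exact: sqrtr_ge0. Qed.

Lemma sqr_sd X : sd X ^+ 2 = vr X.
Proof. by rewrite sqr_sqrtr// vr_ge0. Qed.

Lemma avg_sqr_dist X c :
  avg (fun g => (X g - c) ^+ 2) = vr X + (avg X - c) ^+ 2.
Proof.
rewrite /vr.
have -> : (fun g => (X g - c) ^+ 2)
  = (fun g => (X g - avg X) ^+ 2 + ((2 * (avg X - c)) * (X g - avg X) + (avg X - c) ^+ 2)).
  by apply/funext => g; ring.
by rewrite avgD avgD avgZ avgB !avg_cst subrr mulr0 add0r.
Qed.

Lemma sqr_avg X : avg X ^+ 2 = avg (fun g => X g ^+ 2) - vr X.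
Proof.
have := avg_sqr_dist X 0.
rewrite (@eq_avg _ (fun g => X g ^+ 2)); last by move=> g; rewrite subr0.
by rewrite subr0 => ->; rewrite addrAC subrr add0r.
Qed.

(** The mean minimizes the mean square distance, so any centre c will do. *)
Lemma vr_le X c a : (forall g, `|X g - c| <= a) -> vr X <= a ^+ 2.
Proof.
move=> H; have := avg_sqr_dist X c => E.
have : avg (fun g => (X g - c) ^+ 2) <= a ^+ 2.
  by apply: avg_le => g; rewrite -real_normK ?num_real// lerXn2r ?nnegrE// (le_trans _ (H g)).
by have := sqr_ge0 (avg X - c); lra.
Qed.

Lemma sd_le X c a : (forall g, `|X g - c| <= a) -> sd X <= a.
Proof.
move=> H.
have a0 : 0 <= a.
  by case/card_gt0P: G0 => g _; exact: le_trans (H g).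
by rewrite -(ler_pXn2r (n:=2))// ?nnegrE// ?sd_ge0// sqr_sd; apply: vr_le H.
Qed.

(** As X is centered, Y may be replaced by its deviation from the mean before Cauchy-Schwarz is
    applied. The result is the standard deviation of Y instead of its size; all gains in the scheme
    rest on this. *)
Lemma avg_mul_centered X Y : avg X = 0 -> avg (fun g => X g ^+ 2) <= 1 ->
  `|avg (fun g => X g * Y g)| <= sd Y.
Proof.
move=> X0 X1.
have -> : avg (fun g => X g * Y g) = avg (fun g => X g * (Y g - avg Y)).
  rewrite (@eq_avg (fun g => X g * (Y g - avg Y)) (fun g => X g * Y g - X g * avg Y)).
    by rewrite avgB avgZr X0 mul0r subr0.
  by move=> g; rewrite mulrBr.
rewrite -(ler_pXn2r (n:=2))// ?nnegrE// ?sd_ge0// sqr_sd real_normK ?num_real//.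
apply: le_trans (avg_CS _ _) _.
by rewrite -[leRHS]mul1r; apply: ler_pM => //; [apply: avg_ge0 => g; exact: sqr_ge0 | exact: vr_ge0].
Qed.

End Average.

Section StepEnergy.
Variables (R : realType) (G B : finType).
Hypothesis G0 : (0 < #|G|)%N.

(** The square of a mean is the mean square minus the variance. An error of order r times the
    standard deviations is paid, by Young's inequality, out of that variance. Half of the variance
    is kept in the conclusion, because the second order estimate consumes it later. [kap] stands for
    inhomogeneous terms and [th] for errors of any other shape. *)
Lemma step_energy (X : B -> G -> R) (Y : B -> R) (C r kap s th : R) :
  0 <= C -> 0 <= r -> 0 <= kap -> 0 <= s -> 0 <= th ->
  24 * #|B|%:R ^+ 2 * C ^+ 2 * r ^+ 2 <= 1 ->
  (forall b g, `|X b g| <= s) ->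
  (forall b, `|Y b - avg (X b)| <=
     C * r * (\sum_b' sd (X b')) + C * r ^+ 2 * (kap + s) + th) ->
  \sum_b Y b ^+ 2 <= \sum_b avg (fun g => X b g ^+ 2) - 2^-1 * (\sum_b vr (X b))
    + (8 * #|B|%:R ^+ 3 * C ^+ 2 + 3 * #|B|%:R * C + 1) * (r ^+ 2 * (kap ^+ 2 + s ^+ 2))
    + (2 * #|B|%:R * s * th + 3 * #|B|%:R * th ^+ 2).
Proof.
move=> C0 r0 k0 s0 t0 small Xs HY.
set N : R := #|B|%:R; set D := \sum_b' sd (X b'); set V := \sum_b vr (X b).
have N0 : 0 <= N by exact: ler0n.
have [B0|Bn0] := posnP #|B|.
  have E (F : B -> R) : \sum_b F b = 0.
    by rewrite big1// => b; have := fintype0 b B0.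
  rewrite /V !E /N B0 !mulr0 !mul0r; have := sqr_ge0 kap; have := sqr_ge0 s; have := sqr_ge0 r; nra.
have N1 : 1 <= N by rewrite ler1n.
have D0 : 0 <= D by apply: sumr_ge0 => b _; exact: sd_ge0.
have DV : D ^+ 2 <= N * V.
  have -> : V = \sum_b sd (X b) ^+ 2 by apply: eq_bigr => b _; rewrite sqr_sd.
  exact: sqr_sum_le.
have V0 : 0 <= V by apply: sumr_ge0 => b _; exact: vr_ge0.
set e := C * r * D + C * r ^+ 2 * (kap + s) + th.
have e0 : 0 <= e by rewrite /e; do !apply: addr_ge0 => //; do ?apply: mulr_ge0 => //; rewrite ?sqr_ge0 ?addr_ge0.
have H b : Y b ^+ 2 <= avg (X b) ^+ 2 + (2 * s * e + e ^+ 2).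
  have h1 : `|avg (X b)| <= s by apply: norm_avg_le.
  have h2 := HY b; rewrite -/D -/e in h2.
  have gen (x y : R) : `|x| <= s -> `|y| <= e -> (x + y) ^+ 2 <= x ^+ 2 + (2 * s * e + e ^+ 2).
    move=> hx hy.
    have xy : x * y <= s * e.
      by apply: le_trans (ler_norm _) _; rewrite normrM; apply: ler_pM.
    have yy : y ^+ 2 <= e ^+ 2.
      by rewrite -real_normK ?num_real// lerXn2r ?nnegrE.
    have -> : (x + y) ^+ 2 = x ^+ 2 + (2 * (x * y) + y ^+ 2) by ring.
    have -> : 2 * s * e = 2 * (s * e) by ring.
    by rewrite lerD2l; apply: lerD => //; rewrite ler_pM2l.
  by have := gen _ _ h1 h2; rewrite addrC subrK.
have Hsum : \sum_b Y b ^+ 2 <= \sum_b avg (fun g => X b g ^+ 2) - V + N * (2 * s * e + e ^+ 2).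
  apply: (@le_trans _ _ (\sum_b (avg (X b) ^+ 2 + (2 * s * e + e ^+ 2)))).
    by apply: ler_sum => b _; exact: H.
  rewrite big_split /=; apply: lerD; last by rewrite sumr_const -[_ *+ #|_|]mulr_natl.
  rewrite /V -sumrB; apply: ler_sum => b _.
  by rewrite sqr_avg.
apply: le_trans Hsum _.
have e2 : e ^+ 2 <= 3 * (C ^+ 2 * r ^+ 2 * D ^+ 2 + C ^+ 2 * r ^+ 4 * (kap + s) ^+ 2 + th ^+ 2).
  have gen (x y z : R) : (x + y + z) ^+ 2 <= 3 * (x ^+ 2 + y ^+ 2 + z ^+ 2).
    have := sqr_ge0 (x - y); have := sqr_ge0 (y - z); have := sqr_ge0 (x - z); nra.
  apply: le_trans (gen _ _ _) _; by apply: le_of_eq; ring.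
have r2 : 0 <= r ^+ 2 by exact: sqr_ge0.
have a1 : 2 * N * s * (C * r * D) <= 8 * N ^+ 3 * C ^+ 2 * r ^+ 2 * s ^+ 2 + 8^-1 * V.
  have h : 8 * N * (2 * N * s * (C * r * D)) <= 8 * N * (8 * N ^+ 3 * C ^+ 2 * r ^+ 2 * s ^+ 2 + 8^-1 * V).
    have := sqr_ge0 (8 * N ^+ 2 * C * r * s - D).
    by have := DV; nra.
  by rewrite ler_pM2l in h => //; lra.
have a2 : 2 * N * s * (C * r ^+ 2 * (kap + s)) <= 3 * N * C * (r ^+ 2 * (kap ^+ 2 + s ^+ 2)).
  have -> : 2 * N * s * (C * r ^+ 2 * (kap + s)) = N * C * r ^+ 2 * (2 * s * (kap + s)) by ring.
  have -> : 3 * N * C * (r ^+ 2 * (kap ^+ 2 + s ^+ 2)) = N * C * r ^+ 2 * (3 * (kap ^+ 2 + s ^+ 2)) by ring.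
  apply: ler_wpM2l; first by rewrite !mulr_ge0.
  by have := sqr_ge0 (s - kap); nra.
(* Smallness of r enters here only: it makes the square of the first order error at most an eighth
   of the variance. *)
have NC : N * (C ^+ 2 * r ^+ 2) <= 24^-1 / N.
  rewrite ler_pdivlMr; last by lra.
  move: small; rewrite -/N => small; nra.
have NC' : N * (C ^+ 2 * r ^+ 2) <= 24^-1.
  by apply: le_trans NC _; rewrite -[leRHS]mulr1 ler_pM2l ?invr_gt0 ?ltr0n// invf_le1; lra.
have a3 : 3 * N * (C ^+ 2 * r ^+ 2 * D ^+ 2) <= 8^-1 * V.
  have -> : 3 * N * (C ^+ 2 * r ^+ 2 * D ^+ 2) = 3 * (N * (C ^+ 2 * r ^+ 2)) * D ^+ 2 by ring.
  have h : 3 * (N * (C ^+ 2 * r ^+ 2)) * D ^+ 2 <= 3 * (24^-1 / N) * (N * V).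
    apply: ler_pM => //; rewrite ?mulr_ge0 ?sqr_ge0//; lra.
  apply: le_trans h _.
  have -> : 3 * (24^-1 / N) * (N * V) = 8^-1 * V by field; rewrite gt_eqF//; lra.
  by [].
have a4 : 3 * N * (C ^+ 2 * r ^+ 4 * (kap + s) ^+ 2) <= r ^+ 2 * (kap ^+ 2 + s ^+ 2).
  have -> : 3 * N * (C ^+ 2 * r ^+ 4 * (kap + s) ^+ 2) = (3 * (N * (C ^+ 2 * r ^+ 2)) * (kap + s) ^+ 2) * r ^+ 2 by ring.
  rewrite [leRHS]mulrC; apply: ler_wpM2r => //.
  have h : 3 * (N * (C ^+ 2 * r ^+ 2)) <= 8^-1 by lra.
  have : 3 * (N * (C ^+ 2 * r ^+ 2)) * (kap + s) ^+ 2 <= 8^-1 * (kap + s) ^+ 2.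
    by apply: ler_wpM2r => //; exact: sqr_ge0.
  have := sqr_ge0 (kap - s); nra.
have -> : N * (2 * s * e + e ^+ 2) = 2 * N * s * (C * r * D) + 2 * N * s * (C * r ^+ 2 * (kap + s)) + 2 * N * s * th + N * e ^+ 2.
  rewrite /e; ring.
have ne2 : N * e ^+ 2 <= 3 * N * (C ^+ 2 * r ^+ 2 * D ^+ 2) + 3 * N * (C ^+ 2 * r ^+ 4 * (kap + s) ^+ 2) + 3 * N * th ^+ 2.
  apply: le_trans (ler_wpM2l N0 e2) _; by apply: le_of_eq; ring.
have rk : 0 <= 8 * N ^+ 3 * C ^+ 2 * r ^+ 2 * kap ^+ 2 by do !apply: mulr_ge0 => //; rewrite ?exprn_ge0.
nra.
Qed.

End StepEnergy.

(** * Functions of finitely many real variables *)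

Section DirectionalDerivative.
Variables (R : realType) (V W : normedModType R).

(** Differentiability along v by increments: without a quotient, h = 0 is no exception, and bounds
    on remainders apply directly. *)
Definition has_dder (f : V -> W) (a v : V) (df : W) : Prop :=
  forall e : R, 0 < e -> exists2 dl : R, 0 < dl & forall h : R, `|h| < dl ->
    `|f (a + h *: v) - f a - h *: df| <= e * `|h|.

Lemma has_dderP (f : V -> W) (a v : V) (df : W) :
  is_derive a v f df <-> has_dder f a v df.
Proof.
have E h : h != 0 -> `|df - h^-1 *: ((f \o shift a) (h *: v) - f a)|
    = `|h|^-1 * `|f (a + h *: v) - f a - h *: df|.
  move=> h0; rewrite -normfV -normrZ /= [h *: v + a]addrC -normrN opprB.
  by rewrite [in RHS]scalerBr scalerA mulVf// scale1r.
split=> [H e e0|H].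
  have [D1 D2] := H.
  have : (h^-1 *: ((f \o shift a) (h *: v) - f a)) @[h --> 0^'] --> df.
    by rewrite -D2; exact: D1.
  move=> /cvgrPdist_le/(_ _ e0) /= [dl dl0 Hd]; exists dl => // h hd.
  have [->|h0] := eqVneq h 0.
    by rewrite !scale0r addr0 subrr subr0 !normr0 mulr0.
  have := Hd h; rewrite /= sub0r normrN E// => /(_ hd h0).
  by rewrite mulrC ler_pdivrMr// normr_gt0.
have C : (h^-1 *: ((f \o shift a) (h *: v) - f a)) @[h --> 0^'] --> df.
  apply/cvgrPdist_le => e e0; have [dl dl0 Hd] := H _ e0.
  exists dl => //= h; rewrite /= sub0r normrN => hd h0.
  by rewrite E// mulrC ler_pdivrMr ?normr_gt0//; exact: Hd.
split; first by apply/cvg_ex; exists df.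
exact: cvg_lim.
Qed.

End DirectionalDerivative.

Section Lines.
Variables (R : realType).

Lemma has_dder_add (f g : R -> R) (a df dg : R) :
  has_dder f a 1 df -> has_dder g a 1 dg -> has_dder (fun x : R => f x + g x) a 1 (df + dg).
Proof.
move=> Hf Hg e e0; have e2 : 0 < e / 2 by rewrite divr_gt0.
have [d1 d10 H1] := Hf _ e2; have [d2 d20 H2] := Hg _ e2.
exists (Num.min d1 d2); first by rewrite lt_min d10.
move=> h; rewrite lt_min => /andP[/H1 h1 /H2 h2].
set x := _ - _ - _ in h1; set y := _ - _ - _ in h2.
rewrite [X in `|X|](_ : _ = x + y); last by rewrite /x /y scalerDr; lra.
by apply: le_trans (ler_normD _ _) _; lra.
Qed.

Lemma has_dder_cstmul (f : R -> R) (a df k : R) :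
  has_dder f a 1 df -> has_dder (fun x : R => k * f x) a 1 (k * df).
Proof.
move=> Hf e e0.
have k0 : 0 < `|k| + 1 by rewrite ltr_wpDl.
have [d d0 H] := Hf (e / (`|k| + 1)) (divr_gt0 e0 k0).
exists d => // h /H; set x := _ - _ - _ => hx.
rewrite [X in `|X|](_ : _ = k * x); last by rewrite /x /GRing.scale /=; ring.
rewrite normrM; apply: (@le_trans _ _ ((`|k| + 1) * `|x|)); first by rewrite ler_wpM2r// lerDl.
by rewrite mulrC -ler_pdivlMr//; apply: le_trans hx _; rewrite mulrAC.
Qed.

Lemma has_dder_quad (a k : R) : has_dder (fun x : R => k * x ^+ 2) a 1 (k * (2 * a)).
Proof.
apply: has_dder_cstmul => e e0; exists e => // h he.
rewrite [X in `|X|](_ : _ = h * h); last by rewrite /GRing.scale /=; ring.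
by rewrite normrM ler_wpM2r// ltW.
Qed.

Lemma has_dder_lin (a k : R) : has_dder (fun x : R => k * x) a 1 k.
Proof.
rewrite -[X in has_dder _ _ _ X]mulr1; apply: has_dder_cstmul => e e0; exists e => // h he.
rewrite [X in `|X|](_ : _ = 0); last by rewrite /GRing.scale /=; ring.
by rewrite normr0 mulr_ge0// ltW.
Qed.

Lemma mean_value_ineq (f df : R -> R) (a b s : R) : a <= b ->
  (forall x, a <= x <= b -> has_dder f x 1 (df x)) ->
  (forall x, a <= x <= b -> `|df x| <= s) -> `|f b - f a| <= s * (b - a).
Proof.
move=> ab Hd Hs.
have HD x : x \in `[a, b] -> is_derive x 1 f (df x).
  by rewrite in_itv /= => xab; apply/has_dderP/Hd.
have HD' x : x \in `]a, b[ -> is_derive x 1 f (df x).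
  by move=> xab; apply: HD; exact: subset_itv_oo_cc xab.
have cf : {within `[a, b], continuous f}.
  by apply: derivable_within_continuous => x xab; have [] := HD _ xab.
have [c cab ->] := MVT_segment ab HD' cf.
rewrite normrM [`|b - a|]ger0_norm ?subr_ge0// ler_wpM2r ?subr_ge0//.
by apply: Hs; move: cab; rewrite in_itv.
Qed.

End Lines.

(** * Quantitative calculus on R^J with the l1 norm *)

Definition pt (R : realType) (J : finType) := J -> R.

Section Points.
Variables (R : realType) (J : finType).
Implicit Types (p v w : pt R J).

Definition padd p v : pt R J := fun j => p j + v j.
Definition pscale (x : R) v : pt R J := fun j => x * v j.
Definition nrm1 v : R := \sum_j `|v j|.

Lemma nrm1_ge0 v : 0 <= nrm1 v.
Proof. exact: sumr_ge0. Qed.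

Lemma nrm1_scale x v : nrm1 (pscale x v) = `|x| * nrm1 v.
Proof. by rewrite /nrm1 mulr_sumr; apply: eq_bigr => j _; rewrite normrM. Qed.

Lemma ler_nrm1 v j : `|v j| <= nrm1 v.
Proof. by apply: (@le_sum_term _ _ (fun i => `|v i|)). Qed.

Lemma nrm1_le v w : (forall j, `|v j| <= `|w j|) -> nrm1 v <= nrm1 w.
Proof. by move=> H; apply: ler_sum. Qed.

Lemma paddA p v w : padd (padd p v) w = padd p (padd v w).
Proof. by apply/funext => j; rewrite /padd addrA. Qed.

Lemma pscaleDl x y v : pscale (x + y) v = padd (pscale x v) (pscale y v).
Proof. by apply/funext => j; rewrite /padd /pscale mulrDl. Qed.

Lemma pscale1 v : pscale 1 v = v.
Proof. by apply/funext => j; rewrite /pscale mul1r. Qed.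

Lemma padd0 p v : padd p (pscale 0 v) = p.
Proof. by apply/funext => j; rewrite /padd /pscale mul0r addr0. Qed.

Lemma lin_form_le (f' : J -> pt R J -> R) p v s : (forall j, `|f' j p| <= s) ->
  `|\sum_j v j * f' j p| <= s * nrm1 v.
Proof.
move=> H; apply: le_trans (ler_norm_sum _ _ _) _.
rewrite /nrm1 mulr_sumr; apply: ler_sum => j _; rewrite normrM mulrC.
by apply: ler_wpM2r.
Qed.

(** The class C^{1,1} with one explicit constant. As only increments occur, sums, products and
    compositions reduce to inequalities, and the bounds survive pointwise limits. *)
Definition D1c (C : R) (f : pt R J -> R) (f' : J -> pt R J -> R) : Prop := [/\ 0 <= C, (forall j p, `|f' j p| <= C),
  (forall p v, `|f (padd p v) - f p| <= C * nrm1 v) &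
  (forall p v, `|f (padd p v) - f p - \sum_j v j * f' j p| <= C * nrm1 v ^+ 2)].

Definition D1 (f : pt R J -> R) (f' : J -> pt R J -> R) : Prop := exists C, D1c C f f'.

Lemma D1c_le C C' f f' : C <= C' -> D1c C f f' -> D1c C' f f'.
Proof.
move=> CC [C0 H1 H2 H3]; split.
- exact: le_trans CC.
- by move=> j p; apply: le_trans CC.
- by move=> p v; apply: le_trans (H2 p v) _; rewrite ler_wpM2r// nrm1_ge0.
- by move=> p v; apply: le_trans (H3 p v) _; rewrite ler_wpM2r// sqr_ge0.
Qed.

Definition bdd (f : pt R J -> R) : Prop := exists C, forall p, `|f p| <= C.

Lemma D1_bdd f f' j : D1 f f' -> bdd (f' j).
Proof. by move=> [C [_ H _ _]]; exists C. Qed.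

Lemma eq_D1 f g f' g' : f =1 g -> (forall j, f' j =1 g' j) -> D1 f f' -> D1 g g'.
Proof.
move=> /funext -> H; suff -> : f' = g' by [].
by apply/funext => j; apply/funext.
Qed.

Lemma D1_cst c : D1 (fun=> c) (fun _ _ => 0).
Proof.
exists 0; split => // [_ _|p v|p v]; rewrite ?normr0 ?subrr ?normr0 ?mul0r//.
by rewrite big1 ?subr0 ?normr0// => j _; rewrite mulr0.
Qed.

Lemma D1_coord i : D1 (fun p => p i) (fun j _ => (j == i)%:R).
Proof.
exists 1; split => // [j p|p v|p v]; first by case: eqP; rewrite ?normr1 ?normr0.
  by rewrite /padd mul1r [p i + v i]addrC addrK ler_nrm1.
rewrite (bigD1 i)//= eqxx mulr1 big1 => [|j /negbTE ->]; last by rewrite mulr0.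
by rewrite /padd addr0 [p i + v i]addrC addrK subrr normr0 mul1r sqr_ge0.
Qed.

Lemma D1_add f f' g g' : D1 f f' -> D1 g g' ->
  D1 (fun p => f p + g p) (fun j p => f' j p + g' j p).
Proof.
move=> [C [C0 c1 c2 c3]] [D [D0 d1 d2 d3]]; exists (C + D); split.
- exact: addr_ge0.
- by move=> j p; apply: le_trans (ler_normD _ _) _; apply: lerD.
- move=> p v; rewrite opprD addrACA mulrDl.
  by apply: le_trans (ler_normD _ _) _; apply: lerD; [exact: c2|exact: d2].
- move=> p v.
  have -> : \sum_j v j * (f' j p + g' j p) = \sum_j v j * f' j p + \sum_j v j * g' j p.
    by rewrite -big_split; apply: eq_bigr => j _; rewrite mulrDr.
  set S := \sum_j v j * f' j p; set T := \sum_j v j * g' j p.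
  have -> : f (padd p v) + g (padd p v) - (f p + g p) - (S + T)
    = (f (padd p v) - f p - S) + (g (padd p v) - g p - T) by ring.
  by rewrite mulrDl; apply: le_trans (ler_normD _ _) _; apply: lerD; [exact: c3|exact: d3].
Qed.

(** Coordinates are [D1] without being bounded, so the boundedness of the factors is a separate
    hypothesis. *)
Lemma D1_mul f f' g g' : bdd f -> bdd g -> D1 f f' -> D1 g g' ->
  D1 (fun p => f p * g p) (fun j p => f' j p * g p + f p * g' j p).
Proof.
move=> [F Hf] [E Hg] [C [C0 c1 c2 c3]] [D [D0 d1 d2 d3]].
have F0 : 0 <= F by apply: le_trans (Hf (fun=> 0)).
have E0 : 0 <= E by apply: le_trans (Hg (fun=> 0)).
exists (C * E + F * D + C * D); split.
- by rewrite !addr_ge0// mulr_ge0.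
- move=> j p; apply: le_trans (ler_normD _ _) _.
  apply: le_trans (lerD (_ : _ <= C * E) (_ : _ <= F * D)) _; rewrite ?normrM ?ler_pM//.
  by rewrite lerDl mulr_ge0.
- move=> p v.
  have -> : f (padd p v) * g (padd p v) - f p * g p =
    (f (padd p v) - f p) * g (padd p v) + f p * (g (padd p v) - g p) by ring.
  apply: le_trans (ler_normD _ _) _; rewrite !normrM.
  apply: (@le_trans _ _ (C * nrm1 v * E + F * (D * nrm1 v))).
    by apply: lerD; apply: ler_pM.
  rewrite mulrAC mulrA -mulrDl ler_wpM2r ?nrm1_ge0// lerDl mulr_ge0//.
- move=> p v.
  have -> : \sum_j v j * (f' j p * g p + f p * g' j p)
    = (\sum_j v j * f' j p) * g p + f p * (\sum_j v j * g' j p).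
    rewrite mulr_suml mulr_sumr -big_split; apply: eq_bigr => j _ /=; ring.
  set S := \sum_j v j * f' j p; set T := \sum_j v j * g' j p.
  have -> : f (padd p v) * g (padd p v) - f p * g p - (S * g p + f p * T) =
    (f (padd p v) - f p - S) * g p + f p * (g (padd p v) - g p - T)
      + (f (padd p v) - f p) * (g (padd p v) - g p) by ring.
  apply: le_trans (ler_normD _ _) _.
  apply: le_trans (lerD (ler_normD _ _) (lexx _)) _; rewrite !normrM.
  apply: (@le_trans _ _ (C * nrm1 v ^+ 2 * E + F * (D * nrm1 v ^+ 2) + C * nrm1 v * (D * nrm1 v))).
    by do 2?apply: lerD; apply: ler_pM.
  by apply: le_of_eq; ring.
Qed.

Lemma D1_cstmul c f f' : D1 f f' -> D1 (fun p => c * f p) (fun j p => c * f' j p).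
Proof.
move=> [C [C0 c1 c2 c3]]; exists (`|c| * C); split.
- by rewrite mulr_ge0.
- by move=> j p; rewrite normrM ler_wpM2l.
- by move=> p v; rewrite -mulrBr normrM -mulrA ler_wpM2l.
- move=> p v.
  have -> : \sum_j v j * (c * f' j p) = c * \sum_j v j * f' j p.
    by rewrite mulr_sumr; apply: eq_bigr => j _; rewrite mulrCA.
  by rewrite -!mulrBr normrM -mulrA ler_wpM2l.
Qed.

Lemma D1_sumseq (B : Type) (s : seq B) (F : B -> pt R J -> R) F' :
  (forall b, D1 (F b) (F' b)) ->
  D1 (fun p => \sum_(b <- s) F b p) (fun j p => \sum_(b <- s) F' b j p).
Proof.
move=> H; elim: s => [|b s IH].
  by apply: eq_D1 (D1_cst 0) => [p|j p]; rewrite big_nil.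
by apply: eq_D1 (D1_add (H b) IH) => [p|j p]; rewrite big_cons.
Qed.

Lemma D1_sum (B : finType) (F : B -> pt R J -> R) F' :
  (forall b, D1 (F b) (F' b)) ->
  D1 (fun p => \sum_b F b p) (fun j p => \sum_b F' b j p).
Proof. exact: D1_sumseq. Qed.

Lemma bdd_mul f g : bdd f -> bdd g -> bdd (fun p => f p * g p).
Proof. by move=> [C c] [D d]; exists (C * D) => p; rewrite normrM ler_pM. Qed.

Lemma bdd_sum (B : finType) (F : B -> pt R J -> R) :
  (forall b, bdd (F b)) -> bdd (fun p => \sum_b F b p).
Proof.
move=> /choice[C H]; exists (\sum_b C b) => p.
by apply: le_trans (ler_norm_sum _ _ _) _; apply: ler_sum.
Qed.

End Points.

Lemma D1_unif (R : realType) (J B : finType) (F : B -> pt R J -> R) F' :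
  (forall b, D1 (F b) (F' b)) -> exists C, forall b, D1c C (F b) (F' b).
Proof.
move=> /choice[C H]; exists (\sum_b C b) => b.
by apply: D1c_le (H b); apply: le_sum_term => j; case: (H j).
Qed.

Lemma bdd_comp (R : realType) (J I : finType) (F : pt R J -> R) (P : pt R I -> pt R J) :
  bdd F -> bdd (fun p => F (P p)).
Proof. by move=> [C H]; exists C. Qed.

Lemma D1_comp (R : realType) (J I : finType) (F : pt R J -> R) F'
    (P : J -> pt R I -> R) P' :
  D1 F F' -> (forall j, D1 (P j) (P' j)) ->
  D1 (fun p => F (fun j => P j p))
     (fun i p => \sum_j F' j (fun j => P j p) * P' j i p).
Proof.
move=> [C [C0 c1 c2 c3]] /D1_unif[D0 HD'].
pose D := `|D0|.
have HD j : D1c D (P j) (P' j) by apply: D1c_le (HD' j); exact: ler_norm.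
have D_ge0 : 0 <= D by exact: normr_ge0.

pose N : R := #|J|%:R.
have N0 : 0 <= N by exact: ler0n.
have CD : 0 <= N * (C * D) by rewrite mulr_ge0// mulr_ge0.
have CD2 : 0 <= C * (N * D) ^+ 2 by rewrite mulr_ge0// exprn_ge0// mulr_ge0.
pose w p v : pt R J := fun j => P j (padd p v) - P j p.
have Ew p v : (fun j => P j (padd p v)) = padd (fun j => P j p) (w p v).
  by apply/funext => j; rewrite /padd /w addrC subrK.
have Hw p v : nrm1 (w p v) <= N * D * nrm1 v.
  by rewrite -mulrA; apply: sum_le_const => j; case: (HD j) => _ _ + _; apply.
exists (2 * (N * (C * D)) + C * (N * D) ^+ 2); split.
- by rewrite addr_ge0// mulr_ge0.
- move=> i p; apply: (@le_trans _ _ (N * (C * D))); last by lra.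
  by apply: norm_sum_le_const => j; rewrite normrM; apply: ler_pM => //; case: (HD j).
- move=> p v; rewrite Ew; apply: le_trans (c2 _ _) _.
  apply: (@le_trans _ _ (C * (N * D * nrm1 v))); first by apply: ler_wpM2l.
  by rewrite mulrA ler_wpM2r ?nrm1_ge0//; lra.
- move=> p v; rewrite Ew.
  have -> : \sum_i v i * (\sum_j F' j (fun j0 => P j0 p) * P' j i p)
     = \sum_j F' j (fun j0 => P j0 p) * (\sum_i v i * P' j i p).
    under eq_bigr do rewrite mulr_sumr; rewrite exchange_big /=.
    by apply: eq_bigr => j _; rewrite mulr_sumr; apply: eq_bigr => i _; rewrite mulrCA.
  set p0 := fun j => P j p; set S := \sum_j _.
  have -> : F (padd p0 (w p v)) - F p0 - S =
     (F (padd p0 (w p v)) - F p0 - \sum_j w p v j * F' j p0) +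
     \sum_j F' j p0 * (w p v j - \sum_i v i * P' j i p).
    rewrite [X in _ = _ + X](eq_bigr (fun j => w p v j * F' j p0 - F' j p0 * (\sum_i v i * P' j i p))).
      by rewrite sumrB /S; ring.
    by move=> j _; ring.
  apply: le_trans (ler_normD _ _) _.
  apply: (@le_trans _ _ (C * (N * D * nrm1 v) ^+ 2 + N * (C * (D * nrm1 v ^+ 2)))).
    apply: lerD.
      apply: le_trans (c3 _ _) _; apply: ler_wpM2l => //.
      by rewrite lerXn2r ?nnegrE ?nrm1_ge0 ?mulr_ge0 ?nrm1_ge0.
    apply: norm_sum_le_const => j; rewrite normrM; apply: ler_pM => //.
    by case: (HD j) => _ _ _; apply.
  by have := mulr_ge0 CD (sqr_ge0 (nrm1 v)); lra.
Qed.

(** * Taylor estimates and partial derivatives *)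

Section Taylor.
Variables (R : realType) (J : finType).
Implicit Types (p v w : pt R J).

(** Differentiability uniform over all points, but without a rate. This is what remains of [D1] for
    the derivatives of an arbitrary solution, whose second derivatives are only Hoelder
    continuous. *)
Definition UD (f : pt R J -> R) (f' : J -> pt R J -> R) : Prop :=
  forall e : R, 0 < e -> exists2 dl : R, 0 < dl & forall p v, nrm1 v <= dl ->
    `|f (padd p v) - f p - \sum_j v j * f' j p| <= e * nrm1 v.

Lemma D1_UD f f' : D1 f f' -> UD f f'.
Proof.
move=> [C [C0 _ _ H]] e e0; have C1 : 0 < C + 1 by rewrite ltr_wpDl.
exists (e / (C + 1)); first by rewrite divr_gt0.
move=> p v hv; apply: le_trans (H p v) _.
have n0 := nrm1_ge0 v.
rewrite expr2 mulrA ler_wpM2r//; apply: (@le_trans _ _ ((C + 1) * nrm1 v)); first by rewrite ler_wpM2r// lerDl.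
by rewrite mulrC -ler_pdivlMr.
Qed.

Lemma UD_line f f' p v (x : R) : UD f f' ->
  has_dder (fun y : R => f (padd p (pscale y v))) x 1
    (\sum_j v j * f' j (padd p (pscale x v))).
Proof.
move=> H e e0; have n0 := nrm1_ge0 v; have n1 : 0 < nrm1 v + 1 by rewrite ltr_wpDl.
have [dl dl0 Hd] := H _ (divr_gt0 e0 n1).
exists (dl / (nrm1 v + 1)); first by rewrite divr_gt0.
move=> h hh.
have -> : padd p (pscale (x + h *: (1 : R)) v) = padd (padd p (pscale x v)) (pscale h v).
  by rewrite pscaleDl paddA /GRing.scale /= mulr1.
have -> : h *: (\sum_j v j * f' j (padd p (pscale x v)))
   = \sum_j pscale h v j * f' j (padd p (pscale x v)).
  by rewrite /GRing.scale /= mulr_sumr; apply: eq_bigr => j _; rewrite mulrA.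
have hv : nrm1 (pscale h v) <= dl.
  rewrite nrm1_scale; apply: (@le_trans _ _ (`|h| * (nrm1 v + 1))).
    by rewrite ler_wpM2l// lerDl.
  by rewrite -ler_pdivlMr// ltW.
apply: le_trans (Hd _ _ hv) _; rewrite nrm1_scale mulrCA mulrC ler_wpM2r//.
by rewrite mulrAC ler_pdivrMr// ler_wpM2l ?lerDl// ltW.
Qed.

Lemma lip_bound f f' p v (s : R) : UD f f' ->
  (forall x j, 0 <= x <= 1 -> `|f' j (padd p (pscale x v))| <= s) ->
  `|f (padd p v) - f p| <= s * nrm1 v.
Proof.
move=> Hf Hs.
have := @mean_value_ineq R (fun y => f (padd p (pscale y v))) _ 0 1 (s * nrm1 v) ler01
  (fun x _ => UD_line p v x Hf).
rewrite pscale1 padd0 subr0 mulr1; apply => x x01.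
by apply: (@lin_form_le _ _ f') => j; exact: Hs.
Qed.

Lemma taylor1 f f' p v (w : R) : UD f f' ->
  (forall x j, 0 <= x <= 1 -> `|f' j (padd p (pscale x v)) - f' j p| <= w) ->
  `|f (padd p v) - f p - \sum_j v j * f' j p| <= w * nrm1 v.
Proof.
move=> Hf Hs; set A := \sum_j _.
have Hd (x : R) : has_dder (fun y : R => f (padd p (pscale y v)) + - A * y) x 1
    (\sum_j v j * f' j (padd p (pscale x v)) + - A).
  by apply: has_dder_add; [exact: UD_line | exact: has_dder_lin].
have := @mean_value_ineq R _ _ 0 1 (w * nrm1 v) ler01 (fun x _ => Hd x).
rewrite pscale1 padd0 subr0 !mulr1 mulr0 addr0 addrAC; apply => x x01.
rewrite -sumrB (eq_bigr (fun j => v j * (f' j (padd p (pscale x v)) - f' j p))); last by move=> j _; rewrite mulrBr.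
by apply: (@lin_form_le _ _ (fun j q => f' j q - f' j p)) => j; exact: Hs.
Qed.

(** Along the segment, the derivative of f minus its second order polynomial is a first order
    remainder of [f1], to which [taylor1] applies. No second derivative of a function of one
    variable is taken. *)
Lemma taylor2 f (f1 : J -> pt R J -> R) (f2 : J -> J -> pt R J -> R) p v (w : R) :
  UD f f1 -> (forall a, UD (f1 a) (f2 a)) ->
  (forall x a b, 0 <= x <= 1 -> `|f2 a b (padd p (pscale x v)) - f2 a b p| <= w) ->
  `|f (padd p v) - f p - \sum_a v a * f1 a p
     - 2^-1 * \sum_a \sum_b v a * v b * f2 a b p| <= w * nrm1 v ^+ 2.
Proof.
move=> H1 H2 Hw; set A := \sum_a v a * _; set B := \sum_a \sum_b _.
have Hd (x : R) : has_dder (fun y : R => (f (padd p (pscale y v)) + - A * y) + (- 2^-1 * B) * y ^+ 2) x 1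
    ((\sum_j v j * f1 j (padd p (pscale x v)) + - A) + (- 2^-1 * B) * (2 * x)).
  apply: has_dder_add; last exact: has_dder_quad.
  by apply: has_dder_add; [exact: UD_line | exact: has_dder_lin].
have := @mean_value_ineq R _ _ 0 1 (w * nrm1 v ^+ 2) ler01 (fun x _ => Hd x).
rewrite pscale1 padd0 expr1n expr0n /= subr0 !mulr1 !mulr0 !addr0.
move=> K; apply: (@le_trans _ _ _ _ _ _ (K _)); first by apply: le_of_eq; congr (`|_|); ring.
move=> {K} x x01.
have -> : \sum_j v j * f1 j (padd p (pscale x v)) - A + - 2^-1 * B * (2 * x)
   = \sum_a v a * (f1 a (padd p (pscale x v)) - f1 a p - \sum_b pscale x v b * f2 a b p).
  have -> : - 2^-1 * B * (2 * x) = - (x * B) by field.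
  rewrite /A /B mulr_sumr -!sumrB; apply: eq_bigr => a _.
  rewrite !mulrBr; congr (_ - _); rewrite !mulr_sumr; apply: eq_bigr => b _.
  by rewrite /pscale; ring.
rewrite expr2 mulrA.
apply: (@lin_form_le _ _ (fun a q => f1 a (padd p (pscale x v)) - f1 a p - \sum_b pscale x v b * f2 a b p) p) => a.
have w0 : 0 <= w by apply: le_trans (Hw 0 a a _); rewrite ?lexx ?ler01.
apply: (@le_trans _ _ (w * nrm1 (pscale x v))).
  apply: taylor1 => // y b /andP[y0 y1].
  have -> : pscale y (pscale x v) = pscale (y * x) v by apply/funext => j; rewrite /pscale mulrA.
  case/andP: x01 => x0 x1; apply: Hw; rewrite mulr_ge0//= -[leRHS]mul1r; exact: ler_pM.
case/andP: x01 => x0 x1.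
by rewrite nrm1_scale ger0_norm// ler_wpM2l// ler_piMl// nrm1_ge0.
Qed.

Definition unit_pt (j : J) : pt R J := fun l => (l == j)%:R.

Definition has_partials (f : pt R J -> R) (f' : J -> pt R J -> R) : Prop :=
  forall p j, has_dder (fun x : R => f (padd p (pscale x (unit_pt j)))) 0 1 (f' j p).

Lemma partial_line f f' p j (x : R) : has_partials f f' ->
  has_dder (fun x : R => f (padd p (pscale x (unit_pt j)))) x 1
    (f' j (padd p (pscale x (unit_pt j)))).
Proof.
move=> H e e0; have [dl dl0 Hd] := H (padd p (pscale x (unit_pt j))) j _ e0.
by exists dl => // h /Hd; rewrite add0r padd0 paddA -pscaleDl.
Qed.

Lemma has_dder_scalearg (f : R -> R) (a k l : R) :
  has_dder f (a * k) 1 l -> has_dder (fun x : R => f (x * k)) a 1 (k * l).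
Proof.
move=> H e e0; have k0 : 0 < `|k| + 1 by rewrite ltr_wpDl.
have [dl dl0 Hd] := H _ (divr_gt0 e0 k0).
exists (dl / (`|k| + 1)); first by rewrite divr_gt0.
move=> h hh.
have hk : `|h * k| < dl.
  rewrite normrM; apply: (@le_lt_trans _ _ (`|h| * (`|k| + 1))).
    by rewrite ler_wpM2l// lerDl.
  by rewrite -ltr_pdivlMr.
have := Hd _ hk; rewrite /GRing.scale /= !mulr1 mulrDl mulrA => hd.
apply: le_trans hd _; rewrite normrM mulrCA mulrC ler_wpM2r//.
by rewrite mulrAC ler_pdivrMr// ler_wpM2l ?lerDl// ltW.
Qed.

(* The increment is decomposed into increments along the coordinate axes. *)
Lemma partials_taylor f f' p v (w : R) : has_partials f f' ->
  (forall u, (forall i, `|u i| <= `|v i|) -> forall i, `|f' i (padd p u) - f' i p| <= w) ->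
  `|f (padd p v) - f p - \sum_j v j * f' j p| <= w * nrm1 v.
Proof.
move=> Hf Hw.
pose rs (s : seq J) : pt R J := fun j => if j \in s then v j else 0.
have key (s : seq J) : uniq s ->
    `|f (padd p (rs s)) - f p - \sum_(j <- s) v j * f' j p| <= w * \sum_(j <- s) `|v j|.
  elim: s => [_|j s IH /= /andP[js us]].
    have -> : rs [::] = pscale 0 v by apply/funext => j; rewrite /rs /pscale mul0r.
    by rewrite padd0 !big_nil subrr subr0 normr0 mulr0.
  rewrite !big_cons mulrDr.
  have Ers : rs (j :: s) = padd (rs s) (pscale (v j) (unit_pt j)).
    apply/funext => l; rewrite /rs /padd /pscale /unit_pt inE.
    by case: eqVneq => [->|_]; rewrite ?(negbTE js) ?mulr1 ?mulr0 ?add0r ?addr0.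
  pose q := padd p (rs s).
  have step : `|f (padd q (pscale (v j) (unit_pt j))) - f q - v j * f' j p| <= w * `|v j|.
    have Hd (x : R) : has_dder (fun y : R => f (padd q (pscale (y * v j) (unit_pt j))) + - (v j * f' j p) * y) x 1
       (v j * f' j (padd q (pscale (x * v j) (unit_pt j))) + - (v j * f' j p)).
      apply: has_dder_add; last exact: has_dder_lin.
      by apply: (@has_dder_scalearg (fun y => f (padd q (pscale y (unit_pt j))))); exact: partial_line.
    have := @mean_value_ineq R _ _ 0 1 (w * `|v j|) ler01 (fun x _ => Hd x).
    rewrite mul1r !mul0r padd0 subr0 !mulr1 mulr0 addr0 addrAC; apply => x /andP[x0 x1].
    rewrite -mulrBr normrM mulrC ler_wpM2r// /q paddA; apply: Hw => i.
    rewrite /padd /rs /pscale /unit_pt; case: (eqVneq i j) => [->|_].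
      by rewrite (negbTE js) add0r mulr1 normrM ger0_norm// ler_piMl.
    by rewrite mulr0 addr0; case: ifP; rewrite ?normr0.
  rewrite Ers -paddA -/q.
  rewrite [X in `|X|](_ : _ = (f (padd q (pscale (v j) (unit_pt j))) - f q - v j * f' j p)
    + (f q - f p - \sum_(j0 <- s) v j0 * f' j0 p)); last by ring.
  by apply: le_trans (ler_normD _ _) _; apply: lerD => //; exact: IH.
have := key _ (enum_uniq J); rewrite !big_enum /=.
by have -> : rs (enum J) = v by apply/funext => j; rewrite /rs mem_enum.
Qed.

Lemma partials_lip f f' (C : R) : has_partials f f' -> (forall j p, `|f' j p| <= C) ->
  forall p v, `|f (padd p v) - f p| <= 3 * C * nrm1 v.
Proof.
move=> Hf HC p v.
have h : `|f (padd p v) - f p - \sum_j v j * f' j p| <= 2 * C * nrm1 v.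
  apply: partials_taylor => // u _ i; apply: le_trans (ler_normB _ _) _.
  by rewrite mulr_natl mulr2n lerD.
have l := lin_form_le v (fun j => HC j p).
rewrite -[f (padd p v) - f p](subrK (\sum_j v j * f' j p)).
by apply: le_trans (ler_normD _ _) _; lra.
Qed.

(** Bounded second partials make [f1] Lipschitz, which turns the first order remainder into a
    quadratic one. Each [D1] thus costs one more bounded order than it records. *)
Lemma partials_D1 f f1 (f2 : J -> J -> pt R J -> R) (C : R) : 0 <= C ->
  has_partials f f1 -> (forall a, has_partials (f1 a) (f2 a)) ->
  (forall j p, `|f1 j p| <= C) -> (forall i j p, `|f2 i j p| <= C) -> D1c (3 * C) f f1.
Proof.
move=> C0 H1 H2 C1 C2; split.
- by rewrite mulr_ge0.
- by move=> j p; apply: le_trans (C1 j p) _; lra.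
- exact: partials_lip.
- move=> p v; rewrite expr2 mulrA.
  apply: partials_taylor => // u uv i.
  apply: le_trans (partials_lip (H2 i) (C2 i) p u) _.
  by rewrite ler_wpM2l ?mulr_ge0// nrm1_le.
Qed.

Lemma partials_UD f f' : has_partials f f' ->
  (forall e : R, 0 < e -> exists2 dl : R, 0 < dl & forall p v j, nrm1 v <= dl ->
     `|f' j (padd p v) - f' j p| <= e) -> UD f f'.
Proof.
move=> Hf H e e0; have [dl dl0 Hd] := H _ e0; exists dl => // p v hv.
apply: partials_taylor => // u uv i; apply: Hd.
by apply: le_trans hv; exact: nrm1_le.
Qed.

End Taylor.

(** * Functions with three derivatives *)

(* [j2 F a b] is the derivative of [j1 F a] in the direction b, and so on. *)
Record jet (R : realType) (J : finType) := Jet {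
  j0 : pt R J -> R;
  j1 : J -> pt R J -> R;
  j2 : J -> J -> pt R J -> R;
  j3 : J -> J -> J -> pt R J -> R }.

Definition is_jet (R : realType) (J : finType) (F : jet R J) : Prop :=
  [/\ D1 (j0 F) (j1 F), (forall a, D1 (j1 F a) (j2 F a)) &
      (forall a b, D1 (j2 F a b) (j3 F a b))].

Definition jcoord (R : realType) (J : finType) (i : J) : jet R J :=
  Jet (fun p => p i) (fun j _ => (j == i)%:R) (fun _ _ _ => 0) (fun _ _ _ _ => 0).

Definition jlin (R : realType) (J B : finType) (c : B -> R) (F : B -> jet R J) : jet R J :=
  Jet (fun p => \sum_b c b * j0 (F b) p)
      (fun a p => \sum_b c b * j1 (F b) a p)
      (fun a a' p => \sum_b c b * j2 (F b) a a' p)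
      (fun a a' a'' p => \sum_b c b * j3 (F b) a a' a'' p).

Definition jaxpy (R : realType) (J : finType) (F : jet R J) (c : R) (E : jet R J) : jet R J :=
  Jet (fun p => j0 F p + c * j0 E p)
      (fun a p => j1 F a p + c * j1 E a p)
      (fun a b p => j2 F a b p + c * j2 E a b p)
      (fun a b d p => j3 F a b d p + c * j3 E a b d p).

(** Chain rule up to order 3. The sums are nested exactly as the product rule produces them, so that
    [is_jet_comp] goes through by unification and symmetry of higher derivatives is never
    invoked. *)
Definition jcomp (R : realType) (J I : finType) (F : jet R J) (P : J -> jet R I) : jet R I :=
  let ev p : pt R J := fun j => j0 (P j) p in
  Jet (fun p => j0 F (ev p))
      (fun a p => \sum_j j1 F j (ev p) * j1 (P j) a p)
      (fun a b p =>
         \sum_j (\sum_k j2 F j k (ev p) * j1 (P k) b p) * j1 (P j) a p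
         + \sum_j j1 F j (ev p) * j2 (P j) a b p)
      (fun a b c p =>
         \sum_j ((\sum_k ((\sum_l j3 F j k l (ev p) * j1 (P l) c p) * j1 (P k) b p
                          + j2 F j k (ev p) * j2 (P k) b c p)) * j1 (P j) a p
                 + (\sum_k j2 F j k (ev p) * j1 (P k) b p) * j2 (P j) a c p)
         + \sum_j ((\sum_k j2 F j k (ev p) * j1 (P k) c p) * j2 (P j) a b p
                   + j1 F j (ev p) * j3 (P j) a b c p)).

Section JetBounds.
Variables (R : realType) (J : finType).

Lemma is_jet_bdd (F : jet R J) : is_jet F ->
  [/\ forall a, bdd (j1 F a), forall a b, bdd (j2 F a b) & forall a b c, bdd (j3 F a b c)].
Proof.
by move=> [H1 H2 H3]; split => [a|a b|a b c];
  [exact: D1_bdd H1 | exact: D1_bdd (H2 a) | exact: D1_bdd (H3 a b)].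
Qed.

End JetBounds.

Section JetLemmas.
Variables (R : realType) (J : finType).

Lemma is_jet_coord i : is_jet (@jcoord R J i).
Proof.
split => [|a|a b] /=; first exact: D1_coord.
- exact: D1_cst.
- exact: D1_cst.
Qed.

Lemma is_jet_lin (B : finType) (c : B -> R) (F : B -> jet R J) :
  (forall b, is_jet (F b)) -> is_jet (jlin c F).
Proof.
move=> H; split => [|a|a a'] /=; apply: (@D1_sum R J B) => b;
  by apply: D1_cstmul; case: (H b).
Qed.

Lemma is_jet_axpy (F E : jet R J) c : is_jet F -> is_jet E -> is_jet (jaxpy F c E).
Proof.
by move=> [F1 F2 F3] [E1 E2 E3]; split => [|a|a a'] /=; apply: D1_add => //; exact: D1_cstmul.
Qed.

Lemma is_jet_comp (I : finType) (F : jet R J) (P : J -> jet R I) :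
  is_jet F -> (forall j, is_jet (P j)) -> is_jet (jcomp F P).
Proof.
move=> HF HP; have [F1 F2 F3] := HF; have [B1 B2 B3] := is_jet_bdd HF.
have P1 j : D1 (j0 (P j)) (j1 (P j)) by case: (HP j).
have P2 j a : D1 (j1 (P j) a) (j2 (P j) a) by case: (HP j).
have P3 j a b : D1 (j2 (P j) a b) (j3 (P j) a b) by case: (HP j).
have Q1 j a : bdd (j1 (P j) a) by case: (is_jet_bdd (HP j)).
have Q2 j a b : bdd (j2 (P j) a b) by case: (is_jet_bdd (HP j)).
pose ev := fun p : pt R I => (fun j => j0 (P j) p) : pt R J.
have cb (f : pt R J -> R) : bdd f -> bdd (fun p => f (ev p)) by exact: bdd_comp.
have C f f' : D1 f f' -> D1 (fun p => f (ev p)) (fun i p => \sum_j f' j (ev p) * j1 (P j) i p).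
  by move=> H; exact: D1_comp.
split => [|a|a b].
- exact: C.
- rewrite /=; apply: eq_D1 (D1_sum (F' := fun j b p =>
      (\sum_k j2 F j k (ev p) * j1 (P k) b p) * j1 (P j) a p + j1 F j (ev p) * j2 (P j) a b p) _).
  + by [].
  + by move=> b p /=; rewrite big_split.
  + by move=> j; apply: D1_mul => //; [exact: cb | exact: C].
- rewrite /=; apply: D1_add.
  + apply: D1_sum => j; apply: D1_mul => //.
    * by apply: bdd_sum => k; apply: bdd_mul => //; exact: cb.
    * by apply: D1_sum => k; apply: D1_mul => //; [exact: cb | exact: C].
  + by apply: D1_sum => j; apply: D1_mul => //; [exact: cb | exact: C].
Qed.

End JetLemmas.

Section CompBounds.
Variables (R : realType) (J I : finType) (F : jet R J) (P : J -> jet R I) (p : pt R I).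
Let M : R := #|J|%:R.
Let ev : pt R J := fun j => j0 (P j) p.
Variables (L p1 p2 p3 : R).
Hypothesis F1 : forall a q, `|j1 F a q| <= L.
Hypothesis F2 : forall a b q, `|j2 F a b q| <= L.
Hypothesis F3 : forall a b c q, `|j3 F a b c q| <= L.
Hypothesis P1 : forall j a, `|j1 (P j) a p| <= p1.
Hypothesis P2 : forall j a b, `|j2 (P j) a b p| <= p2.
Hypothesis P3 : forall j a b c, `|j3 (P j) a b c p| <= p3.

Let nmul (x y a b : R) : `|x| <= a -> `|y| <= b -> `|x * y| <= a * b.
Proof. by move=> xa yb; rewrite normrM; apply: ler_pM. Qed.
Let nadd (x y a b : R) : `|x| <= a -> `|y| <= b -> `|x + y| <= a + b.
Proof. by move=> xa yb; apply: le_trans (ler_normD _ _) _; apply: lerD. Qed.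

(** The inner derivatives are bounded at the point p only: in the step estimates they are controlled
    by standard deviations, which depend on the point. *)
Lemma jcomp_bound1 a : `|j1 (jcomp F P) a p| <= M * (L * p1).
Proof. by apply: norm_sum_le_const => j; exact: nmul. Qed.

Lemma jcomp_bound2 a b : `|j2 (jcomp F P) a b p| <= M * (M * (L * p1) * p1) + M * (L * p2).
Proof.
apply: nadd; apply: norm_sum_le_const => j; apply: nmul => //.
by apply: norm_sum_le_const => k; exact: nmul.
Qed.

Lemma jcomp_bound3 a b c : `|j3 (jcomp F P) a b c p| <=
  M * (M * (M * (L * p1) * p1 + L * p2) * p1 + M * (L * p1) * p2)
  + M * (M * (L * p1) * p2 + L * p3).
Proof.
apply: nadd; apply: norm_sum_le_const => j; apply: nadd; apply: nmul => //.
- apply: norm_sum_le_const => k; apply: nadd; last exact: nmul.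
  by apply: nmul => //; apply: norm_sum_le_const => l; exact: nmul.
- by apply: norm_sum_le_const => k; exact: nmul.
- by apply: norm_sum_le_const => k; exact: nmul.
Qed.

End CompBounds.

(** * One step of the scheme and its derivatives *)

Lemma sum_delta (R : realType) (B : finType) (F : B -> R) (b : B) :
  \sum_k (b == k)%:R * F k = F b.
Proof.
rewrite (bigD1 b)//= eqxx mul1r big1 ?addr0// => k /negbTE.
by rewrite eq_sym => ->; rewrite mul0r.
Qed.

(** * Averages of products with random factors close to constants *)

Section Multipliers.
Variables (R : realType) (D G : finType) (eps : G -> D -> R) (E : R).
Hypothesis G0 : (0 < #|G|)%N.
Hypothesis epsE : forall g j, `|eps g j| <= E.
Hypothesis eps0 : forall j, avg (eps^~ j) = 0.
Hypothesis eps1 : forall j, avg (fun g => eps g j ^+ 2) = 1.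
Variable r : R.
Hypothesis r01 : 0 < r <= 1.

Let r0 : 0 <= r. Proof. by case/andP: r01 => /ltW. Qed.
Let r1 : r <= 1. Proof. by case/andP: r01. Qed.
(* A factor that deviates from a constant by a centered term of order r and a
   remainder of order r ^+ 2: averaging a product with such a factor costs
   only r times the standard deviation, plus r ^+ 2. *)
Definition is_mul (C : R) (c : G -> R) (c0 : R) : Prop :=
  exists (a : D -> R) (e : G -> R),
  [/\ forall g, c g = c0 + r * (\sum_j a j * eps g j) + r ^+ 2 * e g,
      forall j, `|a j| <= C, forall g, `|e g| <= C & `|c0| <= C].

Lemma is_mul_le C C' c c0 : C <= C' -> is_mul C c c0 -> is_mul C' c c0.
Proof.
move=> CC [a [e [H1 H2 H3 H4]]]; exists a, e.
by split=> // [j|g|]; apply: le_trans CC.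
Qed.

Definition dE : R := #|D|%:R * `|E|.

Lemma noise_le a (C : R) g : (forall j, `|a j| <= C) -> `|\sum_j a j * eps g j| <= dE * C.
Proof.
move=> H; rewrite /dE -mulrA; apply: norm_sum_le_const => j.
rewrite normrM mulrC; apply: ler_pM => //.
by apply: le_trans (epsE g j) _; exact: ler_norm.
Qed.

(** The terms of order r of the product are again combinations of the centered noise. All others,
    including the product of the two noise sums, carry [r ^+ 2] and go to the remainder. *)
Lemma is_mul_mul C C' c c' c0 c0' : is_mul C c c0 -> is_mul C' c' c0' ->
  is_mul (((dE + 1) ^+ 2 + 2) * (C * C')) (fun g => c g * c' g) (c0 * c0').
Proof.
move=> [a [e [H1 H2 H3 H4]]] [a' [e' [H1' H2' H3' H4']]].
have C0 : 0 <= C by exact: le_trans H4.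
have C0' : 0 <= C' by exact: le_trans H4'.
have CC : 0 <= C * C' by exact: mulr_ge0.
pose S g := \sum_j a j * eps g j; pose S' g := \sum_j a' j * eps g j.
exists (fun j => c0 * a' j + c0' * a j),
  (fun g => c0 * e' g + c0' * e g + S g * S' g + r * (S g * e' g + S' g * e g) + r ^+ 2 * (e g * e' g)).
have nM (x y u v : R) : `|x| <= u -> `|y| <= v -> `|x * y| <= u * v.
  by move=> xu yv; rewrite normrM ler_pM.
have nD (x y u v : R) : `|x| <= u -> `|y| <= v -> `|x + y| <= u + v.
  by move=> xu yv; apply: le_trans (ler_normD _ _) _; apply: lerD.
split.
- move=> g; rewrite H1 H1' -/(S g) -/(S' g).
  have -> : \sum_j (c0 * a' j + c0' * a j) * eps g j = c0 * S' g + c0' * S g.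
    by rewrite /S /S' !mulr_sumr -big_split; apply: eq_bigr => j _ /=; ring.
  by ring.
- move=> j; apply: (@le_trans _ _ (C * C' + C' * C)); first by apply: (nD); exact: nM.
  by have := mulr_ge0 (sqr_ge0 (dE + 1)) CC; lra.
- move=> g.
  have hS : `|S g| <= dE * C by exact: noise_le.
  have hS' : `|S' g| <= dE * C' by exact: noise_le.
  apply: (@le_trans _ _ (C * C' + C' * C + (dE * C) * (dE * C')
     + 1 * ((dE * C) * C' + (dE * C') * C) + 1 * (C * C'))).
    apply: (nD); last first.
      by apply: (nM); [rewrite ger0_norm ?exprn_ge0// exprn_ile1 | exact: nM].
    apply: (nD); last first.
      by apply: (nM); [rewrite ger0_norm | apply: (nD); exact: nM].
    by apply: (nD); [apply: (nD); exact: nM | exact: nM].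
  by apply: le_of_eq; ring.
- apply: le_trans (nM _ _ _ _ H4 H4') _.
  by have := mulr_ge0 (sqr_ge0 (dE + 1)) CC; lra.
Qed.

Lemma avg_eps_le (X : G -> R) j : `|avg (fun g => eps g j * X g)| <= sd X.
Proof. by apply: avg_mul_centered => //; rewrite eps1. Qed.

(** The centered part of the factor produces covariances of X with the noise, each at most the
    standard deviation of X. *)
Lemma avg_mul_near C c c0 (X : G -> R) s : is_mul C c c0 -> (forall g, `|X g| <= s) ->
  `|avg (fun g => X g * c g) - c0 * avg X| <= C * (#|D|%:R * (r * sd X) + r ^+ 2 * s).
Proof.
move=> [a [e [H1 H2 H3 H4]]] Xs.
have C0 : 0 <= C by exact: le_trans H4.
have -> : avg (fun g => X g * c g) = c0 * avg X + (\sum_j (r * a j) * avg (fun g => eps g j * X g))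
   + avg (fun g => r ^+ 2 * (X g * e g)).
  rewrite -avgZ; under eq_bigr do rewrite -avgZ.
  rewrite -avg_sum -!avgD; apply: eq_avg => g; rewrite H1.
  have -> : \sum_j r * a j * (eps g j * X g) = r * (\sum_j a j * eps g j) * X g.
    by rewrite mulr_sumr mulr_suml; apply: eq_bigr => j _; ring.
  by ring.
rewrite addrAC [c0 * _ + _]addrC addrK mulrDr.
apply: le_trans (ler_normD _ _) _; apply: lerD.
  have -> : C * (#|D|%:R * (r * sd X)) = #|D|%:R * (r * C * sd X) by ring.
  apply: norm_sum_le_const => j; rewrite normrM [`|r * a j|]normrM (ger0_norm r0).
  by apply: ler_pM; rewrite ?mulr_ge0//; [exact: ler_wpM2l | exact: avg_eps_le].
apply: norm_avg_le => // g.
have -> : C * (r ^+ 2 * s) = r ^+ 2 * (s * C) by ring.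
rewrite normrM (ger0_norm (sqr_ge0 r)) ler_wpM2l ?sqr_ge0// normrM.
exact: ler_pM.
Qed.

(** With the additional factor [eps] nothing cancels any more, and the error is of order r times the
    size of X. This suffices, since weighted averages occur in the step with a factor r: the
    [r ^+ 2] of the generator times [r^-1]. *)
Lemma avg_eps_mul_near C c c0 (X : G -> R) s j : is_mul C c c0 -> (forall g, `|X g| <= s) ->
  `|avg (fun g => eps g j * (X g * c g)) - c0 * avg (fun g => eps g j * X g)|
   <= C * (`|E| * (dE + 1) * (r * s)).
Proof.
move=> [a [e [H1 H2 H3 H4]]] Xs.
have C0 : 0 <= C by exact: le_trans H4.
rewrite -avgZ -avgB; apply: norm_avg_le => // g.
rewrite H1.
have -> : eps g j * (X g * (c0 + r * (\sum_j a j * eps g j) + r ^+ 2 * e g)) - c0 * (eps g j * X g)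
   = eps g j * (r * (X g * (\sum_j a j * eps g j + r * e g))) by ring.
have -> : C * (`|E| * (dE + 1) * (r * s)) = `|E| * (r * (s * (dE * C + C))) by ring.
rewrite normrM; apply: ler_pM => //; first by apply: le_trans (epsE g j) _; exact: ler_norm.
rewrite normrM ger0_norm// ler_wpM2l// normrM; apply: ler_pM => //.
apply: le_trans (ler_normD _ _) _; apply: lerD; first exact: noise_le.
by rewrite normrM ger0_norm// -[leRHS]mul1r ler_pM.
Qed.

End Multipliers.

Section Scheme.
Variables (R : realType) (I A D G : finType) (eps : G -> D -> R) (dg : I -> I).

Definition jY (r : R) (b : I -> jet R I) (s : I -> D -> jet R I) (g : G) (l : I) : jet R I :=
  jaxpy (jaxpy (jcoord R l) (r ^+ 2) (b l)) 1 (jlin (fun j => r * eps g j) (s l)).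

(** The approximation of the gradient along the columns of s. Its factor [r^-1] is what makes the
    scheme delicate: a bound of u alone gives no bound of this term uniformly in r. *)
Definition jZ r b s (u : A -> jet R I) (ij : A * D) : jet R I :=
  jlin (fun g => #|G|%:R^-1 * (r^-1 * eps g ij.2)) (fun g => jcomp (u ij.1) (jY r b s g)).

(** The jets v are kept apart from u because the diagonal values belong to another parameter: t
    equal to the current time. *)
Definition jdiag (v : A -> jet R I) (i : A) : jet R I :=
  jcomp (v i) (fun l => jcoord R (dg l)).

Definition jarg r b s v u (k : I + A + A * D) : jet R I :=
  match k with
  | inl (inl l) => jcoord R l
  | inl (inr i) => jdiag v i
  | inr ij => jZ r b s u ij
  end.

Definition jstep r b s (f : A -> jet R (I + A + A * D)%type) v u (i : A) : jet R I :=
  jaxpy (jlin (fun=> #|G|%:R^-1) (fun g => jcomp (u i) (jY r b s g)))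
    (r ^+ 2) (jcomp (f i) (jarg r b s v u)).

Lemma is_jet_Y r b s g l : (forall i, is_jet (b i)) -> (forall i j, is_jet (s i j)) ->
  is_jet (jY r b s g l).
Proof.
move=> Hb Hs; apply: is_jet_axpy; last by apply: is_jet_lin => j.
by apply: is_jet_axpy => //; exact: is_jet_coord.
Qed.

Lemma is_jet_step r b s f v u i : (forall i, is_jet (b i)) -> (forall i j, is_jet (s i j)) ->
  (forall i, is_jet (f i)) -> (forall i, is_jet (v i)) -> (forall i, is_jet (u i)) ->
  is_jet (jstep r b s f v u i).
Proof.
move=> Hb Hs Hf Hv Hu.
have HY g : is_jet (jcomp (u i) (jY r b s g)).
  by apply: is_jet_comp => // l; exact: is_jet_Y.
apply: is_jet_axpy; first by apply: is_jet_lin.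
apply: is_jet_comp => // -[[l|i']|[i' j]] /=.
- exact: is_jet_coord.
- by apply: is_jet_comp => // l; exact: is_jet_coord.
- apply: is_jet_lin => g /=; apply: is_jet_comp => // l; exact: is_jet_Y.
Qed.

End Scheme.

(** * Derivatives of u(Y) in terms of the derivatives of u at Y *)

Section CompositeExpansion.
Variables (R : realType) (I D G : finType) (eps : G -> D -> R) (E : R).
Hypothesis epsE : forall g j, `|eps g j| <= E.
Variables (r L : R).
Hypothesis r01 : 0 < r <= 1.
Hypothesis L1 : 1 <= L.
Variables (b : I -> jet R I) (s : I -> D -> jet R I).
Hypothesis b1 : forall l a q, `|j1 (b l) a q| <= L.
Hypothesis b2 : forall l a c q, `|j2 (b l) a c q| <= L.
Hypothesis b3 : forall l a c d q, `|j3 (b l) a c d q| <= L.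
Hypothesis s1 : forall l j a q, `|j1 (s l j) a q| <= L.
Hypothesis s2 : forall l j a c q, `|j2 (s l j) a c q| <= L.
Hypothesis s3 : forall l j a c d q, `|j3 (s l j) a c d q| <= L.
Variable q : pt R I.

Let Y := jY eps r b s.
Let Yq g : pt R I := fun l => j0 (Y g l) q.

(** Here F evaluates one fixed derivative at q. As Y is affine in the noise, so are its derivatives;
    their constant parts are those of a coordinate. *)
Let mulY (F : jet R I -> R) (x0 : R) l : (forall c E1 E2, F (jaxpy E1 c E2) = F E1 + c * F E2) ->
  (forall (c : D -> R) E, F (jlin c E) = \sum_j c j * F (E j)) ->
  F (jcoord R l) = x0 -> `|x0| <= 1 -> `|F (b l)| <= L -> (forall j, `|F (s l j)| <= L) ->
  is_mul eps r L (fun g => F (Y g l)) x0.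
Proof.
move=> Fa Fl Fc x01 Fb Fs; exists (fun j => F (s l j)), (fun=> F (b l)); split => //; last exact: le_trans L1.
move=> g; rewrite /Y /jY !Fa Fl Fc mul1r addrAC; congr (_ + _ + _).
by rewrite mulr_sumr; apply: eq_bigr => j _; ring.
Qed.

Lemma is_mul_Y1 l a : is_mul eps r L (fun g => j1 (Y g l) a q) (a == l)%:R.
Proof. by apply: (mulY (F := fun H => j1 H a q)) => //; case: eqP; rewrite ?normr1 ?normr0. Qed.

Lemma is_mul_Y2 l a c : is_mul eps r L (fun g => j2 (Y g l) a c q) 0.
Proof. by apply: (mulY (F := fun H => j2 H a c q)) => //; rewrite normr0. Qed.

Lemma is_mul_Y3 l a c d : is_mul eps r L (fun g => j3 (Y g l) a c d q) 0.
Proof. by apply: (mulY (F := fun H => j3 H a c d q)) => //; rewrite normr0. Qed.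

Let kE := (dE D E + 1) ^+ 2 + 2.
Definition Cmul : R := kE * (kE * (L * L) * L).
Let kE1 : 1 <= kE. Proof. by rewrite /kE; have := sqr_ge0 (dE D E + 1); lra. Qed.
Let L0 : 0 <= L. Proof. by apply: le_trans L1. Qed.

Let LL : L <= kE * (L * L).
Proof.
apply: (@le_trans _ _ (L * L)); first by rewrite ler_peMr.
by rewrite ler_peMl// mulr_ge0.
Qed.

Let LLC : kE * (L * L) <= Cmul.
Proof.
rewrite /Cmul; set x := kE * (L * L).
have x0 : 0 <= x by exact: le_trans LL.
apply: (@le_trans _ _ (x * L)); first by rewrite ler_peMr.
by rewrite ler_peMl// mulr_ge0.
Qed.

Let m1 c c0 : is_mul eps r L c c0 -> is_mul eps r Cmul c c0.
Proof. by apply: is_mul_le; exact: le_trans LLC. Qed.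

Let m2 c c0 c' c0' : is_mul eps r L c c0 -> is_mul eps r L c' c0' ->
  is_mul eps r Cmul (fun g => c g * c' g) (c0 * c0').
Proof. by move=> H H'; apply: is_mul_le LLC _; exact: is_mul_mul. Qed.

Let m3 c c0 c' c0' c'' c0'' : is_mul eps r L c c0 -> is_mul eps r L c' c0' ->
  is_mul eps r L c'' c0'' ->
  is_mul eps r Cmul (fun g => c g * c' g * c'' g) (c0 * c0' * c0'').
Proof.
move=> H H' H''; apply: (@is_mul_mul _ _ _ _ _ epsE _ r01 _ _ _ _ _ _ _ H'').
exact: is_mul_mul.
Qed.

Variables (F : jet R I) (La : (G -> R) -> R) (T : (G -> R) -> R).
Hypothesis La_sum : forall (B : finType) (X : B -> G -> R),
  La (fun g => \sum_k X k g) = \sum_k La (X k).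
Hypothesis La_add : forall X Z : G -> R, La (fun g => X g + Z g) = La X + La Z.
Hypothesis LaT : forall c c0 X, is_mul eps r Cmul c c0 ->
  `|La (fun g => X g * c g) - c0 * La X| <= T X.
Variables (t1 t2 t3 : R).
Hypothesis T1 : forall l, T (fun g => j1 F l (Yq g)) <= t1.
Hypothesis T2 : forall l m, T (fun g => j2 F l m (Yq g)) <= t2.
Hypothesis T3 : forall l m k, T (fun g => j3 F l m k (Yq g)) <= t3.
Let N : R := #|I|%:R.

Let nD (x y u v : R) : `|x| <= u -> `|y| <= v -> `|x + y| <= u + v.
Proof. by move=> xu yv; apply: le_trans (ler_normD _ _) _; apply: lerD. Qed.

Let eqLa (X Z : G -> R) : X =1 Z -> La X = La Z.
Proof. by move=> /funext ->. Qed.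

(** [La] is either the plain average or the average weighted by a component of the noise, and [T] is
    the price of pulling a multiplier out of it. One expansion thus serves both the transported
    value and the gradient term. *)
Lemma comp_expand1 a :
  `|La (fun g => j1 (jcomp F (Y g)) a q) - La (fun g => j1 F a (Yq g))| <= N * t1.
Proof.
(* The target is written as a sum with Kronecker deltas, which are the constant parts of the first
   derivatives of Y. The difference can then be estimated term by term. *)
rewrite /= La_sum -(@sum_delta _ _ (fun k => La (fun g => j1 F k (Yq g))) a) -sumrB.
apply: norm_sum_le_const => j; apply: le_trans (T1 j).
by apply: (LaT); apply: (m1); exact: is_mul_Y1.
Qed.

Lemma comp_expand2 a c :
  `|La (fun g => j2 (jcomp F (Y g)) a c q) - La (fun g => j2 F a c (Yq g))|
   <= N * (N * t2) + N * t1.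
Proof.
rewrite /= La_add La_sum.
rewrite -(@sum_delta _ _ (fun k => La (fun g => j2 F k c (Yq g))) a).
under [X in _ - X]eq_bigr do rewrite -(@sum_delta _ _ (fun k => La (fun g => j2 F _ k (Yq g))) c).
rewrite addrAC -sumrB; apply: (nD).
  apply: norm_sum_le_const => j.
  rewrite (@eqLa _ (fun g => \sum_k j2 F j k (Yq g) * (j1 (Y g k) c q * j1 (Y g j) a q))); last first.
    by move=> g; rewrite mulr_suml; apply: eq_bigr => k _; rewrite mulrA.
  rewrite La_sum mulr_sumr -sumrB; apply: norm_sum_le_const => k.
  rewrite mulrA [_%:R * _%:R]mulrC; apply: le_trans (T2 j k); apply: (LaT).
  by apply: (m2); exact: is_mul_Y1.
rewrite La_sum; apply: norm_sum_le_const => j; apply: le_trans (T1 j).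
rewrite -[La _]subr0 -[X in _ - X](mul0r (La (fun g => j1 F j (Yq g)))).
by apply: (LaT); apply: (m1); exact: is_mul_Y2.
Qed.

Let La0 c X x : T X <= x -> is_mul eps r Cmul c 0 -> `|La (fun g => X g * c g)| <= x.
Proof.
move=> Tx H; apply: le_trans Tx.
by have := LaT X H; rewrite mul0r subr0.
Qed.

Lemma comp_expand3 a c d :
  `|La (fun g => j3 (jcomp F (Y g)) a c d q) - La (fun g => j3 F a c d (Yq g))|
   <= N * (N * (N * t3 + t2) + N * t2) + N * (N * t2 + t1).
Proof.
rewrite /= La_add.
rewrite -(@sum_delta _ _ (fun k => La (fun g => j3 F k c d (Yq g))) a).
rewrite La_sum addrAC -sumrB; apply: (nD).
  apply: norm_sum_le_const => j.
  rewrite La_add addrAC; apply: (nD); last first.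
    rewrite (@eqLa _ (fun g => \sum_k j2 F j k (Yq g) * (j1 (Y g k) c q * j2 (Y g j) a d q))); last first.
      by move=> g; rewrite mulr_suml; apply: eq_bigr => k _; rewrite mulrA.
    rewrite La_sum; apply: norm_sum_le_const => k; apply: (La0) => //.
    by rewrite -(mulr0 (c == k)%:R); apply: (m2); [exact: is_mul_Y1 | exact: is_mul_Y2].
  rewrite -(@sum_delta _ _ (fun k => La (fun g => j3 F j k d (Yq g))) c).
  rewrite (@eqLa _ (fun g => \sum_k (\sum_l j3 F j k l (Yq g) * (j1 (Y g l) d q * j1 (Y g k) c q * j1 (Y g j) a q)
      + j2 F j k (Yq g) * (j2 (Y g k) c d q * j1 (Y g j) a q)))); last first.
    move=> g; rewrite mulr_suml; apply: eq_bigr => k _; rewrite mulrDl !mulr_suml mulrA; congr (_ + _).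
    by apply: eq_bigr => l _; rewrite !mulrA.
  rewrite La_sum mulr_sumr -sumrB; apply: norm_sum_le_const => k.
  rewrite La_add addrAC; apply: (nD); last first.
    apply: (La0) => //; rewrite -(mul0r (a == j)%:R).
    by apply: (m2); [exact: is_mul_Y2 | exact: is_mul_Y1].
  rewrite -(@sum_delta _ _ (fun l => La (fun g => j3 F j k l (Yq g))) d) !mulr_sumr La_sum -sumrB.
  apply: norm_sum_le_const => l.
  rewrite !mulrA [_%:R * _%:R]mulrC [_ * (d == l)%:R]mulrC mulrA; apply: le_trans (T3 j k l); apply: (LaT).
  by apply: m3; exact: is_mul_Y1.
rewrite La_sum; apply: norm_sum_le_const => j; rewrite La_add; apply: (nD).
  rewrite (@eqLa _ (fun g => \sum_k j2 F j k (Yq g) * (j1 (Y g k) d q * j2 (Y g j) a c q))); last first.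
    by move=> g; rewrite mulr_suml; apply: eq_bigr => k _; rewrite mulrA.
  rewrite La_sum; apply: norm_sum_le_const => k; apply: (La0) => //.
  by rewrite -(mulr0 (d == k)%:R); apply: (m2); [exact: is_mul_Y1 | exact: is_mul_Y2].
by apply: (La0) => //; apply: (m1); exact: is_mul_Y3.
Qed.

End CompositeExpansion.

(** * Estimates for one step *)

Ltac nonneg := repeat first [done | apply: addr_ge0 | apply: mulr_ge0 | apply: exprn_ge0].

Definition jet_le (R : realType) (J : finType) (L : R) (F : jet R J) : Prop :=
  [/\ forall q, `|j0 F q| <= L, forall a q, `|j1 F a q| <= L,
      forall a b q, `|j2 F a b q| <= L & forall a b c q, `|j3 F a b c q| <= L].

Section StepEstimates.
Variables (R : realType) (I A D G : finType) (eps : G -> D -> R) (dg : I -> I) (E L : R).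
Hypothesis G0 : (0 < #|G|)%N.
Hypothesis epsE : forall g j, `|eps g j| <= E.
Hypothesis eps0 : forall j, avg (eps^~ j) = 0.
Hypothesis eps1 : forall j, avg (fun g => eps g j ^+ 2) = 1.
Hypothesis L1 : 1 <= L.

Record step_data (r : R) (b : I -> jet R I) (s : I -> D -> jet R I)
    (f : A -> jet R (I + A + A * D)%type) : Prop := StepData {
  sd_r : 0 < r <= 1;
  sd_b : forall l, is_jet (b l) /\ jet_le L (b l);
  sd_s : forall l j, is_jet (s l j) /\ jet_le L (s l j);
  sd_f : forall i, is_jet (f i) /\ jet_le L (f i) }.

Definition nI : R := #|I|%:R.
Definition nJ : R := #|{: I + A + A * D}|%:R.
(** [Cm] bounds the multipliers, [Ca] and [Cz] the errors of plain and weighted averages, and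
    [Cl * r] the length of the displacement. *)
Definition Cm : R := Cmul D E L.
Definition Ca : R := Cm * (#|D|%:R + #|G|%:R).
Definition Cz : R := Cm * (`|E| * (dE D E + 1) * #|G|%:R).
Definition Cl : R := nI * (L + dE D E * L).

Let L0 : 0 <= L. Proof. by apply: le_trans L1. Qed.
Let dE0 : 0 <= dE D E. Proof. by rewrite mulr_ge0. Qed.
Let Cm0 : 0 <= Cm.
Proof.
have k0 : 0 <= (dE D E + 1) ^+ 2 + 2 by rewrite addr_ge0// sqr_ge0.
by rewrite /Cm /Cmul !mulr_ge0.
Qed.
Let Ca0 : 0 <= Ca. Proof. by rewrite mulr_ge0// addr_ge0. Qed.
Let Cz0 : 0 <= Cz. Proof. by apply: mulr_ge0 => //; apply: mulr_ge0 => //; apply: mulr_ge0 => //; exact: addr_ge0. Qed.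

Variables (r : R) (b : I -> jet R I) (s : I -> D -> jet R I)
  (f : A -> jet R (I + A + A * D)%type) (v u : A -> jet R I).
Hypothesis data : step_data r b s f.
Hypothesis uj : forall i, is_jet (u i).
Variable q : pt R I.

Let r_gt0 : 0 < r. Proof. by case: (data) => /andP[]. Qed.
Let r0 : 0 <= r. Proof. exact: ltW. Qed.
Let r1 : r <= 1. Proof. by case: (data) => /andP[]. Qed.
Let rr : 0 <= r ^+ 2. Proof. exact: sqr_ge0. Qed.
Let rr_gt0 : 0 < r ^+ 2. Proof. exact: exprn_gt0. Qed.

Definition Ypt (g : G) : pt R I := fun l => j0 (jY eps r b s g l) q.
Definition SD1 : R := \sum_(x : A * I) sd (fun g => j1 (u x.1) x.2 (Ypt g)).
Definition SD2 : R := \sum_(x : A * I * I) sd (fun g => j2 (u x.1.1) x.1.2 x.2 (Ypt g)).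
Definition SD3 : R := \sum_(x : A * I * I * I) sd (fun g => j3 (u x.1.1.1) x.1.1.2 x.1.2 x.2 (Ypt g)).

Lemma SD1_ge0 : 0 <= SD1. Proof. by apply: sumr_ge0 => x _; exact: sd_ge0. Qed.
Lemma SD2_ge0 : 0 <= SD2. Proof. by apply: sumr_ge0 => x _; exact: sd_ge0. Qed.
Lemma SD3_ge0 : 0 <= SD3. Proof. by apply: sumr_ge0 => x _; exact: sd_ge0. Qed.

Let sd_le1 i l : sd (fun g => j1 (u i) l (Ypt g)) <= SD1.
Proof.
by apply: (@le_sum_term _ _ (fun x : A * I => sd (fun g => j1 (u x.1) x.2 (Ypt g))) (i, l)) => x; exact: sd_ge0.
Qed.
Let sd_le2 i l m : sd (fun g => j2 (u i) l m (Ypt g)) <= SD2.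
Proof.
by apply: (@le_sum_term _ _ (fun x : A * I * I => sd (fun g => j2 (u x.1.1) x.1.2 x.2 (Ypt g))) (i, l, m)) => x; exact: sd_ge0.
Qed.
Let sd_le3 i l m k : sd (fun g => j3 (u i) l m k (Ypt g)) <= SD3.
Proof.
by apply: (@le_sum_term _ _ (fun x : A * I * I * I => sd (fun g => j3 (u x.1.1.1) x.1.1.2 x.1.2 x.2 (Ypt g))) (i, l, m, k)) => x; exact: sd_ge0.
Qed.

Lemma Ypt_dist g : nrm1 (fun l => Ypt g l - q l) <= Cl * r.
Proof.
have [_ Hb Hs _] := data.
rewrite /Cl -mulrA; apply: sum_le_const => l.
have -> : Ypt g l - q l = r * (r * j0 (b l) q + \sum_j j0 (s l j) q * eps g j).
  rewrite /Ypt /=.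
  have -> : \sum_j r * eps g j * j0 (s l j) q = r * (\sum_j j0 (s l j) q * eps g j).
    by rewrite mulr_sumr; apply: eq_bigr => j _; ring.
  by ring.
rewrite normrM (ger0_norm r0) mulrC ler_wpM2r//.
apply: le_trans (ler_normD _ _) _; apply: lerD.
  rewrite normrM (ger0_norm r0) -[leRHS]mul1r; apply: ler_pM => //.
  by case: (Hb l) => _ [].
by apply: noise_le => // j; case: (Hs l j) => _ [].
Qed.

(** A standard deviation is at most the oscillation over the displaced points, which lie within
    order r of q. *)
Lemma sd_lip (h : pt R I -> R) h' (S : R) : 0 <= S -> UD h h' -> (forall l p, `|h' l p| <= S) ->
  sd (fun g => h (Ypt g)) <= S * (Cl * r).
Proof.
move=> S0 hh hS; apply: (@sd_le _ _ G0 _ (h q)) => g.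
have -> : Ypt g = padd q (fun l => Ypt g l - q l).
  by apply/funext => l; rewrite /padd addrC subrK.
apply: le_trans (lip_bound hh (s := S) _) _; first by move=> x j _; exact: hS.
by rewrite ler_wpM2l// Ypt_dist.
Qed.

(** The price must be a function of X alone, so the sum of the absolute values replaces a bound of
    X. *)
Let Tavg (X : G -> R) : R := Cm * (#|D|%:R * (r * sd X) + r ^+ 2 * (\sum_g `|X g|)).
Let Teps (X : G -> R) : R := Cm * (`|E| * (dE D E + 1) * (r * (\sum_g `|X g|))).

Let Xsum (X : G -> R) g : `|X g| <= \sum_g `|X g|.
Proof. exact: (@le_sum_term _ _ (fun g => `|X g|)). Qed.

Let Tavg_le X x S : sd X <= x -> (forall g, `|X g| <= S) -> 0 <= S ->
  Tavg X <= Ca * (r * x + r ^+ 2 * S).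
Proof.
move=> Xx XS S0; rewrite /Tavg /Ca -mulrA; apply: ler_wpM2l => //.
have x0 : 0 <= x by apply: le_trans Xx; exact: sd_ge0.
have h1 : #|D|%:R * (r * sd X) <= #|D|%:R * (r * x) by rewrite !ler_wpM2l.
have h2 : r ^+ 2 * (\sum_g `|X g|) <= #|G|%:R * (r ^+ 2 * S).
  by rewrite mulrCA ler_wpM2l//; exact: sum_le_const.
have h3 : 0 <= #|D|%:R * (r ^+ 2 * S) by rewrite !mulr_ge0.
have h4 : 0 <= #|G|%:R * (r * x) by rewrite !mulr_ge0.
lra.
Qed.

Let Teps_le X S : (forall g, `|X g| <= S) -> Teps X <= Cz * (r * S).
Proof.
move=> XS; rewrite /Teps /Cz -[leRHS]mulrA; apply: ler_wpM2l => //.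
rewrite -[leRHS]mulrA; apply: ler_wpM2l; first by rewrite mulr_ge0// addr_ge0.
by rewrite mulrCA; apply: ler_wpM2l => //; exact: sum_le_const.
Qed.

Let Lavg c c0 X : is_mul eps r Cm c c0 -> `|avg (fun g => X g * c g) - c0 * avg X| <= Tavg X.
Proof.
have [r01 _ _ _] := data.
by move=> H; exact: (avg_mul_near G0 eps0 eps1 r01 H (Xsum X)).
Qed.

Let Leps j c c0 X : is_mul eps r Cm c c0 ->
  `|avg (fun g => eps g j * (X g * c g)) - c0 * avg (fun g => eps g j * X g)| <= Teps X.
Proof.
have [r01 _ _ _] := data.
by move=> H; exact: (avg_eps_mul_near G0 epsE r01 j H (Xsum X)).
Qed.

Let avg_eps_sum j (B : finType) (X : B -> G -> R) :
  avg (fun g => eps g j * \sum_k X k g) = \sum_k avg (fun g => eps g j * X k g).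
Proof. by rewrite -avg_sum; apply: eq_avg => g; rewrite mulr_sumr. Qed.

Let avg_eps_add j (X Z : G -> R) : avg (fun g => eps g j * (X g + Z g))
  = avg (fun g => eps g j * X g) + avg (fun g => eps g j * Z g).
Proof. by rewrite -avgD; apply: eq_avg => g; rewrite mulrDr. Qed.

Let b1 l a p : `|j1 (b l) a p| <= L. Proof. by case: (sd_b data l) => _ []. Qed.
Let b2 l a c p : `|j2 (b l) a c p| <= L. Proof. by case: (sd_b data l) => _ []. Qed.
Let b3 l a c d p : `|j3 (b l) a c d p| <= L. Proof. by case: (sd_b data l) => _ []. Qed.
Let s1 l j a p : `|j1 (s l j) a p| <= L. Proof. by case: (sd_s data l j) => _ []. Qed.
Let s2 l j a c p : `|j2 (s l j) a c p| <= L. Proof. by case: (sd_s data l j) => _ []. Qed.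
Let s3 l j a c d p : `|j3 (s l j) a c d p| <= L. Proof. by case: (sd_s data l j) => _ []. Qed.
Let f1 i a p : `|j1 (f i) a p| <= L. Proof. by case: (sd_f data i) => _ []. Qed.
Let f2 i a c p : `|j2 (f i) a c p| <= L. Proof. by case: (sd_f data i) => _ []. Qed.
Let f3 i a c d p : `|j3 (f i) a c d p| <= L. Proof. by case: (sd_f data i) => _ []. Qed.

Let avgE (X : G -> R) : \sum_g #|G|%:R^-1 * X g = avg X.
Proof. by rewrite /avg mulr_sumr. Qed.

Let avgZE (X : G -> R) j : r * (\sum_g (#|G|%:R^-1 * (r^-1 * eps g j)) * X g) = avg (fun g => eps g j * X g).
Proof.
rewrite /avg !mulr_sumr; apply: eq_bigr => g _; field.
by rewrite (gt_eqF r_gt0) pnatr_eq0 -lt0n G0.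
Qed.

Section Bounds.
Variables (S1 S2 S3 : R).
Hypotheses (S10 : 0 <= S1) (S20 : 0 <= S2) (S30 : 0 <= S3).
Hypothesis u1 : forall i a p, `|j1 (u i) a p| <= S1.
Hypothesis u2 : forall i a c p, `|j2 (u i) a c p| <= S2.
Hypothesis u3 : forall i a c d p, `|j3 (u i) a c d p| <= S3.
Hypothesis v1 : forall i a p, `|j1 (v i) a p| <= S1.
Hypothesis v2 : forall i a c p, `|j2 (v i) a c p| <= S2.
Hypothesis v3 : forall i a c d p, `|j3 (v i) a c d p| <= S3.

Definition avg_err1 : R := Ca * (r * SD1 + r ^+ 2 * S1).
Definition avg_err2 : R := Ca * (r * SD2 + r ^+ 2 * S2).
Definition avg_err3 : R := Ca * (r * SD3 + r ^+ 2 * S3).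

Lemma avg_bound1 i a : `|\sum_g #|G|%:R^-1 * j1 (jcomp (u i) (jY eps r b s g)) a q
   - avg (fun g => j1 (u i) a (Ypt g))| <= nI * avg_err1.
Proof.
rewrite avgE; apply: (comp_expand1 (E := E) L1 b1 s1 (T := Tavg)).
- by move=> *; exact: avg_sum.
- by move=> *; exact: Lavg.
- by move=> l; apply: Tavg_le.
Qed.

Lemma avg_bound2 i a c : `|\sum_g #|G|%:R^-1 * j2 (jcomp (u i) (jY eps r b s g)) a c q
   - avg (fun g => j2 (u i) a c (Ypt g))| <= nI * (nI * avg_err2) + nI * avg_err1.
Proof.
rewrite avgE; apply: (comp_expand2 epsE (sd_r data) L1 b1 b2 s1 s2 (T := Tavg)).
- by move=> *; exact: avg_sum.
- by move=> *; exact: avgD.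
- by move=> *; exact: Lavg.
- by move=> l; apply: Tavg_le.
- by move=> l m; apply: Tavg_le.
Qed.

Lemma avg_bound3 i a c d : `|\sum_g #|G|%:R^-1 * j3 (jcomp (u i) (jY eps r b s g)) a c d q
   - avg (fun g => j3 (u i) a c d (Ypt g))| <= nI * (nI * (nI * avg_err3 + avg_err2) + nI * avg_err2) + nI * (nI * avg_err2 + avg_err1).
Proof.
rewrite avgE; apply: (comp_expand3 epsE (sd_r data) L1 b1 b2 b3 s1 s2 s3 (T := Tavg)).
- by move=> *; exact: avg_sum.
- by move=> *; exact: avgD.
- by move=> *; exact: Lavg.
- by move=> l; apply: Tavg_le.
- by move=> l m; apply: Tavg_le.
- by move=> l m k; apply: Tavg_le.
Qed.

Definition eps_err1 : R := Cz * (r * S1).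
Definition eps_err2 : R := Cz * (r * S2).
Definition eps_err3 : R := Cz * (r * S3).

Let zfin (x y w z : R) : `|x - y| <= w -> `|y| <= z -> `|x| <= z + w.
Proof. by move=> xy yz; rewrite -(subrK y x) addrC; apply: le_trans (ler_normD _ _) _; apply: lerD. Qed.

Let rnorm x : r * `|x| = `|r * x|. Proof. by rewrite normrM (ger0_norm r0). Qed.

(** Multiplication by r removes the [r^-1] of [jZ]; what is left is a covariance with the noise,
    hence a standard deviation, up to an error of order r. *)
Lemma jZ_bound1 ij a : r * `|j1 (jZ eps r b s u ij) a q| <= SD1 + nI * eps_err1.
Proof.
rewrite rnorm avgZE; case: ij => i j /=.
apply: (zfin (y := avg (fun g => eps g j * j1 (u i) a (Ypt g)))); last first.
  by apply: le_trans (sd_le1 i a); exact: avg_eps_le.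
apply: (comp_expand1 (E := E) L1 b1 s1 (La := fun X => avg (fun g => eps g j * X g)) (T := Teps)).
- by move=> *; exact: avg_eps_sum.
- by move=> *; exact: Leps.
- by move=> l; apply: Teps_le.
Qed.

Lemma jZ_bound2 ij a c : r * `|j2 (jZ eps r b s u ij) a c q| <= SD2 + (nI * (nI * eps_err2) + nI * eps_err1).
Proof.
rewrite rnorm avgZE; case: ij => i j /=.
apply: (zfin (y := avg (fun g => eps g j * j2 (u i) a c (Ypt g)))); last first.
  by apply: le_trans (sd_le2 i a c); exact: avg_eps_le.
apply: (comp_expand2 epsE (sd_r data) L1 b1 b2 s1 s2 (La := fun X => avg (fun g => eps g j * X g)) (T := Teps)).
- by move=> *; exact: avg_eps_sum.
- by move=> *; exact: avg_eps_add.
- by move=> *; exact: Leps.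
- by move=> l; apply: Teps_le.
- by move=> l m; apply: Teps_le.
Qed.

Lemma jZ_bound3 ij a c d : r * `|j3 (jZ eps r b s u ij) a c d q|
  <= SD3 + (nI * (nI * (nI * eps_err3 + eps_err2) + nI * eps_err2) + nI * (nI * eps_err2 + eps_err1)).
Proof.
rewrite rnorm avgZE; case: ij => i j /=.
apply: (zfin (y := avg (fun g => eps g j * j3 (u i) a c d (Ypt g)))); last first.
  by apply: le_trans (sd_le3 i a c d); exact: avg_eps_le.
apply: (comp_expand3 epsE (sd_r data) L1 b1 b2 b3 s1 s2 s3 (La := fun X => avg (fun g => eps g j * X g)) (T := Teps)).
- by move=> *; exact: avg_eps_sum.
- by move=> *; exact: avg_eps_add.
- by move=> *; exact: Leps.
- by move=> l; apply: Teps_le.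
- by move=> l m; apply: Teps_le.
- by move=> l m k; apply: Teps_le.
Qed.

Let cd1 (k l : I) p : `|j1 (jcoord R (dg k)) l p| <= 1.
Proof. by rewrite /=; case: eqP; rewrite ?normr1 ?normr0. Qed.

Lemma jdiag_bound1 i a : `|j1 (jdiag dg v i) a q| <= nI * S1.
Proof. by have := jcomp_bound1 (v1 i) (fun k l => cd1 k l q) a; rewrite mulr1. Qed.

Lemma jdiag_bound2 i a c : `|j2 (jdiag dg v i) a c q| <= nI * (nI * (S1 + S2)).
Proof.
have h1 l p : `|j1 (v i) l p| <= S1 + S2 by apply: le_trans (v1 _ _ _) _; rewrite lerDl.
have h2 l m p : `|j2 (v i) l m p| <= S1 + S2 by apply: le_trans (v2 _ _ _ _) _; rewrite lerDr.
have h0 (k l m : I) : `|j2 (jcoord R (dg k)) l m q| <= 0 by rewrite normr0.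
by have := jcomp_bound2 h1 h2 (fun k l => cd1 k l q) h0 a c; rewrite !mulr1 !mulr0 addr0.
Qed.

Lemma jdiag_bound3 i a c d : `|j3 (jdiag dg v i) a c d q| <= nI * (nI * (nI * (S1 + S2 + S3))).
Proof.
have h1 l p : `|j1 (v i) l p| <= S1 + S2 + S3 by apply: le_trans (v1 _ _ _) _; rewrite -addrA lerDl addr_ge0.
have h2 l m p : `|j2 (v i) l m p| <= S1 + S2 + S3 by apply: le_trans (v2 _ _ _ _) _; rewrite addrAC lerDr addr_ge0.
have h3 l m k p : `|j3 (v i) l m k p| <= S1 + S2 + S3 by apply: le_trans (v3 _ _ _ _ _) _; rewrite lerDr addr_ge0.
have h0 (k l m : I) : `|j2 (jcoord R (dg k)) l m q| <= 0 by rewrite normr0.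
have h00 (k l m o : I) : `|j3 (jcoord R (dg k)) l m o q| <= 0 by rewrite normr0.
by have := jcomp_bound3 h1 h2 h3 (fun k l => cd1 k l q) h0 h00 a c d; rewrite !mulr1 !mulr0 !addr0 mulr0 addr0.
Qed.

Definition kb1 : R := nI * Ca.
Definition carg0 : R := 1 + nI + (1 + nI * Cz).
Definition K1 : R := kb1 + nJ * (L * carg0).

Let SD10 := SD1_ge0.
Let SD20 := SD2_ge0.
Let SD30 := SD3_ge0.

Let scaled (x k W : R) : r ^+ 2 * x <= k * W -> x <= k * W / r ^+ 2.
Proof. by move=> H; rewrite ler_pdivlMr// mulrC. Qed.

Let unscale (x : R) : r ^+ 2 * (x / r ^+ 2) = x.
Proof. by rewrite mulrC divfK// gt_eqF. Qed.

Let weaken (x k k' W : R) : 0 <= W -> k <= k' -> x <= k * W -> x <= k' * W.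
Proof. by move=> W0 kk H; apply: le_trans H _; exact: ler_wpM2r. Qed.

Let addW (x y k k' W : R) : x <= k * W -> y <= k' * W -> x + y <= (k + k') * W.
Proof. by move=> h1 h2; rewrite mulrDl lerD. Qed.

Let mulW (x k n W : R) : 0 <= n -> x <= k * W -> n * x <= n * k * W.
Proof. by move=> n0 h; rewrite -mulrA ler_wpM2l. Qed.

Let leW (x k W : R) : 0 <= k -> x <= W -> k * x <= k * W.
Proof. by move=> k0 h; apply: ler_wpM2l. Qed.

Let stepD (x y z W k k' : R) : `|x - z| <= k * W -> r ^+ 2 * `|y| <= k' * W ->
  `|x + r ^+ 2 * y - z| <= (k + k') * W.
Proof.
move=> h1 h2; rewrite addrAC mulrDl; apply: le_trans (ler_normD _ _) _.
by apply: lerD => //; rewrite normrM (ger0_norm rr).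
Qed.

Let NCz : 0 <= nI * Cz. Proof. exact: mulr_ge0. Qed.
Let rSD1 : 0 <= r * SD1. Proof. exact: mulr_ge0. Qed.
Let rSD2 : 0 <= r * SD2. Proof. exact: mulr_ge0. Qed.
Let rSD3 : 0 <= r * SD3. Proof. exact: mulr_ge0. Qed.
Let rS1 : 0 <= r ^+ 2 * S1. Proof. exact: mulr_ge0. Qed.
Let rS2 : 0 <= r ^+ 2 * S2. Proof. exact: mulr_ge0. Qed.
Let rS3 : 0 <= r ^+ 2 * S3. Proof. exact: mulr_ge0. Qed.

(** [K1] depends on no bound of derivatives, so the estimate is linear in S1 and can be iterated.
    The gradient term contributes [r ^+ 2] times at most (SD1 + O(r S1)) / r, which is the term
    [r * SD1] up to order [r ^+ 2]. *)
Lemma step_bound1 i a : `|j1 (jstep eps dg r b s f v u i) a q - avg (fun g => j1 (u i) a (Ypt g))|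
  <= K1 * (r * SD1 + r ^+ 2 * (1 + S1)).
Proof.
set W := r * SD1 + r ^+ 2 * (1 + S1).
have W0 : 0 <= W by rewrite /W mulrDr mulr1 !addr_ge0.
have W1 : r * SD1 + r ^+ 2 * S1 <= W by rewrite /W mulrDr mulr1 lerD2l lerDr.
have W2 : r ^+ 2 <= W by rewrite /W mulrDr mulr1 addrCA lerDl; nonneg.
apply: stepD.
  apply: le_trans (avg_bound1 i a) _.
  by rewrite /kb1 -[leRHS]mulrA ler_wpM2l// /avg_err1 ler_wpM2l.
have Hp k c : `|j1 (jarg eps dg r b s v u k) c q| <= carg0 * W / r ^+ 2.
  apply: scaled; case: k => [[l|i']|ij].
  - apply: (@weaken _ 1) => //; first by rewrite /carg0 -addrA lerDl; nonneg.
    rewrite mul1r -[leRHS]mulr1; apply: ler_pM => //=.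
    by case: eqP; rewrite ?normr1 ?normr0.
  - apply: (@weaken _ nI) => //; first by rewrite /carg0 addrAC lerDr; nonneg.
    apply: le_trans (ler_wpM2l rr (jdiag_bound1 i' c)) _.
    by rewrite mulrCA ler_wpM2l//; apply: le_trans W1; rewrite lerDr.
  - apply: (@weaken _ (1 + nI * Cz)) => //; first by rewrite /carg0 lerDr; nonneg.
    rewrite expr2 -mulrA; apply: le_trans (ler_wpM2l r0 (jZ_bound1 ij c)) _.
    rewrite mulrDr mulrDl mul1r; apply: lerD; first by apply: le_trans W1; rewrite lerDl.
    have -> : r * (nI * eps_err1) = nI * Cz * (r ^+ 2 * S1) by rewrite /eps_err1; ring.
    by rewrite ler_wpM2l//; apply: le_trans W1; rewrite lerDr.
apply: le_trans (ler_wpM2l rr (jcomp_bound1 (f1 i) Hp a)) _.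
rewrite -/nJ; have -> : r ^+ 2 * (nJ * (L * (carg0 * W / r ^+ 2))) = nJ * L * (r ^+ 2 * (carg0 * W / r ^+ 2)) by ring.
by rewrite unscale; apply: le_of_eq; ring.
Qed.

Definition carg1 : R := 1 + nI * S1 + (1 + nI * Cz * S1).
Let c1_ge0 : 0 <= carg1. Proof. by rewrite !addr_ge0// mulr_ge0. Qed.

Let arg1 k c : r * `|j1 (jarg eps dg r b s v u k) c q| <= carg1 * (r + SD1).
Proof.
have X0 : 0 <= r + SD1 by rewrite addr_ge0.
have rX : r <= r + SD1 by rewrite lerDl.
case: k => [[l|i']|ij].
- apply: (@weaken _ 1) => //; first by rewrite /carg1 -addrA lerDl; nonneg.
  rewrite mul1r; apply: le_trans rX; rewrite ler_piMr//=.
  by case: eqP; rewrite ?normr1 ?normr0.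
- apply: (@weaken _ (nI * S1)) => //; first by rewrite /carg1 addrAC lerDr; nonneg.
  apply: le_trans (ler_wpM2l r0 (jdiag_bound1 i' c)) _.
  by rewrite mulrC ler_wpM2l//; nonneg.
- apply: (@weaken _ (1 + nI * Cz * S1)) => //; first by rewrite /carg1 lerDr; nonneg.
  apply: le_trans (jZ_bound1 ij c) _.
  rewrite mulrDl mul1r; apply: lerD; first by rewrite lerDr.
  have -> : nI * eps_err1 = nI * Cz * S1 * r by rewrite /eps_err1; ring.
  by rewrite ler_wpM2l//; nonneg.
Qed.

Definition carg2 : R := nI * (nI * (S1 + 1)) + (1 + nI * nI * Cz + nI * Cz * S1).
Definition kb2 : R := nI * (nI * Ca) + nI * (Ca * (1 + S1)).
Definition K2 : R := kb2 + (nJ * (nJ * L * (2 * carg1 ^+ 2)) + nJ * (L * carg2)).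

(** The second derivative of the generator multiplies two first derivatives of its arguments, each
    at most a constant times (r + SD1) / r, and [r ^+ 2] just cancels the two denominators. The
    resulting [SD1 ^+ 2] carries no small factor: it would be of order [r ^+ 2] only if the second
    derivatives were already known to be bounded. *)
Lemma step_bound2 i a c : `|j2 (jstep eps dg r b s f v u i) a c q - avg (fun g => j2 (u i) a c (Ypt g))|
  <= K2 * (r * SD2 + r ^+ 2 * (1 + S2) + SD1 ^+ 2).
Proof.
set W := r * SD2 + r ^+ 2 * (1 + S2) + SD1 ^+ 2.
have q1 : 0 <= SD1 ^+ 2 by exact: sqr_ge0.
have W0 : 0 <= W by rewrite /W mulrDr mulr1 !addr_ge0.
have [x1 x2 x3 x4] := And4 rr rSD1 rSD2 rS2.
have W1 : r * SD2 + r ^+ 2 * S2 <= W by rewrite /W; lra.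
have W2 : r ^+ 2 + SD1 ^+ 2 <= W by rewrite /W; lra.
have W3 : r ^+ 2 <= W by rewrite /W; lra.
have W4 : r * SD1 <= W by have := sqr_ge0 (r - SD1); lra.
have W5 : r * SD2 <= W by rewrite /W; lra.
have W6 : r ^+ 2 * S2 <= W by rewrite /W; lra.
have NN : 0 <= nI * nI * Cz by nonneg.
have NCS : 0 <= nI * Cz * S1 by nonneg.
apply: stepD.
  apply: le_trans (avg_bound2 i a c) _.
  apply: addW; apply: mulW => //; first by apply: mulW => //; exact: leW.
  apply: mulW => //; rewrite mulrDl mul1r; apply: lerD => //.
  by rewrite mulrC; exact: leW.
have Hp k e : `|j1 (jarg eps dg r b s v u k) e q| <= carg1 * (r + SD1) / r.
  by rewrite ler_pdivlMr// mulrC; exact: arg1.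
have Hp2 k e e' : `|j2 (jarg eps dg r b s v u k) e e' q| <= carg2 * W / r ^+ 2.
  apply: scaled; case: k => [[l|i']|ij].
  - by rewrite normr0 mulr0 /carg2; nonneg.
  - apply: (@weaken _ (nI * (nI * (S1 + 1)))) => //; first by rewrite /carg2 lerDl; nonneg.
    apply: le_trans (ler_wpM2l rr (jdiag_bound2 i' e e')) _.
    have -> : r ^+ 2 * (nI * (nI * (S1 + S2))) = nI * (nI * (S1 * r ^+ 2 + r ^+ 2 * S2)) by ring.
    do 2![apply: mulW => //]; rewrite mulrDl mul1r; apply: lerD => //.
    exact: leW.
  - apply: (@weaken _ (1 + nI * nI * Cz + nI * Cz * S1)) => //.
      by rewrite /carg2 lerDr; nonneg.
    rewrite expr2 -mulrA; apply: le_trans (ler_wpM2l r0 (jZ_bound2 ij e e')) _.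
    have -> : r * (SD2 + (nI * (nI * eps_err2) + nI * eps_err1)) = r * SD2 + nI * nI * Cz * (r ^+ 2 * S2) + nI * Cz * S1 * r ^+ 2.
      by rewrite /eps_err1 /eps_err2; ring.
    by apply: addW; [apply: addW; [rewrite mul1r | exact: leW] | exact: leW].
apply: le_trans (ler_wpM2l rr (jcomp_bound2 (f1 i) (f2 i) Hp Hp2 a c)) _.
rewrite -/nJ.
have -> : r ^+ 2 * (nJ * (nJ * (L * (carg1 * (r + SD1) / r)) * (carg1 * (r + SD1) / r)) + nJ * (L * (carg2 * W / r ^+ 2)))
   = nJ * (nJ * L * (carg1 ^+ 2 * (r + SD1) ^+ 2)) + nJ * L * (r ^+ 2 * (carg2 * W / r ^+ 2)).
  by field; rewrite gt_eqF.
rewrite unscale; apply: addW; last by apply: le_of_eq; ring.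
apply: mulW => //; apply: mulW; first by nonneg.
have -> : 2 * carg1 ^+ 2 * W = carg1 ^+ 2 * (2 * W) by ring.
apply: leW; first exact: sqr_ge0.
have := sqr_ge0 (r - SD1); lra.
Qed.

Definition csd1 : R := #|{: A * I}|%:R * Cl * S2.
Definition csd2 : R := #|{: A * I * I}|%:R * Cl.
Let d1_ge0 : 0 <= csd1. Proof. by nonneg. Qed.
Let d2_ge0 : 0 <= csd2. Proof. by nonneg. Qed.

Let SD1_small : SD1 <= csd1 * r.
Proof.
have -> : csd1 * r = #|{: A * I}|%:R * (S2 * (Cl * r)) by rewrite /csd1; ring.
apply: sum_le_const => -[i l] /=; apply: (sd_lip (h' := j2 (u i) l)) => //.
by apply: D1_UD; case: (uj i).
Qed.

Let SD2_small : SD2 <= csd2 * S3 * r.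
Proof.
have -> : csd2 * S3 * r = #|{: A * I * I}|%:R * (S3 * (Cl * r)) by rewrite /csd2; ring.
apply: sum_le_const => -[[i l] m] /=; apply: (sd_lip (h' := j3 (u i) l m)) => //.
by apply: D1_UD; case: (uj i).
Qed.

Definition cA1 : R := carg1 * (1 + csd1).
Definition cA2 : R := nI * (nI * (S1 + S2)) + (csd2 + nI * nI * Cz * S2 + nI * Cz * S1).
Definition cA3 : R := nI * (nI * (nI * (S1 + S2 + 1))) + (1 + Cz * (nI * nI * nI + 3 * (nI * nI) * S2 + nI * S1)).
Definition kb3 : R := nI * (nI * (nI * Ca + Ca * (csd2 + S2)) + nI * (Ca * (csd2 + S2)))
   + nI * (nI * (Ca * (csd2 + S2)) + Ca * (csd1 + S1)).
Definition kc3 : R := nJ * (nJ * (nJ * (L * cA1) * cA1 + L * cA2) * cA1 + nJ * (L * cA1) * cA2)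
  + nJ * (nJ * (L * cA1) * cA2 + L * cA3).
Definition K3 : R := kb3 + kc3.

(** Once the second derivatives are bounded, [SD1] is of order r and [SD2] of order r times S3.
    Hence the first derivatives of the arguments of the generator are bounded, the second ones at
    most linear in S3, and no product contains S3 twice. *)
Lemma step_bound3 i a c d : `|j3 (jstep eps dg r b s f v u i) a c d q - avg (fun g => j3 (u i) a c d (Ypt g))|
  <= K3 * (r * SD3 + r ^+ 2 * (1 + S3)).
Proof.
set W := r * SD3 + r ^+ 2 * (1 + S3).
have W0 : 0 <= W by rewrite /W mulrDr mulr1 !addr_ge0.
have [x1 x2 x3] := And3 rr rSD3 rS3.
have W1 : r * SD3 + r ^+ 2 * S3 <= W by rewrite /W; lra.
have W2 : r ^+ 2 * (1 + S3) <= W by rewrite /W; lra.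
have W3 : r ^+ 2 <= W by rewrite /W; lra.
have W4 : r ^+ 2 * S3 <= W by rewrite /W; lra.
have W5 : r * SD3 <= W by rewrite /W; lra.
have S12 : 0 <= S1 + S2 by exact: addr_ge0.
have dS : 0 <= csd2 * S3 by exact: mulr_ge0.
have e1_ge0 : 0 <= cA1 by nonneg.
have NCS2 : 0 <= nI * nI * Cz * S2 by nonneg.
have NCS1 : 0 <= nI * Cz * S1 by nonneg.
have e2_ge0 : 0 <= cA2 by rewrite /cA2; nonneg.
have e3z : 0 <= Cz * (nI * nI * nI + 3 * (nI * nI) * S2 + nI * S1).
  by nonneg.
have e3_ge0 : 0 <= cA3 by rewrite /cA3; nonneg.
have rSD2' : r * SD2 <= csd2 * W.
  apply: le_trans (ler_wpM2l r0 SD2_small) _.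
  have -> : r * (csd2 * S3 * r) = csd2 * (r ^+ 2 * S3) by ring.
  by rewrite ler_wpM2l.
have rSD1' : r * SD1 <= csd1 * W.
  apply: le_trans (ler_wpM2l r0 SD1_small) _.
  have -> : r * (csd1 * r) = csd1 * r ^+ 2 by ring.
  by rewrite ler_wpM2l.
have t3W : avg_err3 <= Ca * W by exact: leW.
have t2W : avg_err2 <= Ca * (csd2 + S2) * W.
  by apply: mulW => //; apply: addW => //; rewrite mulrC; exact: leW.
have t1W : avg_err1 <= Ca * (csd1 + S1) * W.
  by apply: mulW => //; apply: addW => //; rewrite mulrC; exact: leW.
apply: stepD.
  apply: le_trans (avg_bound3 i a c d) _.
  apply: addW; apply: mulW => //; apply: addW => //; apply: mulW => //.
  by apply: addW => //; exact: mulW.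
have Hp k e : `|j1 (jarg eps dg r b s v u k) e q| <= cA1.
  rewrite -(ler_pM2l r_gt0); apply: le_trans (arg1 k e) _.
  have -> : r * cA1 = carg1 * (r + csd1 * r) by rewrite /cA1; ring.
  by rewrite ler_wpM2l// lerD2l.
have Hp2 k e e' : `|j2 (jarg eps dg r b s v u k) e e' q| <= cA2 * (1 + S3).
  have S31 : 1 <= 1 + S3 by rewrite lerDl.
  case: k => [[l|i']|ij].
  - by rewrite normr0; nonneg.
  - apply: le_trans (jdiag_bound2 i' e e') _.
    apply: (@le_trans _ _ cA2); first by rewrite /cA2 lerDl; nonneg.
    by rewrite ler_peMr.
  - rewrite -(ler_pM2l r_gt0); apply: le_trans (jZ_bound2 ij e e') _.
    have h : nI * (nI * eps_err2) + nI * eps_err1 = r * (nI * nI * Cz * S2 + nI * Cz * S1) by rewrite /eps_err1 /eps_err2; ring.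
    rewrite h; apply: le_trans (lerD SD2_small (lexx _)) _.
    rewrite [_ * r]mulrC -mulrDr ler_wpM2l// /cA2.
    have h1 : 0 <= nI * (nI * (S1 + S2)) * (1 + S3) by nonneg.
    have h2 : 0 <= (nI * nI * Cz * S2 + nI * Cz * S1) * S3 by nonneg.
    by have := d2_ge0; lra.
have Hp3 k e e' e'' : `|j3 (jarg eps dg r b s v u k) e e' e'' q| <= cA3 * W / r ^+ 2.
  apply: scaled; case: k => [[l|i']|ij].
  - by rewrite normr0 mulr0; nonneg.
  - apply: (@weaken _ (nI * (nI * (nI * (S1 + S2 + 1))))) => //; first by rewrite /cA3 lerDl; nonneg.
    apply: le_trans (ler_wpM2l rr (jdiag_bound3 i' e e' e'')) _.
    have -> : r ^+ 2 * (nI * (nI * (nI * (S1 + S2 + S3)))) = nI * (nI * (nI * ((S1 + S2) * r ^+ 2 + r ^+ 2 * S3))) by ring.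
    do 3![apply: mulW => //]; apply: addW; rewrite ?mul1r//; exact: leW.
  - apply: (@weaken _ (1 + Cz * (nI * nI * nI + 3 * (nI * nI) * S2 + nI * S1))) => //.
      by rewrite /cA3 lerDr; nonneg.
    rewrite expr2 -mulrA; apply: le_trans (ler_wpM2l r0 (jZ_bound3 ij e e' e'')) _.
    have -> : r * (SD3 + (nI * (nI * (nI * eps_err3 + eps_err2) + nI * eps_err2) + nI * (nI * eps_err2 + eps_err1)))
      = r * SD3 + Cz * (nI * nI * nI * (r ^+ 2 * S3) + (3 * (nI * nI) * S2 + nI * S1) * r ^+ 2).
      by rewrite /eps_err1 /eps_err2 /eps_err3; ring.
    apply: addW; first by rewrite mul1r.
    apply: mulW => //; rewrite -addrA; apply: addW; apply: leW => //; nonneg.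
apply: le_trans (ler_wpM2l rr (jcomp_bound3 (f1 i) (f2 i) (f3 i) Hp Hp2 Hp3 a c d)) _.
rewrite -/nJ.
have -> : r ^+ 2 * (nJ * (nJ * (nJ * (L * cA1) * cA1 + L * (cA2 * (1 + S3))) * cA1 + nJ * (L * cA1) * (cA2 * (1 + S3)))
   + nJ * (nJ * (L * cA1) * (cA2 * (1 + S3)) + L * (cA3 * W / r ^+ 2)))
   = nJ * (nJ * (nJ * (L * cA1) * cA1) * cA1) * r ^+ 2
    + (nJ * (nJ * (L * cA2) * cA1 + nJ * (L * cA1) * cA2) + nJ * (nJ * (L * cA1) * cA2)) * (r ^+ 2 * (1 + S3))
    + nJ * L * (r ^+ 2 * (cA3 * W / r ^+ 2)).
  by ring.
rewrite unscale.
have -> : kc3 * W = nJ * (nJ * (nJ * (L * cA1) * cA1) * cA1) * W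
    + (nJ * (nJ * (L * cA2) * cA1 + nJ * (L * cA1) * cA2) + nJ * (nJ * (L * cA1) * cA2)) * W
    + nJ * L * (cA3 * W) by rewrite /kc3; ring.
by rewrite lerD2r; apply: lerD; apply: ler_wpM2l => //; nonneg.
Qed.

End Bounds.
End StepEstimates.

(** * Uniform bounds for the scheme *)

Section Gronwall.
Variable R : realType.

Lemma pow_le_exp (C r T : R) (j n : nat) : 0 <= C -> n%:R * r ^+ 2 <= T -> (j <= n)%N ->
  (1 + C * r ^+ 2) ^+ j <= expR (C * T).
Proof.
move=> C0 nT jn; have rr := sqr_ge0 r.
apply: (@le_trans _ _ (expR (C * r ^+ 2) ^+ j)).
  by rewrite lerXn2r ?nnegrE ?expR_ge0 ?expR_ge1Dx// addr_ge0// mulr_ge0.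
rewrite -expRM_natl ler_expR mulrCA; apply: ler_wpM2l => //.
by apply: le_trans nT; rewrite ler_wpM2r// ler_nat.
Qed.

Lemma gronwall_pow (x : nat -> R) (C r P : R) : 0 <= C ->
  (forall j, x j.+1 <= x j + C * r ^+ 2 * (x j + P)) ->
  forall j, x j + P <= (1 + C * r ^+ 2) ^+ j * (x 0 + P).
Proof.
move=> C0 H; have rr := sqr_ge0 r; elim=> [|j IH]; first by rewrite expr0 mul1r.
rewrite exprS -mulrA; apply: (@le_trans _ _ ((1 + C * r ^+ 2) * (x j + P))).
  by have := H j; lra.
by rewrite ler_wpM2l// addr_ge0// mulr_ge0.
Qed.

End Gronwall.

Definition eC (R : realType) (B : finType) (C : R) : R :=
  8 * #|B|%:R ^+ 3 * C ^+ 2 + 3 * #|B|%:R * C + 1.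

Lemma eC_ge0 (R : realType) (B : finType) (C : R) : 0 <= C -> 0 <= eC B C.
Proof. by move=> C0; rewrite /eC; nonneg. Qed.

(** The iteration runs over suprema of energies, because the displaced points differ from step to
    step. The root of such a supremum bounds every single entry. *)
Lemma step_energy_sup (R : realType) (G B : finType) (X : B -> G -> R) (Y : B -> R)
    (C r kap Phi th : R) : (0 < #|G|)%N ->
  0 <= C -> 0 <= r -> 0 <= kap -> 0 <= th ->
  24 * #|B|%:R ^+ 2 * C ^+ 2 * r ^+ 2 <= 1 ->
  (forall g, \sum_b X b g ^+ 2 <= Phi) ->
  (forall b, `|Y b - avg (X b)| <=
     C * r * (\sum_b' sd (X b')) + C * r ^+ 2 * (kap + Num.sqrt Phi) + th) ->
  \sum_b Y b ^+ 2 <= avg (fun g => \sum_b X b g ^+ 2) - 2^-1 * (\sum_b vr (X b))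
    + eC B C * (r ^+ 2 * (kap ^+ 2 + Phi))
    + (2 * #|B|%:R * Num.sqrt Phi * th + 3 * #|B|%:R * th ^+ 2).
Proof.
move=> G0 C0 r0 k0 t0 small HX HY.
have P0 : 0 <= Phi.
  by case/card_gt0P: G0 => g _; apply: le_trans (HX g); exact: sum_sqr_ge0.
have Xs b g : `|X b g| <= Num.sqrt Phi.
  rewrite -(ler_pXn2r (n := 2))// ?nnegrE ?sqrtr_ge0// real_normK ?num_real// sqr_sqrtr//.
  by apply: le_trans (HX g); exact: (le_sum_sqr (fun b => X b g)).
have := step_energy G0 C0 r0 k0 (sqrtr_ge0 Phi) t0 small Xs HY.
by rewrite (sqr_sqrtr P0) avg_sum.
Qed.

Section Iterate.
Variables (R : realType) (I A D G : finType) (eps : G -> D -> R) (dg : I -> I) (E L : R).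
Hypothesis G0 : (0 < #|G|)%N.
Hypothesis epsE : forall g j, `|eps g j| <= E.
Hypothesis eps0 : forall j, avg (eps^~ j) = 0.
Hypothesis eps1 : forall j, avg (fun g => eps g j ^+ 2) = 1.
Hypothesis L1 : 1 <= L.
Variables (T : R).

Let L0 : 0 <= L. Proof. by apply: le_trans L1. Qed.

Record scheme_data (r : R) (n : nat) (b : nat -> I -> jet R I) (s : nat -> I -> D -> jet R I)
    (f : nat -> R -> A -> jet R (I + A + A * D)%type) (psi : R -> A -> jet R I) : Prop := SchemeData {
  scd_step : forall j t, step_data L r (b j) (s j) (f j t);
  scd_psi : forall t i, is_jet (psi t i) /\ jet_le L (psi t i);
  scd_time : n%:R * r ^+ 2 <= T;
  scd_f_lip : forall j t t' i p, `|j0 (f j t i) p - j0 (f j t' i) p| <= L * `|t - t'|;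
  scd_psi_lip : forall t t' i p, `|j0 (psi t i) p - j0 (psi t' i) p| <= L * `|t - t'| }.

Section Levels.
Variables (r : R) (n : nat) (b : nat -> I -> jet R I) (s : nat -> I -> D -> jet R I)
  (f : nat -> R -> A -> jet R (I + A + A * D)%type) (psi : R -> A -> jet R I) (tau : nat -> R).

(** Steps are counted backwards from the terminal time, and [tau k] is meant to be the time of level
    k. The whole family in t is carried along, because the diagonal argument asks for the slice with
    [t = tau k]. *)
Fixpoint level (j : nat) (t : R) : A -> jet R I :=
  if j is k.+1 then jstep eps dg r (b k) (s k) (f k t) (level k (tau k)) (level k t)
  else psi t.

Hypothesis data : scheme_data r n b s f psi.

Let r_gt0 : 0 < r. Proof. by case: (sd_r (scd_step data 0 0)) => /andP[]. Qed.
Let r0 : 0 <= r. Proof. exact: ltW. Qed.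
Let rr : 0 <= r ^+ 2. Proof. exact: sqr_ge0. Qed.

Lemma is_jet_level j t i : is_jet (level j t i).
Proof.
elim: j t i => [|j IH] t i /=; first by case: (scd_psi data t i).
apply: is_jet_step => // [l|l k|k].
- by case: (sd_b (scd_step data j 0) l).
- by case: (sd_s (scd_step data j 0) l k).
- by case: (sd_f (scd_step data j t) k).
Qed.

Let avgE (X : G -> R) : \sum_g #|G|%:R^-1 * X g = avg X.
Proof. by rewrite /avg mulr_sumr. Qed.

Lemma level_bound0 j t i q : `|j0 (level j t i) q| <= L + j%:R * r ^+ 2 * L.
Proof.
elim: j t i q => [|j IH] t i q; first by rewrite !mul0r addr0; case: (scd_psi data t i) => _ [].
rewrite /= avgE -natr1 !mulrDl mul1r addrA; apply: le_trans (ler_normD _ _) _; apply: lerD.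
  by apply: norm_avg_le => // g; exact: IH.
by rewrite normrM (ger0_norm rr) ler_wpM2l//; case: (sd_f (scd_step data j t) i) => _ [].
Qed.

Definition en1 (u : A -> jet R I) q := \sum_(x : A * I) j1 (u x.1) x.2 q ^+ 2.
Definition en2 (u : A -> jet R I) q := \sum_(x : A * I * I) j2 (u x.1.1) x.1.2 x.2 q ^+ 2.
Definition en3 (u : A -> jet R I) q := \sum_(x : A * I * I * I) j3 (u x.1.1.1) x.1.1.2 x.1.2 x.2 q ^+ 2.

Let B1 : finType := (A * I)%type.
Let B2 : finType := (A * I * I)%type.
Let B3 : finType := (A * I * I * I)%type.

Let sq_le (x y : R) : x ^+ 2 <= y -> `|x| <= Num.sqrt y.
Proof.
move=> xy; have y0 : 0 <= y by apply: le_trans xy; exact: sqr_ge0.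
by rewrite -(ler_pXn2r (n := 2))// ?nnegrE ?sqrtr_ge0// real_normK ?num_real// sqr_sqrtr.
Qed.

Lemma en1_le u (S : R) i a p : en1 u p <= S -> `|j1 (u i) a p| <= Num.sqrt S.
Proof.
move=> H; apply: sq_le; apply: le_trans H.
exact: (le_sum_sqr (fun x : A * I => j1 (u x.1) x.2 p) (i, a)).
Qed.
Lemma en2_le u (S : R) i a c p : en2 u p <= S -> `|j2 (u i) a c p| <= Num.sqrt S.
Proof.
move=> H; apply: sq_le; apply: le_trans H.
exact: (le_sum_sqr (fun x : A * I * I => j2 (u x.1.1) x.1.2 x.2 p) (i, a, c)).
Qed.
Lemma en3_le u (S : R) i a c d p : en3 u p <= S -> `|j3 (u i) a c d p| <= Num.sqrt S.
Proof.
move=> H; apply: sq_le; apply: le_trans H.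
exact: (le_sum_sqr (fun x : A * I * I * I => j3 (u x.1.1.1) x.1.1.2 x.1.2 x.2 p) (i, a, c, d)).
Qed.

Let norm_absmul (k x : R) : 0 <= x -> k * x <= `|k| * x.
Proof. by move=> x0; rewrite ler_wpM2r// ler_norm. Qed.

Let k1 : R := `|K1 I A D G E L|.
Let k2 (x : R) : R := `|K2 I A D G E L x|.
Let k3 (x y : R) : R := `|K3 I A D G E L x y|.

Definition vr1 j t q : R :=
  \sum_(x : A * I) vr (fun g => j1 (level j t x.1) x.2 (Ypt eps r (b j) (s j) q g)).

Lemma en1_step j (Phi : R) :
  24 * #|B1|%:R ^+ 2 * k1 ^+ 2 * r ^+ 2 <= 1 ->
  (forall t q, en1 (level j t) q <= Phi) -> forall t q,
  en1 (level j.+1 t) q <= avg (fun g => en1 (level j t) (Ypt eps r (b j) (s j) q g))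
    - 2^-1 * vr1 j t q + eC B1 k1 * (r ^+ 2 * (1 + Phi)).
Proof.
move=> small HP t q.
have S0 : 0 <= Num.sqrt Phi by exact: sqrtr_ge0.
have HY (x : B1) : `|j1 (level j.+1 t x.1) x.2 q
     - avg (fun g => j1 (level j t x.1) x.2 (Ypt eps r (b j) (s j) q g))| <=
   k1 * r * SD1 eps r (b j) (s j) (level j t) q + k1 * r ^+ 2 * (1 + Num.sqrt Phi) + 0.
  case: x => i a /=.
  apply: le_trans (step_bound1 dg G0 epsE eps0 eps1 L1 (scd_step data j t) q S0 _ _ i a) _.
  - by move=> *; exact: en1_le.
  - by move=> *; exact: en1_le.
  set X := SD1 _ _ _ _ _ _; set Z := 1 + _.
  rewrite (_ : _ + 0 = k1 * (r * X + r ^+ 2 * Z)); last by ring.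
  apply: norm_absmul; rewrite /X /Z.
  by have X0 := SD1_ge0 eps r (b j) (s j) (level j t) q; nonneg.
have := step_energy_sup (B := B1) (X := fun x g => j1 (level j t x.1) x.2 (Ypt eps r (b j) (s j) q g))
  G0 (normr_ge0 _) r0 ler01 (lexx 0) small _ HY.
by rewrite !mulr0 expr0n /= !mulr0 !addr0 expr1n; apply => g; exact: HP.
Qed.

(** The step hypothesis may already use the final bound, which holds for all earlier levels anyway.
    The second order energy needs this: its weight must be chosen before the iteration, but large
    with respect to the outcome. *)
Lemma sup_iter (e : nat -> R -> pt R I -> R) (C P Phi0 : R) : 0 <= C -> 0 <= P -> 0 <= Phi0 ->
  (forall t q, e 0 t q <= Phi0) ->
  (forall j Phi, (j < n)%N -> Phi + P <= expR (C * T) * (Phi0 + P) -> (forall t q, e j t q <= Phi) ->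
     forall t q, e j.+1 t q <= Phi + C * r ^+ 2 * (Phi + P)) ->
  forall j t q, (j <= n)%N -> e j t q <= expR (C * T) * (Phi0 + P).
Proof.
move=> C0 P0 Phi00 He0 Hs.
(* The extremal sequence of the recursive inequality: [gx] bounds it independently of e, and [key]
   dominates e by it. *)
pose x := fix x (j : nat) : R := if j is k.+1 then x k + C * r ^+ 2 * (x k + P) else Phi0.
have gx j : (j <= n)%N -> x j + P <= expR (C * T) * (Phi0 + P).
  move=> jn; apply: le_trans (gronwall_pow (x := x) (r := r) (P := P) C0 _ j) _ => //.
  by rewrite ler_wpM2r ?addr_ge0//; exact: pow_le_exp (scd_time data) jn.
have key j : (j <= n)%N -> forall t q, e j t q <= x j.
  elim: j => [_|j IH jn] //.
  by apply: Hs => //; [exact: gx (ltnW jn) | exact: IH (ltnW jn)].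
move=> j t q jn; apply: le_trans (key j jn t q) _; apply: le_trans (gx j jn).
by rewrite lerDl.
Qed.

Let nB1 : R := #|B1|%:R.
Let nB2 : R := #|B2|%:R.
Let nB3 : R := #|B3|%:R.

Let C1 : R := eC B1 k1.
Definition bnd1 : R := expR (C1 * T) * (nB1 * L ^+ 2 + 1).

Let k1_ge0 : 0 <= k1. Proof. exact: normr_ge0. Qed.
Let C1_ge0 : 0 <= C1. Proof. exact: eC_ge0. Qed.
Lemma bnd1_ge0 : 0 <= bnd1.
Proof. by rewrite /bnd1 mulr_ge0 ?expR_ge0// addr_ge0// mulr_ge0// sqr_ge0. Qed.

Let sqL (x : R) : `|x| <= L -> x ^+ 2 <= L ^+ 2.
Proof. by move=> h; rewrite -real_normK ?num_real// lerXn2r ?nnegrE. Qed.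

Let small1 : Prop := 24 * #|B1|%:R ^+ 2 * k1 ^+ 2 * r ^+ 2 <= 1.

Lemma level_en1 : small1 -> forall j t q, (j <= n)%N -> en1 (level j t) q <= bnd1.
Proof.
move=> small; apply: sup_iter => //.
- by rewrite mulr_ge0// sqr_ge0.
- move=> t q; apply: sum_le_const => -[i a] /=; apply: sqL.
  by case: (scd_psi data t i) => _ [].
- move=> j Phi _ _ HP t q; apply: le_trans (en1_step small HP t q) _.
  have h1 : avg (fun g => en1 (level j t) (Ypt eps r (b j) (s j) q g)) <= Phi.
    by apply: avg_le => // g; exact: HP.
  have h2 : 0 <= vr1 j t q by apply: sumr_ge0 => x _; exact: vr_ge0.
  rewrite -/C1; have -> : C1 * (r ^+ 2 * (1 + Phi)) = C1 * r ^+ 2 * (Phi + 1) by ring.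
  lra.
Qed.

Let S1 : R := Num.sqrt bnd1.
Let k2_ : R := k2 S1.
Let C2 : R := eC B2 k2_ + C1 * (1 + bnd1).

(** The quadratic term is passed to the energy estimate as [th]. It is then expressed through the
    variance of the first derivatives and left in this form, to be compared with the variance that
    [en1_step] subtracts. *)
Lemma en2_step j (Phi2 : R) : (j < n)%N -> small1 ->
  24 * #|B2|%:R ^+ 2 * k2_ ^+ 2 * r ^+ 2 <= 1 ->
  (forall t q, en2 (level j t) q <= Phi2) -> forall t q,
  en2 (level j.+1 t) q <= avg (fun g => en2 (level j t) (Ypt eps r (b j) (s j) q g))
    + eC B2 k2_ * (r ^+ 2 * (1 + Phi2))
    + (2 * nB2 * Num.sqrt Phi2 * k2_ * nB1 + 3 * nB2 * k2_ ^+ 2 * nB1 ^+ 2 * bnd1) * vr1 j t q.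
Proof.
move=> jn sm1 small HP t q.
have jn' := ltnW jn.
have S0 : 0 <= Num.sqrt Phi2 by exact: sqrtr_ge0.
have S10 : 0 <= S1 by exact: sqrtr_ge0.
set u := level j t; set sd1 := SD1 eps r (b j) (s j) u q.
have sd10 : 0 <= sd1 by exact: SD1_ge0.
have HY (x : B2) : `|j2 (level j.+1 t x.1.1) x.1.2 x.2 q
     - avg (fun g => j2 (u x.1.1) x.1.2 x.2 (Ypt eps r (b j) (s j) q g))| <=
   k2_ * r * SD2 eps r (b j) (s j) u q + k2_ * r ^+ 2 * (1 + Num.sqrt Phi2) + k2_ * sd1 ^+ 2.
  case: x => [[i a] c] /=.
  apply: le_trans (step_bound2 dg G0 epsE eps0 eps1 L1 (scd_step data j t) q S10 S0 _ _ _ _ i a c) _.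
  - by move=> *; apply: en1_le; exact: level_en1.
  - by move=> *; exact: en2_le.
  - by move=> *; apply: en1_le; exact: level_en1.
  - by move=> *; exact: en2_le.
  rewrite -/u -/sd1; set X := SD2 _ _ _ _ _ _; set Z := 1 + _.
  rewrite (_ : _ + k2_ * sd1 ^+ 2 = k2_ * (r * X + r ^+ 2 * Z + sd1 ^+ 2)); last by ring.
  apply: norm_absmul; rewrite /X /Z.
  by have X0 := SD2_ge0 eps r (b j) (s j) u q; nonneg.
have th0 : 0 <= k2_ * sd1 ^+ 2 by rewrite mulr_ge0 ?sqr_ge0// normr_ge0.
have := step_energy_sup (B := B2) (X := fun x g => j2 (u x.1.1) x.1.2 x.2 (Ypt eps r (b j) (s j) q g))
  G0 (normr_ge0 _) r0 ler01 th0 small _ HY.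
rewrite expr1n => /(_ (fun g => HP t _)) H; apply: le_trans H _.
have V2 : 0 <= \sum_(x : B2) vr (fun g => j2 (u x.1.1) x.1.2 x.2 (Ypt eps r (b j) (s j) q g)).
  by apply: sumr_ge0 => x _; exact: vr_ge0.
set V := vr1 j t q.
have V0 : 0 <= V by apply: sumr_ge0 => x _; exact: vr_ge0.
have VS : sd1 ^+ 2 <= nB1 * V.
  apply: le_trans (sqr_sum_le _) _; rewrite ler_wpM2l//; apply: ler_sum => x _.
  by rewrite sqr_sd.
(* In [th ^+ 2] the variance occurs squared. One of the two factors is bounded by the first order
   energy, so that this term is linear in V as well. *)
have Vb : V <= bnd1.
  apply: (@le_trans _ _ (avg (fun g => en1 u (Ypt eps r (b j) (s j) q g)))); last first.
    by apply: avg_le => // g; exact: level_en1.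
  rewrite /en1 avg_sum; apply: ler_sum => x _.
  by have := sqr_avg G0 (fun g => j1 (u x.1) x.2 (Ypt eps r (b j) (s j) q g)); have := sqr_ge0 (avg (fun g => j1 (u x.1) x.2 (Ypt eps r (b j) (s j) q g))); lra.
have nB10 : 0 <= nB1 by exact: ler0n.
have nB20 : 0 <= nB2 by exact: ler0n.
have k20 : 0 <= k2_ by exact: normr_ge0.
have T1 : 2 * nB2 * Num.sqrt Phi2 * (k2_ * sd1 ^+ 2) <= 2 * nB2 * Num.sqrt Phi2 * k2_ * nB1 * V.
  have -> : 2 * nB2 * Num.sqrt Phi2 * k2_ * nB1 * V = 2 * nB2 * Num.sqrt Phi2 * (k2_ * (nB1 * V)) by ring.
  by do 2![apply: ler_wpM2l; first by nonneg].
have T2 : 3 * nB2 * (k2_ * sd1 ^+ 2) ^+ 2 <= 3 * nB2 * k2_ ^+ 2 * nB1 ^+ 2 * bnd1 * V.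
  have -> : 3 * nB2 * k2_ ^+ 2 * nB1 ^+ 2 * bnd1 * V = 3 * nB2 * (k2_ ^+ 2 * (nB1 * bnd1 * (nB1 * V))) by ring.
  apply: ler_wpM2l; first by nonneg.
  rewrite exprMn; apply: ler_wpM2l; first exact: sqr_ge0.
  rewrite [_ ^+ 2 ^+ 2]expr2; apply: ler_pM; rewrite ?sqr_ge0//.
  by apply: le_trans VS _; rewrite ler_wpM2l.
rewrite -/nB2 [X in _ <= _ + X]mulrDl /en2; lra.
Qed.

Let ex2 : R := expR (C2 * T).
Let a1 : R := 2 * nB2 * k2_ * nB1.
Let a2 : R := 3 * nB2 * k2_ ^+ 2 * nB1 ^+ 2 * bnd1.
Let c0 : R := ex2 * (nB2 * L ^+ 2 + nB1 * L ^+ 2 + 1).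
(* The weight K of the first order energy is so large that the variance of
   the first derivatives absorbs the terms of the second order equation that
   are quadratic in the second derivatives; this is possible since the bound
   of the energy that results from the weight K is only of order K. *)
Let Kw : R := 32 * a1 ^+ 2 * c0 + 4 * a2 + 1.
Definition bnd2 : R := ex2 * (nB2 * L ^+ 2 + Kw * (nB1 * L ^+ 2) + (1 + Kw)).

Let k2_ge0 : 0 <= k2_. Proof. exact: normr_ge0. Qed.
Let eC2_ge0 : 0 <= eC B2 k2_. Proof. exact: eC_ge0. Qed.
Let C2_ge0 : 0 <= C2.
Proof. by rewrite /C2 addr_ge0// mulr_ge0// addr_ge0// bnd1_ge0. Qed.
Let a1_ge0 : 0 <= a1. Proof. by rewrite /a1; nonneg. Qed.
Let a2_ge0 : 0 <= a2. Proof. by have h := bnd1_ge0; rewrite /a2; nonneg. Qed.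
Let ex2_ge0 : 0 <= ex2. Proof. exact: expR_ge0. Qed.
Let Kw1 : 1 <= Kw.
Proof.
have h : 0 <= 32 * a1 ^+ 2 * c0 by nonneg.
by have := a2_ge0; rewrite /Kw; lra.
Qed.
Let Kw_ge0 : 0 <= Kw. Proof. by apply: le_trans Kw1. Qed.

Lemma bnd2_ge0 : 0 <= bnd2.
Proof. by rewrite /bnd2; nonneg. Qed.

Let Kw_large : a1 * Num.sqrt bnd2 + a2 <= 2^-1 * Kw.
Proof.
have K1' := Kw1; have a20 := a2_ge0.
have h0 : 0 <= a1 ^+ 2 * c0 by nonneg.
have hb : bnd2 <= c0 * (1 + Kw).
  have -> : c0 * (1 + Kw) = ex2 * ((nB2 * L ^+ 2 + nB1 * L ^+ 2 + 1) * (1 + Kw)).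
    by rewrite /c0; move: Kw => K; ring.
  apply: ler_wpM2l => //.
  have : 0 <= Kw * (nB2 * L ^+ 2) by nonneg.
  have : 0 <= nB1 * L ^+ 2 by nonneg.
  lra.
have : a1 * Num.sqrt bnd2 <= 4^-1 * Kw.
  rewrite -(ler_pXn2r (n := 2))// ?nnegrE; [|by nonneg|by nonneg].
  rewrite [(a1 * _) ^+ 2]exprMn (sqr_sqrtr bnd2_ge0) [(4^-1 * Kw) ^+ 2]exprMn.
  apply: (@le_trans _ _ (a1 ^+ 2 * (c0 * (1 + Kw)))); first by apply: ler_wpM2l => //; exact: sqr_ge0.
  have -> : a1 ^+ 2 * (c0 * (1 + Kw)) = a1 ^+ 2 * c0 * (1 + Kw) by ring.
  apply: (@le_trans _ _ (a1 ^+ 2 * c0 * (2 * Kw))); first by apply: ler_wpM2l => //; lra.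
  have : 32 * (a1 ^+ 2 * c0) * Kw <= Kw * Kw by apply: ler_wpM2r => //; rewrite /Kw; lra.
  have -> : 4^-1 ^+ 2 * Kw ^+ 2 = 16^-1 * (Kw * Kw) by field.
  lra.
have : 4 * a2 <= Kw by rewrite /Kw; lra.
lra.
Qed.

Let small2 : Prop := 24 * #|B2|%:R ^+ 2 * k2_ ^+ 2 * r ^+ 2 <= 1.

Lemma level_en2 : small1 -> small2 -> forall j t q, (j <= n)%N -> en2 (level j t) q <= bnd2.
Proof.
move=> sm1 sm2 j t q jn.
have en1_0 j' t' q' : 0 <= en1 (level j' t') q' by exact: sum_sqr_ge0.
have en2_0 j' t' q' : 0 <= en2 (level j' t') q' by exact: sum_sqr_ge0.
suff : en2 (level j t) q + Kw * en1 (level j t) q <= bnd2.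
  by have := mulr_ge0 Kw_ge0 (en1_0 j t q); lra.
apply: (@sup_iter (fun j t q => en2 (level j t) q + Kw * en1 (level j t) q)) => //.
- by rewrite addr_ge0.
- by nonneg.
- move=> t' q'; apply: lerD; last apply: ler_wpM2l => //.
    apply: sum_le_const => -[[i a] c] /=; apply: sqL.
    by case: (scd_psi data t' i) => _ [].
  apply: sum_le_const => -[i a] /=; apply: sqL.
  by case: (scd_psi data t' i) => _ [].
- move=> {}j Phi {}jn HPhi HP {}t {}q.
  have Phi_ge0 : 0 <= Phi.
    by apply: le_trans (HP t q); rewrite addr_ge0// mulr_ge0.
  have HP2 t' q' : en2 (level j t') q' <= Phi.
    by have := HP t' q'; have := mulr_ge0 Kw_ge0 (en1_0 j t' q'); lra.
  have H2 := en2_step jn sm1 sm2 HP2 t q.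
  have H1 := en1_step sm1 (fun t' q' => level_en1 sm1 t' q' (ltnW jn)) t q.
  have HA : avg (fun g => en2 (level j t) (Ypt eps r (b j) (s j) q g))
     + Kw * avg (fun g => en1 (level j t) (Ypt eps r (b j) (s j) q g)) <= Phi.
    by rewrite -avgZ -avgD; apply: avg_le => // g; exact: HP.
  set V := vr1 j t q in H1 H2.
  have V0 : 0 <= V by apply: sumr_ge0 => x _; exact: vr_ge0.
  (* The quadratic terms are absorbed here by the variance from [en1_step], multiplied by the
     weight. The current Phi is at most [bnd2] by the a priori bound of [sup_iter]. *)
  have HK : (2 * nB2 * Num.sqrt Phi * k2_ * nB1 + 3 * nB2 * k2_ ^+ 2 * nB1 ^+ 2 * bnd1) * V <= 2^-1 * Kw * V.
    apply: ler_wpM2r => //; apply: le_trans Kw_large; rewrite -/a2 lerD2r.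
    have -> : 2 * nB2 * Num.sqrt Phi * k2_ * nB1 = a1 * Num.sqrt Phi by rewrite /a1; ring.
    apply: ler_wpM2l => //; rewrite ler_sqrt ?bnd2_ge0//.
    by apply: le_trans HPhi; have := Kw_ge0; lra.
  have H1K := ler_wpM2l Kw_ge0 H1.
  have HC1 : eC B2 k2_ * (r ^+ 2 * (1 + Phi)) <= C2 * (r ^+ 2 * (1 + Phi)).
    apply: ler_wpM2r; first by nonneg.
    by rewrite /C2 lerDl mulr_ge0// addr_ge0// bnd1_ge0.
  have HC2 : Kw * (C1 * (r ^+ 2 * (1 + bnd1))) <= C2 * (r ^+ 2 * Kw).
    have -> : Kw * (C1 * (r ^+ 2 * (1 + bnd1))) = C1 * (1 + bnd1) * (r ^+ 2 * Kw) by ring.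
    apply: ler_wpM2r; first by nonneg.
    by rewrite /C2 lerDr.
  have -> : C2 * r ^+ 2 * (Phi + (1 + Kw)) = C2 * (r ^+ 2 * (1 + Phi)) + C2 * (r ^+ 2 * Kw) by ring.
  rewrite -/C1 in H1K; lra.
Qed.

Let S2 : R := Num.sqrt bnd2.
Let k3_ : R := k3 S1 S2.
Let C3 : R := eC B3 k3_.
Definition bnd3 : R := expR (C3 * T) * (nB3 * L ^+ 2 + 1).
Let small3 : Prop := 24 * #|B3|%:R ^+ 2 * k3_ ^+ 2 * r ^+ 2 <= 1.

Lemma level_en3 : small1 -> small2 -> small3 ->
  forall j t q, (j <= n)%N -> en3 (level j t) q <= bnd3.
Proof.
move=> sm1 sm2 sm3; apply: sup_iter => //.
- by apply: eC_ge0; exact: normr_ge0.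
- by nonneg.
- move=> t q; apply: sum_le_const => -[[[i a] c] d] /=; apply: sqL.
  by case: (scd_psi data t i) => _ [].
- move=> j Phi jn _ HP t q; have jn' := ltnW jn.
  have S0 : 0 <= Num.sqrt Phi by exact: sqrtr_ge0.
  have S10 : 0 <= S1 by exact: sqrtr_ge0.
  have S20 : 0 <= S2 by exact: sqrtr_ge0.
  set u := level j t.
  have HY (x : B3) : `|j3 (level j.+1 t x.1.1.1) x.1.1.2 x.1.2 x.2 q
       - avg (fun g => j3 (u x.1.1.1) x.1.1.2 x.1.2 x.2 (Ypt eps r (b j) (s j) q g))| <=
     k3_ * r * SD3 eps r (b j) (s j) u q + k3_ * r ^+ 2 * (1 + Num.sqrt Phi) + 0.
    case: x => [[[i a] c] d] /=.
    apply: le_trans (step_bound3 dg G0 epsE eps0 eps1 L1 (scd_step data j t) _ q S10 S20 S0 _ _ _ _ _ _ i a c d) _.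
    - by move=> i'; exact: is_jet_level.
    - by move=> *; apply: en1_le; exact: level_en1.
    - by move=> *; apply: en2_le; exact: level_en2.
    - by move=> *; exact: en3_le.
    - by move=> *; apply: en1_le; exact: level_en1.
    - by move=> *; apply: en2_le; exact: level_en2.
    - by move=> *; exact: en3_le.
    rewrite -/u; set X := SD3 _ _ _ _ _ _; set Z := 1 + _.
    rewrite (_ : _ + 0 = k3_ * (r * X + r ^+ 2 * Z)); last by ring.
    apply: norm_absmul; rewrite /X /Z.
    by have X0 := SD3_ge0 eps r (b j) (s j) u q; nonneg.
  have := step_energy_sup (B := B3) (X := fun x g => j3 (u x.1.1.1) x.1.1.2 x.1.2 x.2 (Ypt eps r (b j) (s j) q g))
    G0 (normr_ge0 _) r0 ler01 (lexx 0) sm3 _ HY.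
  rewrite !mulr0 expr0n /= !mulr0 !addr0 expr1n => /(_ (fun g => HP t _)) H; apply: le_trans H _.
  have h1 : avg (fun g => en3 u (Ypt eps r (b j) (s j) q g)) <= Phi.
    by apply: avg_le => // g; exact: HP.
  have h2 : 0 <= \sum_(x : B3) vr (fun g => j3 (u x.1.1.1) x.1.1.2 x.1.2 x.2 (Ypt eps r (b j) (s j) q g)).
    by apply: sumr_ge0 => x _; exact: vr_ge0.
  have -> : C3 * r ^+ 2 * (Phi + 1) = C3 * (r ^+ 2 * (1 + Phi)) by ring.
  rewrite /en3 in h1; rewrite /C3; lra.
Qed.

Definition bnd : R := L + T * L + Num.sqrt bnd1 + Num.sqrt bnd2 + Num.sqrt bnd3.

Lemma level_le : small1 -> small2 -> small3 ->
  forall j t i, (j <= n)%N -> jet_le bnd (level j t i).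
Proof.
move=> sm1 sm2 sm3 j t i jn.
have T0 : 0 <= T by apply: le_trans (scd_time data); rewrite mulr_ge0.
have [x1 x2 x3 x4] : [/\ 0 <= Num.sqrt bnd1, 0 <= Num.sqrt bnd2, 0 <= Num.sqrt bnd3 & 0 <= T * L].
  by split; rewrite ?sqrtr_ge0// mulr_ge0.
have L0' := L0.
split.
- move=> q; apply: le_trans (level_bound0 j t i q) _.
  have : j%:R * r ^+ 2 * L <= T * L.
    apply: ler_wpM2r => //; apply: le_trans (scd_time data).
    by rewrite ler_wpM2r// ler_nat.
  by rewrite /bnd; lra.
- move=> a q; apply: le_trans (en1_le i a (level_en1 sm1 t q jn)) _; rewrite /bnd; lra.
- move=> a c q; apply: le_trans (en2_le i a c (level_en2 sm1 sm2 t q jn)) _; rewrite /bnd; lra.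
- move=> a c d q; apply: le_trans (en3_le i a c d (level_en3 sm1 sm2 sm3 t q jn)) _; rewrite /bnd; lra.
Qed.

Let kl : R := L * (1 + #|D|%:R).
Definition bndt : R := Num.sqrt (expR (eC A kl * T) * (#|A|%:R * L ^+ 2 + 1)).
Let small0 : Prop := 24 * #|A|%:R ^+ 2 * kl ^+ 2 * r ^+ 2 <= 1.

Lemma jet_lip (J : finType) (F : jet R J) (S : R) p p' : is_jet F -> jet_le S F ->
  `|j0 F p - j0 F p'| <= S * nrm1 (fun j => p j - p' j).
Proof.
move=> [F1 _ _] [_ H _ _].
have := lip_bound (p := p') (v := fun j => p j - p' j) (s := S) (D1_UD F1) (fun x j _ => H j _).
by have -> : padd p' (fun j => p j - p' j) = p by apply/funext => j; rewrite /padd addrC subrK.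
Qed.

(** The slices for t and t' use the same diagonal values, which therefore cancel in the difference.
    The energy estimate of order 0 applies to the difference, with [kap] equal to the distance of
    the parameters. *)
Lemma level_t_lip t t' : small0 -> forall j i q, (j <= n)%N ->
  `|j0 (level j t i) q - j0 (level j t' i) q| <= bndt * `|t - t'|.
Proof.
move=> sm j i q jn; set dl := `|t - t'|.
have dl0 : 0 <= dl by exact: normr_ge0.
have kl0 : 0 <= kl by rewrite /kl; nonneg.
(* The parameter is a dummy, to fit [sup_iter]; t and t' stay fixed. *)
pose e j (_ : R) q := \sum_i (j0 (level j t i) q - j0 (level j t' i) q) ^+ 2.
have H : e j 0 q <= expR (eC A kl * T) * (#|A|%:R * (L * dl) ^+ 2 + dl ^+ 2).
  apply: sup_iter => //.
  - exact: eC_ge0.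
  - exact: sqr_ge0.
  - by rewrite mulr_ge0// sqr_ge0.
  - move=> t0 q'; apply: sum_le_const => k.
    rewrite -real_normK ?num_real// lerXn2r ?nnegrE ?mulr_ge0//.
    exact: (scd_psi_lip data).
  - move=> k Phi kn _ HP t0 q'.
    pose Y g := Ypt eps r (b k) (s k) q' g.
    pose X i0 g := j0 (level k t i0) (Y g) - j0 (level k t' i0) (Y g).
    have HY (x : A) : `|(j0 (level k.+1 t x) q' - j0 (level k.+1 t' x) q') - avg (X x)| <=
        kl * r * (\sum_x' sd (X x')) + kl * r ^+ 2 * (dl + Num.sqrt Phi) + 0.
      set SX := \sum_x' sd (X x').
      have SX0 : 0 <= SX by apply: sumr_ge0 => x' _; exact: sd_ge0.
      pose pp t1 c := j0 (jarg eps dg r (b k) (s k) (level k (tau k)) (level k t1) c) q'.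
      have E1 t1 : j0 (level k.+1 t1 x) q' = avg (fun g => j0 (level k t1 x) (Y g)) + r ^+ 2 * j0 (f k t1 x) (pp t1).
        by rewrite /= avgE.
      rewrite !E1 /X avgB.
      have Z (y z w o : R) : y + r ^+ 2 * w - (z + r ^+ 2 * o) - (y - z) = r ^+ 2 * (w - o) by ring.
      rewrite Z normrM (ger0_norm rr).
      set p1 := pp t; set p2 := pp t'.
      have h1 : `|j0 (f k t x) p1 - j0 (f k t' x) p2| <= L * dl + L * nrm1 (fun j => p1 j - p2 j).
        rewrite -(subrK (j0 (f k t' x) p1) (j0 (f k t x) p1)) -addrA.
        apply: le_trans (ler_normD _ _) _; apply: lerD; first exact: (scd_f_lip data).
        by apply: jet_lip; case: (sd_f (scd_step data k t') x).
      have h2 : r * nrm1 (fun j => p1 j - p2 j) <= #|D|%:R * SX.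
        rewrite /nrm1 !big_sumType /= [X in X + _ + _]big1 => [|l _]; last by rewrite subrr normr0.
        rewrite [X in _ + X + _]big1 => [|l _]; last by rewrite subrr normr0.
        rewrite !add0r mulr_sumr.
        apply: (@le_trans _ _ (\sum_(ij : A * D) sd (X ij.1))).
          apply: ler_sum => -[i0 j'] _ /=; rewrite -sumrB.
          apply: le_trans (avg_eps_le G0 eps0 eps1 (X i0) j').
          rewrite -[X in X * `|_|](ger0_norm r0) -normrM mulr_sumr; apply: le_of_eq; congr (`|_|).
          rewrite /avg mulr_sumr; apply: eq_bigr => g _; rewrite /X /Y /Ypt; field.
          by rewrite (gt_eqF r_gt0) pnatr_eq0 -lt0n G0.
        rewrite -(pair_bigA _ (fun i0 j' => sd (X i0))) /= /SX mulr_sumr.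
        by apply: ler_sum => i0 _; rewrite sumr_const -[_ *+ #|_|]mulr_natl.
      have h3 : r * (r * nrm1 (fun j => p1 j - p2 j)) <= r * (#|D|%:R * SX) by apply: ler_wpM2l.
      have h4 := ler_wpM2l rr h1.
      have h5 := ler_wpM2l L0 h3.
      apply: le_trans h4 _.
      have y1 : 0 <= L * #|D|%:R * r ^+ 2 * dl by nonneg.
      have y2 : 0 <= L * r * SX by nonneg.
      have y3 : 0 <= L * (1 + #|D|%:R) * r ^+ 2 * Num.sqrt Phi by nonneg; exact: sqrtr_ge0.
      rewrite /kl; lra.
    have := step_energy_sup (B := A) (X := X) G0 kl0 r0 dl0 (lexx 0) sm _ HY.
    rewrite !mulr0 expr0n /= !mulr0 !addr0 => /(_ (fun g => HP 0 (Y g))) H; apply: le_trans H _.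
    have w1 : avg (fun g => \sum_x X x g ^+ 2) <= Phi by apply: avg_le => // g; exact: HP 0 (Y g).
    have w2 : 0 <= \sum_x vr (X x) by apply: sumr_ge0 => x _; exact: vr_ge0.
    have -> : eC A kl * r ^+ 2 * (Phi + dl ^+ 2) = eC A kl * (r ^+ 2 * (dl ^+ 2 + Phi)) by ring.
    lra.
have B0 : 0 <= expR (eC A kl * T) * (#|A|%:R * L ^+ 2 + 1).
  by rewrite mulr_ge0 ?expR_ge0// addr_ge0// mulr_ge0// sqr_ge0.
rewrite -(ler_pXn2r (n := 2))// ?nnegrE ?mulr_ge0 ?sqrtr_ge0// exprMn sqr_sqrtr// real_normK ?num_real//.
apply: (@le_trans _ _ (e j 0 q)); first exact: (le_sum_sqr (fun i => j0 (level j t i) q - j0 (level j t' i) q)).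
by apply: le_trans H _; apply: le_of_eq; ring.
Qed.

End Levels.

(* Smallness of the step size only serves to have [24 N^2 C^2 r^2 <= 1] in the
   step lemma, for the four values of (N, C) that occur. *)
Theorem level_unif : exists M r0 : R, [/\ 0 < M, 0 < r0 &
  forall r n b s f psi tau, scheme_data r n b s f psi -> r <= r0 ->
  forall j, (j <= n)%N ->
    (forall t i, jet_le M (level r b s f psi tau j t i)) /\
    (forall t t' i q, `|j0 (level r b s f psi tau j t i) q - j0 (level r b s f psi tau j t' i) q| <= M * `|t - t'|)].
Proof.
pose c1 := 24 * #|{: A * I}|%:R ^+ 2 * `|K1 I A D G E L| ^+ 2.
pose c2 := 24 * #|{: A * I * I}|%:R ^+ 2 * `|K2 I A D G E L (Num.sqrt bnd1)| ^+ 2.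
pose c3 := 24 * #|{: A * I * I * I}|%:R ^+ 2 * `|K3 I A D G E L (Num.sqrt bnd1) (Num.sqrt bnd2)| ^+ 2.
pose c0 := 24 * #|A|%:R ^+ 2 * (L * (1 + #|D|%:R)) ^+ 2.
pose c := c1 + c2 + c3 + c0 + 1.
have c1_0 : 0 <= c1 by rewrite /c1; nonneg.
have c2_0 : 0 <= c2 by rewrite /c2; nonneg.
have c3_0 : 0 <= c3 by rewrite /c3; nonneg.
have c0_0 : 0 <= c0 by rewrite /c0; nonneg.
have c_1 : 1 <= c by rewrite /c; lra.
have c_0 : 0 < c by lra.
exists (`|bnd| + bndt + 1), c^-1; split.
- by rewrite ltr_wpDl// addr_ge0// sqrtr_ge0.
- by rewrite invr_gt0.
move=> r n b s f psi tau data rr0 j jn.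
have r_gt0 : 0 < r by case: (sd_r (scd_step data 0 0)) => /andP[].
have r1 : r <= 1 by case: (sd_r (scd_step data 0 0)) => /andP[].
have crr : c * r ^+ 2 <= 1.
  apply: (@le_trans _ _ (c * r)); first by rewrite ler_pM2l// expr2 ler_piMl// ltW.
  by rewrite mulrC -ler_pdivlMr// mul1r.
have sm x : 0 <= x -> x <= c -> x * r ^+ 2 <= 1.
  by move=> x0 xc; apply: le_trans crr; rewrite ler_wpM2r// sqr_ge0.
have s1 := sm _ c1_0 _; have s2 := sm _ c2_0 _; have s3 := sm _ c3_0 _; have s4 := sm _ c0_0 _.
have bt0 : 0 <= bndt by exact: sqrtr_ge0.
split.
- move=> t i.
  have [|||] := level_le tau data _ _ _ t i jn.
  + by apply: s1; rewrite /c; lra.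
  + by apply: s2; rewrite /c; lra.
  + by apply: s3; rewrite /c; lra.
  have hb : bnd <= `|bnd| + bndt + 1 by have := ler_norm bnd; lra.
  by move=> g0 g1 g2 g3; split => *; apply: le_trans hb.
- move=> t t' i q; apply: le_trans (level_t_lip tau data t t' _ i q jn) _.
    by apply: s4; rewrite /c; lra.
  by rewrite ler_wpM2r//; have := normr_ge0 bnd; lra.
Qed.

End Iterate.

(** * Consistency *)

Section Consistency.
Variables (R : realType) (I A D G : finType) (eps : G -> D -> R) (dg : I -> I) (E L : R).
Hypothesis G0 : (0 < #|G|)%N.
Hypothesis epsE : forall g j, `|eps g j| <= E.
Hypothesis eps0 : forall j, avg (eps^~ j) = 0.
Hypothesis epscov : forall j k, avg (fun g => eps g j * eps g k) = (j == k)%:R.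
Hypothesis L1 : 1 <= L.

Let L0 : 0 <= L. Proof. by apply: le_trans L1. Qed.
Let N : R := #|I|%:R.

Lemma eps_sqr j : avg (fun g => eps g j ^+ 2) = 1.
Proof. by have := epscov j j; rewrite eqxx. Qed.

Section Noise.
Variables (r : R) (c : R) (w : G -> I -> R) (bq : I -> R) (sq : I -> D -> R).
Hypothesis wE : forall g l, w g l = r ^+ 2 * bq l + r * (\sum_k sq l k * eps g k).

Lemma avg_eps_noise j l : avg (fun g => eps g j * w g l) = r * sq l j.
Proof.
rewrite (@eq_avg _ _ _ (fun g => eps g j * (r ^+ 2 * bq l) + \sum_k r * sq l k * (eps g j * eps g k))).
  rewrite avgD avgZr eps0 mul0r add0r avg_sum (bigD1 j)//= avgZ epscov eqxx mulr1 big1 ?addr0// => k.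
  by rewrite avgZ epscov eq_sym => /negbTE ->; rewrite mulr0.
move=> g; rewrite wE mulrDr; congr (_ + _).
by rewrite !mulr_sumr; apply: eq_bigr => k _; ring.
Qed.

Lemma avg_noise l : avg (fun g => w g l) = r ^+ 2 * bq l.
Proof.
rewrite (@eq_avg _ _ _ (fun g => r ^+ 2 * bq l + \sum_k r * sq l k * eps g k)).
  by rewrite avgD avg_cst// avg_sum big1 ?addr0// => k _; rewrite avgZ eps0 mulr0.
by move=> g; rewrite wE mulr_sumr; congr (_ + _); apply: eq_bigr => k _; ring.
Qed.

Lemma avg_noise2 l m : avg (fun g => w g l * w g m)
  = r ^+ 2 * (\sum_k sq l k * sq m k) + r ^+ 2 * r ^+ 2 * (bq l * bq m).
Proof.
rewrite (@eq_avg _ _ _ (fun g => w g m * (r ^+ 2 * bq l) + \sum_k r * sq l k * (eps g k * w g m))).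
  rewrite avgD avgZr avg_noise avg_sum addrC; congr (_ + _); last by ring.
  by rewrite mulr_sumr; apply: eq_bigr => k _; rewrite avgZ avg_eps_noise; ring.
move=> g; rewrite [w g l]wE mulrDl; congr (_ + _); first by ring.
by rewrite mulr_sumr mulr_suml; apply: eq_bigr => k _; ring.
Qed.

End Noise.

Variables (r M : R) (b : I -> jet R I) (s : I -> D -> jet R I)
  (f : A -> jet R (I + A + A * D)%type) (v u : A -> jet R I).
Hypothesis data : step_data L r b s f.
Hypothesis M0 : 0 <= M.
Hypothesis uj : forall i, is_jet (u i).
Hypothesis uM : forall i, jet_le M (u i).
Variable q : pt R I.

Let cl : R := Cl I D E L.
Let Yq g := Ypt eps r b s q g.
Let bq l := j0 (b l) q.
Let sq l k := j0 (s l k) q.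
Let w g : pt R I := fun l => Yq g l - q l.
Let r_gt0 : 0 < r. Proof. by case: (data) => /andP[]. Qed.
Let r0 : 0 <= r. Proof. exact: ltW. Qed.
Let r1 : r <= 1. Proof. by case: (data) => /andP[]. Qed.
Let rr : 0 <= r ^+ 2. Proof. exact: sqr_ge0. Qed.

Let wE g l : w g l = r ^+ 2 * bq l + r * (\sum_k sq l k * eps g k).
Proof.
rewrite /w /Yq /Ypt /=.
have -> : \sum_j r * eps g j * j0 (s l j) q = r * (\sum_j sq l j * eps g j).
  by rewrite mulr_sumr; apply: eq_bigr => j _; rewrite /sq; ring.
by rewrite /bq; ring.
Qed.

Let wn g : nrm1 (w g) <= cl * r.
Proof. exact: (Ypt_dist epsE data). Qed.

Let wn0 g : 0 <= nrm1 (w g). Proof. exact: nrm1_ge0. Qed.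

Let Yw g : Yq g = padd q (w g).
Proof. by apply/funext => l; rewrite /padd /w addrC subrK. Qed.

Let bL l : `|bq l| <= L. Proof. by case: (sd_b data l) => _ [H _ _ _]; exact: H. Qed.

Let lip_le h h' x g : UD h h' -> (forall l p, `|h' l p| <= M) -> 0 <= x <= 1 ->
  `|h (padd q (pscale x (w g))) - h q| <= M * (cl * r).
Proof.
move=> hh hM /andP[x0 x1]; apply: le_trans (lip_bound hh (fun y j _ => hM j _)) _.
rewrite ler_wpM2l// nrm1_scale ger0_norm//.
by apply: le_trans (wn g); rewrite ler_piMl.
Qed.

Let T1 h h1 h2 g : UD h h1 -> (forall l, UD (h1 l) (h2 l)) -> (forall l m p, `|h2 l m p| <= M) ->
  `|h (Yq g) - h q - \sum_l w g l * h1 l q| <= M * (cl ^+ 2 * r ^+ 2).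
Proof.
move=> H1 H2 HM; rewrite Yw; apply: le_trans (taylor1 (w := M * (cl * r)) H1 _) _.
  by move=> x l x01; exact: (lip_le _ (H2 l) (HM l) x01).
have -> : M * (cl ^+ 2 * r ^+ 2) = M * (cl * r) * (cl * r) by ring.
by rewrite ler_wpM2l//; nonneg.
Qed.

Definition Ca1 : R := N * (L * M) + M * cl ^+ 2.

(** Displacements are of order r, but the noise is centered: the linear term averages to order
    [r ^+ 2], as large as the quadratic remainder. *)
Lemma avg_increment h h1 h2 : UD h h1 -> (forall l, UD (h1 l) (h2 l)) ->
  (forall l p, `|h1 l p| <= M) -> (forall l m p, `|h2 l m p| <= M) ->
  `|avg (fun g => h (Yq g)) - h q| <= Ca1 * r ^+ 2.
Proof.
move=> H1 H2 HM1 HM2.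
have -> : avg (fun g => h (Yq g)) - h q
   = avg (fun g => h (Yq g) - h q - \sum_l w g l * h1 l q) + r ^+ 2 * \sum_l bq l * h1 l q.
  rewrite !avgB avg_cst// avg_sum mulr_sumr.
  rewrite [X in _ = _ - X + _](eq_bigr (fun l => r ^+ 2 * (bq l * h1 l q))); first by rewrite subrK.
  by move=> l _; rewrite avgZr (avg_noise wE) mulrA.
rewrite /Ca1 addrC mulrDl; apply: le_trans (ler_normD _ _) _; apply: lerD.
  rewrite normrM (ger0_norm rr) mulrC ler_wpM2r//.
  by apply: norm_sum_le_const => l; rewrite normrM ler_pM.
by apply: norm_avg_le => // g; rewrite -mulrA; exact: T1 H1 H2 HM2.
Qed.

Definition Ca2 : R := `|E| * (M * cl ^+ 2).

Lemma avg_eps_increment h h1 h2 k : UD h h1 -> (forall l, UD (h1 l) (h2 l)) ->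
  (forall l m p, `|h2 l m p| <= M) ->
  `|r^-1 * avg (fun g => eps g k * h (Yq g)) - \sum_l sq l k * h1 l q| <= Ca2 * r.
Proof.
move=> H1 H2 HM2.
have E1 : avg (fun g => eps g k * h (Yq g)) =
    avg (fun g => eps g k * (h (Yq g) - h q - \sum_l w g l * h1 l q)) + r * \sum_l sq l k * h1 l q.
  rewrite (@eq_avg _ _ (fun g => eps g k * (h (Yq g) - h q - \sum_l w g l * h1 l q))
    (fun g => eps g k * h (Yq g) - eps g k * h q - \sum_l eps g k * w g l * h1 l q)).
    rewrite !avgB avgZr eps0 mul0r subr0 avg_sum mulr_sumr.
    rewrite [X in _ = _ - X + _](eq_bigr (fun l => r * (sq l k * h1 l q))); first by rewrite subrK.
    by move=> l _; rewrite avgZr (avg_eps_noise wE) mulrA.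
  move=> g; rewrite !mulrBr mulr_sumr; congr (_ - _).
  by apply: eq_bigr => l _; rewrite mulrA.
rewrite E1 mulrDr mulKf ?gt_eqF// addrK normrM gtr0_norm ?invr_gt0//.
rewrite mulrC ler_pdivrMr//; apply: norm_avg_le => // g.
rewrite normrM /Ca2; have -> : `|E| * (M * cl ^+ 2) * r * r = `|E| * (M * (cl ^+ 2 * r ^+ 2)) by ring.
apply: ler_pM => //; first by apply: le_trans (epsE g k) _; exact: ler_norm.
exact: T1 H1 H2 HM2.
Qed.

(** First summand: the remainder of order 3, bounded through the third derivatives. Second summand:
    the product of drifts in the second moment of the displacement, which is even of order
    [r ^+ 4]. *)
Definition Ca3 : R := M * cl ^+ 3 + 2^-1 * (N * (N * (L * L * M))).

Lemma avg_generator h h1 h2 h3 : UD h h1 -> (forall l, UD (h1 l) (h2 l)) ->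
  (forall l m, UD (h2 l m) (h3 l m)) ->
  (forall l m p, `|h2 l m p| <= M) -> (forall l m k p, `|h3 l m k p| <= M) ->
  `|avg (fun g => h (Yq g)) - h q - r ^+ 2 * (\sum_l bq l * h1 l q
     + 2^-1 * \sum_l \sum_m (\sum_k sq l k * sq m k) * h2 l m q)| <= Ca3 * r ^+ 3.
Proof.
move=> H1 H2 H3 HM2 HM3.
have E1 : avg (fun g => h (Yq g)) - h q - r ^+ 2 * (\sum_l bq l * h1 l q
     + 2^-1 * \sum_l \sum_m (\sum_k sq l k * sq m k) * h2 l m q)
  = avg (fun g => h (Yq g) - h q - \sum_l w g l * h1 l q - 2^-1 * \sum_l \sum_m w g l * w g m * h2 l m q)
    + r ^+ 2 * r ^+ 2 * (2^-1 * \sum_l \sum_m bq l * bq m * h2 l m q).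
  rewrite !avgB avg_cst// avg_sum avgZ avg_sum.
  have -> : \sum_l avg (fun g => w g l * h1 l q) = r ^+ 2 * \sum_l bq l * h1 l q.
    by rewrite mulr_sumr; apply: eq_bigr => l _; rewrite avgZr (avg_noise wE) mulrA.
  have -> : \sum_l avg (fun g => \sum_m w g l * w g m * h2 l m q)
     = r ^+ 2 * (\sum_l \sum_m (\sum_k sq l k * sq m k) * h2 l m q)
       + r ^+ 2 * r ^+ 2 * \sum_l \sum_m bq l * bq m * h2 l m q.
    rewrite !mulr_sumr -big_split; apply: eq_bigr => l _ /=.
    rewrite avg_sum !mulr_sumr -big_split; apply: eq_bigr => m _ /=.
    by rewrite avgZr (avg_noise2 wE) mulrDl !mulrA.
  by ring.
rewrite E1 /Ca3 mulrDl; apply: le_trans (ler_normD _ _) _; apply: lerD.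
  apply: norm_avg_le => // g; rewrite Yw.
  apply: le_trans (taylor2 (w := M * (cl * r)) H1 H2 _) _.
    by move=> x l m x01; exact: (lip_le _ (H3 l m) (HM3 l m) x01).
  have -> : M * cl ^+ 3 * r ^+ 3 = M * (cl * r) * (cl * r) ^+ 2 by ring.
  apply: ler_wpM2l; first by nonneg.
  by rewrite lerXn2r ?nnegrE//; nonneg.
rewrite normrM (ger0_norm (mulr_ge0 rr rr)) mulrC.
apply: ler_pM; rewrite ?mulr_ge0//.
  rewrite normrM ger0_norm// ler_wpM2l//.
  apply: norm_sum_le_const => l; apply: norm_sum_le_const => m.
  by rewrite normrM ler_pM// normrM ler_pM.
have -> : r ^+ 2 * r ^+ 2 = r * r ^+ 3 by ring.
by rewrite ler_piMl// exprn_ge0.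
Qed.

Definition exact_arg (k : I + A + A * D) : R :=
  match k with
  | inl (inl l) => q l
  | inl (inr i) => j0 (jdiag dg v i) q
  | inr (i, k) => \sum_l sq l k * j1 (u i) l q
  end.

Definition rhs (i : A) : R := \sum_l bq l * j1 (u i) l q
  + 2^-1 * (\sum_l \sum_m (\sum_k sq l k * sq m k) * j2 (u i) l m q) + j0 (f i) exact_arg.

Definition Ccons : R := Ca3 + L * (#|{: A * D}|%:R * Ca2).

Let avgE (X : G -> R) : \sum_g #|G|%:R^-1 * X g = avg X.
Proof. by rewrite /avg mulr_sumr. Qed.

Lemma step_consistent i :
  `|j0 (jstep eps dg r b s f v u i) q - j0 (u i) q - r ^+ 2 * rhs i| <= Ccons * r ^+ 3.
Proof.
have [F1 F2 F3] := uj i; have [_ M1 M2 M3] := uM i.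
have H := avg_generator (D1_UD F1) (fun l => D1_UD (F2 l)) (fun l m => D1_UD (F3 l m)) M2 M3.
pose p c := j0 (jarg eps dg r b s v u c) q.
have -> : j0 (jstep eps dg r b s f v u i) q = avg (fun g => j0 (u i) (Yq g)) + r ^+ 2 * j0 (f i) p.
  by rewrite /= avgE.
rewrite /rhs; set X := \sum_l bq l * _; set Z := 2^-1 * _; set x := avg _; set y := j0 (u i) q.
have -> : x + r ^+ 2 * j0 (f i) p - y - r ^+ 2 * (X + Z + j0 (f i) exact_arg)
   = (x - y - r ^+ 2 * (X + Z)) + r ^+ 2 * (j0 (f i) p - j0 (f i) exact_arg) by ring.
rewrite /Ccons mulrDl; apply: le_trans (ler_normD _ _) _; apply: lerD; first exact: H.
have -> : L * (#|{: A * D}|%:R * Ca2) * r ^+ 3 = r ^+ 2 * (L * (#|{: A * D}|%:R * (Ca2 * r))) by ring.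
rewrite normrM (ger0_norm rr) ler_wpM2l//.
have [fj fL] := sd_f data i.
apply: le_trans (jet_lip p exact_arg fj fL) _; rewrite ler_wpM2l//.
rewrite /nrm1 !big_sumType /= [X in X + _ + _]big1 => [|l _]; last by rewrite subrr normr0.
rewrite [X in _ + X + _]big1 => [|l _]; last by rewrite subrr normr0.
rewrite !add0r; apply: sum_le_const => -[i' k] /=.
have [E1 E2 E3] := uj i'; have [_ N1 N2 N3] := uM i'.
have := avg_eps_increment k (D1_UD E1) (fun l => D1_UD (E2 l)) N2.
apply: le_trans; rewrite /p /=; apply: le_of_eq; congr (`|_ - _|).
rewrite /avg !mulr_sumr; apply: eq_bigr => g _; rewrite /Yq /Ypt; field.
by rewrite (gt_eqF r_gt0) pnatr_eq0 -lt0n G0.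
Qed.

Hypothesis vM : forall i, jet_le M (v i).

Definition Cinc : R := `|K1 I A D G E L| * (#|{: A * I}|%:R * (M * cl) + (1 + M)) + Ca1.

(** The increment of a first derivative is split at its average over the displaced points. The step
    estimate handles one part, where [SD1] is of order r by now; for the other part the third
    derivatives of u serve as second derivatives of [j1]. *)
Lemma step_increment1 i a :
  `|j1 (jstep eps dg r b s f v u i) a q - j1 (u i) a q| <= Cinc * r ^+ 2.
Proof.
have [F1 F2 F3] := uj i; have [_ M1 M2 M3] := uM i.
rewrite -(subrK (avg (fun g => j1 (u i) a (Yq g))) (j1 (jstep _ _ _ _ _ _ _ _ _) a q)) -addrA.
rewrite /Cinc mulrDl; apply: le_trans (ler_normD _ _) _; apply: lerD; last first.
  by apply: (avg_increment (D1_UD (F2 a)) (fun l => D1_UD (F3 a l))).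
have u1 i' a' p : `|j1 (u i') a' p| <= M by case: (uM i').
have v1 i' a' p : `|j1 (v i') a' p| <= M by case: (vM i').
apply: le_trans (step_bound1 dg G0 epsE eps0 eps_sqr L1 data q M0 u1 v1 i a) _.
have S0 : 0 <= SD1 eps r b s u q by exact: SD1_ge0.
apply: (@le_trans _ _ (`|K1 I A D G E L| * (r * SD1 eps r b s u q + r ^+ 2 * (1 + M)))).
  by rewrite ler_wpM2r ?ler_norm//; nonneg.
set K := `|K1 _ _ _ _ _ _|.
have -> : K * (#|{: A * I}|%:R * (M * cl) + (1 + M)) * r ^+ 2
  = K * (r * (#|{: A * I}|%:R * (M * (cl * r))) + r ^+ 2 * (1 + M)) by ring.
apply: ler_wpM2l; first exact: normr_ge0.
rewrite lerD2r.
rewrite ler_wpM2l//; apply: sum_le_const => -[i' a'] /=.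
have [_ E2 _] := uj i'; have [_ _ N2 _] := uM i'.
by apply: (sd_lip G0 epsE data q M0 (D1_UD (E2 a'))).
Qed.

Lemma step_increment0 i :
  `|j0 (jstep eps dg r b s f v u i) q - j0 (u i) q| <= (Ca1 + L) * r ^+ 2.
Proof.
have [F1 F2 F3] := uj i; have [_ M1 M2 M3] := uM i.
have H := avg_increment (D1_UD F1) (fun l => D1_UD (F2 l)) M1 M2.
rewrite /= avgE addrAC mulrDl; apply: le_trans (ler_normD _ _) _; apply: lerD => //.
by rewrite normrM (ger0_norm rr) mulrC ler_wpM2r//; case: (sd_f data i) => _ [].
Qed.

End Consistency.

(** * Regularity in time *)

Section Interpolation.
Variables (R : realType) (J : finType).

Lemma nrm1_unit (c : J) (x : R) : nrm1 (pscale x (unit_pt R c)) = `|x|.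
Proof.
rewrite nrm1_scale /nrm1 /unit_pt (bigD1 c)//= eqxx normr1 big1 ?addr0 ?mulr1// => l /negbTE ->.
by rewrite normr0.
Qed.

Lemma sum_unit (c : J) (x : R) (F : J -> R) :
  \sum_l pscale x (unit_pt R c) l * F l = x * F c.
Proof.
rewrite /pscale /unit_pt (bigD1 c)//= eqxx mulr1 big1 ?addr0// => l /negbTE ->.
by rewrite mulr0 mul0r.
Qed.

(** Both Taylor expansions are compared along a coordinate step of length [Num.sqrt dl]. The values
    differ by dl, the remainders are of order dl, and division by the length leaves its square
    root. *)
Lemma interpolation (f f' : pt R J -> R) (g g' : J -> pt R J -> R) (M dl : R) c q : 0 < dl ->
  (forall p v, `|f (padd p v) - f p - \sum_l v l * g l p| <= M * nrm1 v ^+ 2) ->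
  (forall p v, `|f' (padd p v) - f' p - \sum_l v l * g' l p| <= M * nrm1 v ^+ 2) ->
  (forall p, `|f p - f' p| <= dl) -> `|g c q - g' c q| <= (2 * M + 2) * Num.sqrt dl.
Proof.
move=> dl0 H H' D.
set x := Num.sqrt dl; have x0 : 0 < x by rewrite sqrtr_gt0.
have xx : x ^+ 2 = dl by rewrite sqr_sqrtr// ltW.
have := H q (pscale x (unit_pt R c)); have := H' q (pscale x (unit_pt R c)).
rewrite !sum_unit nrm1_unit (gtr0_norm x0) xx.
set y := f (padd _ _); set y' := f' (padd _ _) => h h'.
have d1 : `|y - y'| <= dl by exact: D.
have d2 := D q.
have e : x * (g c q - g' c q) = (y' - f' q - x * g' c q) - (y - f q - x * g c q) + (y - y') - (f q - f' q) by ring.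
rewrite -(ler_pM2l x0) -{1}(gtr0_norm x0) -normrM e.
have -> : x * ((2 * M + 2) * x) = M * dl + M * dl + dl + dl by rewrite -xx; ring.
apply: le_trans (ler_normB _ _) _; apply: lerD => //.
apply: le_trans (ler_normD _ _) _; apply: lerD => //.
by apply: le_trans (ler_normB _ _) _; apply: lerD.
Qed.

Lemma jet_taylor0 (F : jet R J) M p v : is_jet F -> jet_le M F ->
  `|j0 F (padd p v) - j0 F p - \sum_l v l * j1 F l p| <= M * nrm1 v ^+ 2.
Proof.
move=> [F1 F2 F3] [_ _ M2 _].
have M0 (a : J) : 0 <= M by apply: le_trans (M2 a a p).
have [[a _]|h] := pselect (exists a : J, True); last first.
  have h0 (c : J) : False by apply: h; exists c.
  have -> : padd p v = p by apply/funext => l; case: (h0 l).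
  rewrite subrr sub0r normrN big1 ?normr0 => [|l]; last by case: (h0 l).
  by rewrite /nrm1 big1 ?expr0n ?mulr0// => l; case: (h0 l).
rewrite expr2 mulrA; apply: taylor1; first exact: D1_UD.
move=> x l /andP[x0 x1]; apply: le_trans (lip_bound (D1_UD (F2 l)) (fun y j _ => M2 l j _)) _.
by rewrite ler_wpM2l ?(M0 a)// nrm1_scale ger0_norm// ler_piMl// nrm1_ge0.
Qed.

Lemma jet_taylor1 (F : jet R J) M a p v : is_jet F -> jet_le M F ->
  `|j1 F a (padd p v) - j1 F a p - \sum_l v l * j2 F a l p| <= M * nrm1 v ^+ 2.
Proof.
move=> [F1 F2 F3] [_ _ _ M3].
have M0 : 0 <= M by apply: le_trans (M3 a a a p).
rewrite expr2 mulrA; apply: taylor1; first exact: D1_UD.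
move=> x l /andP[x0 x1]; apply: le_trans (lip_bound (D1_UD (F3 a l)) (fun y j _ => M3 a l j _)) _.
by rewrite ler_wpM2l// nrm1_scale ger0_norm// ler_piMl// nrm1_ge0.
Qed.

Lemma jet_lip2 (F : jet R J) M a c p v : is_jet F -> jet_le M F ->
  `|j2 F a c (padd p v) - j2 F a c p| <= M * nrm1 v.
Proof.
by move=> [F1 F2 F3] [_ _ _ M3]; apply: lip_bound (D1_UD (F3 a c)) _ => x j _.
Qed.

End Interpolation.

Lemma chain_le (R : realType) (x : nat -> R) (C : R) (n : nat) :
  (forall j, (j < n)%N -> `|x j.+1 - x j| <= C) ->
  forall j k, (j + k <= n)%N -> `|x (j + k)%N - x j| <= k%:R * C.
Proof.
move=> H j; elim=> [|k IH] jk; first by rewrite addn0 subrr normr0 mul0r.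
rewrite addnS -natr1 mulrDl mul1r [leRHS]addrC.
have jk' : (j + k < n)%N by move: jk; rewrite addnS.
have -> : x (j + k).+1 - x j = (x (j + k).+1 - x (j + k)%N) + (x (j + k)%N - x j) by ring.
apply: le_trans (ler_normD _ _) _; apply: lerD; first exact: H.
exact: IH (ltnW jk').
Qed.

Section TimeRegularity.
Variables (R : realType) (I A D G : finType) (eps : G -> D -> R) (dg : I -> I) (E L : R).
Hypothesis G0 : (0 < #|G|)%N.
Hypothesis epsE : forall g j, `|eps g j| <= E.
Hypothesis eps0 : forall j, avg (eps^~ j) = 0.
Hypothesis epscov : forall j k, avg (fun g => eps g j * eps g k) = (j == k)%:R.
Hypothesis L1 : 1 <= L.
Variables (T M : R).
Hypothesis M1 : 1 <= M.

Let L0 : 0 <= L. Proof. by apply: le_trans L1. Qed.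
Let M0 : 0 <= M. Proof. by apply: le_trans M1. Qed.

Variables (r : R) (n : nat) (b : nat -> I -> jet R I) (s : nat -> I -> D -> jet R I)
  (f : nat -> R -> A -> jet R (I + A + A * D)%type) (psi : R -> A -> jet R I) (tau : nat -> R).
Hypothesis data : scheme_data L T r n b s f psi.
Let lev := level eps dg r b s f psi tau.
Hypothesis levM : forall j t i, (j <= n)%N -> jet_le M (lev j t i).
Hypothesis lev_t : forall j t t' i q, (j <= n)%N ->
  `|j0 (lev j t i) q - j0 (lev j t' i) q| <= M * `|t - t'|.
Hypothesis tau_lip : forall j k, `|tau (j + k)%N - tau j| <= k%:R * r ^+ 2.
Hypothesis b_lip : forall j k l q, `|j0 (b (j + k)%N l) q - j0 (b j l) q| <= L * (k%:R * r ^+ 2).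
Hypothesis s_lip : forall j k l c q, `|j0 (s (j + k)%N l c) q - j0 (s j l c) q| <= L * (k%:R * r ^+ 2).
Hypothesis f_lip : forall j k t i p, `|j0 (f (j + k)%N t i) p - j0 (f j t i) p| <= L * (k%:R * r ^+ 2).

Let r_gt0 : 0 < r. Proof. by case: (sd_r (scd_step data 0 0)) => /andP[]. Qed.
Let r0 : 0 <= r. Proof. exact: ltW. Qed.
Let rr : 0 <= r ^+ 2. Proof. exact: sqr_ge0. Qed.
Let levj j t i : is_jet (lev j t i). Proof. exact: (is_jet_level _ _ _ data). Qed.

Definition ti0 : R := Ca1 I D E L M + L.
Definition ti1 : R := Cinc I A D G E L M + 1.
Definition ti2 : R := (2 * M + 2) * Num.sqrt ti1.

Let Ca1_ge0 : 0 <= Ca1 I D E L M.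
Proof. by rewrite /Ca1 /Cl /nI /dE; nonneg. Qed.
Let Cinc_ge0 : 0 <= Cinc I A D G E L M.
Proof. by rewrite /Cinc /Cl /nI /dE; nonneg. Qed.
Let ti1_gt0 : 0 < ti1. Proof. by rewrite ltr_wpDl. Qed.
Let ti1_ge0 : 0 <= ti1. Proof. exact: ltW. Qed.
Let ti2_ge0 : 0 <= ti2. Proof. by rewrite mulr_ge0 ?sqrtr_ge0// addr_ge0// mulr_ge0. Qed.

Lemma time_lip0 j k t i q : (j + k <= n)%N ->
  `|j0 (lev (j + k)%N t i) q - j0 (lev j t i) q| <= ti0 * (k%:R * r ^+ 2).
Proof.
move=> jk; have -> : ti0 * (k%:R * r ^+ 2) = k%:R * (ti0 * r ^+ 2) by ring.
apply: (chain_le (x := fun j => j0 (lev j t i) q)) jk => l ln.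
exact: (step_increment0 dg G0 epsE eps0 L1 (lev l (tau l)) (scd_step data l t) M0
  (fun i' => levj l t i') (fun i' => levM t i' (ltnW ln)) q i).
Qed.

Lemma time_lip1 j k t i a q : (j + k <= n)%N ->
  `|j1 (lev (j + k)%N t i) a q - j1 (lev j t i) a q| <= ti1 * (k%:R * r ^+ 2).
Proof.
move=> jk; have -> : ti1 * (k%:R * r ^+ 2) = k%:R * (ti1 * r ^+ 2) by ring.
apply: (chain_le (x := fun j => j1 (lev j t i) a q)) jk => l ln.
apply: (@le_trans _ _ (Cinc I A D G E L M * r ^+ 2)); last by rewrite ler_wpM2r// lerDl.
exact: (step_increment1 dg G0 epsE eps0 epscov L1 (scd_step data l t) M0
  (fun i' => levj l t i') (fun i' => levM t i' (ltnW ln)) q (fun i' => levM (tau l) i' (ltnW ln)) i a).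
Qed.

(** Interpolation between the first derivatives, which are Lipschitz in time, and the third ones,
    which are bounded. No fourth derivative of the scheme is needed. *)
Lemma time_holder2 j k t i a c q : (j + k <= n)%N ->
  `|j2 (lev (j + k)%N t i) a c q - j2 (lev j t i) a c q| <= ti2 * Num.sqrt (k%:R * r ^+ 2).
Proof.
move=> jk; have [->|k0] := posnP k.
  by rewrite addn0 subrr normr0 mulr_ge0 ?sqrtr_ge0.
have tk : 0 < ti1 * (k%:R * r ^+ 2) by rewrite !mulr_gt0 ?ltr0n// exprn_gt0.
have -> : ti2 * Num.sqrt (k%:R * r ^+ 2) = (2 * M + 2) * Num.sqrt (ti1 * (k%:R * r ^+ 2)).
  by rewrite [Num.sqrt (ti1 * _)](sqrtrM _ ti1_ge0) /ti2; ring.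
apply: (@interpolation _ _ (j1 (lev (j + k)%N t i) a) (j1 (lev j t i) a)) => //.
- by move=> p v; apply: jet_taylor1 => //; exact: levM.
- move=> p v; apply: jet_taylor1 => //; apply: levM; exact: leq_trans (leq_addr _ _) jk.
- by move=> p; exact: time_lip1.
Qed.

Definition drift j t i q : R :=
  rhs dg (b j) (s j) (f j t) (lev j (tau j)) (lev j t) q i.

Let diffmul (x x' y y' cx cy ex ey : R) : `|x' - x| <= ex -> `|y' - y| <= ey ->
  `|x| <= cx -> `|y'| <= cy -> `|x' * y' - x * y| <= ex * cy + cx * ey.
Proof.
move=> h1 h2 h3 h4; have -> : x' * y' - x * y = (x' - x) * y' + x * (y' - y) by ring.
by apply: le_trans (ler_normD _ _) _; rewrite !normrM; apply: lerD; apply: ler_pM.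
Qed.

Let diffsum (B : finType) (x x' : B -> R) (c : R) : (forall k, `|x' k - x k| <= c) ->
  `|\sum_k x' k - \sum_k x k| <= #|B|%:R * c.
Proof. by move=> H; rewrite -sumrB; exact: norm_sum_le_const. Qed.

Let nI' : R := #|I|%:R.
Let nD : R := #|D|%:R.
Definition ti3 : R := nI' * (L * M + L * ti1)
  + 2^-1 * (nI' * (nI' * (nD * (L * L + L * L) * M + nD * (L * L) * ti2)))
  + (L + L * (#|A|%:R * (M + ti0) + #|{: A * D}|%:R * (nI' * (L * M + L * ti1)))).

(** Only the second derivatives force the square root; all other ingredients are Lipschitz in time.
    The diagonal argument changes with the level and with the parameter [tau], which is one of the
    uses of the Lipschitz bound in t. *)
Lemma rho_diff j k t i q : (j + k <= n)%N ->
  `|drift (j + k)%N t i q - drift j t i q| <= ti3 * (Num.sqrt (k%:R * r ^+ 2) + k%:R * r ^+ 2).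
Proof.
move=> jk; have jn : (j <= n)%N by exact: leq_trans (leq_addr _ _) jk.
set ta := k%:R * r ^+ 2; set W := _ + ta.
have ta0 : 0 <= ta by rewrite /ta; nonneg.
have sq0 : 0 <= Num.sqrt ta by exact: sqrtr_ge0.
have taW : ta <= W by rewrite /W lerDr.
have sqW : Num.sqrt ta <= W by rewrite /W lerDl.
have W0 : 0 <= W by rewrite addr_ge0.
have bL l p : `|j0 (b j l) p| <= L by case: (sd_b (scd_step data j 0) l) => _ [H _ _ _]; exact: H.
have sL j' l c p : `|j0 (s j' l c) p| <= L by case: (sd_s (scd_step data j' 0) l c) => _ [H _ _ _]; exact: H.
have lM1 j' t' i' a p : (j' <= n)%N -> `|j1 (lev j' t' i') a p| <= M by move=> h; case: (levM t' i' h).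
have lM2 j' t' i' a c p : (j' <= n)%N -> `|j2 (lev j' t' i') a c p| <= M by move=> h; case: (levM t' i' h).
have wk x y : 0 <= y -> x <= y * ta -> x <= y * W by move=> y0 h; apply: le_trans h _; exact: ler_wpM2l.
rewrite /drift /rhs.
set X := \sum_l _ * j1 _ l q; set X' := \sum_l _ * j1 _ l q.
set Y := \sum_l \sum_m _; set Y' := \sum_l \sum_m _.
set F := j0 (f _ t i) _; set F' := j0 (f _ t i) _.
have -> : X + 2^-1 * Y + F - (X' + 2^-1 * Y' + F') = (X - X') + 2^-1 * (Y - Y') + (F - F') by ring.
have addW x y k1 k2 : x <= k1 * W -> y <= k2 * W -> x + y <= (k1 + k2) * W.
  by move=> h1 h2; rewrite mulrDl lerD.
have mA x c k1 : x <= c * (k1 * W) -> x <= c * k1 * W by rewrite mulrA.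
have sd1 i' l c : `|j0 (s (j + k)%N l c) q * j1 (lev (j + k)%N t i') l q - j0 (s j l c) q * j1 (lev j t i') l q|
    <= (L * M + L * ti1) * ta.
  have -> : (L * M + L * ti1) * ta = (L * ta) * M + L * (ti1 * ta) by ring.
  by apply: (diffmul) => //; [exact: time_lip1 | exact: lM1].
apply: le_trans (ler_normD _ _) _; apply: (addW).
  apply: le_trans (ler_normD _ _) _; apply: (addW).
    apply: (mA); apply: (diffsum) => l; apply: (wk); first by nonneg.
    have -> : (L * M + L * ti1) * ta = (L * ta) * M + L * (ti1 * ta) by ring.
    by apply: (diffmul) => //; [exact: time_lip1 | exact: lM1].
  rewrite normrM ger0_norm//; apply: (mA); apply: ler_wpM2l => //.
  apply: (mA); apply: (diffsum) => l; apply: (mA); apply: (diffsum) => m.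
  apply: (@le_trans _ _ ((nD * ((L * L + L * L) * ta)) * M + nD * (L * L) * (ti2 * Num.sqrt ta))).
    apply: (diffmul).
    - apply: (diffsum) => c.
      have -> : (L * L + L * L) * ta = (L * ta) * L + L * (L * ta) by ring.
      by apply: (diffmul).
    - exact: time_holder2.
    - by apply: norm_sum_le_const => c; rewrite normrM ler_pM.
    - exact: lM2.
  apply: (addW).
    have -> : nD * ((L * L + L * L) * ta) * M = nD * (L * L + L * L) * M * ta by ring.
    by apply: ler_wpM2l => //; nonneg.
  have -> : nD * (L * L) * (ti2 * Num.sqrt ta) = nD * (L * L) * ti2 * Num.sqrt ta by ring.
  by apply: ler_wpM2l => //; nonneg.
have [fj fL] := sd_f (scd_step data (j + k)%N t) i.
rewrite /F /F'; set p := exact_arg _ _ _ _ _; set p' := exact_arg _ _ _ _ _.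
have -> : j0 (f (j + k)%N t i) p - j0 (f j t i) p'
  = (j0 (f (j + k)%N t i) p' - j0 (f j t i) p') + (j0 (f (j + k)%N t i) p - j0 (f (j + k)%N t i) p').
  by ring.
apply: le_trans (ler_normD _ _) _; apply: (addW); first by apply: (wk) => //; exact: f_lip.
apply: le_trans (jet_lip p p' fj fL) _; apply: (mA); apply: ler_wpM2l => //.
rewrite /nrm1 !big_sumType /= [X in X + _ + _]big1 => [|l _]; last by rewrite subrr normr0.
rewrite add0r; apply: (addW).
  apply: (mA); apply: sum_le_const => i'; apply: (wk); first by nonneg.
  rewrite mulrDl /=; set q' := (fun j => q (dg j)).
  have -> : j0 (lev (j + k)%N (tau (j + k)%N) i') q' - j0 (lev j (tau j) i') q'
     = (j0 (lev (j + k)%N (tau (j + k)%N) i') q' - j0 (lev (j + k)%N (tau j) i') q')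
      + (j0 (lev (j + k)%N (tau j) i') q' - j0 (lev j (tau j) i') q') by ring.
  apply: le_trans (ler_normD _ _) _; apply: lerD; last exact: time_lip0.
  by apply: le_trans (lev_t _ _ _ _ jk) _; rewrite ler_wpM2l.
apply: (mA); apply: sum_le_const => -[i' c] /=.
apply: (mA); apply: (diffsum) => l; apply: (wk); first by nonneg.
exact: sd1.
Qed.

Definition ti4 : R := Ccons I A D E L M + ti3.

(** Over k steps the consistency errors of order [r ^+ 3] add up to elapsed time times r. Replacing
    the drift of the intermediate levels by that of level j costs its modulus of continuity in
    time. *)
Lemma time_expansion j k t i q : (j + k <= n)%N ->
  `|j0 (lev (j + k)%N t i) q - j0 (lev j t i) q - k%:R * r ^+ 2 * drift j t i q|
  <= ti4 * (k%:R * r ^+ 2 * (Num.sqrt (k%:R * r ^+ 2) + k%:R * r ^+ 2 + r)).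
Proof.
move=> jk; set ta := k%:R * r ^+ 2.
have ta0 : 0 <= ta by rewrite /ta; nonneg.
have sq0 : 0 <= Num.sqrt ta by exact: sqrtr_ge0.
have ti3_ge0 : 0 <= ti3 by rewrite /ti3; nonneg.
have Cc0 : 0 <= Ccons I A D E L M by rewrite /Ccons /Ca3 /Ca2 /Cl /nI /dE; nonneg.
pose y m := j0 (lev (j + m)%N t i) q - m%:R * r ^+ 2 * drift j t i q.
suff K : `|y (0 + k)%N - y 0| <= k%:R * (ti4 * (r ^+ 2 * (Num.sqrt ta + ta + r))).
  move: K; rewrite add0n /y addn0 !mul0r subr0 addrAC => K; apply: le_trans K _.
  by apply: le_of_eq; rewrite /ta; ring.
apply: (@chain_le R y _ k) => // l lk.
have jl : (j + l <= n)%N by apply: leq_trans jk; rewrite leq_add2l ltnW.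
rewrite /y addnS -natr1.
have -> : j0 (lev (j + l).+1 t i) q - (l%:R + 1) * r ^+ 2 * drift j t i q
   - (j0 (lev (j + l)%N t i) q - l%:R * r ^+ 2 * drift j t i q)
   = (j0 (lev (j + l).+1 t i) q - j0 (lev (j + l)%N t i) q - r ^+ 2 * drift (j + l)%N t i q)
    + r ^+ 2 * (drift (j + l)%N t i q - drift j t i q) by ring.
have h1 : `|j0 (lev (j + l).+1 t i) q - j0 (lev (j + l)%N t i) q - r ^+ 2 * drift (j + l)%N t i q| <= Ccons I A D E L M * r ^+ 3.
  exact: (step_consistent dg G0 epsE eps0 epscov L1 _ (scd_step data (j + l)%N t) M0
    (fun i' => levj (j + l)%N t i') (fun i' => levM t i' jl) q i).
have h2 := rho_diff t i q jl.
have lk' : l%:R * r ^+ 2 <= ta by rewrite /ta ler_wpM2r// ler_nat ltnW.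
have h3 : Num.sqrt (l%:R * r ^+ 2) <= Num.sqrt ta by rewrite ler_sqrt.
apply: le_trans (ler_normD _ _) _; rewrite [`|r ^+ 2 * _|]normrM (ger0_norm rr).
have h4 : r ^+ 2 * `|drift (j + l)%N t i q - drift j t i q| <= r ^+ 2 * (ti3 * (Num.sqrt ta + ta)).
  rewrite ler_wpM2l//; apply: le_trans h2 _; rewrite ler_wpM2l//; exact: lerD.
have z1 : 0 <= Ccons I A D E L M * r ^+ 2 * (Num.sqrt ta + ta) by nonneg.
have z2 : 0 <= ti3 * r ^+ 2 * r by nonneg.
rewrite /ti4; lra.
Qed.

End TimeRegularity.

(** * The limit of the scheme *)

Section UltraLimit.
Variables (R : realType) (U : set_system nat).
Hypothesis UU : UltraFilter U.
Hypothesis Uoo : \oo `<=` U.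
Implicit Types (x y : nat -> R) (a c : R).

(* A record, so that implicit arguments are not inserted under the definition. *)
Record tends x a : Prop := Tends { tendsE : x @ U --> a }.

Let UP : ProperFilter U. Proof. exact: ultra_proper. Qed.
Let UF : Filter U. Proof. exact: filter_filter. Qed.

Lemma tendsP x a : tends x a <-> forall e, 0 < e -> U [set N | `|a - x N| <= e].
Proof. by split => [[/cvgrPdist_le]|H]; [|split; apply/cvgrPdist_le]. Qed.

(** The limit is the supremum of the numbers that are below x along U, since an ultrafilter decides
    on which side of a threshold x lies. In this way the values at uncountably many points converge
    at once, without extraction of subsequences. *)
Lemma bounded_tends x C : (forall N, `|x N| <= C) -> tends x (lim (x @ U)).
Proof.
move=> H; suff [p px] : exists p, tends x p by rewrite (cvg_lim (@Rhausdorff R) (tendsE px)).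
pose S := [set a | U [set N | a <= x N]].
have SC a : S a -> a <= C.
  move=> Sa; apply/negP => /negP; rewrite -ltNge => Ca.
  apply: (@filter_not_empty _ U _); apply: filterS Sa => N /= aN.
  by have := H N; have := ler_norm (x N); lra.
have S0 : S (- C).
  rewrite /S /=; apply: filterE => N /=.
  by have := H N; rewrite ler_norml => /andP[].
have hs : has_sup S by split; [exists (- C) | exists C => a /SC].
exists (sup S); apply/tendsP => e e0.
have [a Sa ae] := sup_adherent e0 hs.
have nS : ~ S (sup S + e).
  move=> h; have := ub_le_sup (proj2 hs) h; lra.
have [//|h2] := in_ultra_setVsetC [set N | sup S + e <= x N] UU.
apply: filterS (filterI Sa h2) => N /= [h1 /negP]; rewrite -ltNge => h3.
rewrite ler_norml; lra.
Qed.

Lemma tends_lim x a : x @ \oo --> a -> tends x a.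
Proof. by move=> h; split=> B /h; exact: Uoo. Qed.

Lemma tends_cst c : tends (fun=> c) c.
Proof. by split; exact: cvg_cst. Qed.

Lemma tendsD x y a c : tends x a -> tends y c -> tends (fun N => x N + y N) (a + c).
Proof. by move=> [h] [k]; split; exact: cvgD. Qed.

Lemma tendsB x y a c : tends x a -> tends y c -> tends (fun N => x N - y N) (a - c).
Proof. by move=> [h] [k]; split; exact: cvgB. Qed.

Lemma tendsM x y a c : tends x a -> tends y c -> tends (fun N => x N * y N) (a * c).
Proof. by move=> [h] [k]; split; exact: cvgM. Qed.

Lemma tends_norm x a : tends x a -> tends (fun N => `|x N|) `|a|.
Proof. by move=> [h]; split; exact: cvg_norm. Qed.

Lemma tends_sqrt x a : tends x a -> tends (fun N => Num.sqrt (x N)) (Num.sqrt a).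
Proof. by move=> [h]; split; apply: (continuous_cvg UF (sqrt_continuous (x := a)) h). Qed.

Lemma tends_sum (B : finType) (x : B -> nat -> R) (a : B -> R) :
  (forall b, tends (x b) (a b)) -> tends (fun N => \sum_b x b N) (\sum_b a b).
Proof.
move=> H; elim: (index_enum B) => [|b s IH].
  by rewrite big_nil; under eq_fun do rewrite big_nil; exact: tends_cst.
by rewrite big_cons; under eq_fun do rewrite big_cons; exact: tendsD.
Qed.

Lemma tends_le x y a c : tends x a -> tends y c -> (forall N, x N <= y N) -> a <= c.
Proof. by move=> [hx] [hy] H; apply: (@ler_cvg_to _ U UP R x y a c hx hy); exact: filterE. Qed.

Lemma tends_close x y e a : (forall N, `|x N - y N| <= e N) -> tends e 0 -> tends y a -> tends x a.
Proof.
move=> H he hy; have -> : x = (fun N => (x N - y N) + y N) by apply/funext => N; rewrite subrK.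
rewrite -[a]add0r; apply: tendsD => //; apply/tendsP => d d0.
move/tendsP: he => /(_ _ d0); apply: filterS => N /=; rewrite !sub0r !normrN => h.
by apply: le_trans (H N) _; apply: le_trans h; exact: ler_norm.
Qed.

End UltraLimit.

Section Limit.
Variables (R : realType) (I A D G : finType) (eps : G -> D -> R) (dg : I -> I) (E L : R).
Hypothesis G0 : (0 < #|G|)%N.
Hypothesis epsE : forall g j, `|eps g j| <= E.
Hypothesis eps0 : forall j, avg (eps^~ j) = 0.
Hypothesis epscov : forall j k, avg (fun g => eps g j * eps g k) = (j == k)%:R.
Hypothesis L1 : 1 <= L.
Variable T : R.
Hypothesis T0 : 0 < T.

Let L0 : 0 <= L. Proof. by apply: le_trans L1. Qed.

Variables (bN : nat -> R -> I -> jet R I) (sN : nat -> R -> I -> D -> jet R I)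
  (fN : nat -> R -> R -> A -> jet R (I + A + A * D)%type) (psiN : nat -> R -> A -> jet R I).
Variables (binf : R -> I -> pt R I -> R) (sinf : R -> I -> D -> pt R I -> R)
  (finf : R -> R -> A -> pt R (I + A + A * D)%type -> R) (psiinf : R -> A -> pt R I -> R).

(** The true data have derivatives only in the interior of their domain. They enter as limits in k
    of data that are smooth in space for all real times, with one common constant. *)
Record approx_data : Prop := ApproxData {
  ap_b : forall k s l, is_jet (bN k s l) /\ jet_le L (bN k s l);
  ap_s : forall k s l c, is_jet (sN k s l c) /\ jet_le L (sN k s l c);
  ap_f : forall k s t i, is_jet (fN k s t i) /\ jet_le L (fN k s t i);
  ap_psi : forall k t i, is_jet (psiN k t i) /\ jet_le L (psiN k t i);
  ap_b_lip : forall k s s' l q, `|j0 (bN k s l) q - j0 (bN k s' l) q| <= L * `|s - s'|;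
  ap_s_lip : forall k s s' l c q, `|j0 (sN k s l c) q - j0 (sN k s' l c) q| <= L * `|s - s'|;
  ap_f_lips : forall k s s' t i p, `|j0 (fN k s t i) p - j0 (fN k s' t i) p| <= L * `|s - s'|;
  ap_f_lipt : forall k s t t' i p, `|j0 (fN k s t i) p - j0 (fN k s t' i) p| <= L * `|t - t'|;
  ap_psi_lip : forall k t t' i q, `|j0 (psiN k t i) q - j0 (psiN k t' i) q| <= L * `|t - t'|;
  ap_b_lim : forall s l q, (fun k => j0 (bN k s l) q) @ \oo --> binf s l q;
  ap_s_lim : forall s l c q, (fun k => j0 (sN k s l c) q) @ \oo --> sinf s l c q;
  ap_f_lim : forall s t i p, (fun k => j0 (fN k s t i) p) @ \oo --> finf s t i p;
  ap_psi_lim : forall t i q, (fun k => j0 (psiN k t i) q) @ \oo --> psiinf t i q }.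

Definition limit_arg (Th : R -> R -> A -> pt R I -> R) (Th1 : R -> R -> A -> I -> pt R I -> R)
    t s q (k : I + A + A * D) : R :=
  match k with
  | inl (inl l) => q l
  | inl (inr i) => Th s s i (fun l => q (dg l))
  | inr (i, c) => \sum_l sinf s l c q * Th1 t s i l q
  end.

Definition limit_rhs Th Th1 (Th2 : R -> R -> A -> I -> I -> pt R I -> R) t s i q : R :=
  \sum_l binf s l q * Th1 t s i l q
  + 2^-1 * (\sum_l \sum_m (\sum_c sinf s l c q * sinf s m c q) * Th2 t s i l m q)
  + finf s t i (limit_arg Th Th1 t s q).

(** Derivatives are described by Taylor remainders and not by limits, because inequalities between
    finitely many values pass to the limit. The time expansion starts at the later time s, in the
    direction in which the scheme proceeds. *)
Record limit_solution (C : R) Th Th1 Th2 : Prop := LimitSolution {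
  ls_C : 0 <= C;
  ls0 : forall t s i q, 0 <= s <= T -> `|Th t s i q| <= C;
  ls1 : forall t s i l q, 0 <= s <= T -> `|Th1 t s i l q| <= C;
  ls2 : forall t s i l m q, 0 <= s <= T -> `|Th2 t s i l m q| <= C;
  ls_d0 : forall t s i q v, 0 <= s <= T ->
    `|Th t s i (padd q v) - Th t s i q - \sum_l v l * Th1 t s i l q| <= C * nrm1 v ^+ 2;
  ls_d1 : forall t s i l q v, 0 <= s <= T ->
    `|Th1 t s i l (padd q v) - Th1 t s i l q - \sum_m v m * Th2 t s i l m q| <= C * nrm1 v ^+ 2;
  ls_lip2 : forall t s i l m q v, 0 <= s <= T ->
    `|Th2 t s i l m (padd q v) - Th2 t s i l m q| <= C * nrm1 v;
  ls_t : forall t t' s i q, 0 <= s <= T -> `|Th t s i q - Th t' s i q| <= C * `|t - t'|;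
  ls_s0 : forall t s s' i q, 0 <= s' -> s' <= s -> s <= T ->
    `|Th t s' i q - Th t s i q| <= C * (s - s');
  ls_s1 : forall t s s' i l q, 0 <= s' -> s' <= s -> s <= T ->
    `|Th1 t s' i l q - Th1 t s i l q| <= C * (s - s');
  ls_s2 : forall t s s' i l m q, 0 <= s' -> s' <= s -> s <= T ->
    `|Th2 t s' i l m q - Th2 t s i l m q| <= C * Num.sqrt (s - s');
  ls_T : forall t i q, Th t T i q = psiinf t i q;
  ls_eq : forall t s s' i q, 0 <= s' -> s' <= s -> s <= T ->
    `|Th t s' i q - Th t s i q - (s - s') * limit_rhs Th Th1 Th2 t s i q|
      <= C * ((s - s') * (Num.sqrt (s - s') + (s - s'))) }.

Hypothesis ap : approx_data.

Theorem limit_exists : exists C Th Th1 Th2, limit_solution C Th Th1 Th2.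
Proof.
have [M [r0 [M_gt0 r0_gt0 HM]]] := level_unif A dg G0 epsE eps0 (eps_sqr epscov) L1 T.
pose M' := M + 1.
have M1' : 1 <= M' by rewrite lerDr ltW.
have M0 : 0 <= M' by apply: le_trans M1'.
pose rm := Num.min r0 1.
have rm0 : 0 < rm by rewrite lt_min r0_gt0 ltr01.
(* With at least K steps, the step size is admissible for every index, so that no initial indices
   have to be discarded. *)
pose K := (Num.truncn (T / rm ^+ 2)).+1.
pose n k := (K + k)%N.
have n_gt0 k : 0 < ((n k)%:R : R) by rewrite ltr0n.
pose h k := T / (n k)%:R.
have h_gt0 k : 0 < h k by rewrite divr_gt0.
have h_ge0 k : 0 <= h k by exact: ltW.
pose r k := Num.sqrt (h k).
have r_gt0 k : 0 < r k by rewrite sqrtr_gt0.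
have rr k : r k ^+ 2 = h k by rewrite sqr_sqrtr.
have nh k : (n k)%:R * h k = T by rewrite mulrC divfK// gt_eqF.
have r_le k : r k <= rm.
  rewrite -(ler_pXn2r (n := 2))// ?nnegrE; [|exact: ltW|exact: ltW].
  rewrite rr /h ler_pdivrMr// mulrC -ler_pdivrMr ?exprn_gt0//.
  have TK : 0 <= T / rm ^+ 2 by apply: divr_ge0; [exact: ltW | exact: sqr_ge0].
  have /andP[_ /ltW h1] := truncn_itv TK.
  by apply: le_trans h1 _; rewrite ler_nat leq_addr.
have r_r0 k : r k <= r0 by apply: le_trans (r_le k) _; rewrite ge_min lexx.
have r_1 k : 0 < r k <= 1 by rewrite r_gt0 (le_trans (r_le k))// ge_min lexx orbT.
have h_lim : h k @[k --> \oo] --> 0.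
  apply/cvgrPdist_le => e e0.
  exists (Num.truncn (T / e)).+1 => // k /= kn.
  rewrite sub0r normrN ger0_norm// /h ler_pdivrMr// mulrC -ler_pdivrMr//.
  have /andP[_ /ltW h1] := truncn_itv (divr_ge0 (ltW T0) (ltW e0)).
  apply: le_trans h1 _; rewrite ler_nat; apply: leq_trans kn _; exact: leq_addl.
pose tau k j := T - j%:R * h k.
pose b k j := bN k (tau k j); pose s k j := sN k (tau k j); pose f k j := fN k (tau k j).
have data k : scheme_data L T (r k) (n k) (b k) (s k) (f k) (psiN k).
  split.
  - move=> j t; split; [exact: r_1 | by move=> l; exact: ap_b | by move=> l c; exact: ap_s | by move=> i; exact: ap_f].
  - by move=> t i; exact: ap_psi.
  - by rewrite rr nh.
  - by move=> *; exact: ap_f_lipt.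
  - by move=> *; exact: ap_psi_lip.
pose lev k := level eps dg (r k) (b k) (s k) (f k) (psiN k) (tau k).
have levM k j t i : (j <= n k)%N -> jet_le M' (lev k j t i).
  move=> jn; have [H _] := HM _ _ _ _ _ _ (tau k) (data k) (r_r0 k) j jn.
  have MM : M <= M' by rewrite lerDl.
  by case: (H t i) => g0 g1 g2 g3; split => *; apply: le_trans MM.
have lev_t k j t t' i q : (j <= n k)%N -> `|j0 (lev k j t i) q - j0 (lev k j t' i) q| <= M' * `|t - t'|.
  move=> jn; have [_ H] := HM _ _ _ _ _ _ (tau k) (data k) (r_r0 k) j jn.
  by apply: le_trans (H t t' i q) _; rewrite ler_wpM2r// lerDl.
have tauE k j l : tau k (j + l)%N - tau k j = - (l%:R * r k ^+ 2).
  by rewrite /tau rr natrD; ring.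
have tau_lip k j l : `|tau k (j + l)%N - tau k j| <= l%:R * r k ^+ 2.
  by rewrite tauE normrN ger0_norm// mulr_ge0// sqr_ge0.
have b_lip k j l i q : `|j0 (b k (j + l)%N i) q - j0 (b k j i) q| <= L * (l%:R * r k ^+ 2).
  by apply: le_trans (ap_b_lip ap _ _ _ _ _) _; rewrite ler_wpM2l.
have s_lip k j l i c q : `|j0 (s k (j + l)%N i c) q - j0 (s k j i c) q| <= L * (l%:R * r k ^+ 2).
  by apply: le_trans (ap_s_lip ap _ _ _ _ _ _) _; rewrite ler_wpM2l.
have f_lip k j l t i p : `|j0 (f k (j + l)%N t i) p - j0 (f k j t i) p| <= L * (l%:R * r k ^+ 2).
  by apply: le_trans (ap_f_lips ap _ _ _ _ _ _) _; rewrite ler_wpM2l.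
have levj k j t i : is_jet (lev k j t i) by exact: (is_jet_level _ _ _ (data k)).
pose C0 := ti0 I D E L M'; pose C1 := ti1 I A D G E L M'; pose C2 := ti2 I A D G E L M'.
pose C4 := ti4 I A D G E L M'.
have B0 k := time_lip0 G0 epsE eps0 L1 M1' (data k) (@levM k).
have B1 k := time_lip1 G0 epsE eps0 epscov L1 M1' (data k) (@levM k).
have B2 k := time_holder2 G0 epsE eps0 epscov L1 M1' (data k) (@levM k).
have B4 k := time_expansion G0 epsE eps0 epscov L1 M1' (data k) (@levM k) (@lev_t k)
  (@tau_lip k) (@b_lip k) (@s_lip k) (@f_lip k).
(* The last level whose time has not passed below x: its time exceeds x by less than [h k]. At x = T
   it is level 0, so the terminal values involve no error in time. *)
pose jx k x := Num.truncn ((T - x) / h k).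
have jx_itv k x : x <= T -> (jx k x)%:R * h k <= T - x < (jx k x)%:R * h k + h k.
  move=> xT; have h0 : 0 <= (T - x) / h k by rewrite divr_ge0// subr_ge0.
  have /andP[h1 h2] := truncn_itv h0.
  have -> : (jx k x)%:R * h k + h k = (jx k x).+1%:R * h k by rewrite -natr1 mulrDl mul1r.
  by rewrite -ler_pdivlMr// h1 -ltr_pdivrMr.
have jx_n k x : 0 <= x <= T -> (jx k x <= n k)%N.
  move=> /andP[x0 xT]; have /andP[h1 _] := jx_itv k x xT.
  rewrite -(ler_nat R) -(ler_pM2r (h_gt0 k)) nh; lra.
have jx_mono k x x' : x' <= x -> x <= T -> (jx k x <= jx k x')%N.
  move=> xx xT; have /andP[h1 h2] := jx_itv k x xT; have /andP[h3 h4] := jx_itv k x' (le_trans xx xT).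
  rewrite -ltnS -(ltr_nat R) -(ltr_pM2r (h_gt0 k)) -natr1 mulrDl mul1r; lra.
have tau_jx k x : x <= T -> `|tau k (jx k x) - x| <= h k.
  move=> xT; have /andP[h1 h2] := jx_itv k x xT.
  by rewrite ler_norml /tau; apply/andP; split; lra.
have [U [UU Uoo]] := ultraFilterLemma (F := \oo) _.
have hU : tends U h 0 by exact: tends_lim.
have hUc c : tends U (fun k => c * h k) 0.
  by rewrite -(mulr0 c); apply: tendsM => //; exact: tends_cst.
pose Th t x i q := lim ((fun k => j0 (lev k (jx k x) t i) q) @ U).
pose Th1 t x i l q := lim ((fun k => j1 (lev k (jx k x) t i) l q) @ U).
pose Th2 t x i l m q := lim ((fun k => j2 (lev k (jx k x) t i) l m q) @ U).
have c0 t x i q : 0 <= x <= T -> tends U (fun k => j0 (lev k (jx k x) t i) q) (Th t x i q).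
  move=> xT; apply: (bounded_tends UU (C := M')) => k.
  by case: (levM k _ t i (jx_n k x xT)).
have c1 t x i l q : 0 <= x <= T -> tends U (fun k => j1 (lev k (jx k x) t i) l q) (Th1 t x i l q).
  move=> xT; apply: (bounded_tends UU (C := M')) => k.
  by case: (levM k _ t i (jx_n k x xT)).
have c2 t x i l m q : 0 <= x <= T -> tends U (fun k => j2 (lev k (jx k x) t i) l m q) (Th2 t x i l m q).
  move=> xT; apply: (bounded_tends UU (C := M')) => k.
  by case: (levM k _ t i (jx_n k x xT)).
have dk k x x' : (jx k x <= jx k x')%N ->
    (jx k x' - jx k x)%:R * r k ^+ 2 = tau k (jx k x) - tau k (jx k x').
  by move=> jj; rewrite natrB// rr /tau; ring.
have ctau x : x <= T -> tends U (fun k => tau k (jx k x)) x.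
  move=> xT; apply: (tends_close UU (e := h) (y := fun=> x)) => //; first by move=> k; exact: tau_jx.
  exact: tends_cst.
exists (M' + `|C0| + `|C1| + `|C2| + `|C4|), Th, Th1, Th2.
set C := M' + _ + _ + _ + _.
have [n0 n1 n2 n4] := And4 (normr_ge0 C0) (normr_ge0 C1) (normr_ge0 C2) (normr_ge0 C4).
have MC : M' <= C by rewrite /C; lra.
have C0C : C0 <= C by have := ler_norm C0; rewrite /C; lra.
have C1C : C1 <= C by have := ler_norm C1; rewrite /C; lra.
have C2C : C2 <= C by have := ler_norm C2; rewrite /C; lra.
have C4C : C4 <= C by have := ler_norm C4; rewrite /C; lra.
have cle (x : nat -> R) (y a : R) : tends U x a -> (forall k, `|x k| <= y) -> `|a| <= y.
  by move=> hx H; apply: (tends_le UU (tends_norm UU hx) (tends_cst UU y)).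
split.
- by apply: le_trans MC.
- move=> t x i q xT; apply: le_trans MC; apply: (cle _ _ _ (c0 t x i q xT)) => k.
  by case: (levM k _ t i (jx_n k x xT)).
- move=> t x i l q xT; apply: le_trans MC; apply: (cle _ _ _ (c1 t x i l q xT)) => k.
  by case: (levM k _ t i (jx_n k x xT)).
- move=> t x i l m q xT; apply: le_trans MC; apply: (cle _ _ _ (c2 t x i l m q xT)) => k.
  by case: (levM k _ t i (jx_n k x xT)).
- move=> t x i q v xT.
  apply: (cle (fun k => j0 (lev k (jx k x) t i) (padd q v) - j0 (lev k (jx k x) t i) q
     - \sum_l v l * j1 (lev k (jx k x) t i) l q)).
    apply: (tendsB UU); first by apply: (tendsB UU); exact: c0.
    by apply: (tends_sum UU) => l; apply: (tendsM UU); [exact: tends_cst | exact: c1].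
  move=> k; apply: le_trans (jet_taylor0 _ _ (levj k _ t i) (levM k _ t i (jx_n k x xT))) _.
  by rewrite ler_wpM2r// sqr_ge0.
- move=> t x i l q v xT.
  apply: (cle (fun k => j1 (lev k (jx k x) t i) l (padd q v) - j1 (lev k (jx k x) t i) l q
     - \sum_m v m * j2 (lev k (jx k x) t i) l m q)).
    apply: (tendsB UU); first by apply: (tendsB UU); exact: c1.
    by apply: (tends_sum UU) => m; apply: (tendsM UU); [exact: tends_cst | exact: c2].
  move=> k; apply: le_trans (jet_taylor1 _ _ _ (levj k _ t i) (levM k _ t i (jx_n k x xT))) _.
  by rewrite ler_wpM2r// sqr_ge0.
- move=> t x i l m q v xT.
  apply: (cle (fun k => j2 (lev k (jx k x) t i) l m (padd q v) - j2 (lev k (jx k x) t i) l m q)).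
    by apply: (tendsB UU); exact: c2.
  move=> k; apply: le_trans (jet_lip2 _ _ _ _ (levj k _ t i) (levM k _ t i (jx_n k x xT))) _.
  by rewrite ler_wpM2r// nrm1_ge0.
- move=> t t' x i q xT.
  apply: (cle (fun k => j0 (lev k (jx k x) t i) q - j0 (lev k (jx k x) t' i) q)).
    by apply: (tendsB UU); exact: c0.
  by move=> k; apply: le_trans (lev_t k _ _ _ _ _ (jx_n k x xT)) _; rewrite ler_wpM2r.
- move=> t x x' i q x0 xx xT.
  have [xI xI'] : (0 <= x <= T) /\ (0 <= x' <= T) by rewrite x0 xT (le_trans x0 xx) (le_trans xx xT).
  apply: (@le_trans _ _ (C0 * (x - x'))); last by rewrite ler_wpM2r// subr_ge0.
  apply: (tends_le UU (x := fun k => `|j0 (lev k (jx k x') t i) q - j0 (lev k (jx k x) t i) q|)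
    (y := fun k => C0 * (tau k (jx k x) - tau k (jx k x')))).
  + by apply: (tends_norm UU); apply: (tendsB UU); exact: c0.
  + apply: (tendsM UU); first exact: tends_cst.
    by apply: (tendsB UU); apply: ctau => //; exact: le_trans xT.
  + move=> k; have jj := jx_mono k x x' xx xT; have jn := jx_n k x' xI'.
    have := B0 k (jx k x) (jx k x' - jx k x)%N t i q; rewrite subnKC// => /(_ jn).
    by rewrite dk.
- move=> t x x' i l q x0 xx xT.
  have [xI xI'] : (0 <= x <= T) /\ (0 <= x' <= T) by rewrite x0 xT (le_trans x0 xx) (le_trans xx xT).
  apply: (@le_trans _ _ (C1 * (x - x'))); last by rewrite ler_wpM2r// subr_ge0.
  apply: (tends_le UU (x := fun k => `|j1 (lev k (jx k x') t i) l q - j1 (lev k (jx k x) t i) l q|)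
    (y := fun k => C1 * (tau k (jx k x) - tau k (jx k x')))).
  + by apply: (tends_norm UU); apply: (tendsB UU); exact: c1.
  + apply: (tendsM UU); first exact: tends_cst.
    by apply: (tendsB UU); apply: ctau => //; exact: le_trans xT.
  + move=> k; have jj := jx_mono k x x' xx xT; have jn := jx_n k x' xI'.
    have := B1 k (jx k x) (jx k x' - jx k x)%N t i l q; rewrite subnKC// => /(_ jn).
    by rewrite dk.
- move=> t x x' i l m q x0 xx xT.
  have [xI xI'] : (0 <= x <= T) /\ (0 <= x' <= T) by rewrite x0 xT (le_trans x0 xx) (le_trans xx xT).
  apply: (@le_trans _ _ (C2 * Num.sqrt (x - x'))); last by rewrite ler_wpM2r// sqrtr_ge0.
  apply: (tends_le UU (x := fun k => `|j2 (lev k (jx k x') t i) l m q - j2 (lev k (jx k x) t i) l m q|)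
    (y := fun k => C2 * Num.sqrt (tau k (jx k x) - tau k (jx k x')))).
  + by apply: (tends_norm UU); apply: (tendsB UU); exact: c2.
  + apply: (tendsM UU); first exact: tends_cst.
    by apply: (tends_sqrt UU); apply: (tendsB UU); apply: ctau => //; exact: le_trans xT.
  + move=> k; have jj := jx_mono k x x' xx xT; have jn := jx_n k x' xI'.
    have := B2 k (jx k x) (jx k x' - jx k x)%N t i l m q; rewrite subnKC// => /(_ jn).
    by rewrite dk.
- move=> t i q; have TT : 0 <= T <= T by rewrite lexx ltW.
  have jT k : jx k T = 0%N by rewrite /jx subrr mul0r truncn0.
  have e1 : tends U (fun k => j0 (psiN k t i) q) (Th t T i q).
    have := c0 t T i q TT; rewrite (_ : (fun k => _) = (fun k => j0 (psiN k t i) q))//.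
    by apply/funext => k; rewrite jT.
  have e2 : tends U (fun k => j0 (psiN k t i) q) (psiinf t i q).
    by apply: (tends_lim Uoo); exact: ap_psi_lim.
  by apply/eqP; rewrite eq_le; apply/andP; split; apply: (tends_le UU _ _ (fun k => lexx _)); eassumption.
- move=> t x x' i q x0 xx xT.
  have [xI xI'] : (0 <= x <= T) /\ (0 <= x' <= T) by rewrite x0 xT (le_trans x0 xx) (le_trans xx xT).
  have xx0 : 0 <= x - x' by rewrite subr_ge0.
  pose dl k := tau k (jx k x) - tau k (jx k x').
  have cdl : tends U dl (x - x').
    by apply: (tendsB UU); apply: ctau => //; exact: le_trans xT.
  pose rho k := drift eps dg (r k) (b k) (s k) (f k) (psiN k) (tau k) (jx k x) t i q.
  have crho : tends U rho (limit_rhs Th Th1 Th2 t x i q).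
    have cb l : tends U (fun k => j0 (b k (jx k x) l) q) (binf x l q).
      apply: (tends_close UU (e := fun k => L * h k) (y := fun k => j0 (bN k x l) q)) => //.
      - by move=> k; apply: le_trans (ap_b_lip ap _ _ _ _ _) _; rewrite ler_wpM2l//; exact: tau_jx.
      - by apply: (tends_lim Uoo); exact: ap_b_lim.
    have cs l c : tends U (fun k => j0 (s k (jx k x) l c) q) (sinf x l c q).
      apply: (tends_close UU (e := fun k => L * h k) (y := fun k => j0 (sN k x l c) q)) => //.
      - by move=> k; apply: le_trans (ap_s_lip ap _ _ _ _ _ _) _; rewrite ler_wpM2l//; exact: tau_jx.
      - by apply: (tends_lim Uoo); exact: ap_s_lim.
    rewrite /rho /drift /rhs /limit_rhs; apply: (tendsD UU); first apply: (tendsD UU).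
    - by apply: (tends_sum UU) => l; apply: (tendsM UU); [exact: cb | exact: c1].
    - apply: (tendsM UU); first exact: tends_cst.
      apply: (tends_sum UU) => l; apply: (tends_sum UU) => m.
      apply: (tendsM UU); last exact: c2.
      by apply: (tends_sum UU) => c; apply: (tendsM UU); exact: cs.
    - pose p k := exact_arg dg (s k (jx k x)) (lev k (jx k x) (tau k (jx k x))) (lev k (jx k x) t) q.
      suff : tends U (fun k => j0 (f k (jx k x) t i) (p k)) (finf x t i (limit_arg Th Th1 t x q)) by [].
      have cp c : tends U (fun k => p k c) (limit_arg Th Th1 t x q c).
        rewrite /p; case: c => [[l|i']|[i' c]] /=; first exact: tends_cst.
        (* In the scheme the diagonal value carries the parameter [tau], which is only close to x.
           The Lipschitz bound in t replaces it by x. *)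
        + apply: (tends_close UU (e := fun k => M' * h k)
            (y := fun k => j0 (lev k (jx k x) x i') (fun l => q (dg l)))) => //; last exact: c0.
          move=> k; apply: le_trans (lev_t k _ _ _ _ _ (jx_n k x xI)) _.
          by rewrite ler_wpM2l//; exact: tau_jx.
        + by apply: (tends_sum UU) => l; apply: (tendsM UU); [exact: cs | exact: c1].
      pose pl := limit_arg Th Th1 t x q.
      apply: (tends_close UU (e := fun k => L * h k + L * nrm1 (fun c => p k c - pl c))
        (y := fun k => j0 (fN k x t i) pl)).
      + move=> k; have [fj fL] := ap_f ap k x t i.
        rewrite -(subrK (j0 (fN k x t i) (p k)) (j0 (f k (jx k x) t i) (p k))) -addrA.
        apply: le_trans (ler_normD _ _) _; apply: lerD; last exact: jet_lip.
        by apply: le_trans (ap_f_lips ap _ _ _ _ _ _) _; rewrite ler_wpM2l//; exact: tau_jx.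
      + rewrite -[0]addr0; apply: (tendsD UU) => //.
        rewrite -(mulr0 L); apply: (tendsM UU); first exact: tends_cst.
        have := tends_sum UU (x := fun c k => `|p k c - pl c|) (a := fun=> 0) _.
        rewrite big1//; apply => c; rewrite -(@normr0 R R) -(subrr (pl c)).
        by apply: (tends_norm UU); apply: (tendsB UU) => //; exact: tends_cst.
      + by apply: (tends_lim Uoo); exact: ap_f_lim.
  have cr : tends U r 0.
    by rewrite -(@sqrtr0 R); apply: (tends_sqrt UU).
  apply: (@le_trans _ _ (C4 * ((x - x') * (Num.sqrt (x - x') + (x - x') + 0)))); last first.
    by rewrite addr0 ler_wpM2r// mulr_ge0// addr_ge0// sqrtr_ge0.
  apply: (tends_le UU (x := fun k => `|j0 (lev k (jx k x') t i) q - j0 (lev k (jx k x) t i) q - dl k * rho k|)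
    (y := fun k => C4 * (dl k * (Num.sqrt (dl k) + dl k + r k)))).
  + apply: (tends_norm UU); apply: (tendsB UU); first by apply: (tendsB UU); exact: c0.
    exact: tendsM.
  + apply: (tendsM UU); first exact: tends_cst.
    apply: (tendsM UU) => //; apply: (tendsD UU) => //; apply: (tendsD UU) => //.
    exact: tends_sqrt.
  + move=> k; have jj := jx_mono k x x' xx xT; have jn := jx_n k x' xI'.
    have := B4 k (jx k x) (jx k x' - jx k x)%N t i q; rewrite subnKC// => /(_ jn).
    by rewrite dk.
Qed.

End Limit.

Lemma lim_norm_le (R : realType) (x : nat -> R) (a c : R) :
  x @ \oo --> a -> (forall k, `|x k| <= c) -> `|a| <= c.
Proof.
move=> xa h; apply: (ler_cvg_to (cvg_norm xa) (cvg_cst c)).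
by apply: nearW => k; exact: h.
Qed.

Lemma lim_dist_le (R : realType) (x y : nat -> R) (a b c : R) :
  x @ \oo --> a -> y @ \oo --> b -> (forall k, `|x k - y k| <= c) -> `|a - b| <= c.
Proof. by move=> xa yb; apply: lim_norm_le; exact: cvgB. Qed.

(** * Regularity of the right-hand side of the limit equation *)

Section LimitData.
Variables (R : realType) (I A D : finType) (dg : I -> I) (L T : R).
Variables (binf : R -> I -> pt R I -> R) (sinf : R -> I -> D -> pt R I -> R)
  (finf : R -> R -> A -> pt R (I + A + A * D)%type -> R) (psiinf : R -> A -> pt R I -> R).

Record lip_data : Prop := LipData {
  ld_b : forall s l q, `|binf s l q| <= L;
  ld_s : forall s l c q, `|sinf s l c q| <= L;
  ld_f : forall s t i p, `|finf s t i p| <= L;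
  ld_b_lip : forall s s' l q q',
    `|binf s l q - binf s' l q'| <= L * (`|s - s'| + nrm1 (fun j => q j - q' j));
  ld_s_lip : forall s s' l c q q',
    `|sinf s l c q - sinf s' l c q'| <= L * (`|s - s'| + nrm1 (fun j => q j - q' j));
  ld_f_lip : forall s s' t i p p',
    `|finf s t i p - finf s' t i p'| <= L * (`|s - s'| + nrm1 (fun j => p j - p' j)) }.

Lemma approx_lip_data bN sN fN psiN :
  approx_data L bN sN fN psiN binf sinf finf psiinf -> lip_data.
Proof.
case=> hb hs hf hp bl sl fl flt pl cb cs cf cp; split.
- move=> s l q; apply: (@lim_norm_le R (fun k => j0 (bN k s l) q)); first exact: cb.
  by move=> k; case: (hb k s l) => _ [].
- move=> s l c q; apply: (@lim_norm_le R (fun k => j0 (sN k s l c) q)); first exact: cs.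
  by move=> k; case: (hs k s l c) => _ [].
- move=> s t i q; apply: (@lim_norm_le R (fun k => j0 (fN k s t i) q)); first exact: cf.
  by move=> k; case: (hf k s t i) => _ [].
- move=> s s' l q q'; apply: (@lim_dist_le R (fun k => j0 (bN k s l) q) (fun k => j0 (bN k s' l) q')).
  + exact: cb.
  + exact: cb.
  move=> k; rewrite -(subrK (j0 (bN k s' l) q) (j0 (bN k s l) q)) -addrA mulrDr.
  apply: le_trans (ler_normD _ _) _; apply: lerD; first exact: bl.
  by case: (hb k s' l); exact: jet_lip.
- move=> s s' l c q q'; apply: (@lim_dist_le R (fun k => j0 (sN k s l c) q) (fun k => j0 (sN k s' l c) q')).
  + exact: cs.
  + exact: cs.
  move=> k; rewrite -(subrK (j0 (sN k s' l c) q) (j0 (sN k s l c) q)) -addrA mulrDr.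
  apply: le_trans (ler_normD _ _) _; apply: lerD; first exact: sl.
  by case: (hs k s' l c); exact: jet_lip.
- move=> s s' t i q q'; apply: (@lim_dist_le R (fun k => j0 (fN k s t i) q) (fun k => j0 (fN k s' t i) q')).
  + exact: cf.
  + exact: cf.
  move=> k; rewrite -(subrK (j0 (fN k s' t i) q) (j0 (fN k s t i) q)) -addrA mulrDr.
  apply: le_trans (ler_normD _ _) _; apply: lerD; first exact: fl.
  by case: (hf k s' t i); exact: jet_lip.
Qed.

Hypothesis T0 : 0 < T.
Hypothesis ld : lip_data.

Let sdist (s s' : R) (q q' : pt R I) : R := Num.sqrt `|s - s'| + nrm1 (fun j => q j - q' j).

(** The parabolic modulus that the second derivatives impose: exponent 1/2 in time and Lipschitz in
    space. The constant is uniform in t, and t never varies. *)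
Definition hinc (f : R -> R -> pt R I -> R) : Prop := exists2 C : R, 0 <= C &
  forall t s s' q q', 0 <= s <= T -> 0 <= s' <= T -> `|f t s q - f t s' q'| <= C * sdist s s' q q'.

Definition hbdd (f : R -> R -> pt R I -> R) : Prop := exists2 C : R, 0 <= C &
  forall t s q, 0 <= s <= T -> `|f t s q| <= C.

Definition hreg f : Prop := hinc f /\ hbdd f.

Lemma hreg_const c : hreg (fun _ _ _ => c).
Proof.
split; [exists 0|exists `|c|] => //.
by move=> *; rewrite subrr normr0 mul0r.
Qed.

Lemma hinc_add f g : hinc f -> hinc g -> hinc (fun t s q => f t s q + g t s q).
Proof.
move=> [C C0 h] [C' C0' h']; exists (C + C'); first exact: addr_ge0.
move=> t s s' q q' sT sT'; rewrite mulrDl.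
have -> : f t s q + g t s q - (f t s' q' + g t s' q') = (f t s q - f t s' q') + (g t s q - g t s' q') by ring.
by apply: le_trans (ler_normD _ _) _; apply: lerD; [exact: h | exact: h'].
Qed.

Lemma hreg_add f g : hreg f -> hreg g -> hreg (fun t s q => f t s q + g t s q).
Proof.
move=> [f1 [C C0 h]] [g1 [C' C0' h']]; split; first exact: hinc_add.
exists (C + C'); first exact: addr_ge0.
by move=> t s q sT; apply: le_trans (ler_normD _ _) _; apply: lerD; [exact: h | exact: h'].
Qed.

Lemma hreg_mul f g : hreg f -> hreg g -> hreg (fun t s q => f t s q * g t s q).
Proof.
move=> [[K K0 k] [C C0 h]] [[K' K0' k'] [C' C0' h']]; split.
  exists (C * K' + K * C'); first by rewrite addr_ge0 ?mulr_ge0.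
  move=> t s s' q q' sT sT'.
  have -> : f t s q * g t s q - f t s' q' * g t s' q' =
    f t s q * (g t s q - g t s' q') + (f t s q - f t s' q') * g t s' q' by ring.
  apply: le_trans (ler_normD _ _) _; rewrite [leRHS]mulrDl; apply: lerD; rewrite normrM.
    by rewrite -mulrA; apply: ler_pM => //; [exact: h | exact: k'].
  have -> : K * C' * sdist s s' q q' = K * sdist s s' q q' * C' by ring.
  by apply: ler_pM => //; [exact: k | exact: h'].
exists (C * C'); first exact: mulr_ge0.
by move=> t s q sT; rewrite normrM; apply: ler_pM => //; [exact: h | exact: h'].
Qed.

Lemma hreg_sum (B : finType) (F : B -> R -> R -> pt R I -> R) :
  (forall j, hreg (F j)) -> hreg (fun t s q => \sum_j F j t s q).
Proof.
move=> H; suff h r : hreg (fun t s q => \sum_(j <- r) F j t s q) by exact: h.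
elim: r => [|j r IH].
  have -> : (fun t s q => \sum_(j <- [::]) F j t s q) = (fun _ _ _ => 0).
    by apply/funext => t; apply/funext => s; apply/funext => q; rewrite big_nil.
  exact: hreg_const.
have -> : (fun t s q => \sum_(j <- j :: r) F j t s q) =
    (fun t s q => F j t s q + \sum_(j <- r) F j t s q).
  by apply/funext => t; apply/funext => s; apply/funext => q; rewrite big_cons.
exact: hreg_add.
Qed.

Let lip_sdist (s s' : R) q q' : 0 <= s <= T -> 0 <= s' <= T ->
  `|s - s'| + nrm1 (fun j => q j - q' j) <= (Num.sqrt T + 1) * sdist s s' q q'.
Proof.
move=> /andP[s0 sT] /andP[s0' sT']; rewrite mulrDl mul1r mulrDr.
have h : `|s - s'| <= Num.sqrt T * Num.sqrt `|s - s'|.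
  rewrite -{1}(sqr_sqrtr (normr_ge0 (s - s'))) expr2 ler_wpM2r ?sqrtr_ge0//.
  by rewrite ler_wsqrtr// ler_norml; apply/andP; split; lra.
have := nrm1_ge0 (fun j => q j - q' j); have := sqrtr_ge0 T; have := sqrtr_ge0 `|s - s'|.
move: h; rewrite /sdist; set x := _ * _; set y := Num.sqrt _; set z := nrm1 _ => h a b c.
by have := mulr_ge0 b c; rewrite -/z; lra.
Qed.

Lemma hinc_lip f C : 0 <= C -> (forall t s s' q q', 0 <= s <= T -> 0 <= s' <= T ->
  `|f t s q - f t s' q'| <= C * (`|s - s'| + nrm1 (fun j => q j - q' j))) -> hinc f.
Proof.
move=> C0 h; exists (C * (Num.sqrt T + 1)); first by rewrite mulr_ge0// addr_ge0 ?sqrtr_ge0.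
move=> t s s' q q' sT sT'; apply: le_trans (h _ _ _ _ _ sT sT') _.
by rewrite -mulrA ler_wpM2l//; exact: lip_sdist.
Qed.

Lemma hinc_comp (B : finType) (F : R -> R -> pt R B -> R) (G : B -> R -> R -> pt R I -> R) C : 0 <= C ->
  (forall t s s' p p', `|F t s p - F t s' p'| <= C * (`|s - s'| + nrm1 (fun j => p j - p' j))) ->
  (forall j, hinc (G j)) -> hinc (fun t s q => F t s (fun j => G j t s q)).
Proof.
move=> C0 HF /(_ _)/cid2 HG; pose c j := projT1 (HG j).
have c0 j : 0 <= c j by rewrite /c; case: (HG j).
have cG j : forall t s s' q q', 0 <= s <= T -> 0 <= s' <= T ->
    `|G j t s q - G j t s' q'| <= c j * sdist s s' q q' by rewrite /c; case: (HG j).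
exists (C * (Num.sqrt T + 1 + \sum_j c j)).
  by rewrite mulr_ge0// !addr_ge0 ?sqrtr_ge0// sumr_ge0.
move=> t s s' q q' sT sT'; apply: le_trans (HF _ _ _ _ _) _.
rewrite -mulrA ler_wpM2l// [leRHS]mulrDl; apply: lerD.
  apply: le_trans (lip_sdist q q' sT sT'); rewrite lerDl; exact: nrm1_ge0.
by rewrite mulr_suml; apply: ler_sum => j _; exact: cG.
Qed.

Variables (C : R) (Th : R -> R -> A -> pt R I -> R) (Th1 : R -> R -> A -> I -> pt R I -> R)
  (Th2 : R -> R -> A -> I -> I -> pt R I -> R).
Hypothesis L0 : 0 <= L.
Hypothesis ls : limit_solution dg T binf sinf finf psiinf C Th Th1 Th2.

Let sub_padd (q q' : pt R I) : padd q' (fun j => q j - q' j) = q.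
Proof. by apply/funext => j; rewrite /padd addrC subrK. Qed.

Lemma time_sym (f : R -> R) (w : R -> R) :
  (forall s s', 0 <= s' -> s' <= s -> s <= T -> `|f s' - f s| <= w (s - s')) ->
  forall s s', 0 <= s <= T -> 0 <= s' <= T -> `|f s - f s'| <= w `|s - s'|.
Proof.
move=> h s s' /andP[s0 sT] /andP[s0' sT']; have [ss|/ltW ss] := leP s s'.
  by have := h _ _ s0 ss sT'; rewrite (distrC s s') (ger0_norm (_ : 0 <= s' - s)) ?subr_ge0.
by have := h _ _ s0' ss sT; rewrite (distrC (f s)) (ger0_norm (_ : 0 <= s - s')) ?subr_ge0.
Qed.

Lemma Th_lip s t i q q' : 0 <= s <= T -> `|Th t s i q - Th t s i q'| <= C * nrm1 (fun j => q j - q' j).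
Proof.
move=> sT; have U : UD (fun q => Th t s i q) (fun l q => Th1 t s i l q).
  move=> e e0; have C1 : 0 < C + 1 by rewrite ltr_wpDl// (ls_C ls).
  exists (e / (C + 1)); first by rewrite divr_gt0.
  move=> p v hv; apply: le_trans (ls_d0 ls _ _ _ _ sT) _.
  have n0 := nrm1_ge0 v; rewrite expr2 mulrA ler_wpM2r//.
  apply: (@le_trans _ _ ((C + 1) * nrm1 v)); first by rewrite ler_wpM2r// lerDl.
  by rewrite mulrC -ler_pdivlMr.
have := lip_bound (p := q') (v := fun j => q j - q' j) U (fun x j _ => ls1 ls _ _ _ _ sT).
by rewrite sub_padd.
Qed.

Lemma Th1_lip s t i l q q' : 0 <= s <= T -> `|Th1 t s i l q - Th1 t s i l q'| <= C * nrm1 (fun j => q j - q' j).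
Proof.
move=> sT; have U : UD (fun q => Th1 t s i l q) (fun m q => Th2 t s i l m q).
  move=> e e0; have C1 : 0 < C + 1 by rewrite ltr_wpDl// (ls_C ls).
  exists (e / (C + 1)); first by rewrite divr_gt0.
  move=> p v hv; apply: le_trans (ls_d1 ls _ _ _ _ _ sT) _.
  have n0 := nrm1_ge0 v; rewrite expr2 mulrA ler_wpM2r//.
  apply: (@le_trans _ _ ((C + 1) * nrm1 v)); first by rewrite ler_wpM2r// lerDl.
  by rewrite mulrC -ler_pdivlMr.
have := lip_bound (p := q') (v := fun j => q j - q' j) U (fun x j _ => ls2 ls _ _ _ _ _ sT).
by rewrite sub_padd.
Qed.

Lemma split_inc (x y z a c : R) : `|x - y| <= a -> `|y - z| <= c -> `|x - z| <= a + c.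
Proof.
move=> h1 h2; rewrite -(subrK y x) -addrA.
by apply: le_trans (ler_normD _ _) _; exact: lerD.
Qed.

Lemma hreg_Th1 i l : hreg (fun t s q => Th1 t s i l q).
Proof.
split; last by exists C; [exact: (ls_C ls) | move=> *; exact: (ls1 ls)].
apply: (@hinc_lip _ C); first exact: (ls_C ls).
move=> t s s' q q' sT sT'; rewrite mulrDr; apply: (@split_inc _ (Th1 t s' i l q)); last exact: Th1_lip.
apply: (@time_sym (fun s => Th1 t s i l q) (fun x => C * x)) => // r r' *; exact: (ls_s1 ls).
Qed.

Lemma hreg_Th2 i l m : hreg (fun t s q => Th2 t s i l m q).
Proof.
split; last by exists C; [exact: (ls_C ls) | move=> *; exact: (ls2 ls)].
exists C; first exact: (ls_C ls).
move=> t s s' q q' sT sT'; rewrite mulrDr; apply: (@split_inc _ (Th2 t s' i l m q)).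
  apply: (@time_sym (fun s => Th2 t s i l m q) (fun x => C * Num.sqrt x)) => // r r' *; exact: (ls_s2 ls).
by have := ls_lip2 ls t i l m q' (fun j => q j - q' j) sT'; rewrite sub_padd.
Qed.

Lemma hinc_Th_diag i : hinc (fun t s q => Th s s i (fun l => q (dg l))).
Proof.
pose N : R := #|I|%:R.
have C0 := ls_C ls; have N0 : 0 <= N by exact: ler0n.
apply: (@hinc_lip _ (2 * C + C * N)); first by rewrite addr_ge0 ?mulr_ge0.
move=> _ s s' q q' sT sT'.
have n0 := nrm1_ge0 (fun j => q j - q' j).
(* On the diagonal a change of time moves the parameter too. The increment is split into a change of
   parameter, of time, and of the point. *)
have h1 : `|Th s s i (fun l => q (dg l)) - Th s' s i (fun l => q (dg l))| <= C * `|s - s'|.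
  exact: (ls_t ls).
have h2 : `|Th s' s i (fun l => q (dg l)) - Th s' s' i (fun l => q (dg l))| <= C * `|s - s'|.
  by apply: (@time_sym (fun s => Th s' s i (fun l => q (dg l))) (fun x => C * x)) => // r r' *; exact: (ls_s0 ls).
have h3 : `|Th s' s' i (fun l => q (dg l)) - Th s' s' i (fun l => q' (dg l))| <= C * (N * nrm1 (fun j => q j - q' j)).
  apply: le_trans (Th_lip _ _ _ _ sT') _; rewrite ler_wpM2l//.
  apply: (@le_trans _ _ (\sum_(l : I) nrm1 (fun j => q j - q' j))); last first.
    by rewrite sumr_const -[_ *+ #|_|]mulr_natl.
  by apply: ler_sum => l _; apply: (le_sum_term (a := fun j => `|q j - q' j|)).
apply: le_trans (split_inc h1 (split_inc h2 h3)) _.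
have := normr_ge0 (s - s'); have := mulr_ge0 C0 n0.
have := mulr_ge0 (mulr_ge0 C0 N0) (normr_ge0 (s - s')).
by set x := `|s - s'|; set y := nrm1 _ => *; lra.
Qed.

Lemma hreg_sinf l c : hreg (fun _ s q => sinf s l c q).
Proof.
split; last by exists L => // *; exact: (ld_s ld).
by apply: (hinc_lip L0) => *; exact: (ld_s_lip ld).
Qed.

Lemma hreg_limit_rhs i : hreg (fun t s q => limit_rhs dg binf sinf finf Th Th1 Th2 t s i q).
Proof.
apply: hreg_add; first apply: hreg_add.
- apply: hreg_sum => l; apply: hreg_mul; last exact: hreg_Th1.
  split; last by exists L => // *; exact: (ld_b ld).
  by apply: (hinc_lip L0) => *; exact: (ld_b_lip ld).
- apply: hreg_mul; first exact: hreg_const.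
  apply: hreg_sum => l; apply: hreg_sum => m; apply: hreg_mul; last exact: hreg_Th2.
  by apply: hreg_sum => c; apply: hreg_mul; exact: hreg_sinf.
- split; last by exists L => // *; exact: (ld_f ld).
  apply: (@hinc_comp _ (fun t s p => finf s t i p)
    (fun k t s q => limit_arg dg sinf Th Th1 t s q k) L L0) => [*|]; first exact: (ld_f_lip ld).
  case=> [[l|i']|[i' c]] /=.
  + apply: (@hinc_lip _ 1) => // t s s' q q' _ _; rewrite mul1r.
    apply: le_trans (le_sum_term (a := fun j => `|q j - q' j|) l _) _ => //.
    by rewrite lerDr.
  + exact: hinc_Th_diag.
  + by have [] : hreg (fun t s q => \sum_l sinf s l c q * Th1 t s i' l q);
      first by apply: hreg_sum => l; apply: hreg_mul; [exact: hreg_sinf | exact: hreg_Th1].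
Qed.

End LimitData.

(** * The smoothness class of the data *)

Section BoundedDerivatives.
Variables (R : realType) (V W : normedModType R) (D : set V).

(** Coordinates of vectors and matrices, through which [Cb] on normed spaces is reduced to real
    functions. The zero functional is included; it yields the coefficients of the coordinates of xi,
    which do not move. *)
Definition functional1 (phi : W -> R) : Prop :=
  [/\ forall w w', phi (w - w') = phi w - phi w', forall x w, phi (x *: w) = x * phi w
    & forall w, `|phi w| <= `|w|].

Lemma Cb_le (k k' : nat) (F : V -> W) : (k' <= k)%N -> Cb k D F -> Cb k' D F.
Proof.
elim: k k' F => [|k IH] [|k'] F //.
- by move=> _ [c b _]; split.
- move=> kk [c b H]; split => // v; have [f' Hf Hc] := H v.
  by exists f' => //; exact: IH.
Qed.

Lemma Cb_bound k (F : V -> W) : Cb k D F -> exists C, 0 <= C /\ forall x, D x -> `|F x| <= C.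
Proof.
have bound (f : V -> W) : [bounded f x | x in D] -> exists C, 0 <= C /\ forall x, D x -> `|f x| <= C.
  by move=> /pinfty_ex_gt0 [C C0 H]; exists C; split; [exact: ltW|].
by case: k => [|k] [_ /bound].
Qed.

Lemma Cb_continuous k (F : V -> W) : Cb k D F -> {within D, continuous F}.
Proof. by case: k => [|k] []. Qed.

Variable phi : W -> R.
Hypothesis phi1 : functional1 phi.

Lemma functional_dder (F : V -> W) x v df : has_dder F x v df ->
  has_dder (fun y : R => phi (F (x + y *: v))) 0 1 (phi df).
Proof.
have [pB pZ pn] := phi1.
move=> H e /H [d d0 Hd]; exists d => // h /Hd {}Hd.
rewrite add0r scale0r addr0 [h *: 1]mulr1.
have -> : h *: phi df = phi (h *: df) by rewrite pZ.
by rewrite -!pB; apply: le_trans (pn _) _.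
Qed.

(** Derivatives are given in the interior only, so the whole segment has to lie there. The shrunk
    times are made to satisfy this. *)
Lemma Cb_lip (F : V -> W) (v : V) : Cb 1 D F -> exists C, 0 <= C /\
  forall x dl, (forall th, 0 <= th <= 1 -> D° (x + (th * dl) *: v)) ->
    `|phi (F (x + dl *: v)) - phi (F x)| <= C * `|dl|.
Proof.
move=> [_ _ /(_ v) [f' Hd Hc]]; have [C [C0 HC]] := Cb_bound (Hc : Cb 0 D f').
exists C; split => // x dl HD; have [pB pZ pn] := phi1.
have dd (y : R) : 0 <= y <= 1 -> has_dder (fun z : R => phi (F (x + (z * dl) *: v))) y 1
    (dl * phi (f' (x + (y * dl) *: v))).
  move=> y01; apply: (has_dder_scalearg (f := fun z => phi (F (x + z *: v)))).
  have /has_dderP/functional_dder H := Hd _ (HD y y01).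
  move=> e e0; have [d d0 H'] := H _ e0; exists d => // h /H'.
  by rewrite add0r scale0r addr0 -[x + _ + _]addrA -scalerDl.
have := mean_value_ineq ler01 dd (s := C * `|dl|).
rewrite mul1r mul0r scale0r addr0 subr0 mulr1; apply => y y01.
rewrite normrM mulrC ler_wpM2r//; apply: le_trans (pn _) _; apply: HC.
exact: interior_subset (HD y y01).
Qed.

Lemma within_seq_lim (F : V -> W) (y : nat -> V) x : {within D, continuous F} ->
  (forall k, D (y k)) -> D x -> y @ \oo --> x -> (fun k => phi (F (y k))) @ \oo --> phi (F x).
Proof.
move=> /subspace_continuousP cF Dy Dx yx; have [pB pZ pn] := phi1.
have FY : (fun k => F (y k)) @ \oo --> F x.
  apply: (cvg_comp y F _ (cF x Dx)) => B /= /yx [n _ Hn].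
  by exists n => // k kn; exact: Hn.
apply/cvgrPdist_le => e e0; have := FY => /cvgrPdist_le/(_ _ e0).
by apply: filterS => k /= hk; rewrite -pB; apply: le_trans hk; exact: pn.
Qed.

Variables (J : finType) (vJ : J -> V).

Definition emb (x : V) (q : pt R J) : V := x + \sum_j q j *: vJ j.

Lemma emb_unit x q (y : R) j : emb x (padd q (pscale y (unit_pt R j))) = emb x q + y *: vJ j.
Proof.
rewrite /emb -addrA; congr (_ + _).
under eq_bigr do rewrite scalerDl; rewrite big_split /=; congr (_ + _).
rewrite (bigD1 j)//= /pscale /unit_pt eqxx mulr1 big1 ?addr0// => l /negbTE ->.
by rewrite mulr0 scale0r.
Qed.

(** In the application q moves only unrestricted variables, so that this is a condition on the times
    alone. *)
Definition inside (x : V) : Prop := forall q, D° (emb x q).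

Lemma Cb_partials k (F : V -> W) : Cb k.+1 D F -> exists F' : J -> V -> W,
  (forall j, Cb k D (F' j)) /\
  forall x, inside x -> has_partials (fun q => phi (F (emb x q))) (fun j q => phi (F' j (emb x q))).
Proof.
move=> [_ _ H].
have H' j : exists f', (forall x, D° x -> is_derive x (vJ j) F (f' x)) /\ Cb k D f'.
  by have [f' h1 h2] := H (vJ j); exists f'.
have [F' HF] := choice H'; exists F'; split => [j|x xin q j]; first by case: (HF j).
have [Hd _] := HF j.
have /has_dderP/functional_dder h := Hd _ (xin q).
move=> e e0; have [d d0 h'] := h _ e0; exists d => // y /h'.
by rewrite !emb_unit.
Qed.

(** The third derivatives of a jet must leave a quadratic remainder for the second ones, which takes
    bounded partial derivatives of order 4. The choice k = 4 originates here. *)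
Lemma Cb_jets (F : V -> W) : Cb 4 D F -> exists C, 0 <= C /\ forall x, inside x ->
  exists Fj : jet R J, [/\ is_jet Fj, jet_le C Fj & forall q, j0 Fj q = phi (F (emb x q))].
Proof.
move=> HF; have [pB pZ pn] := phi1.
have [F1 [C1 H1]] := Cb_partials HF.
have [F2 HF2] := choice (fun j => Cb_partials (C1 j)).
have [F3 HF3] := choice (fun jl : J * J => Cb_partials (proj1 (HF2 jl.1) jl.2)).
have [F4 HF4] := choice (fun jlm : J * J * J => Cb_partials (proj1 (HF3 jlm.1) jlm.2)).
have bnd (B : finType) (f : B -> V -> W) k : (forall c, Cb k D (f c)) ->
    exists C, 0 <= C /\ forall c x q, inside x -> `|phi (f c (emb x q))| <= C.
  move=> Hf; have /choice[c Hc] := fun b => Cb_bound (Hf b).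
  exists (\sum_b c b); split; first by apply: sumr_ge0 => b _; case: (Hc b).
  move=> b x q xin; apply: le_trans (pn _) _; have [_ h] := Hc b.
  apply: le_trans (h _ (interior_subset (xin q))) _.
  by apply: le_sum_term => b'; case: (Hc b').
have [K0 [K00 B0]] := bnd _ (fun _ : unit => F) _ (fun=> HF).
have [K1 [K10 B1]] := bnd _ F1 _ C1.
have [K2 [K20 B2]] := bnd _ (fun jl : J * J => F2 jl.1 jl.2) _ (fun jl => proj1 (HF2 jl.1) jl.2).
have [K3 [K30 B3]] := bnd _ (fun j : J * J * J => F3 j.1 j.2) _ (fun j => proj1 (HF3 j.1) j.2).
have [K4 [K40 B4]] := bnd _ (fun j : J * J * J * J => F4 j.1 j.2) _ (fun j => proj1 (HF4 j.1) j.2).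
pose K := K0 + K1 + K2 + K3 + K4.
have K_ge0 : 0 <= K by rewrite !addr_ge0.
exists K; split => // x xin.
exists (Jet (fun q => phi (F (emb x q))) (fun a q => phi (F1 a (emb x q)))
  (fun a b q => phi (F2 a b (emb x q))) (fun a b c q => phi (F3 (a, b) c (emb x q)))).
have b1 j q : `|phi (F1 j (emb x q))| <= K by apply: le_trans (B1 _ _ _ xin) _; rewrite /K; lra.
have b2 j l q : `|phi (F2 j l (emb x q))| <= K by apply: le_trans (B2 (j, l) _ _ xin) _; rewrite /K; lra.
have b3 j l q : `|phi (F3 j l (emb x q))| <= K by apply: le_trans (B3 (j, l) _ _ xin) _; rewrite /K; lra.
have b4 j l q : `|phi (F4 j l (emb x q))| <= K by apply: le_trans (B4 (j, l) _ _ xin) _; rewrite /K; lra.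
split => //; last first.
  by split => //= q; apply: le_trans (B0 tt _ _ xin) _; rewrite /K; lra.
split => [|a|a c] /=; exists (3 * K).
- apply: (@partials_D1 _ _ _ _ (fun c d q => phi (F2 c d (emb x q)))) => //; first exact: H1.
  by move=> c; case: (HF2 c) => _; apply.
- apply: (@partials_D1 _ _ _ _ (fun c d q => phi (F3 (a, c) d (emb x q)))) => //.
  + by case: (HF2 a) => _; apply.
  + by move=> c; case: (HF3 (a, c)) => _; apply.
- apply: (@partials_D1 _ _ _ _ (fun d e q => phi (F4 (a, c, d) e (emb x q)))) => //.
  + by case: (HF3 (a, c)) => _; apply.
  + by move=> d; case: (HF4 (a, c, d)) => _; apply.
Qed.

End BoundedDerivatives.

(** * Shrinking the data into the interior of their domain *)

Lemma interior_norm (R : realType) (V : normedModType R) (D : set V) x (e : R) : 0 < e ->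
  (forall y, `|x - y| < e -> D y) -> D° x.
Proof. by move=> e0 H; apply/nbhs_ballP; exists e => //= y; rewrite -ball_normE; exact: H. Qed.

Lemma sum_pair (B : finType) (V W : zmodType) (f : B -> V) (g : B -> W) :
  \sum_i (f i, g i) = (\sum_i f i, \sum_i g i).
Proof. by elim/big_rec3: _ => // i x y z _ ->. Qed.

Lemma coord_le_norm (R : realType) (p q : nat) (M : 'M[R]_(p, q)) i j : `|M i j| <= `|M|.
Proof.
rewrite [`|M|]mx_normrE.
exact: (le_bigmax _ (fun ij => `|M ij.1 ij.2|) (i, j)).
Qed.

Lemma functional1_coord (R : realType) (p q : nat) i j :
  functional1 (fun M : 'M[R]_(p, q) => M i j).
Proof. by split => [w w'|x w|w]; [rewrite !mxE | rewrite mxE | exact: coord_le_norm]. Qed.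

Lemma functional1_zero (R : realType) (W : normedModType R) : functional1 (fun _ : W => 0 : R).
Proof. by split => [w w'|x w|w]; rewrite ?subr0 ?mulr0 ?normr0. Qed.

Section Shrink.
Variables (R : realType) (T : R).
Hypothesis T0 : 0 < T.

Definition clamp (x : R) : R := Num.max 0 (Num.min x T).
Definition lam (k : nat) : R := k.+4%:R^-1.
(** Affine contractions which move the triangle t <= s into its interior: the gaps between 0, t, s
    and T become at least [lam k * T]. As [lam k] is at most 1/4, the factor [1 - 3 * lam k] stays
    positive. Clamping, and for t the minimum with s, extend them to all real times; all maps
    involved have Lipschitz constant 1, so no constant deteriorates with k. *)
Definition shr_s k s : R := (1 - 3 * lam k) * clamp s + 2 * lam k * T.
Definition shr_t k t s : R := (1 - 3 * lam k) * clamp (Num.min t s) + lam k * T.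

Lemma clamp_itv x : 0 <= clamp x <= T.
Proof. by rewrite /clamp le_max lexx ge_max ge_min lexx orbT (ltW T0). Qed.

Lemma clamp_id x : 0 <= x <= T -> clamp x = x.
Proof. by move=> /andP[x0 xT]; rewrite /clamp min_l// max_r. Qed.

Lemma clamp_mono x y : x <= y -> clamp x <= clamp y.
Proof.
move=> xy; rewrite /clamp /Num.max /Num.min.
case: (ltP x T) => h1; case: (ltP y T) => h2; case: ltP => h3; case: ltP => h4; lra.
Qed.

Lemma clamp_lip x y : `|clamp x - clamp y| <= `|x - y|.
Proof.
have key a c : a <= c -> clamp c - clamp a <= c - a.
  move=> ac; rewrite /clamp /Num.max /Num.min.
  case: (ltP a T) => h1; case: (ltP c T) => h2; case: ltP => h3; case: ltP => h4; lra.
have [xy|/ltW xy] := leP x y.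
  rewrite distrC [`|x - y|]distrC !ger0_norm ?subr_ge0//; [exact: key|exact: clamp_mono].
by rewrite !ger0_norm ?subr_ge0//; [exact: key|exact: clamp_mono].
Qed.

Lemma min_lip (t t' s : R) : `|Num.min t s - Num.min t' s| <= `|t - t'|.
Proof.
rewrite /Num.min; case: (ltP t s) => h; case: (ltP t' s) => h'; rewrite ?subrr ?normr0//.
- by rewrite distrC [`|t - t'|]distrC !ger0_norm; lra.
- by rewrite !ger0_norm; lra.
Qed.

Lemma lam_itv k : 0 < lam k <= 4^-1.
Proof.
by rewrite /lam invr_gt0 ltr0n/= lef_pV2 ?posrE ?ltr0n// ler_nat.
Qed.

Lemma lam_lim : lam @ \oo --> 0.
Proof.
apply/cvgrPdist_le => e e0.
exists (Num.truncn e^-1).+1 => // k /= kn.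
rewrite sub0r normrN ger0_norm ?invr_ge0// /lam.
have ei : 0 <= e^-1 by rewrite invr_ge0 ltW.
have /andP[_ h1] := truncn_itv ei.
rewrite -[e]invrK lef_pV2 ?posrE ?ltr0n// ?invr_gt0//.
apply: (le_trans (ltW h1)); rewrite ler_nat; apply: leq_trans kn _.
by rewrite -addn4 leq_addr.
Qed.

Lemma shr_s_itv k s : 0 < shr_s k s < T.
Proof.
have /andP[l0 l4] := lam_itv k; have /andP[c0 cT] := clamp_itv s.
have h1 : 0 <= (1 - 3 * lam k) * clamp s by rewrite mulr_ge0//; lra.
have h2 : (1 - 3 * lam k) * clamp s <= (1 - 3 * lam k) * T by rewrite ler_wpM2l//; lra.
have h3 : 0 < lam k * T by exact: mulr_gt0.
by rewrite /shr_s; apply/andP; split; lra.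
Qed.

Lemma shr_t_itv k t s : 0 < shr_t k t s < shr_s k s.
Proof.
have /andP[l0 l4] := lam_itv k; have /andP[c0 cT] := clamp_itv (Num.min t s).
have h1 : 0 <= (1 - 3 * lam k) * clamp (Num.min t s) by rewrite mulr_ge0//; lra.
have h2 : (1 - 3 * lam k) * clamp (Num.min t s) <= (1 - 3 * lam k) * clamp s.
  by rewrite ler_wpM2l//; [lra | apply: clamp_mono; rewrite ge_min lexx orbT].
have h3 : 0 < lam k * T by exact: mulr_gt0.
by rewrite /shr_s /shr_t; apply/andP; split; lra.
Qed.

Let contr k (x y : R) : `|(1 - 3 * lam k) * x - (1 - 3 * lam k) * y| <= `|x - y|.
Proof.
have /andP[l0 l4] := lam_itv k.
by rewrite -mulrBr normrM ger0_norm ?ler_piMl//; lra.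
Qed.

Lemma shr_s_lip k s s' : `|shr_s k s - shr_s k s'| <= `|s - s'|.
Proof.
rewrite /shr_s [X in `|X|](_ : _ = (1 - 3 * lam k) * clamp s - (1 - 3 * lam k) * clamp s'); last by ring.
exact: le_trans (contr _ _ _) (clamp_lip _ _).
Qed.

Lemma shr_t_lip k t t' s : `|shr_t k t s - shr_t k t' s| <= `|t - t'|.
Proof.
rewrite /shr_t [X in `|X|](_ : _ = (1 - 3 * lam k) * clamp (Num.min t s) - (1 - 3 * lam k) * clamp (Num.min t' s)); last by ring.
by apply: le_trans (contr _ _ _) _; apply: le_trans (clamp_lip _ _) _; exact: min_lip.
Qed.

Lemma shr_t_lips k t s s' : `|shr_t k t s - shr_t k t s'| <= `|s - s'|.
Proof.
rewrite /shr_t ![Num.min t _]minC.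
rewrite [X in `|X|](_ : _ = (1 - 3 * lam k) * clamp (Num.min s t) - (1 - 3 * lam k) * clamp (Num.min s' t)); last by ring.
by apply: le_trans (contr _ _ _) _; apply: le_trans (clamp_lip _ _) _; exact: min_lip.
Qed.

Let lim_aux (x y : R) : (fun k => (1 - 3 * lam k) * x + lam k * y) @ \oo --> x.
Proof.
have -> : (fun k => (1 - 3 * lam k) * x + lam k * y) = (fun k => x + lam k * (y - 3 * x)).
  by apply/funext => k; ring.
suff : (fun k => x + lam k * (y - 3 * x)) @ \oo --> x + 0 * (y - 3 * x) by rewrite mul0r addr0.
by apply: cvgD; [exact: cvg_cst | apply: cvgM; [exact: lam_lim | exact: cvg_cst]].
Qed.

Lemma shr_s_lim s : (fun k => shr_s k s) @ \oo --> clamp s.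
Proof.
have -> : (fun k => shr_s k s) = (fun k => (1 - 3 * lam k) * clamp s + lam k * (2 * T)).
  by apply/funext => k; rewrite /shr_s; ring.
exact: lim_aux.
Qed.

Lemma shr_t_lim t s : (fun k => shr_t k t s) @ \oo --> clamp (Num.min t s).
Proof. exact: lim_aux. Qed.

End Shrink.

Lemma cvg_pair2 (R : realType) (V W : normedModType R) (f : nat -> V) (g : nat -> W) (a : V) (b : W) :
  f @ \oo --> a -> g @ \oo --> b -> (fun k => (f k, g k)) @ \oo --> (a, b).
Proof. by move=> fa gb; apply: (@cvg_pair _ _ _ _ (nbhs a) (nbhs b)). Qed.

Lemma norm_fst_le (R : realType) (V W : normedModType R) (x : V * W) : `|x.1| <= `|x|.
Proof. by rewrite prod_normE le_max lexx. Qed.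

Lemma norm_snd_le (R : realType) (V W : normedModType R) (x : V * W) : `|x.2| <= `|x|.
Proof. by rewrite prod_normE le_max lexx orbT. Qed.

Lemma unif_const (R : realType) (B : finType) (P : B -> R -> Prop) :
  (forall b C C', C <= C' -> P b C -> P b C') ->
  (forall b, exists C, 0 <= C /\ P b C) -> exists C, 0 <= C /\ forall b, P b C.
Proof.
move=> mono /choice[c H]; exists (\sum_b c b); split.
  by apply: sumr_ge0 => b _; case: (H b).
move=> b; case: (H b) => _; apply: mono; apply: le_sum_term => b'; by case: (H b').
Qed.

Lemma between (R : realType) (a c x y th : R) : a < x < c -> a < y < c -> 0 <= th <= 1 ->
  a < y + th * (x - y) < c.
Proof.
move=> /andP[ax xc] /andP[ay yc] /andP[h0 h1].
have [xy|/ltW xy] := leP x y.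
  have : 0 <= th * (y - x) by rewrite mulr_ge0// subr_ge0.
  have : 0 <= (1 - th) * (y - x) by rewrite mulr_ge0// subr_ge0.
  by move=> ? ?; apply/andP; split; lra.
have : 0 <= th * (x - y) by rewrite mulr_ge0// subr_ge0.
have : 0 <= (1 - th) * (x - y) by rewrite mulr_ge0// subr_ge0.
by move=> ? ?; apply/andP; split; lra.
Qed.

Lemma jet_le_weaken (R : realType) (J : finType) (C C' : R) (F : jet R J) :
  C <= C' -> jet_le C F -> jet_le C' F.
Proof. by move=> CC [h0 h1 h2 h3]; split => *; apply: le_trans CC. Qed.

Lemma sum_scale_dir (R : realType) (n : nat) (c : 'I_n -> R) :
  \sum_a c a *: dir R a = \col_a c a.
Proof.
apply/matrixP => i j; rewrite ord1 summxE !mxE (bigD1 i)//= big1 ?addr0.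
  by rewrite !mxE !eqxx mulr1.
by move=> a ai; rewrite !mxE eq_sym (negbTE ai) mulr0.
Qed.

Lemma sum_scale_delta (R : realType) (m d : nat) (c : 'I_m * 'I_d -> R) :
  \sum_ij c ij *: delta_mx ij.1 ij.2 = \matrix_(i, j) c (i, j) :> 'M[R]_(m, d).
Proof.
apply/matrixP => i j; rewrite summxE !mxE (bigD1 (i, j))//= big1 ?addr0.
  by rewrite !mxE !eqxx mulr1.
move=> [a b] ab; rewrite !mxE /=.
case: eqP => [ia|]; last by rewrite mulr0.
case: eqP => [jb|]; last by rewrite mulr0.
by move: ab; rewrite ia jb eqxx.
Qed.

Section Approximation.
Variables (R : realType) (n m d : nat) (T : R).
Hypothesis T0 : 0 < T.

(** Coordinates of xi on the left and of x on the right. [args] has the shape [I + A + A * D] of the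
    arguments of the generator in the scheme. *)
Definition state : finType := ('I_n + 'I_n)%type.
Definition args : finType := (state + 'I_m + 'I_m * 'I_d)%type.
Definition xi_of (q : pt R state) : 'cV[R]_n := \col_a q (inl a).
Definition x_of (q : pt R state) : 'cV[R]_n := \col_a q (inr a).

Section Strip.
Variables (W : normedModType R) (F : R * 'cV[R]_n -> W) (B : finType) (phi : B -> W -> R).
Hypothesis phi1 : forall l, functional1 (phi l).
Let D := [set p : R * 'cV[R]_n | p.1 \in `[0, T]].
Let V : normedModType R := (R * 'cV[R]_n)%type.
Hypothesis HF : Cb 4 D F.

Let vJ (j : state) : V := match j with inl _ => (0, 0) | inr a => (0, dir R a) end.

Let embE (t : R) q : emb vJ ((t, 0) : V) q = (t, x_of q).
Proof.
rewrite /emb big_sumType /= big1 => [|a _]; last by rewrite (scaler0 _ (q (inl a))).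
rewrite add0r (eq_bigr (fun a => (0, q (inr a) *: dir R a))); last first.
  by move=> a _; congr (_, _); rewrite scaler0.
by rewrite sum_pair sumr_const mul0rn sum_scale_dir; congr (_, _); rewrite ?addr0 ?add0r.
Qed.

Let in_strip (t : R) x : 0 < t < T -> D° (t, x).
Proof.
move=> /andP[t0 tT]; apply: (@interior_norm R V _ _ (Num.min t (T - t))).
  by rewrite lt_min t0 subr_gt0.
move=> y; rewrite lt_min => /andP[h1 h2].
have := norm_fst_le ((t, x) - y : V); rewrite /D /= in_itv /=.
move: h1 h2; move: (`|_|) => c h1 h2 /= h3.
have : `|t - y.1| < t by exact: le_lt_trans h1.
have : `|t - y.1| < T - t by exact: le_lt_trans h2.
by rewrite !ltr_norml => /andP[? ?] /andP[? ?]; apply/andP; split; lra.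
Qed.

(** The target space W and the family phi are left general, so that drift and diffusion coefficients
    are covered by one statement. *)
Lemma approx_strip : exists L, 0 <= L /\ exists FN : nat -> R -> B -> jet R state,
  [/\ forall k s l, is_jet (FN k s l) /\ jet_le L (FN k s l),
      forall k s s' l q, `|j0 (FN k s l) q - j0 (FN k s' l) q| <= L * `|s - s'| &
      forall s l q, (fun k => j0 (FN k s l) q) @ \oo --> phi l (F (clamp T s, x_of q))].
Proof.
have [L1 [L10 H1]] : exists L, 0 <= L /\ forall l, forall x, inside D vJ x ->
   exists Fj : jet R state, [/\ is_jet Fj, jet_le L Fj & forall q, j0 Fj q = phi l (F (emb vJ x q))].
  apply: unif_const => [l C C' CC H x /H [Fj [h1 h2 h3]]|l]; last exact: (Cb_jets (phi1 l) vJ HF).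
  by exists Fj; split => //; exact: jet_le_weaken CC h2.
have [L2 [L20 H2]] : exists L, 0 <= L /\ forall l, forall x dl,
   (forall th, 0 <= th <= 1 -> D° (x + (th * dl) *: ((1, 0) : V))) ->
    `|phi l (F (x + dl *: ((1, 0) : V))) - phi l (F x)| <= L * `|dl|.
  apply: unif_const => [l C C' CC H x dl /H h|l].
    by apply: le_trans h _; rewrite ler_wpM2r.
  exact: (Cb_lip (phi1 l) ((1, 0) : V) (Cb_le (isT : (1 <= 4)%N) HF)).
have ins k s : inside D vJ ((shr_s T k s, 0) : V).
  by move=> q; rewrite embE; apply: in_strip; exact: shr_s_itv.
have /choice[FN HFN] : forall ksl : nat * R * B, exists Fj : jet R state,
   [/\ is_jet Fj, jet_le L1 Fj & forall q, j0 Fj q = phi ksl.2 (F (shr_s T ksl.1.1 ksl.1.2, x_of q))].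
  move=> [[k s] l] /=; have [Fj [h1 h2 h3]] := H1 l _ (ins k s).
  by exists Fj; split => // q; rewrite h3 embE.
exists (L1 + L2); split; first exact: addr_ge0.
exists (fun k s l => FN (k, s, l)); split.
- move=> k s l; have [h1 h2 _] := HFN (k, s, l); split => //.
  by apply: jet_le_weaken h2; rewrite lerDl.
- move=> k s s' l q; have [_ _ h] := HFN (k, s, l); have [_ _ h'] := HFN (k, s', l).
  rewrite h h' /=; set t := shr_s T k s; set t' := shr_s T k s'.
  have tt : `|t - t'| <= `|s - s'| by exact: shr_s_lip.
  have e1 : (t, x_of q) = (t', x_of q) + (t - t') *: ((1, 0) : V).
    by congr (_, _); rewrite /= ?scaler0 ?addr0// [_ *: _]mulr1 addrC subrK.
  rewrite e1; apply: le_trans (H2 _ _ _ _) _ => [th /andP[th0 th1]|].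
    have -> : (t', x_of q) + (th * (t - t')) *: ((1, 0) : V) = (t' + th * (t - t'), x_of q).
      by congr (_, _); rewrite /= ?scaler0 ?addr0// [_ *: _]mulr1.
    apply: in_strip; have /andP[a1 a2] := shr_s_itv T0 k s; have /andP[b1 b2] := shr_s_itv T0 k s'.
    rewrite -/t -/t' in a1 a2 b1 b2.
    by apply: between; rewrite ?a1 ?b1 ?th0.
  apply: ler_pM => //; by rewrite lerDr.
- move=> s l q.
  have -> : (fun k => j0 (FN (k, s, l)) q) = (fun k => phi l (F (shr_s T k s, x_of q))).
    by apply/funext => k; have [_ _ ->] := HFN (k, s, l).
  apply: (within_seq_lim (phi1 l) (y := fun k => (shr_s T k s, x_of q)) (Cb_continuous HF)).
  + by move=> k; rewrite /D /= in_itv /=; have /andP[/ltW -> /ltW ->] := shr_s_itv T0 k s.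
  + by rewrite /D /= in_itv /=; exact: clamp_itv.
  + apply: (@cvg_pair _ _ _ _ (nbhs (clamp T s)) (nbhs (x_of q))).
      exact: shr_s_lim.
    exact: cvg_cst.
Qed.

End Strip.

Section Terminal.
Variables (psi : R -> 'cV[R]_n -> 'cV[R]_n -> 'cV[R]_m).
Hypothesis Hpsi : smooth_psi T 4 psi.
Let V : normedModType R := (R * 'cV[R]_n * 'cV[R]_n)%type.
Let D : set V := [set p : R * 'cV[R]_n * 'cV[R]_n | p.1.1 \in `[0, T]].
Let F : V -> 'cV[R]_m := fun p : R * 'cV[R]_n * 'cV[R]_n => let: (t, xi, x) := p in psi t xi x.
Let HF : Cb 4 D F. Proof. by move: Hpsi; rewrite /smooth_psi /D /F /V /reverse_coercion. Qed.
Let phi (i : 'I_m) (w : 'cV[R]_m) : R := w i 0.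
Let phi1 i : functional1 (phi i). Proof. exact: functional1_coord. Qed.

Let vJ (j : state) : V := match j with inl a => (0, dir R a, 0) | inr a => (0, 0, dir R a) end.

Let embE (t : R) q : emb vJ ((t, 0, 0) : V) q = (t, xi_of q, x_of q).
Proof.
rewrite /emb big_sumType /=.
rewrite [X in _ + (X + _)](eq_bigr (fun a => (0, q (inl a) *: dir R a, 0))); last first.
  by move=> a _; congr (_, _, _); rewrite scaler0.
rewrite [X in _ + (_ + X)](eq_bigr (fun a => (0, 0, q (inr a) *: dir R a))); last first.
  by move=> a _; congr (_, _, _); rewrite scaler0.
rewrite !sum_pair !sumr_const !mul0rn !sum_scale_dir.
by congr (_, _, _); rewrite /= ?addr0 ?add0r.
Qed.

Let in_strip (t : R) xi x : 0 < t < T -> D° (t, xi, x).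
Proof.
move=> /andP[t0 tT]; apply: (@interior_norm R V _ _ (Num.min t (T - t))).
  by rewrite lt_min t0 subr_gt0.
move=> y; rewrite lt_min => /andP[h1 h2].
have := le_trans (norm_fst_le ((t, xi, x) - y : V).1) (norm_fst_le ((t, xi, x) - y : V)).
rewrite /D /= in_itv /=.
move: h1 h2; move: (`|_|) => c h1 h2 /= h3.
have : `|t - y.1.1| < t by exact: le_lt_trans h1.
have : `|t - y.1.1| < T - t by exact: le_lt_trans h2.
by rewrite !ltr_norml => /andP[? ?] /andP[? ?]; apply/andP; split; lra.
Qed.

Let ts k t := shr_t T k t T.
Let ts_itv k t : 0 < ts k t < T.
Proof.
have /andP[h1 h2] := shr_t_itv T0 k t T; have /andP[_ h3] := shr_s_itv T0 k T.
by rewrite h1 (lt_trans h2 h3).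
Qed.

Lemma approx_psi : exists L, 0 <= L /\ exists FN : nat -> R -> 'I_m -> jet R state,
  [/\ forall k t i, is_jet (FN k t i) /\ jet_le L (FN k t i),
      forall k t t' i q, `|j0 (FN k t i) q - j0 (FN k t' i) q| <= L * `|t - t'| &
      forall t i q, (fun k => j0 (FN k t i) q) @ \oo --> psi (clamp T t) (xi_of q) (x_of q) i 0].
Proof.
have [L1 [L10 H1]] : exists L, 0 <= L /\ forall l, forall x, inside D vJ x ->
   exists Fj : jet R state, [/\ is_jet Fj, jet_le L Fj & forall q, j0 Fj q = phi l (F (emb vJ x q))].
  apply: unif_const => [l C C' CC H x /H [Fj [h1 h2 h3]]|l]; last exact: (Cb_jets (phi1 l) vJ HF).
  by exists Fj; split => //; exact: jet_le_weaken CC h2.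
have [L2 [L20 H2]] : exists L, 0 <= L /\ forall l, forall x dl,
   (forall th, 0 <= th <= 1 -> D° (x + (th * dl) *: ((1, 0, 0) : V))) ->
    `|phi l (F (x + dl *: ((1, 0, 0) : V))) - phi l (F x)| <= L * `|dl|.
  apply: unif_const => [l C C' CC H x dl /H h|l].
    by apply: le_trans h _; rewrite ler_wpM2r.
  exact: (Cb_lip (phi1 l) ((1, 0, 0) : V) (Cb_le (isT : (1 <= 4)%N) HF)).
have ins k s : inside D vJ ((ts k s, 0, 0) : V).
  by move=> q; rewrite embE; apply: in_strip; exact: ts_itv.
have /choice[FN HFN] : forall ksl : nat * R * 'I_m, exists Fj : jet R state,
   [/\ is_jet Fj, jet_le L1 Fj & forall q, j0 Fj q = phi ksl.2 (F (ts ksl.1.1 ksl.1.2, xi_of q, x_of q))].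
  move=> [[k s] l] /=; have [Fj [h1 h2 h3]] := H1 l _ (ins k s).
  by exists Fj; split => // q; rewrite h3 embE.
exists (L1 + L2); split; first exact: addr_ge0.
exists (fun k s l => FN (k, s, l)); split.
- move=> k s l; have [h1 h2 _] := HFN (k, s, l); split => //.
  by apply: jet_le_weaken h2; rewrite lerDl.
- move=> k s s' l q; have [_ _ h] := HFN (k, s, l); have [_ _ h'] := HFN (k, s', l).
  rewrite h h'; pose t := ts k s; pose t' := ts k s'.
  have tt : `|t - t'| <= `|s - s'| by exact: shr_t_lip.
  have e0 (z : R) : (t' + z, xi_of q, x_of q) = (t', xi_of q, x_of q) + z *: ((1, 0, 0) : V).
    by congr (_, _, _); rewrite /= ?scaler0 ?addr0// [_ *: _]mulr1.
  have e1 : (t, xi_of q, x_of q) = (t', xi_of q, x_of q) + (t - t') *: ((1, 0, 0) : V).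
    by rewrite -e0 addrC subrK.
  have := H2 l (t', xi_of q, x_of q) (t - t'); rewrite -e1 => lip.
  apply: le_trans (lip _) _ => [th h01|].
    by rewrite -e0; apply: in_strip; apply: between => //; exact: ts_itv.
  by apply: ler_pM => //; rewrite lerDr.
- move=> s l q.
  have -> : (fun k => j0 (FN (k, s, l)) q) = (fun k => phi l (F (ts k s, xi_of q, x_of q))).
    by apply/funext => k; have [_ _ ->] := HFN (k, s, l).
  apply: (within_seq_lim (phi1 l) (y := fun k => (ts k s, xi_of q, x_of q)) (x := (clamp T s, xi_of q, x_of q)) (Cb_continuous HF)).
  + by move=> k; rewrite /D /= in_itv /=; have /andP[/ltW -> /ltW ->] := ts_itv k s.
  + by rewrite /D /= in_itv /=; exact: clamp_itv.
  + apply: (@cvg_pair _ _ _ _ (nbhs (clamp T s, xi_of q)) (nbhs (x_of q))); last exact: cvg_cst.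
    apply: (@cvg_pair _ _ _ _ (nbhs (clamp T s)) (nbhs (xi_of q))); last exact: cvg_cst.
    have -> : clamp T s = clamp T (Num.min s T).
      by rewrite /clamp; congr Num.max; rewrite -minA minxx.
    exact: shr_t_lim.
Qed.

End Terminal.

Section Generator.
Variables (g : R -> R -> 'cV[R]_n -> 'cV[R]_n -> 'cV[R]_m -> 'M[R]_(m, d) -> 'cV[R]_m).
Hypothesis Hg : smooth_g T 4 g.
Let V : normedModType R := (R * R * 'cV[R]_n * 'cV[R]_n * 'cV[R]_m * 'M[R]_(m, d))%type.
Let D : set V := [set p : R * R * 'cV[R]_n * 'cV[R]_n * 'cV[R]_m * 'M[R]_(m, d) | let: (t, s, _, _, _, _) := p in Delta T (t, s)].
Let F : V -> 'cV[R]_m := fun p : R * R * 'cV[R]_n * 'cV[R]_n * 'cV[R]_m * 'M[R]_(m, d) => let: (t, s, xi, x, y, z) := p in g t s xi x y z.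
Let HF : Cb 4 D F. Proof. by move: Hg; rewrite /smooth_g /D /F /V /reverse_coercion. Qed.
Let phi (i : 'I_m) (w : 'cV[R]_m) : R := w i 0.
Let phi1 i : functional1 (phi i). Proof. exact: functional1_coord. Qed.

Definition arg_xi (p : pt R args) : 'cV[R]_n := \col_a p (inl (inl (inl a))).
Definition arg_x (p : pt R args) : 'cV[R]_n := \col_a p (inl (inl (inr a))).
Definition arg_y (p : pt R args) : 'cV[R]_m := \col_i p (inl (inr i)).
Definition arg_z (p : pt R args) : 'M[R]_(m, d) := \matrix_(i, j) p (inr (i, j)).

Let vJ (j : args) : V := match j with
  | inl (inl (inl a)) => (0, 0, dir R a, 0, 0, 0)
  | inl (inl (inr a)) => (0, 0, 0, dir R a, 0, 0)
  | inl (inr i) => (0, 0, 0, 0, dir R i, 0)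
  | inr ij => (0, 0, 0, 0, 0, delta_mx ij.1 ij.2) end.

Let full (t s : R) p : V := (t, s, arg_xi p, arg_x p, arg_y p, arg_z p).

Let sc (c : R) (a : R * R * 'cV[R]_n * 'cV[R]_n * 'cV[R]_m * 'M[R]_(m, d)) : c *: (a : V) =
   (c * a.1.1.1.1.1, c * a.1.1.1.1.2, c *: a.1.1.1.2, c *: a.1.1.2, c *: a.1.2, c *: a.2).
Proof. by []. Qed.

Let ad (a a' : R * R * 'cV[R]_n * 'cV[R]_n * 'cV[R]_m * 'M[R]_(m, d)) : (a : V) + (a' : V) =
   (a.1.1.1.1.1 + a'.1.1.1.1.1, a.1.1.1.1.2 + a'.1.1.1.1.2, a.1.1.1.2 + a'.1.1.1.2,
    a.1.1.2 + a'.1.1.2, a.1.2 + a'.1.2, a.2 + a'.2).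
Proof. by []. Qed.

Let embE (t s : R) p : emb vJ ((t, s, 0, 0, 0, 0) : V) p = full t s p.
Proof.
rewrite /emb !big_sumType.
have e1 : \sum_a p (inl (inl (inl a))) *: vJ (inl (inl (inl a))) = (0, 0, arg_xi p, 0, 0, 0) :> V.
  rewrite (eq_bigr (fun a => (0, 0, p (inl (inl (inl a))) *: dir R a, 0, 0, 0))).
    by rewrite !sum_pair !sumr_const !mul0rn sum_scale_dir.
  by move=> a _; rewrite sc /= !mulr0 !scaler0.
have e2 : \sum_a p (inl (inl (inr a))) *: vJ (inl (inl (inr a))) = (0, 0, 0, arg_x p, 0, 0) :> V.
  rewrite (eq_bigr (fun a => (0, 0, 0, p (inl (inl (inr a))) *: dir R a, 0, 0))).
    by rewrite !sum_pair !sumr_const !mul0rn sum_scale_dir.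
  by move=> a _; rewrite sc /= !mulr0 !scaler0.
have e3 : \sum_a p (inl (inr a)) *: vJ (inl (inr a)) = (0, 0, 0, 0, arg_y p, 0) :> V.
  rewrite (eq_bigr (fun a => (0, 0, 0, 0, p (inl (inr a)) *: dir R a, 0))).
    by rewrite !sum_pair !sumr_const !mul0rn sum_scale_dir.
  by move=> a _; rewrite sc /= !mulr0 !scaler0.
have e4 : \sum_a p (inr a) *: vJ (inr a) = (0, 0, 0, 0, 0, arg_z p) :> V.
  rewrite (eq_bigr (fun a => (0, 0, 0, 0, 0, p (inr a) *: delta_mx a.1 a.2))).
    by rewrite !sum_pair !sumr_const !mul0rn sum_scale_delta.
  by move=> a _; rewrite sc /= !mulr0 !scaler0.
rewrite e1 e2 e3 e4.
by rewrite !ad /= !addr0 !add0r.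
Qed.

Let in_tri (t s : R) xi x y z : 0 < t -> t < s -> s < T -> D° (t, s, xi, x, y, z).
Proof.
move=> t0 ts sT; apply: (@interior_norm R V _ _ (Num.min t (Num.min ((s - t) / 2) (T - s)))).
  by rewrite !lt_min t0 divr_gt0 ?subr_gt0//=.
move=> w; rewrite !lt_min => /and3P[h1 h2 h3].
set w0 : V := (t, s, xi, x, y, z) in h1 h2 h3 *.
have k1 : `|(w0 - w).1.1.1.1| <= `|w0 - w|.
  by do 3![apply: le_trans (norm_fst_le _) _]; exact: norm_fst_le.
have kt := le_trans (norm_fst_le _) k1; have ks := le_trans (norm_snd_le _) k1.
move: h1 h2 h3 kt ks; clear k1; move: (`|w0 - w|) => c h1 h2 h3.
case: w => [[[[[t' s'] xi'] x'] y'] z'] /= kt ks.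
have : `|t - t'| < t by exact: le_lt_trans h1.
have : `|t - t'| < (s - t) / 2 by exact: le_lt_trans h2.
have : `|s - s'| < (s - t) / 2 by exact: le_lt_trans h2.
have : `|s - s'| < T - s by exact: le_lt_trans h3.
rewrite !ltr_norml => /andP[? ?] /andP[? ?] /andP[? ?] /andP[? ?].
by split; rewrite /=; lra.
Qed.

Let tt k t s := shr_t T k t s.
Let ss k s := shr_s T k s.
Let tt0 k t s : 0 < tt k t s. Proof. by have /andP[] := shr_t_itv T0 k t s. Qed.
Let ttss k t s : tt k t s < ss k s. Proof. by have /andP[] := shr_t_itv T0 k t s. Qed.
Let ssT k s : ss k s < T. Proof. by have /andP[] := shr_s_itv T0 k s. Qed.

Lemma approx_g : exists L, 0 <= L /\ exists FN : nat -> R -> R -> 'I_m -> jet R args,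
  [/\ forall k s t i, is_jet (FN k s t i) /\ jet_le L (FN k s t i),
      forall k s s' t i p, `|j0 (FN k s t i) p - j0 (FN k s' t i) p| <= L * `|s - s'|,
      forall k s t t' i p, `|j0 (FN k s t i) p - j0 (FN k s t' i) p| <= L * `|t - t'| &
      forall s t i p, (fun k => j0 (FN k s t i) p) @ \oo -->
        g (clamp T (Num.min t s)) (clamp T s) (arg_xi p) (arg_x p) (arg_y p) (arg_z p) i 0].
Proof.
have [L1 [L10 H1]] : exists L, 0 <= L /\ forall l, forall x, inside D vJ x ->
   exists Fj : jet R args, [/\ is_jet Fj, jet_le L Fj & forall q, j0 Fj q = phi l (F (emb vJ x q))].
  apply: unif_const => [l C C' CC H x /H [Fj [h1 h2 h3]]|l]; last exact: (Cb_jets (phi1 l) vJ HF).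
  by exists Fj; split => //; exact: jet_le_weaken CC h2.
pose vt : V := (1, 0, 0, 0, 0, 0); pose vs : V := (0, 1, 0, 0, 0, 0).
have [L2 [L20 H2]] : exists L, 0 <= L /\ forall l, forall x dl,
   (forall th, 0 <= th <= 1 -> D° (x + (th * dl) *: vt)) ->
    `|phi l (F (x + dl *: vt)) - phi l (F x)| <= L * `|dl|.
  apply: unif_const => [l C C' CC H x dl /H h|l].
    by apply: le_trans h _; rewrite ler_wpM2r.
  exact: (Cb_lip (phi1 l) vt (Cb_le (isT : (1 <= 4)%N) HF)).
have [L3 [L30 H3]] : exists L, 0 <= L /\ forall l, forall x dl,
   (forall th, 0 <= th <= 1 -> D° (x + (th * dl) *: vs)) ->
    `|phi l (F (x + dl *: vs)) - phi l (F x)| <= L * `|dl|.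
  apply: unif_const => [l C C' CC H x dl /H h|l].
    by apply: le_trans h _; rewrite ler_wpM2r.
  exact: (Cb_lip (phi1 l) vs (Cb_le (isT : (1 <= 4)%N) HF)).
have mt (t s : R) p (z : R) : full (t + z) s p = full t s p + z *: vt.
  by rewrite /vt /full sc ad /= !scaler0 !mulr0 mulr1 !addr0.
have ms (t s : R) p (z : R) : full t (s + z) p = full t s p + z *: vs.
  by rewrite /vs /full sc ad /= !scaler0 !mulr0 mulr1 !addr0.
have Lt (t t' s : R) i p : 0 < t < s -> 0 < t' < s -> s < T ->
    `|phi i (F (full t s p)) - phi i (F (full t' s p))| <= L2 * `|t - t'|.
  move=> h h' sT; have -> : full t s p = full t' s p + (t - t') *: vt by rewrite -mt addrC subrK.
  apply: H2 => th h01; rewrite -mt.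
  by have /andP[h1 h2] := between h h' h01; apply: in_tri.
have Ls (t s s' : R) i p : 0 < t -> t < s < T -> t < s' < T ->
    `|phi i (F (full t s p)) - phi i (F (full t s' p))| <= L3 * `|s - s'|.
  move=> t0 h h'; have -> : full t s p = full t s' p + (s - s') *: vs by rewrite -ms addrC subrK.
  apply: H3 => th h01; rewrite -ms.
  by have /andP[h1 h2] := between h h' h01; apply: in_tri.
have ins k s t : inside D vJ ((tt k t s, ss k s, 0, 0, 0, 0) : V).
  by move=> q; rewrite embE; apply: in_tri.
have /choice[FN HFN] : forall c : nat * R * R * 'I_m, exists Fj : jet R args,
   [/\ is_jet Fj, jet_le L1 Fj & forall q,
     j0 Fj q = phi c.2 (F (full (tt c.1.1.1 c.1.2 c.1.1.2) (ss c.1.1.1 c.1.1.2) q))].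
  move=> [[[k s] t] l] /=; have [Fj [h1 h2 h3]] := H1 l _ (ins k s t).
  by exists Fj; split => // q; rewrite h3 embE.
exists (L1 + (L2 + L3)); split; first by rewrite !addr_ge0.
exists (fun k s t l => FN (k, s, t, l)); split.
- move=> k s t l; have [h1 h2 _] := HFN (k, s, t, l); split => //.
  by apply: jet_le_weaken h2; rewrite lerDl addr_ge0.
- move=> k s s' t l q; have [_ _ h] := HFN (k, s, t, l); have [_ _ h'] := HFN (k, s', t, l).
  rewrite h h'; set X := phi _ _; set X' := phi _ _.
  have lip1 : `|tt k t s - tt k t s'| <= `|s - s'| by exact: shr_t_lips.
  have lip2 : `|ss k s - ss k s'| <= `|s - s'| by exact: shr_s_lip.
  apply: (@le_trans _ _ (L2 * `|s - s'| + L3 * `|s - s'|)); last first.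
    by rewrite -mulrDl ler_wpM2r// lerDr.
  (* A change of s also moves the shrunk t. The intermediate point combines the larger s with the t
     of the smaller one, which keeps it inside the triangle. *)
  have [sss|/ltW sss] := leP (ss k s) (ss k s').
  + have -> : X - X' = (phi l (F (full (tt k t s) (ss k s') q)) - X') + (X - phi l (F (full (tt k t s) (ss k s') q))) by ring.
    have t1 : tt k t s < ss k s' by apply: lt_le_trans sss.
    apply: le_trans (ler_normD _ _) _; apply: lerD.
      by apply: le_trans (Lt _ _ _ _ _ _ _ _) _; rewrite ?tt0 ?ssT ?ttss ?t1// ler_wpM2l.
    by apply: le_trans (Ls _ _ _ _ _ _ _ _) _; rewrite ?tt0 ?ssT ?ttss ?t1// ler_wpM2l.
  + have -> : X - X' = (X - phi l (F (full (tt k t s') (ss k s) q))) + (phi l (F (full (tt k t s') (ss k s) q)) - X') by ring.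
    have t1 : tt k t s' < ss k s by apply: lt_le_trans sss.
    apply: le_trans (ler_normD _ _) _; apply: lerD.
      by apply: le_trans (Lt _ _ _ _ _ _ _ _) _; rewrite ?tt0 ?ssT ?ttss ?t1// ler_wpM2l.
    by apply: le_trans (Ls _ _ _ _ _ _ _ _) _; rewrite ?tt0 ?ssT ?ttss ?t1// ler_wpM2l.
- move=> k s t t' l q; have [_ _ h] := HFN (k, s, t, l); have [_ _ h'] := HFN (k, s, t', l).
  rewrite h h'; apply: le_trans (Lt _ _ _ _ _ _ _ _) _; rewrite ?tt0 ?ssT ?ttss//.
  by apply: ler_pM => //; [rewrite addrCA lerDl addr_ge0 | exact: shr_t_lip].
- move=> s t l q.
  have -> : (fun k => j0 (FN (k, s, t, l)) q) = (fun k => phi l (F (full (tt k t s) (ss k s) q))).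
    by apply/funext => k; have [_ _ ->] := HFN (k, s, t, l).
  apply: (within_seq_lim (phi1 l) (y := fun k => full (tt k t s) (ss k s) q)
    (x := full (clamp T (Num.min t s)) (clamp T s) q) (Cb_continuous HF)).
  + by move=> k; split; rewrite /= ltW.
  + have /andP[a1 a2] := clamp_itv T0 (Num.min t s); have /andP[b1 b2] := clamp_itv T0 s.
    by split => //=; apply: clamp_mono; rewrite ge_min lexx orbT.
  + do 4![apply: cvg_pair2; last exact: cvg_cst].
    by apply: cvg_pair2; [exact: shr_t_lim | exact: shr_s_lim].
Qed.

End Generator.
End Approximation.

(** * The limit in coordinates *)

Section Noise.
Variables (R : realType) (d : nat).
Hypothesis d0 : (0 < d)%N.

Definition noise (g : 'I_d * bool) (j : 'I_d) : R :=
  if g.1 == j then (if g.2 then 1 else -1) * Num.sqrt d%:R else 0.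

Lemma noise_card : (0 < #|{: 'I_d * bool}|)%N.
Proof. by rewrite card_prod card_ord card_bool muln_gt0 d0. Qed.

Lemma noise_bound g j : `|noise g j| <= Num.sqrt d%:R.
Proof.
rewrite /noise; case: eqP => _; last by rewrite normr0 sqrtr_ge0.
by rewrite normrM (ger0_norm (sqrtr_ge0 _)); case: g.2; rewrite ?normrN normr1 mul1r.
Qed.

Lemma noise_mean j : avg (R:=R) (noise^~ j) = 0.
Proof.
rewrite /avg -(pair_bigA _ (fun c b => noise (c, b) j)) /= big1 ?mulr0// => c _.
rewrite big_bool /noise /=; case: eqP => _; last by rewrite addr0.
by rewrite mul1r mulN1r subrr.
Qed.

Lemma noise_cov j k : avg (R:=R) (fun g => noise g j * noise g k) = (j == k)%:R.
Proof.
rewrite /avg -(pair_bigA _ (fun c b => noise (c, b) j * noise (c, b) k)) /=.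
have [<-|jk] := eqVneq j k; last first.
  rewrite big1 ?mulr0// => c _; rewrite big1// => b _; rewrite /noise /=.
  by case: eqP => [->|]; rewrite ?mul0r// (negbTE jk) mulr0.
rewrite (bigD1 j)//= [X in _ + X]big1 => [|c cj]; last first.
  by rewrite big1// => b _; rewrite /noise /= (negbTE cj) mul0r.
have dd : Num.sqrt d%:R * Num.sqrt d%:R = d%:R :> R by rewrite -expr2 sqr_sqrtr// ler0n.
have -> : \sum_(b : bool) noise (j, b) j * noise (j, b) j + 0 = d%:R * 2 :> R.
  by rewrite big_bool /noise /= eqxx mul1r mulN1r mulrNN dd addr0; ring.
by rewrite card_prod card_ord card_bool natrM mulVf// mulf_neq0// pnatr_eq0 -?lt0n.
Qed.

End Noise.

Definition vnorm1 (R : realType) (n : nat) (v : 'cV[R]_n) : R := \sum_a `|v a 0|.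

Section CoordinateSolution.
Variables (R : realType) (n m d : nat) (T : R).
Variables (b : R -> 'cV[R]_n -> 'cV[R]_n) (sigma : R -> 'cV[R]_n -> 'M[R]_(n, d)).
Variables (psi : R -> 'cV[R]_n -> 'cV[R]_n -> 'cV[R]_m)
  (g : R -> R -> 'cV[R]_n -> 'cV[R]_n -> 'cV[R]_m -> 'M[R]_(m, d) -> 'cV[R]_m).

Section Fields.
Variables (U : R -> R -> 'cV[R]_n -> 'cV[R]_n -> 'cV[R]_m)
  (P : R -> R -> 'cV[R]_n -> 'cV[R]_n -> 'M[R]_(m, n))
  (H : R -> R -> 'cV[R]_n -> 'cV[R]_n -> 'I_m -> 'M[R]_n).

Definition coord_rhs t s xi x i : R :=
  \sum_a b s x a 0 * P t s xi x i a
  + 2^-1 * (\sum_a \sum_a' (\sum_c sigma s x a c * sigma s x a' c) * H t s xi x i a a')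
  + g t s xi x (U s s x x) (P t s xi x *m sigma s x) i 0.

(** Derivatives in xi, indispensable within the scheme, are dropped. Whatever involves the equation
    is restricted to times in the triangle, where clamping has no effect and the right-hand side is
    that of the given system. *)
Record coord_solution (C : R) : Prop := CoordSolution {
  cs_C : 0 <= C;
  cs0 : forall t s xi x i, 0 <= s <= T -> `|U t s xi x i 0| <= C;
  cs1 : forall t s xi x i a, 0 <= s <= T -> `|P t s xi x i a| <= C;
  cs2 : forall t s xi x i a a', 0 <= s <= T -> `|H t s xi x i a a'| <= C;
  cs_d0 : forall t s xi x v i, 0 <= s <= T ->
    `|U t s xi (x + v) i 0 - U t s xi x i 0 - \sum_a v a 0 * P t s xi x i a| <= C * vnorm1 v ^+ 2;
  cs_d1 : forall t s xi x v i a, 0 <= s <= T ->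
    `|P t s xi (x + v) i a - P t s xi x i a - \sum_a' v a' 0 * H t s xi x i a a'| <= C * vnorm1 v ^+ 2;
  cs_lip0 : forall t s xi x x' i, 0 <= s <= T ->
    `|U t s xi x i 0 - U t s xi x' i 0| <= C * vnorm1 (x - x');
  cs_lip1 : forall t s xi x x' i a, 0 <= s <= T ->
    `|P t s xi x i a - P t s xi x' i a| <= C * vnorm1 (x - x');
  cs_lip2 : forall t s xi x v i a a', 0 <= s <= T ->
    `|H t s xi (x + v) i a a' - H t s xi x i a a'| <= C * vnorm1 v;
  cs_s0 : forall t s s' xi x i, 0 <= s' -> s' <= s -> s <= T ->
    `|U t s' xi x i 0 - U t s xi x i 0| <= C * (s - s');
  cs_s1 : forall t s s' xi x i a, 0 <= s' -> s' <= s -> s <= T ->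
    `|P t s' xi x i a - P t s xi x i a| <= C * (s - s');
  cs_s2 : forall t s s' xi x i a a', 0 <= s' -> s' <= s -> s <= T ->
    `|H t s' xi x i a a' - H t s xi x i a a'| <= C * Num.sqrt (s - s');
  cs_T : forall t xi x, 0 <= t <= T -> U t T xi x = psi t xi x;
  cs_eq : forall t s s' xi x i, 0 <= t -> t <= s' -> s' <= s -> s <= T ->
    `|U t s' xi x i 0 - U t s xi x i 0 - (s - s') * coord_rhs t s xi x i|
      <= C * ((s - s') * (Num.sqrt (s - s') + (s - s')));
  cs_rhs : forall t s xi x i, 0 <= t -> t <= s <= T -> `|coord_rhs t s xi x i| <= C;
  cs_rhs_inc : forall t s s' xi x x' i, 0 <= t -> t <= s <= T -> t <= s' <= T ->
    `|coord_rhs t s xi x i - coord_rhs t s' xi x' i| <= C * (Num.sqrt `|s - s'| + vnorm1 (x - x')) }.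

End Fields.

Hypothesis d0 : (0 < d)%N.
Hypothesis T0 : 0 < T.

(** Precomposition with it turns the point (xi, x) into (x, x). *)
Definition diag_map (l : state n) : state n := match l with inl a => inr a | inr a => inr a end.
Definition mk_state (xi x : 'cV[R]_n) : pt R (state n) :=
  fun l => match l with inl a => xi a 0 | inr a => x a 0 end.

Definition lim_b (s : R) (l : state n) (q : pt R (state n)) : R :=
  match l with inl _ => 0 | inr a => b (clamp T s) (x_of q) a 0 end.
Definition lim_sigma (s : R) (l : state n) (c : 'I_d) (q : pt R (state n)) : R :=
  match l with inl _ => 0 | inr a => sigma (clamp T s) (x_of q) a c end.
Definition lim_g (s t : R) (i : 'I_m) (p : pt R (args n m d)) : R :=
  g (clamp T (Num.min t s)) (clamp T s) (arg_xi p) (arg_x p) (arg_y p) (arg_z p) i 0.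
Definition lim_psi (t : R) (i : 'I_m) (q : pt R (state n)) : R :=
  psi (clamp T t) (xi_of q) (x_of q) i 0.

Lemma xi_of_mk xi x : xi_of (mk_state xi x) = xi.
Proof. by apply/colP => a; rewrite mxE. Qed.
Lemma x_of_mk xi x : x_of (mk_state xi x) = x.
Proof. by apply/colP => a; rewrite mxE. Qed.

Lemma data_limit : smooth_b T 4 b -> smooth_sigma T 4 sigma -> smooth_psi T 4 psi ->
  smooth_g T 4 g -> (exists2 L, 0 <= L & lip_data L lim_b lim_sigma lim_g) /\
  exists C Th Th1 Th2, limit_solution diag_map T lim_b lim_sigma lim_g lim_psi C Th Th1 Th2.
Proof.
move=> Hb Hs Hp Hg.
(* Components for xi are produced by the zero functional: xi has neither drift nor noise. *)
pose pb (l : state n) (w : 'cV[R]_n) : R := match l with inl _ => 0 | inr a => w a 0 end.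
pose ps (lc : state n * 'I_d) (w : 'M[R]_(n, d)) : R :=
  match lc.1 with inl _ => 0 | inr a => w a lc.2 end.
have pb1 l : functional1 (pb l).
  by case: l => a; [exact: functional1_zero | exact: functional1_coord].
have ps1 lc : functional1 (ps lc).
  by case: lc => [[a|a] c]; [exact: functional1_zero | exact: functional1_coord].
have [Lb [Lb0 [bN [b1 b2 b3]]]] := approx_strip T0 pb1 Hb.
have [Ls [Ls0 [sN [s1 s2 s3]]]] := approx_strip T0 ps1 Hs.
have [Lp [Lp0 [pN [p1 p2 p3]]]] := approx_psi T0 Hp.
have [Lg [Lg0 [gN [g1 g2 g3 g4]]]] := approx_g T0 Hg.
pose L := 1 + (Lb + Ls + Lp + Lg).
have lL (L' : R) : L' <= Lb + Ls + Lp + Lg -> L' <= L.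
  by move=> h; apply: le_trans h _; rewrite /L lerDr.
have lb : Lb <= L by apply: lL; rewrite -!addrA lerDl !addr_ge0.
have ls : Ls <= L by apply: lL; rewrite -!addrA addrCA lerDl !addr_ge0.
have lp : Lp <= L by apply: lL; rewrite -addrA addrCA lerDl !addr_ge0.
have lg : Lg <= L by apply: lL; rewrite addrC lerDl !addr_ge0.
have L1 : 1 <= L by rewrite /L lerDl !addr_ge0.
have ap : approx_data L bN (fun k s l c => sN k s (l, c)) gN pN lim_b lim_sigma lim_g lim_psi.
  split.
  - by move=> k s l; have [? h] := b1 k s l; split => //; exact: jet_le_weaken h.
  - by move=> k s l c; have [? h] := s1 k s (l, c); split => //; exact: jet_le_weaken h.
  - by move=> k s t i; have [? h] := g1 k s t i; split => //; exact: jet_le_weaken h.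
  - by move=> k t i; have [? h] := p1 k t i; split => //; exact: jet_le_weaken h.
  - by move=> k s s' l q; apply: le_trans (b2 _ _ _ _ _) _; rewrite ler_wpM2r.
  - by move=> k s s' l c q; apply: le_trans (s2 _ _ _ _ _) _; rewrite ler_wpM2r.
  - by move=> k s s' t i p; apply: le_trans (g2 _ _ _ _ _ _) _; rewrite ler_wpM2r.
  - by move=> k s t t' i p; apply: le_trans (g3 _ _ _ _ _ _) _; rewrite ler_wpM2r.
  - by move=> k t t' i q; apply: le_trans (p2 _ _ _ _ _) _; rewrite ler_wpM2r.
  - by move=> s l q; have := b3 s l q; case: l.
  - by move=> s l c q; have := s3 s (l, c) q; case: l.
  - exact: g4.
  - exact: p3.
split; first by exists L; [exact: le_trans L1 | exact: approx_lip_data ap].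
exact: (limit_exists diag_map (noise_card d0) (@noise_bound R d) (@noise_mean R d)
  (noise_cov R d0) L1 T0 ap).
Qed.

Lemma mk_state_add xi xi' x x' : mk_state (xi + xi') (x + x') = padd (mk_state xi x) (mk_state xi' x').
Proof. by apply/funext => -[a|a]; rewrite /padd /= mxE. Qed.

Lemma sum_mk_state xi x (F : state n -> R) :
  \sum_l mk_state xi x l * F l = \sum_a xi a 0 * F (inl a) + \sum_a x a 0 * F (inr a).
Proof. by rewrite big_sumType. Qed.

Lemma nrm1_mk xi x : nrm1 (mk_state xi x) = vnorm1 xi + vnorm1 x.
Proof. by rewrite /nrm1 big_sumType. Qed.

Lemma vnorm1_0 : vnorm1 (0 : 'cV[R]_n) = 0.
Proof. by rewrite /vnorm1 big1// => a _; rewrite mxE normr0. Qed.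

Lemma mk_x xi x v : mk_state xi (x + v) = padd (mk_state xi x) (mk_state 0 v).
Proof. by rewrite -mk_state_add addr0. Qed.

Lemma sum_mk_x v (F : state n -> R) : \sum_l mk_state 0 v l * F l = \sum_a v a 0 * F (inr a).
Proof. by rewrite sum_mk_state big1 ?add0r// => a _; rewrite mxE mul0r. Qed.

Lemma nrm1_x v : nrm1 (mk_state 0 v) = vnorm1 v.
Proof. by rewrite nrm1_mk vnorm1_0 add0r. Qed.

Lemma nrm1_mk_sub xi x x' :
  nrm1 (fun l => mk_state xi x l - mk_state xi x' l) = vnorm1 (x - x').
Proof.
rewrite -nrm1_x /nrm1; apply: eq_bigr => -[a|a] _ /=; rewrite !mxE ?subrr//.
Qed.

Section CoordFields.
Variables (Th : R -> R -> 'I_m -> pt R (state n) -> R)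
  (Th1 : R -> R -> 'I_m -> state n -> pt R (state n) -> R)
  (Th2 : R -> R -> 'I_m -> state n -> state n -> pt R (state n) -> R).
Let U t s xi x : 'cV[R]_m := \col_i Th t s i (mk_state xi x).
Let P t s xi x : 'M[R]_(m, n) := \matrix_(i, a) Th1 t s i (inr a) (mk_state xi x).
Let H t s xi x i : 'M[R]_n := \matrix_(a, a') Th2 t s i (inr a) (inr a') (mk_state xi x).

Lemma coord_rhsE t s xi x i : 0 <= t -> t <= s <= T ->
  limit_rhs diag_map lim_b lim_sigma lim_g Th Th1 Th2 t s i (mk_state xi x) = coord_rhs U P H t s xi x i.
Proof.
move=> t0 /andP[ts sT].
have ct : clamp T (Num.min t s) = t.
  by rewrite (min_idPl ts) clamp_id// t0 (le_trans ts).
have cs : clamp T s = s by rewrite clamp_id// sT (le_trans t0).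
rewrite /limit_rhs /coord_rhs; congr (_ + 2^-1 * _ + _).
- rewrite big_sumType /= big1 ?add0r => [|a _]; last by rewrite mul0r.
  by apply: eq_bigr => a _; rewrite cs x_of_mk mxE.
- rewrite big_sumType /= big1 ?add0r => [|a _]; last first.
    by rewrite big1// => l _; rewrite big1 ?mul0r// => c _; rewrite mul0r.
  apply: eq_bigr => a _; rewrite big_sumType /= big1 ?add0r => [|a' _]; last first.
    by rewrite big1 ?mul0r// => c _; rewrite mulr0.
  by apply: eq_bigr => a' _; rewrite cs x_of_mk [H _ _ _ _ _ _ _]mxE.
- rewrite /lim_g ct cs; congr (g _ _ _ _ _ _ _ _).
  + by apply/colP => a; rewrite mxE.
  + by apply/colP => a; rewrite mxE.
  + apply/colP => i'; rewrite !mxE /=; congr (Th _ _ _ _).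
    by apply/funext => -[a|a].
  + apply/matrixP => i' c; rewrite !mxE /= big_sumType /= big1 ?add0r => [|a _]; last by rewrite mul0r.
    by apply: eq_bigr => a _; rewrite cs x_of_mk mxE mulrC.
Qed.

End CoordFields.

Theorem coord_solution_exists : smooth_b T 4 b -> smooth_sigma T 4 sigma -> smooth_psi T 4 psi ->
  smooth_g T 4 g -> exists C U P H, coord_solution U P H C.
Proof.
move=> Hb Hs Hp Hg; have [[L L0 ld] [C [Th [Th1 [Th2 ls]]]]] := data_limit Hb Hs Hp Hg.
pose U t s xi x : 'cV[R]_m := \col_i Th t s i (mk_state xi x).
pose P t s xi x : 'M[R]_(m, n) := \matrix_(i, a) Th1 t s i (inr a) (mk_state xi x).
pose H t s xi x i : 'M[R]_n := \matrix_(a, a') Th2 t s i (inr a) (inr a') (mk_state xi x).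
have C0 := ls_C ls.
pose rhs := limit_rhs diag_map lim_b lim_sigma lim_g Th Th1 Th2.
(* The modulus of the right-hand side was obtained for each component separately; finitely many
   components have a common constant. *)
have [C' [C'0 HC']] : exists C', 0 <= C' /\ forall i : 'I_m,
    (forall t s s' q q', 0 <= s <= T -> 0 <= s' <= T -> `|rhs t s i q - rhs t s' i q'|
      <= C' * (Num.sqrt `|s - s'| + nrm1 (fun j => q j - q' j))) /\
    (forall t s q, 0 <= s <= T -> `|rhs t s i q| <= C').
  apply: unif_const => [i c c' cc [h1 h2]|i].
    split=> [*|*]; last by apply: le_trans cc; exact: h2.
    by apply: le_trans (h1 _ _ _ _ _ _ _) _ => //; rewrite ler_wpM2r// addr_ge0 ?sqrtr_ge0// nrm1_ge0.
  have [[c c0 h] [c' c'0 h']] := hreg_limit_rhs ld L0 ls i.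
  exists (c + c'); split; first exact: addr_ge0.
  split=> *; last by apply: le_trans (h' _ _ _ _) _ => //; rewrite lerDr.
  by apply: le_trans (h _ _ _ _ _ _ _) _ => //; rewrite ler_wpM2r ?lerDl// addr_ge0 ?sqrtr_ge0// nrm1_ge0.
exists (C + C'), U, P, H.
have CK : C <= C + C' by rewrite lerDl.
have CK' : C' <= C + C' by rewrite lerDr.
have tT (t s : R) : 0 <= t -> t <= s <= T -> 0 <= s <= T.
  by move=> t0 /andP[ts ->]; rewrite (le_trans t0).
split.
- exact: le_trans CK.
- by move=> t s xi x i sT; rewrite mxE; apply: le_trans CK; exact: (ls0 ls).
- by move=> t s xi x i a sT; rewrite mxE; apply: le_trans CK; exact: (ls1 ls).
- by move=> t s xi x i a a' sT; rewrite mxE; apply: le_trans CK; exact: (ls2 ls).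
- move=> t s xi x v i sT; have := ls_d0 ls t i (mk_state xi x) (mk_state 0 v) sT.
  rewrite sum_mk_x nrm1_x -mk_x !mxE => h.
  rewrite (eq_bigr (fun a => v a 0 * Th1 t s i (inr a) (mk_state xi x))) => [|a _]; last by rewrite mxE.
  by apply: le_trans h _; rewrite ler_wpM2r// exprn_ge0// sumr_ge0.
- move=> t s xi x v i a sT; have := ls_d1 ls t i (inr a) (mk_state xi x) (mk_state 0 v) sT.
  rewrite sum_mk_x nrm1_x -mk_x !mxE => h.
  rewrite (eq_bigr (fun a' => v a' 0 * Th2 t s i (inr a) (inr a') (mk_state xi x))) => [|a' _]; last by rewrite mxE.
  by apply: le_trans h _; rewrite ler_wpM2r// exprn_ge0// sumr_ge0.
- move=> t s xi x x' i sT; rewrite !mxE; apply: le_trans (Th_lip ls t i _ _ sT) _.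
  by rewrite nrm1_mk_sub ler_wpM2r// sumr_ge0.
- move=> t s xi x x' i a sT; rewrite !mxE; apply: le_trans (Th1_lip ls t i _ _ _ sT) _.
  by rewrite nrm1_mk_sub ler_wpM2r// sumr_ge0.
- move=> t s xi x v i a a' sT; have := ls_lip2 ls t i (inr a) (inr a') (mk_state xi x) (mk_state 0 v) sT.
  rewrite nrm1_x -mk_x !mxE => h.
  by apply: le_trans h _; rewrite ler_wpM2r// sumr_ge0.
- move=> t s s' xi x i s0 ss sT; rewrite !mxE; apply: le_trans (ls_s0 ls _ _ _ s0 ss sT) _.
  by rewrite ler_wpM2r// subr_ge0.
- move=> t s s' xi x i a s0 ss sT; rewrite !mxE; apply: le_trans (ls_s1 ls _ _ _ _ s0 ss sT) _.
  by rewrite ler_wpM2r// subr_ge0.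
- move=> t s s' xi x i a a' s0 ss sT; rewrite !mxE; apply: le_trans (ls_s2 ls _ _ _ _ _ s0 ss sT) _.
  by rewrite ler_wpM2r// sqrtr_ge0.
- move=> t xi x tT'; apply/colP => i; rewrite mxE (ls_T ls) /lim_psi xi_of_mk x_of_mk clamp_id//.
- move=> t s s' xi x i t0 ts ss sT; rewrite -coord_rhsE ?(le_trans ts)// !mxE.
  apply: le_trans (ls_eq ls _ _ _ (le_trans t0 ts) ss sT) _.
  have d0' : 0 <= s - s' by rewrite subr_ge0.
  by rewrite ler_wpM2r// mulr_ge0// addr_ge0 ?sqrtr_ge0.
- move=> t s xi x i t0 ts; rewrite -coord_rhsE//; apply: le_trans CK'.
  by case: (HC' i) => _; apply; exact: tT ts.
- move=> t s s' xi x x' i t0 ts ts'; rewrite -!coord_rhsE//.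
  case: (HC' i) => h _; apply: le_trans (h _ _ _ _ _ (tT _ _ t0 ts) (tT _ _ t0 ts')) _.
  by rewrite nrm1_mk_sub ler_wpM2r// addr_ge0 ?sqrtr_ge0// sumr_ge0.
Qed.

End CoordinateSolution.

(** * Hoelder norms *)

Lemma norm_le_coord (R : realType) (p q : nat) (M : 'M[R]_(p, q)) (c : R) : 0 <= c ->
  (forall i j, `|M i j| <= c) -> `|M| <= c.
Proof. by move=> c0 h; rewrite [`|M|]mx_normrE; apply: bigmax_le => // -[i j] _; exact: h. Qed.

Lemma enorm_ge0 (R : realType) (p q : nat) (A : 'M[R]_(p, q)) : 0 <= enorm A.
Proof. exact: sqrtr_ge0. Qed.

Lemma coord_le_enorm (R : realType) (p q : nat) (A : 'M[R]_(p, q)) i j : `|A i j| <= enorm A.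
Proof.
rewrite /enorm -sqrtr_sqr ler_wsqrtr//.
apply: le_trans (le_sum_term (a := fun i => \sum_j A i j ^+ 2) i _) => [|i'].
  by apply: (le_sum_term (a := fun j => A i j ^+ 2)) => j'; exact: sqr_ge0.
by apply: sumr_ge0 => j' _; exact: sqr_ge0.
Qed.

Lemma vnorm1_le_enorm (R : realType) (n : nat) (v : 'cV[R]_n) : vnorm1 v <= n%:R * enorm v.
Proof.
apply: (@le_trans _ _ (\sum_(a < n) enorm v)); first by apply: ler_sum => a _; exact: coord_le_enorm.
by rewrite sumr_const -[_ *+ #|_|]mulr_natl card_ord.
Qed.

Lemma vnorm1_le_norm (R : realType) (n : nat) (v : 'cV[R]_n) : vnorm1 v <= n%:R * `|v|.
Proof.
apply: (@le_trans _ _ (\sum_(a < n) `|v|)); first by apply: ler_sum => a _; exact: coord_le_norm.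
by rewrite sumr_const -[_ *+ #|_|]mulr_natl card_ord.
Qed.

Lemma enorm_le (R : realType) (p q : nat) (A : 'M[R]_(p, q)) (c : R) : 0 <= c ->
  (forall i j, `|A i j| <= c) -> enorm A <= c * (p * q)%:R.
Proof.
move=> c0 h; rewrite -[leRHS]ger0_norm ?mulr_ge0// -sqrtr_sqr ler_wsqrtr//.
apply: (@le_trans _ _ (\sum_(i < p) \sum_(j < q) c ^+ 2)).
  apply: ler_sum => i _; apply: ler_sum => j _.
  by rewrite -[A i j ^+ 2]real_normK ?num_real// lerXn2r ?nnegrE.
rewrite (eq_bigr (fun=> q%:R * c ^+ 2)) => [|i _]; last by rewrite sumr_const -[_ *+ #|_|]mulr_natl card_ord.
rewrite sumr_const -[_ *+ #|_|]mulr_natl card_ord mulrA -natrM.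
have -> : (c * (p * q)%:R) ^+ 2 = ((p * q) ^ 2)%:R * c ^+ 2 by rewrite natrX; ring.
by rewrite ler_wpM2r ?sqr_ge0// ler_nat expnS expn1; case: (p * q)%N => // k; rewrite leq_pmull.
Qed.

Lemma nnsup_le (R : realType) (A : set \bar R) (c : R) : 0 <= c ->
  (forall r, A r -> (r <= c%:E)%E) -> (nnsup A <= c%:E)%E.
Proof.
by move=> c0 h; apply: ge_ereal_sup => r [->|/h//]; rewrite lee_fin.
Qed.

Section Entries.
Variables (R : realType) (n p q : nat) (S T : R).
Implicit Types f : R -> 'cV[R]_n -> 'M[R]_(p, q).

Definition entry_bdd (C : R) f := forall s x i j, S <= s <= T -> `|f s x i j| <= C.
Definition entry_inc (C gam : R) f := forall s s' x i j, S <= s <= T -> S <= s' <= T ->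
  `|f s x i j - f s' x i j| <= C * `|s - s'| `^ gam.
Definition entry_lip (C : R) f := forall s x x' i j, S <= s <= T ->
  `|f s x i j - f s x' i j| <= C * vnorm1 (x - x').

Let N : R := (p * q)%:R.

Lemma norm_sup_le C f : 0 <= C -> entry_bdd C f -> (norm_sup S T f <= (C * N)%:E)%E.
Proof.
move=> C0 h; apply: nnsup_le; first exact: mulr_ge0.
move=> r [s [x [sT ->]]]; rewrite lee_fin; apply: enorm_le => // i j; apply: h.
by rewrite in_itv in sT.
Qed.

(** Passage to a smaller Hoelder exponent on an interval of length at most M. Below 1 powers
    decrease in the exponent; above 1 the larger power is at most x, hence at most M. *)
Lemma powR_le_powR (x a c M : R) : 0 <= x <= M -> 1 <= M -> 0 < a <= c -> c <= 1 ->
  x `^ c <= M * x `^ a.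
Proof.
move=> /andP[x0 xM] M1 /andP[a0 ac] c1.
have [->|xn] := eqVneq x 0; first by rewrite !powR0 ?mulr0 ?gt_eqF// (lt_le_trans a0).
have xp : 0 < x by rewrite lt_neqAle eq_sym xn.
have [x1|x1] := leP x 1.
  apply: (@le_trans _ _ (x `^ a)); first by rewrite ger_powR// xp x1.
  by rewrite ler_peMl// powR_ge0.
apply: (@le_trans _ _ x); first by rewrite -[leRHS]powRr1// ler_powR// ltW.
apply: (@le_trans _ _ M) => //; rewrite ler_peMr ?(le_trans ler01)//.
by rewrite -(powRr0 x) ler_powR// ltW.
Qed.

Lemma holder_s_le C M gam beta f : 0 <= C -> T - S <= M -> 1 <= M -> 0 < beta <= gam -> gam <= 1 ->
  entry_inc C gam f -> (holder_s S T f beta <= (M * C * N)%:E)%E.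
Proof.
move=> C0 TSM M1 bg g1 h; have M0 : 0 <= M by exact: le_trans M1.
apply: nnsup_le; first by rewrite !mulr_ge0.
move=> r [s [s' [x [sT sT' ss ->]]]]; rewrite lee_fin; rewrite !in_itv /= in sT sT'.
have d0 : 0 < `|s - s'| by rewrite normr_gt0 subr_eq0.
rewrite ler_pdivrMr ?powR_gt0//.
have -> : M * C * N * `|s - s'| `^ beta = M * C * `|s - s'| `^ beta * N by ring.
apply: enorm_le => [|i j]; first by rewrite !mulr_ge0 ?powR_ge0.
rewrite !mxE; apply: le_trans (h _ _ _ _ _ sT sT') _.
have -> : M * C * `|s - s'| `^ beta = C * (M * `|s - s'| `^ beta) by ring.
rewrite ler_wpM2l// powR_le_powR// normr_ge0 /=.
move: sT sT' => /andP[? ?] /andP[? ?]; apply: le_trans TSM.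
by rewrite ler_norml; apply/andP; split; lra.
Qed.

Lemma holder_x_le C alpha f : 0 <= C -> 0 < alpha <= 1 -> entry_lip C f ->
  (holder_x S T f alpha <= (n%:R * C * N)%:E)%E.
Proof.
move=> C0 /andP[a0 a1] h; apply: nnsup_le; first by rewrite !mulr_ge0.
move=> r [s [x [x' [sT /andP[d0 d1] ->]]]]; rewrite lee_fin; rewrite in_itv /= in sT.
rewrite ler_pdivrMr ?powR_gt0//.
have -> : n%:R * C * N * enorm (x - x') `^ alpha = n%:R * C * enorm (x - x') `^ alpha * N by ring.
apply: enorm_le => [|i j]; first by rewrite !mulr_ge0 ?powR_ge0.
rewrite !mxE; apply: le_trans (h _ _ _ _ _ sT) _.
have -> : n%:R * C * enorm (x - x') `^ alpha = C * (n%:R * enorm (x - x') `^ alpha) by ring.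
rewrite ler_wpM2l//; apply: le_trans (vnorm1_le_enorm _) _; rewrite ler_wpM2l//.
by rewrite ger1_powR// d0.
Qed.

Lemma entry_continuous C gam f : 0 <= C -> 0 < gam -> entry_inc C gam f -> entry_lip C f ->
  {within [set p : R * 'cV[R]_n | p.1 \in `[S, T]], continuous (fun p => f p.1 p.2)}.
Proof.
move=> C0 g0 hs hx; apply/subspace_continuousP => -[s x] sT; rewrite /= in_itv /= in sT.
apply/cvgrPdist_le => e e0; rewrite /within /=; apply/nbhs_ballP.
have C1 : 0 < C + 1 by rewrite ltr_wpDl.
pose e1 := e / 2 / (C + 1); have e10 : 0 < e1 by rewrite !divr_gt0.
have n1 : 0 < (n%:R + 1 : R) by rewrite ltr_wpDl.
pose dl := Num.min (e1 `^ gam^-1) (e1 / (n%:R + 1)).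
have dl0 : 0 < dl.
  by rewrite /dl lt_min; apply/andP; split; [exact: powR_gt0 | exact: divr_gt0].
exists dl => //= -[s' x']; rewrite -ball_normE /ball_ /= => hd; rewrite in_itv /= => sT'.
have hds : `|s - s'| <= e1 `^ gam^-1.
  apply: le_trans (norm_fst_le ((s, x) - (s', x') : R * 'cV[R]_n)) _; apply: ltW.
  by apply: lt_le_trans hd _; rewrite ge_min lexx.
have hdx : `|x - x'| <= e1 / (n%:R + 1).
  apply: le_trans (norm_snd_le ((s, x) - (s', x') : R * 'cV[R]_n)) _; apply: ltW.
  by apply: lt_le_trans hd _; rewrite ge_min lexx orbT.
have eE : e1 * (C + 1) = e / 2 by rewrite /e1 divfK ?gt_eqF.
apply: norm_le_coord => [|i j]; first exact: ltW.
rewrite !mxE; apply: le_trans (split_inc (hs s s' x i j sT sT') (hx s' x x' i j sT')) _.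
have h1 : `|s - s'| `^ gam <= e1.
  have <- : (e1 `^ gam^-1) `^ gam = e1 by rewrite -powRrM mulVf ?lt0r_neq0// powRr1// ltW.
  by apply: ge0_ler_powR => //; rewrite ?nnegrE ?powR_ge0// ltW.
have h2 : vnorm1 (x - x') <= e1.
  apply: le_trans (vnorm1_le_norm _) _.
  apply: (@le_trans _ _ ((n%:R + 1) * `|x - x'|)); first by rewrite ler_wpM2r// lerDl.
  by rewrite mulrC -ler_pdivlMr.
have k1 : C * `|s - s'| `^ gam <= C * e1 by rewrite ler_wpM2l.
have k2 : C * vnorm1 (x - x') <= C * e1 by rewrite ler_wpM2l.
by move: eE; rewrite mulrDr mulr1; lra.
Qed.

End Entries.

(** * Derivatives relative to a time interval *)

Section TimeDerivatives.
Variables (R : realType) (W : normedModType R) (S T : R).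

(** Properness makes the limit in [derive_in] unique. The witness lies to the right of s, except at
    the right end point. *)
Lemma punctured_proper (s : R) : S < T -> S <= s <= T -> ProperFilter (within `[S, T] s^').
Proof.
move=> ST /andP[Ss sT]; apply: Build_ProperFilter_ex => A /nbhs_ballP[e /= e0 He].
have [sT'|Ts] := ltP s T.
  exists (s + Num.min (e / 2) (T - s)); set dl := Num.min _ _.
  have dl0 : 0 < dl by rewrite lt_min divr_gt0//= subr_gt0.
  have dl1 : dl <= T - s by rewrite ge_min lexx orbT.
  have dl2 : dl <= e / 2 by rewrite ge_min lexx.
  apply: He.
  - by rewrite -ball_normE /= opprD addrA subrr sub0r normrN gtr0_norm//; lra.
  - by rewrite /= -subr_eq0 addrC addKr gt_eqF.
  - by rewrite /= in_itv /=; apply/andP; split; lra.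
exists (s - Num.min (e / 2) (s - S)); set dl := Num.min _ _.
have dl0 : 0 < dl by rewrite lt_min divr_gt0//= subr_gt0; lra.
have dl1 : dl <= s - S by rewrite ge_min lexx orbT.
have dl2 : dl <= e / 2 by rewrite ge_min lexx.
apply: He.
- by rewrite -ball_normE /= opprB addrCA subrr addr0 gtr0_norm//; lra.
- by rewrite /= -subr_eq0 addrAC subrr sub0r oppr_eq0 gt_eqF.
- by rewrite /= in_itv /=; apply/andP; split; lra.
Qed.

Lemma dquot_cvg (f : R -> W) (s : R) (df : W) (C : R) : 0 <= C ->
  (forall s', S <= s' <= T -> `|f s' - f s - (s' - s) *: df| <= C * (`|s' - s| * Num.sqrt `|s' - s|)) ->
  dquot f s @ within `[S, T] s^' --> df.
Proof.
move=> C0 h; apply/cvgrPdist_le => e e0; rewrite /within /dnbhs /within /=; apply/nbhs_ballP.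
have C1 : 0 < C + 1 by rewrite ltr_wpDl.
pose e1 := e / (C + 1); have e10 : 0 < e1 by rewrite divr_gt0.
exists (e1 ^+ 2) => /=; first exact: exprn_gt0.
move=> s'; rewrite -ball_normE /= => hd ss; rewrite in_itv /= => sT'.
have d0 : 0 < `|s' - s| by rewrite normr_gt0 subr_eq0.
have -> : df - dquot f s s' = - ((s' - s)^-1 *: (f s' - f s - (s' - s) *: df)).
  have c0 : s' - s != 0 by rewrite subr_eq0.
  by rewrite /dquot; move: (f s' - f s) => X; rewrite scalerBr scalerA mulVf// scale1r opprB.
rewrite normrN normrZ normfV ler_pdivrMl//; apply: le_trans (h _ sT') _.
rewrite mulrCA ler_wpM2l//.
have hs : Num.sqrt `|s' - s| <= e1.
  by rewrite -[leRHS](ger0_norm (ltW e10)) -(sqrtr_sqr e1) ler_wsqrtr// distrC ltW.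
apply: (@le_trans _ _ (C * e1)); first by rewrite ler_wpM2l.
rewrite /e1 mulrCA ger_pMr// ler_pdivrMr// mul1r; lra.
Qed.

End TimeDerivatives.

Lemma vnorm1_ge0 (R : realType) (n : nat) (v : 'cV[R]_n) : 0 <= vnorm1 v.
Proof. exact: sumr_ge0. Qed.

Lemma vnorm1_dir (R : realType) (n : nat) (h : R) (j : 'I_n) : vnorm1 (h *: dir R j) = `|h|.
Proof.
rewrite /vnorm1 (bigD1 j)//= big1 => [|a aj].
  by rewrite !mxE !eqxx mulr1 addr0.
by rewrite !mxE (negbTE aj) mulr0 normr0.
Qed.

Lemma sum_dir (R : realType) (n : nat) (h : R) (j : 'I_n) (F : 'I_n -> R) :
  \sum_a (h *: dir R j) a 0 * F a = h * F j.
Proof.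
rewrite (bigD1 j)//= big1 => [|a aj]; first by rewrite !mxE !eqxx mulr1 addr0.
by rewrite !mxE (negbTE aj) mulr0 mul0r.
Qed.

Lemma taylor_is_derive (R : realType) (n m : nat) (h : 'cV[R]_n -> 'cV[R]_m) x (p : 'I_m -> 'I_n -> R) (C : R) :
  0 <= C ->
  (forall v i, `|h (x + v) i 0 - h x i 0 - \sum_a v a 0 * p i a| <= C * vnorm1 v ^+ 2) ->
  forall j, is_derive x (dir R j) h (\col_i p i j).
Proof.
move=> C0 H j; apply/has_dderP => e e0; have C1 : 0 < C + 1 by rewrite ltr_wpDl.
exists (e / (C + 1)); first by rewrite divr_gt0.
move=> y hy; apply: norm_le_coord => [|i k]; first by rewrite mulr_ge0// ltW.
rewrite ord1 !mxE; have := H (y *: dir R j) i; rewrite sum_dir vnorm1_dir => h1.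
apply: le_trans h1 _.
rewrite expr2 mulrA ler_wpM2r//; apply: (@le_trans _ _ ((C + 1) * `|y|)).
  by rewrite ler_wpM2r// lerDl.
by rewrite mulrC -ler_pdivlMr// ltW.
Qed.

Lemma quadE (R : realType) (n m d : nat) (A : 'M[R]_(n, d)) (h : 'cV[R]_n -> 'cV[R]_m) x i :
  quad A h x i 0 = \sum_a \sum_a' (\sum_c A a c * A a' c) * hess h x i a' a.
Proof.
rewrite mxE; move: (hess h x i) => H.
rewrite (eq_bigr (fun l => \sum_a \sum_a' A a l * A a' l * H a' a)) => [|l _]; last first.
  rewrite mxE; apply: eq_bigr => a _; rewrite mxE mulr_suml.
  by apply: eq_bigr => a' _; rewrite !mxE; ring.
rewrite exchange_big /=; apply: eq_bigr => a _; rewrite exchange_big /=; apply: eq_bigr => a' _.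
by rewrite mulr_suml.
Qed.

(** * Slices given with Taylor bounds, and their Hoelder norms *)

Section Slices.
Variables (R : realType) (n m : nat) (S T : R).
Implicit Types (phi phis : R -> 'cV[R]_n -> 'cV[R]_m) (P : R -> 'cV[R]_n -> 'M[R]_(m, n))
  (H : R -> 'cV[R]_n -> 'I_m -> 'M[R]_n).

(* phis, P and H are the derivatives of phi in time, in space, and the second derivatives. *)
Record nice (C : R) phi phis P H : Prop := Nice {
  nc_C : 0 <= C;
  nc_phi : entry_bdd S T C phi;
  nc_phis : entry_bdd S T C phis;
  nc_P : entry_bdd S T C P;
  nc_H : forall i, entry_bdd S T C (fun s x => H s x i);
  nc_phi_s : entry_inc S T C 1 phi;
  nc_phi_x : entry_lip S T C phi;
  nc_phis_s : entry_inc S T C 2^-1 phis;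
  nc_phis_x : entry_lip S T C phis;
  nc_P_s : entry_inc S T C 1 P;
  nc_P_x : entry_lip S T C P;
  nc_H_s : forall i, entry_inc S T C 2^-1 (fun s x => H s x i);
  nc_H_x : forall i, entry_lip S T C (fun s x => H s x i);
  nc_d0 : forall s x v i, S <= s <= T ->
    `|phi s (x + v) i 0 - phi s x i 0 - \sum_a v a 0 * P s x i a| <= C * vnorm1 v ^+ 2;
  nc_d1 : forall s x v i a, S <= s <= T ->
    `|P s (x + v) i a - P s x i a - \sum_a' v a' 0 * H s x i a a'| <= C * vnorm1 v ^+ 2;
  nc_t : forall s s' x i, S <= s <= T -> S <= s' <= T ->
    `|phi s' x i 0 - phi s x i 0 - (s' - s) * phis s x i 0| <= C * (`|s' - s| * Num.sqrt `|s' - s|) }.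

Section Consequences.
Variables (C : R) (phi phis : R -> 'cV[R]_n -> 'cV[R]_m) (P : R -> 'cV[R]_n -> 'M[R]_(m, n))
  (H : R -> 'cV[R]_n -> 'I_m -> 'M[R]_n).
Hypothesis nc : nice C phi phis P H.

Lemma nice_is_derive s x j : S <= s <= T -> is_derive x (dir R j) (phi s) (col j (P s x)).
Proof.
move=> sT; have := taylor_is_derive (nc_C nc) (fun v i => nc_d0 nc x v i sT) j.
by have -> : \col_i P s x i j = col j (P s x) by apply/colP => i; rewrite !mxE.
Qed.

Lemma nice_Dx s x l : S <= s <= T -> 'D_(dir R l) (phi s) x = col l (P s x).
Proof. by move=> sT; have h := nice_is_derive x l sT; exact: derive_val. Qed.

Lemma nice_D s l : S <= s <= T -> 'D_(dir R l) (phi s) = fun x => col l (P s x).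
Proof. by move=> sT; apply/funext => x; exact: nice_Dx. Qed.

Lemma nice_is_derive2 s x j l : S <= s <= T ->
  is_derive x (dir R j) ('D_(dir R l) (phi s)) (\col_i H s x i l j).
Proof.
move=> sT; rewrite (nice_D l sT).
apply: (@taylor_is_derive R n m (fun x => col l (P s x)) x (fun i a' => H s x i l a') C (nc_C nc)).
by move=> v i; rewrite !mxE; exact: (nc_d1 nc).
Qed.

Lemma nice_fx s x : S <= s <= T -> fx phi s x = P s x.
Proof. by move=> sT; apply/matrixP => i j; rewrite /fx /jac mxE nice_Dx// mxE. Qed.

Lemma nice_hess s x i : S <= s <= T -> hess (phi s) x i = (H s x i)^T.
Proof.
move=> sT; apply/matrixP => j l; rewrite !mxE.
by have h := nice_is_derive2 x j l sT; rewrite derive_val mxE.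
Qed.

Lemma nice_fxx i k : exists a a', forall r y, S <= r <= T -> fxx phi r y i k = H r y i a a'.
Proof.
case: (mxvec_indexP k) => j l; exists l, j => r y rT.
by rewrite /fxx /d2 mxE mxvecE nice_hess// mxE.
Qed.

Lemma nice_quad d (A : 'M[R]_(n, d)) s x i : S <= s <= T ->
  quad A (phi s) x i 0 = \sum_a \sum_a' (\sum_c A a c * A a' c) * H s x i a a'.
Proof.
move=> sT; rewrite quadE; apply: eq_bigr => a _; apply: eq_bigr => a' _.
by rewrite nice_hess// mxE.
Qed.

Lemma nice_dquot s x : S <= s <= T -> dquot (phi^~ x) s @ within `[S, T] s^' --> phis s x.
Proof.
move=> sT; apply: (dquot_cvg (nc_C nc)) => s' sT'; apply: norm_le_coord => [|i k].
  by rewrite !mulr_ge0 ?(nc_C nc)// sqrtr_ge0.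
by rewrite ord1 !mxE; exact: (nc_t nc).
Qed.

(** The slice t = T belongs to the supremum in the theorem. There the interval is a point and the
    derivative is 0 by convention, although [phis] need not vanish. *)
Lemma nice_fs s x : S <= s <= T -> fs S T phi s x = if S < T then phis s x else 0.
Proof.
move=> sT; rewrite /fs /derive_in; case: ifPn => // ST.
have PF := punctured_proper ST sT.
apply: (@cvg_lim _ _ _ _ PF); [exact: norm_hausdorff | exact: nice_dquot].
Qed.

Lemma nice_has_derivatives : has_derivatives S T phi.
Proof.
move=> s x; rewrite in_itv /= => sT; split.
  by apply/cvg_ex; exists (phis s x); exact: nice_dquot.
split=> [j|j l].
  by have h := nice_is_derive x j sT; exact: ex_derive.
by have h := nice_is_derive2 x j l sT; exact: ex_derive.
Qed.

Lemma nice_fs_bdd : [/\ entry_bdd S T C (fs S T phi), entry_inc S T C 2^-1 (fs S T phi)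
  & entry_lip S T C (fs S T phi)].
Proof.
have C0 := nc_C nc; split.
- move=> s x i j sT; rewrite nice_fs//; case: ifP => _; first exact: (nc_phis nc).
  by rewrite mxE normr0.
- move=> s s' x i j sT sT'; rewrite !nice_fs//; case: ifP => _; first exact: (nc_phis_s nc).
  by rewrite subrr normr0 mulr_ge0// powR_ge0.
- move=> s x x' i j sT; rewrite !nice_fs//; case: ifP => _; first exact: (nc_phis_x nc).
  by rewrite subrr normr0 mulr_ge0// vnorm1_ge0.
Qed.

Lemma nice_fxx_bdd : [/\ entry_bdd S T C (fxx phi), entry_inc S T C 2^-1 (fxx phi)
  & entry_lip S T C (fxx phi)].
Proof.
have := nice_fxx; move: (fxx phi) => F HF; split.
- by move=> s x i j sT; have [a [a' ->//]] := HF i j; exact: (nc_H nc).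
- move=> s s' x i j sT sT'; have [a [a' h]] := HF i j; rewrite (h s x sT) (h s' x sT').
  exact: (nc_H_s nc).
- move=> s x x' i j sT; have [a [a' h]] := HF i j; rewrite (h s x sT) (h s x' sT).
  exact: (nc_H_x nc).
Qed.

Lemma nice_fx_bdd : [/\ entry_bdd S T C (fx phi), entry_inc S T C 1 (fx phi)
  & entry_lip S T C (fx phi)].
Proof.
split.
- by move=> s x i j sT; rewrite nice_fx//; exact: (nc_P nc).
- by move=> s s' x i j sT sT'; rewrite !nice_fx//; exact: (nc_P_s nc).
- by move=> s x x' i j sT; rewrite !nice_fx//; exact: (nc_P_x nc).
Qed.

Lemma nice_continuous : let D := [set p : R * 'cV[R]_n | p.1 \in `[S, T]] in
  [/\ {within D, continuous (fun p => phi p.1 p.2)},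
      {within D, continuous (fun p => fs S T phi p.1 p.2)},
      {within D, continuous (fun p => fx phi p.1 p.2)} &
      {within D, continuous (fun p => fxx phi p.1 p.2)}].
Proof.
have C0 := nc_C nc; have [_ s1 s2] := nice_fs_bdd; have [_ x1 x2] := nice_fx_bdd.
have [_ h1 h2] := nice_fxx_bdd; have half : 0 < 2^-1 :> R by rewrite invr_gt0.
split.
- exact: (entry_continuous C0 ltr01 (nc_phi_s nc) (nc_phi_x nc)).
- exact: (entry_continuous C0 half s1 s2).
- exact: (entry_continuous C0 ltr01 x1 x2).
- exact: (entry_continuous C0 half h1 h2).
Qed.

(** [norm_2holder] consists of 9 seminorms. The last factor dominates the numbers of entries of the
    function, its gradient and its Hessians; M comes from lowering exponents in time, and n from
    comparing the l1 norm with the Euclidean one. *)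
Definition norm_factor (M : R) : R := 9 * ((M + n%:R) * (m * (n * n).+1)%:R).

Lemma nice_norm M alpha : 1 <= M -> T - S <= M -> 0 < alpha < 1 ->
  (norm_2holder S T phi alpha <= (norm_factor M * C)%:E)%E.
Proof.
move=> M1 TSM /andP[a0 a1]; have C0 := nc_C nc.
pose N : R := (m * (n * n).+1)%:R; pose K : R := (M + n%:R) * N.
have N0 : 0 <= N by exact: ler0n.
have M0 : 0 <= M by exact: le_trans M1.
have n0 : 0 <= n%:R :> R by exact: ler0n.
have KC : 0 <= K * C by rewrite !mulr_ge0// addr_ge0.
have dim q : (q <= (n * n).+1)%N -> (m * q)%:R <= N :> R.
  by move=> h; rewrite ler_nat leq_mul2l h orbT.
have d1 : (m * 1)%:R <= N by exact: dim.
have dn : (m * n)%:R <= N.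
  by apply: dim; case: (n) => // k; rewrite leqW// leq_pmull.
have dnn : (m * (n * n))%:R <= N by apply: dim.
have b1 (x y : R) : 0 <= x -> x <= N -> y <= M + n%:R -> y * C * x <= K * C.
  move=> x0 xN yM; rewrite /K.
  have -> : (M + n%:R) * N * C = (M + n%:R) * C * N by ring.
  apply: (@le_trans _ _ ((M + n%:R) * C * x)); first by rewrite ler_wpM2r// ler_wpM2r.
  by rewrite ler_wpM2l// mulr_ge0// addr_ge0.
have M1' : 1 <= M + n%:R by rewrite (le_trans M1)// lerDl.
have MM : M <= M + n%:R by rewrite lerDl.
have nM : n%:R <= M + n%:R by rewrite lerDr.
have nsup q (f : R -> 'cV[R]_n -> 'M[R]_(m, q)) : (m * q)%:R <= N -> entry_bdd S T C f ->
    (norm_sup S T f <= (K * C)%:E)%E.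
  move=> qN hf; apply: le_trans (norm_sup_le C0 hf) _; rewrite lee_fin.
  by rewrite -[C * _]mul1r mulrA; apply: b1.
have hs q (f : R -> 'cV[R]_n -> 'M[R]_(m, q)) gam beta : (m * q)%:R <= N ->
    0 < beta <= gam -> gam <= 1 -> entry_inc S T C gam f -> (holder_s S T f beta <= (K * C)%:E)%E.
  move=> qN bg g1 hf; apply: le_trans (holder_s_le C0 TSM M1 bg g1 hf) _; rewrite lee_fin.
  by apply: b1.
have hx q (f : R -> 'cV[R]_n -> 'M[R]_(m, q)) : (m * q)%:R <= N -> entry_lip S T C f ->
    (holder_x S T f alpha <= (K * C)%:E)%E.
  move=> qN hf; have a01 : 0 < alpha <= 1 by rewrite a0 ltW.
  by apply: le_trans (holder_x_le C0 a01 hf) _; rewrite lee_fin; apply: b1.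
have [s0 s1 s2] := nice_fs_bdd; have [x0 x1 _] := nice_fx_bdd; have [h0 h1 h2] := nice_fxx_bdd.
have half : 0 < alpha / 2 <= 2^-1 by apply/andP; split; lra.
have half1 : 2^-1 <= 1 :> R by lra.
have aa : 0 < (1 + alpha) / 2 <= 1 by apply/andP; split; lra.
have -> : (norm_factor M * C)%:E =
   ((K * C)%:E + (K * C)%:E + (K * C)%:E + (K * C)%:E + ((K * C)%:E + (K * C)%:E)
    + ((K * C)%:E + (K * C)%:E) + (K * C)%:E)%E.
  by rewrite -!EFinD; congr EFin; rewrite /norm_factor -/N -/K; ring.
rewrite /norm_2holder /norm_2 /norm_1 /holder.
repeat apply: leeD.
- by apply: nsup => //; exact: (nc_phi nc).
- exact: nsup.
- exact: nsup.
- exact: nsup.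
- exact: hs half half1 s1.
- exact: hx.
- exact: hs half half1 h1.
- exact: hx.
- exact: hs aa (lexx _) x1.
Qed.

Lemma nice_ext phi' : (forall s x, S <= s <= T -> phi' s x = phi s x) -> nice C phi' phis P H.
Proof.
move=> e; case: nc => *; split => //.
- by move=> s x i j sT; rewrite e//; auto.
- by move=> s s' x i j sT sT'; rewrite !e//; auto.
- by move=> s x x' i j sT; rewrite !e//; auto.
- by move=> s x v i sT; rewrite !e//; auto.
- by move=> s s' x i sT sT'; rewrite !e//; auto.
Qed.

End Consequences.

Lemma nice_zero : nice 0 (fun _ _ => 0) (fun _ _ => 0) (fun _ _ => 0) (fun _ _ _ => 0).
Proof.
split => //; rewrite /entry_bdd /entry_inc /entry_lip;
  try by move=> *; rewrite ?subrr ?mxE normr0 ?mul0r.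
- by move=> *; rewrite !mxE subrr sub0r normrN big1 ?normr0 ?mul0r// => a _; rewrite /= ?mxE mulr0.
- by move=> *; rewrite !mxE subrr sub0r normrN big1 ?normr0 ?mul0r// => a _; rewrite /= ?mxE mulr0.
- by move=> *; rewrite !mxE subrr mulr0 subrr normr0 mul0r.
Qed.

Lemma nice_sub C C' phi phis P H phi' phis' P' H' : nice C phi phis P H -> nice C' phi' phis' P' H' ->
  nice (C + C') (fun s x => phi s x - phi' s x) (fun s x => phis s x - phis' s x)
    (fun s x => P s x - P' s x) (fun s x i => H s x i - H' s x i).
Proof.
move=> h h'.
have nb (x y a c : R) : `|x| <= a -> `|y| <= c -> `|x - y| <= a + c.
  by move=> h1 h2; apply: le_trans (ler_normB _ _) _; exact: lerD.
have sB (F G : 'I_n -> R) (v : 'cV[R]_n) : \sum_a v a 0 * (F a - G a) =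
    \sum_a v a 0 * F a - \sum_a v a 0 * G a.
  by rewrite -sumrB; apply: eq_bigr => a _; rewrite mulrBr.
have bd p q (f g : R -> 'cV[R]_n -> 'M[R]_(p, q)) : entry_bdd S T C f -> entry_bdd S T C' g ->
    entry_bdd S T (C + C') (fun s x => f s x - g s x).
  by move=> k k' s x i j sT; rewrite !mxE; apply: nb; [exact: k | exact: k'].
have ic p q gam (f g : R -> 'cV[R]_n -> 'M[R]_(p, q)) : entry_inc S T C gam f -> entry_inc S T C' gam g ->
    entry_inc S T (C + C') gam (fun s x => f s x - g s x).
  move=> k k' s s' x i j sT sT'; rewrite !mxE mulrDl.
  have -> : f s x i j - g s x i j - (f s' x i j - g s' x i j) =
    (f s x i j - f s' x i j) - (g s x i j - g s' x i j) by ring.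
  by apply: nb; [exact: k | exact: k'].
have lp p q (f g : R -> 'cV[R]_n -> 'M[R]_(p, q)) : entry_lip S T C f -> entry_lip S T C' g ->
    entry_lip S T (C + C') (fun s x => f s x - g s x).
  move=> k k' s x x' i j sT; rewrite !mxE mulrDl.
  have -> : f s x i j - g s x i j - (f s x' i j - g s x' i j) =
    (f s x i j - f s x' i j) - (g s x i j - g s x' i j) by ring.
  by apply: nb; [exact: k | exact: k'].
case: h => a0 a1 a2 a3 a4 a5 a6 a7 a8 a9 a10 a11 a12 a13 a14 a15.
case: h' => b0 b1 b2 b3 b4 b5 b6 b7 b8 b9 b10 b11 b12 b13 b14 b15.
split; [exact: addr_ge0 | exact: bd | exact: bd | exact: bd | by move=> i; apply: bd | exact: ic | exact: lp
  | exact: ic | exact: lp | exact: ic | exact: lp | by move=> i; apply: ic | by move=> i; apply: lp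
  | move=> s x v i sT | move=> s x v i a sT | move=> s s' x i sT sT'].
- rewrite !mxE (eq_bigr (fun a => v a 0 * (P s x i a - P' s x i a))) => [|a _]; last by rewrite /= !mxE.
  rewrite sB mulrDl; have := nb _ _ _ _ (a13 s x v i sT) (b13 s x v i sT).
  by rewrite (_ : forall x y z t u w : R, x - y - z - (t - u - w) = x - t - (y - u) - (z - w)) => // *; ring.
- rewrite !mxE (eq_bigr (fun a' => v a' 0 * (H s x i a a' - H' s x i a a'))) => [|a' _]; last by rewrite /= !mxE.
  rewrite sB mulrDl; have := nb _ _ _ _ (a14 s x v i a sT) (b14 s x v i a sT).
  by rewrite (_ : forall x y z t u w : R, x - y - z - (t - u - w) = x - t - (y - u) - (z - w)) => // *; ring.
- rewrite !mxE [leRHS]mulrDl.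
  have := nb _ _ _ _ (a15 s s' x i sT sT') (b15 s s' x i sT sT').
  set X := (X in `|X| <= _) => h; set Y := (X in `|X| <= _).
  by have -> : Y = X by rewrite /X /Y; ring.
Qed.

End Slices.

(** * Existence *)

Section Existence.
Variables (R : realType) (n m d : nat) (T : R).
Variables (b : R -> 'cV[R]_n -> 'cV[R]_n) (sigma : R -> 'cV[R]_n -> 'M[R]_(n, d)).
Variables (psi : R -> 'cV[R]_n -> 'cV[R]_n -> 'cV[R]_m)
  (g : R -> R -> 'cV[R]_n -> 'cV[R]_n -> 'cV[R]_m -> 'M[R]_(m, d) -> 'cV[R]_m).
Implicit Types Theta : R -> R -> 'cV[R]_n -> 'cV[R]_n -> 'cV[R]_m.

Definition nice_family (K : R) Theta : Prop := forall t xi, 0 <= t <= T ->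
  exists phis P H, nice t T K (slice Theta t xi) phis P H.

Lemma nice_family_regular alpha K Theta : 0 < T -> 0 < alpha < 1 -> nice_family K Theta ->
  forall t xi, 0 <= t <= T ->
  C2holder t T (slice Theta t xi) alpha /\
  (norm_2holder t T (slice Theta t xi) alpha <= (norm_factor n m (1 + T) * K)%:E)%E.
Proof.
move=> T0 al nf t xi tT; have [phis [P [H nc]]] := nf t xi tT.
have /andP[t0 _] := tT.
have bd : (norm_2holder t T (slice Theta t xi) alpha <= (norm_factor n m (1 + T) * K)%:E)%E.
  by apply: (nice_norm nc) => //; lra.
split=> //; split; first exact: nice_has_derivatives nc.
by apply: le_lt_trans bd _; rewrite ltry.
Qed.

Section FromCoordinates.
Variables (C : R) (U : R -> R -> 'cV[R]_n -> 'cV[R]_n -> 'cV[R]_m)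
  (P : R -> R -> 'cV[R]_n -> 'cV[R]_n -> 'M[R]_(m, n))
  (H : R -> R -> 'cV[R]_n -> 'cV[R]_n -> 'I_m -> 'M[R]_n).
Hypothesis cs : coord_solution T b sigma psi g U P H C.
Hypothesis T0 : 0 < T.

Let rhs := coord_rhs b sigma g U P H.
Let phis t xi s x : 'cV[R]_m := \col_i - rhs t s xi x i.
(** The part [1 + Num.sqrt T] turns the error r (sqrt r + r) into a multiple of r sqrt r for r <= T.
    The remaining 1 pays for evaluating the right-hand side at the other end of the time step. *)
Let K : R := C * (2 + Num.sqrt T).

Lemma coord_nice t xi : 0 <= t <= T -> nice t T K (slice U t xi) (phis t xi)
  (fun s x => P t s xi x) (fun s x i => H t s xi x i).
Proof.
move=> /andP[t0 tT]; have C0 := cs_C cs; have sT0 := sqrtr_ge0 T.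
have CK : C <= K by rewrite /K ler_peMr//; lra.
have dom s : t <= s <= T -> 0 <= s <= T by move=> /andP[ts ->]; rewrite (le_trans t0).
have up (x y : R) : 0 <= y -> x <= C * y -> x <= K * y.
  by move=> y0 h; apply: le_trans h _; rewrite ler_wpM2r.
have sym (f : R -> R) (w : R -> R) : (forall s s', 0 <= s' -> s' <= s -> s <= T -> `|f s' - f s| <= w (s - s')) ->
    forall s s', t <= s <= T -> t <= s' <= T -> `|f s - f s'| <= w `|s - s'|.
  by move=> h s s' hs hs'; apply: (time_sym h); exact: dom.
split.
- exact: le_trans CK.
- by move=> s x i j sT; rewrite ord1; apply: le_trans CK; exact: (cs0 cs _ _ _ _ (dom _ sT)).
- by move=> s x i j sT; rewrite ord1 mxE normrN; apply: le_trans CK; exact: (cs_rhs cs).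
- by move=> s x i j sT; apply: le_trans CK; exact: (cs1 cs _ _ _ _ _ (dom _ sT)).
- by move=> i s x j l sT; apply: le_trans CK; exact: (cs2 cs _ _ _ _ _ _ (dom _ sT)).
- move=> s s' x i j sT sT'; rewrite ord1 powRr1//; apply: up => //.
  by apply: (sym (fun s => U t s xi x i 0) (fun z => C * z)) => // r r' *; exact: (cs_s0 cs).
- by move=> s x x' i j sT; rewrite ord1; apply: up; [exact: vnorm1_ge0 | exact: (cs_lip0 cs _ _ _ _ _ (dom _ sT))].
- move=> s s' x i j sT sT'; rewrite ord1 !mxE powR12_sqrt//; apply: up; first exact: sqrtr_ge0.
  rewrite opprK addrC; have := cs_rhs_inc cs xi x x i t0 sT' sT.
  by rewrite subrr vnorm1_0 addr0 (distrC s' s).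
- move=> s x x' i j sT; rewrite ord1 !mxE; apply: up; first exact: vnorm1_ge0.
  rewrite opprK addrC distrC; have := cs_rhs_inc cs xi x x' i t0 sT sT.
  by rewrite subrr normr0 sqrtr0 add0r.
- move=> s s' x i j sT sT'; rewrite powRr1//; apply: up => //.
  by apply: (sym (fun s => P t s xi x i j) (fun z => C * z)) => // r r' *; exact: (cs_s1 cs).
- by move=> s x x' i j sT; apply: up; [exact: vnorm1_ge0 | exact: (cs_lip1 cs _ _ _ _ _ _ (dom _ sT))].
- move=> i s s' x j l sT sT'; rewrite powR12_sqrt//; apply: up; first exact: sqrtr_ge0.
  by apply: (sym (fun s => H t s xi x i j l) (fun z => C * Num.sqrt z)) => // r r' *; exact: (cs_s2 cs).
- move=> i s x x' j l sT; apply: up; first exact: vnorm1_ge0.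
  by have := cs_lip2 cs t xi x' (x - x') i j l (dom _ sT); rewrite (addrC x') subrK.
- move=> s x v i sT; apply: up; first by rewrite exprn_ge0// vnorm1_ge0.
  exact: (cs_d0 cs _ _ _ _ _ (dom _ sT)).
- move=> s x v i a sT; apply: up; first by rewrite exprn_ge0// vnorm1_ge0.
  exact: (cs_d1 cs _ _ _ _ _ _ (dom _ sT)).
- move=> s s' x i sT sT'.
  have err (r : R) : 0 <= r -> r <= T -> C * (r * (Num.sqrt r + r)) <= C * (1 + Num.sqrt T) * (r * Num.sqrt r).
    move=> r0 rT; have -> : C * (1 + Num.sqrt T) * (r * Num.sqrt r) =
      C * (r * (Num.sqrt r + Num.sqrt T * Num.sqrt r)) by ring.
    rewrite ler_wpM2l// ler_wpM2l// lerD2l -{1}(sqr_sqrtr r0) expr2.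
    by rewrite ler_wpM2r ?sqrtr_ge0// ler_wsqrtr.
  have /andP[ts sT2] := sT; have /andP[ts' sT2'] := sT'.
  (* The expansion of [cs_eq] starts at the later time. If s' is the later one, the expansion is
     made at s' and its right-hand side is then moved back to s. *)
  rewrite mxE; have [ss|/ltW ss] := leP s' s.
    have r0 : 0 <= s - s' by rewrite subr_ge0.
    have h := cs_eq cs xi x i t0 ts' ss sT2.
    have -> : `|s' - s| = s - s' by rewrite distrC ger0_norm.
    have -> : (s' - s) * - rhs t s xi x i = (s - s') * rhs t s xi x i by ring.
    apply: le_trans h _; apply: le_trans (err _ r0 _) _; first lra.
    by rewrite ler_wpM2r ?mulr_ge0 ?sqrtr_ge0// /K ler_wpM2l//; lra.
  have r0 : 0 <= s' - s by rewrite subr_ge0.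
  have h := cs_eq cs xi x i t0 ts ss sT2'.
  have k := cs_rhs_inc cs xi x x i t0 sT' sT; rewrite subrr vnorm1_0 addr0 in k.
  rewrite (ger0_norm r0) in k *.
  have -> : slice U t xi s' x i 0 - slice U t xi s x i 0 - (s' - s) * - rhs t s xi x i =
    - ((U t s xi x i 0 - U t s' xi x i 0 - (s' - s) * rhs t s' xi x i)
      + (s' - s) * (rhs t s' xi x i - rhs t s xi x i)) by rewrite /slice; ring.
  rewrite normrN; apply: le_trans (ler_normD _ _) _.
  have h' := le_trans h (err _ r0 (_ : s' - s <= T)).
  have k' : `|(s' - s) * (rhs t s' xi x i - rhs t s xi x i)| <= C * ((s' - s) * Num.sqrt (s' - s)).
    by rewrite normrM (ger0_norm r0) mulrCA ler_wpM2l.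
  apply: le_trans (lerD (h' _) k') _; first lra.
  by rewrite /K le_eqVlt; apply/orP; left; apply/eqP; ring.
Qed.

Lemma coord_classical : classical_solution T b sigma psi g U.
Proof.
split.
- move=> t xi; rewrite in_itv /= => tT; have nc := coord_nice xi tT.
  have := nice_continuous nc; cbv zeta; case=> c1 c2 c3 c4.
  by split; [exact: nice_has_derivatives nc | exact: c1 | exact: c2 | exact: c3 | exact: c4].
- move=> t s xi x [/= t0 ts sT] tT.
  have tT' : 0 <= t <= T by rewrite t0 ltW.
  have sI : t <= s <= T by rewrite ts.
  have nc := coord_nice xi tT'.
  apply/colP => i; rewrite (nice_fs nc)// tT /along (nice_fx nc)//.
  have mE (u v w y : 'cV[R]_m) : (u + 2^-1 *: v + w + y) i 0 = u i 0 + 2^-1 * v i 0 + w i 0 + y i 0.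
    by rewrite !mxE.
  rewrite mE (nice_quad nc)// /phis [X in X + _ + _ + _]mxE [X in _ + X + _]mxE [RHS]mxE.
  rewrite /rhs /coord_rhs (eq_bigr (fun a => P t s xi x i a * b s x a 0)) => [|a _]; last by rewrite mulrC.
  by ring.
- by move=> t xi x; rewrite in_itv /=; exact: (cs_T cs).
Qed.

Lemma coord_nice_family : nice_family K U.
Proof. by move=> t xi tT; do 3!eexists; exact: coord_nice. Qed.

End FromCoordinates.

Hypothesis d0 : (0 < d)%N.
Hypothesis T0 : 0 < T.

Theorem nice_solution_exists : smooth_b T 4 b -> smooth_sigma T 4 sigma -> smooth_psi T 4 psi ->
  smooth_g T 4 g -> exists2 Theta, classical_solution T b sigma psi g Theta & exists K, nice_family K Theta.
Proof.
move=> Hb Hs Hp Hg; have [C [U [P [H cs]]]] := coord_solution_exists d0 T0 Hb Hs Hp Hg.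
by exists U; [exact: coord_classical cs | eexists; exact: coord_nice_family cs].
Qed.

End Existence.

(** * Comparison *)

Section Comparison.
Variables (R : realType) (I A D G : finType) (eps : G -> D -> R) (E L : R).
Hypothesis G0 : (0 < #|G|)%N.
Hypothesis epsE : forall g j, `|eps g j| <= E.
Hypothesis eps0 : forall j, avg (eps^~ j) = 0.
Hypothesis epscov : forall j k, avg (fun g => eps g j * eps g k) = (j == k)%:R.
Hypothesis L1 : 1 <= L.

Let L0 : 0 <= L. Proof. by apply: le_trans L1. Qed.
Let nI : R := #|I|%:R.
Let nD : R := #|D|%:R.
Let nA : R := #|A|%:R.
Let nD0 : 0 <= nD. Proof. exact: ler0n. Qed.
Let cl : R := nI * (L + nD * (L * `|E|)).
Let cl0 : 0 <= cl. Proof. by rewrite mulr_ge0// addr_ge0// mulr_ge0// mulr_ge0. Qed.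

Section OneStep.
Variables (r M : R) (bq : I -> R) (sq : I -> D -> R) (q : pt R I).
Hypothesis r01 : 0 < r <= 1.
Hypothesis bL : forall l, `|bq l| <= L.
Hypothesis sL : forall l k, `|sq l k| <= L.
Hypothesis M0 : 0 <= M.

Let r_gt0 : 0 < r. Proof. by case/andP: r01. Qed.
Let r0 : 0 <= r. Proof. exact: ltW. Qed.
Let rr : 0 <= r ^+ 2. Proof. exact: sqr_ge0. Qed.
Let r2r : r ^+ 2 <= r. Proof. by rewrite expr2 ler_piMr//; case/andP: r01. Qed.

Definition incr g : pt R I := fun l => r ^+ 2 * bq l + r * (\sum_k sq l k * eps g k).

Lemma incr_le g : nrm1 (incr g) <= cl * r.
Proof.
have -> : cl * r = nI * ((L + nD * (L * `|E|)) * r) by rewrite /cl; ring.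
rewrite /nrm1; apply: le_trans (sum_le_const (c := (L + nD * (L * `|E|)) * r) _) _ => // l.
rewrite /incr mulrDl; apply: le_trans (ler_normD _ _) _; apply: lerD.
  by rewrite normrM (ger0_norm rr) mulrC; apply: ler_pM.
rewrite normrM (ger0_norm r0) mulrC ler_wpM2r//.
apply: norm_sum_le_const => k; rewrite normrM; apply: ler_pM => //.
by apply: le_trans (epsE g k) _; exact: ler_norm.
Qed.

Let wE g l : incr g l = r ^+ 2 * bq l + r * (\sum_k sq l k * eps g k).
Proof. by []. Qed.

Variables (h : pt R I -> R) (h1 : I -> pt R I -> R) (h2 : I -> I -> pt R I -> R).
Hypothesis H1 : UD h h1.
Hypothesis H2 : forall l, UD (h1 l) (h2 l).
Hypothesis HM : forall l m p, `|h2 l m p| <= M.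

Let T1 g : `|h (padd q (incr g)) - h q - \sum_l incr g l * h1 l q| <= M * (cl ^+ 2 * r ^+ 2).
Proof.
have n0 := nrm1_ge0 (incr g); have wn := incr_le g; have cr : 0 <= cl * r by exact: mulr_ge0.
apply: le_trans (taylor1 (w := M * (cl * r)) H1 _) _.
  move=> x l /andP[x0 x1]; apply: le_trans (lip_bound (H2 l) (fun y j _ => HM l j _)) _.
  rewrite ler_wpM2l// nrm1_scale ger0_norm//.
  by apply: le_trans wn; rewrite ler_piMl.
have -> : M * (cl ^+ 2 * r ^+ 2) = M * (cl * r) * (cl * r) by ring.
by rewrite ler_wpM2l// mulr_ge0.
Qed.

Lemma gradient_noise k :
  `|r^-1 * avg (fun g => eps g k * h (padd q (incr g))) - \sum_l sq l k * h1 l q|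
    <= `|E| * (M * cl ^+ 2) * r.
Proof.
have E1 : avg (fun g => eps g k * h (padd q (incr g))) =
    avg (fun g => eps g k * (h (padd q (incr g)) - h q - \sum_l incr g l * h1 l q))
    + r * \sum_l sq l k * h1 l q.
  rewrite (@eq_avg _ _ (fun g => eps g k * (h (padd q (incr g)) - h q - \sum_l incr g l * h1 l q))
    (fun g => eps g k * h (padd q (incr g)) - eps g k * h q - \sum_l eps g k * incr g l * h1 l q)).
    rewrite !avgB avgZr eps0 mul0r subr0 avg_sum mulr_sumr.
    rewrite [X in _ = _ - X + _](eq_bigr (fun l => r * (sq l k * h1 l q))); first by rewrite subrK.
    by move=> l _; rewrite avgZr (avg_eps_noise eps0 epscov wE) mulrA.
  move=> g; rewrite !mulrBr mulr_sumr; congr (_ - _).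
  by apply: eq_bigr => l _; rewrite mulrA.
rewrite E1 mulrDr mulKf ?gt_eqF// addrK normrM gtr0_norm ?invr_gt0//.
rewrite mulrC ler_pdivrMr//; apply: norm_avg_le => // g.
rewrite normrM; have -> : `|E| * (M * cl ^+ 2) * r * r = `|E| * (M * (cl ^+ 2 * r ^+ 2)) by ring.
by apply: ler_pM => //; apply: le_trans (epsE g k) _; exact: ler_norm.
Qed.

Variable eta : R.
Hypothesis Hmod : forall v l m, nrm1 v <= cl * r -> `|h2 l m (padd q v) - h2 l m q| <= eta.

(** The counterpart of [avg_generator] for functions without third derivatives: a modulus of
    continuity [eta] of the second derivatives at the scale of the displacement replaces them. A
    competing solution is only known to have Hoelder continuous second derivatives. *)
Lemma generator_noise :
  `|avg (fun g => h (padd q (incr g))) - h q - r ^+ 2 * (\sum_l bq l * h1 l q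
     + 2^-1 * \sum_l \sum_m (\sum_k sq l k * sq m k) * h2 l m q)|
  <= r ^+ 2 * (eta * cl ^+ 2 + nI * (nI * (L * L * M)) * r).
Proof.
pose T g := h (padd q (incr g)) - h q - \sum_l incr g l * h1 l q
  - 2^-1 * \sum_l \sum_m incr g l * incr g m * h2 l m q.
have T2 g : `|T g| <= eta * cl ^+ 2 * r ^+ 2.
  have n0 := nrm1_ge0 (incr g); have wn := incr_le g; have cr : 0 <= cl * r by exact: mulr_ge0.
  have e0 : (0 < #|I|)%N -> 0 <= eta.
    case/card_gt0P => l _; apply: le_trans (Hmod (v := fun _ => 0) l l _); first exact: normr_ge0.
    by rewrite /nrm1 big1// => j _; rewrite normr0.
  apply: le_trans (taylor2 (w := eta) H1 H2 _) _.
    move=> x a c /andP[x0 x1]; apply: Hmod; rewrite nrm1_scale ger0_norm//.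
    by apply: le_trans wn; rewrite ler_piMl.
  have [I0|/e0 e1] := posnP #|I|.
    have z : nrm1 (incr g) = 0 by rewrite /nrm1 big1// => l _; have := fintype0 l I0.
    have -> : cl = 0 by rewrite /cl /nI I0 mul0r.
    by rewrite z expr0n /= !(mulr0, mul0r).
  rewrite -mulrA ler_wpM2l// -exprMn lerXn2r ?nnegrE//.
have e2 : avg (fun g => \sum_l incr g l * h1 l q) = r ^+ 2 * \sum_l bq l * h1 l q.
  rewrite avg_sum mulr_sumr; apply: eq_bigr => l _.
  by rewrite avgZr (avg_noise G0 eps0 wE) mulrA.
have e3 : avg (fun g => \sum_l \sum_m incr g l * incr g m * h2 l m q)
  = r ^+ 2 * (\sum_l \sum_m (\sum_k sq l k * sq m k) * h2 l m q)
    + r ^+ 2 * r ^+ 2 * (\sum_l \sum_m bq l * bq m * h2 l m q).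
  rewrite avg_sum !mulr_sumr -big_split; apply: eq_bigr => l _ /=.
  rewrite avg_sum !mulr_sumr -big_split; apply: eq_bigr => m _ /=.
  by rewrite avgZr (avg_noise2 G0 eps0 epscov wE); ring.
have e4 : avg T = avg (fun g => h (padd q (incr g))) - h q - r ^+ 2 * (\sum_l bq l * h1 l q)
    - 2^-1 * avg (fun g => \sum_l \sum_m incr g l * incr g m * h2 l m q).
  by rewrite /T !avgB avg_cst// e2 avgZ.
pose X := avg (fun g => h (padd q (incr g))); pose Z := \sum_l bq l * h1 l q.
pose W := \sum_l \sum_m (\sum_k sq l k * sq m k) * h2 l m q.
pose V := \sum_l \sum_m bq l * bq m * h2 l m q.
rewrite -/X -/Z -/W; rewrite -/X -/Z in e4; rewrite -/W -/V in e3.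
have -> : X - h q - r ^+ 2 * (Z + 2^-1 * W) = avg T + 2^-1 * (r ^+ 2 * r ^+ 2 * V).
  by rewrite e4 e3; field.
apply: le_trans (ler_normD _ _) _; rewrite mulrDr; apply: lerD.
  by rewrite mulrC; apply: norm_avg_le.
have hV : `|V| <= nI * (nI * (L * L * M)).
  apply: norm_sum_le_const => l; apply: norm_sum_le_const => m.
  by rewrite !normrM; apply: ler_pM => //; exact: ler_pM.
have B0 : 0 <= nI * (nI * (L * L * M)) by exact: le_trans hV.
have c0 : 0 <= 2^-1 * (r ^+ 2 * r ^+ 2) by apply: mulr_ge0; [lra | exact: mulr_ge0].
rewrite (mulrA 2^-1) normrM (ger0_norm c0).
have -> : r ^+ 2 * (nI * (nI * (L * L * M)) * r) = r ^+ 2 * r * (nI * (nI * (L * L * M))) by ring.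
apply: ler_pM => //.
apply: (@le_trans _ _ (r ^+ 2 * r ^+ 2)); last by rewrite ler_wpM2l.
by rewrite ler_piMl ?mulr_ge0//; lra.
Qed.

End OneStep.

Definition cmpC : R := L * (nD + 1).
Definition cmpK : R := eC A cmpC + 4 * nA.
(** In this order: the expansion in time, the oscillation of the second derivatives, the squared
    drift, and the replacement of the gradient by a weighted average. *)
Definition cmp_err (eta eta' M r : R) : R :=
  eta' + eta * cl ^+ 2 + nI * (nI * (L * L * M)) * r + L * (nA * (nD * (`|E| * (M * cl ^+ 2) * r))).

Let cmpC0 : 0 <= cmpC. Proof. by rewrite mulr_ge0// addr_ge0. Qed.

(** The functions need not come from the scheme; they satisfy it up to a small error. The gradient
    in the bound of [gam] is traded for [r^-1] times standard deviations, which the energy estimate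
    absorbs in the variance. The difference of the diagonal values enters through [kap] only. *)
Lemma comparison_step (r M kap Phi eta eta' : R) (bq : I -> R) (sq : I -> D -> R) (q : pt R I)
    (h : A -> pt R I -> R) (h1 : A -> I -> pt R I -> R) (h2 : A -> I -> I -> pt R I -> R)
    (gam y : A -> R) :
  0 < r <= 1 -> (forall l, `|bq l| <= L) -> (forall l k, `|sq l k| <= L) -> 0 <= M ->
  0 <= kap -> 0 <= eta -> 0 <= eta' -> 24 * nA ^+ 2 * cmpC ^+ 2 * r ^+ 2 <= 1 ->
  (forall i, UD (h i) (h1 i)) -> (forall i l, UD (h1 i l) (h2 i l)) ->
  (forall i l m p, `|h2 i l m p| <= M) ->
  (forall v i l m, nrm1 v <= cl * r -> `|h2 i l m (padd q v) - h2 i l m q| <= eta) ->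
  (forall i, `|gam i| <= L * (kap + \sum_i' \sum_k `|\sum_l sq l k * h1 i' l q|)) ->
  (forall i, `|y i - h i q - r ^+ 2 * (\sum_l bq l * h1 i l q
     + 2^-1 * (\sum_l \sum_m (\sum_k sq l k * sq m k) * h2 i l m q) + gam i)| <= r ^+ 2 * eta') ->
  (forall p, \sum_i h i p ^+ 2 <= Phi) ->
  \sum_i y i ^+ 2 <= Phi + cmpK * r ^+ 2 * (Phi + kap ^+ 2 + cmp_err eta eta' M r ^+ 2).
Proof.
move=> r01 bL sL M0 k0 e0 e0' small H1 H2 HM Hmod Hg Hy HP.
have /andP[r_gt0 r1] := r01; have r0 := ltW r_gt0; have rr := sqr_ge0 r.
pose X i g := h i (padd q (incr r bq sq g)).
have z_le i k : `|\sum_l sq l k * h1 i l q| <= r^-1 * sd (X i) + `|E| * (M * cl ^+ 2) * r.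
  rewrite -(subrK (r^-1 * avg (fun g => eps g k * X i g)) (\sum_l _)) addrC.
  apply: le_trans (ler_normD _ _) _; apply: lerD; last first.
    by rewrite distrC; exact: (gradient_noise q r01 bL sL M0 (H1 i) (H2 i) (HM i) k).
  rewrite normrM gtr0_norm ?invr_gt0// ler_wpM2l ?invr_ge0//.
  by apply: (avg_mul_centered G0 (X i) (eps0 k)); rewrite (eps_sqr epscov).
pose Sd := \sum_i sd (X i); pose e2 := `|E| * (M * cl ^+ 2) * r.
have Sd0 : 0 <= Sd by apply: sumr_ge0 => i _; exact: sd_ge0.
have zsum : \sum_i \sum_k `|\sum_l sq l k * h1 i l q| <= r^-1 * (nD * Sd) + nA * (nD * e2).
  apply: (@le_trans _ _ (\sum_i nD * (r^-1 * sd (X i) + e2))).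
    by apply: ler_sum => i _; apply: sum_le_const => k; exact: z_le.
  rewrite -mulr_sumr big_split /= -mulr_sumr sumr_const -[_ *+ #|_|]mulr_natl -/Sd.
  by rewrite le_eqVlt; apply/orP; left; apply/eqP; rewrite -/nA; ring.
pose th := r ^+ 2 * cmp_err eta eta' M r.
have err0 : 0 <= cmp_err eta eta' M r.
  rewrite /cmp_err; do !apply: addr_ge0 => //; do ?apply: mulr_ge0 => //; rewrite ?exprn_ge0//.
  all: do ?apply: mulr_ge0 => //; rewrite ?exprn_ge0//.
  all: do ?apply: mulr_ge0 => //; rewrite ?exprn_ge0//.
  all: do ?apply: mulr_ge0 => //; rewrite ?exprn_ge0//.
have th0 : 0 <= th by exact: mulr_ge0.
have P0 : 0 <= Phi by apply: le_trans (HP q); exact: sum_sqr_ge0.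
have HY i : `|y i - avg (X i)| <= cmpC * r * Sd + cmpC * r ^+ 2 * (kap + Num.sqrt Phi) + th.
  have hgen := generator_noise (q := q) r01 bL sL (H1 i) (H2 i) (HM i) (fun v l m => Hmod v i l m).
  set GG := \sum_l bq l * h1 i l q + _ in hgen.
  have hy := Hy i; rewrite -/GG in hy.
  have hg : `|gam i| <= L * (kap + (r^-1 * (nD * Sd) + nA * (nD * e2))).
    by apply: le_trans (Hg i) _; rewrite ler_wpM2l// lerD2l.
  have -> : y i - avg (X i) = (y i - h i q - r ^+ 2 * (GG + gam i))
      - (avg (X i) - h i q - r ^+ 2 * GG) + r ^+ 2 * gam i by ring.
  apply: le_trans (ler_normD _ _) _; apply: le_trans (lerD (ler_normB _ _) (lexx _)) _.
  rewrite [`|r ^+ 2 * _|]normrM (ger0_norm rr).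
  apply: le_trans (lerD (lerD hy hgen) (ler_wpM2l rr hg)) _.
  have re : r ^+ 2 * (L * (kap + (r^-1 * (nD * Sd) + nA * (nD * e2)))) =
    L * nD * r * Sd + L * r ^+ 2 * kap + r ^+ 2 * (L * (nA * (nD * e2))).
    by field; rewrite gt_eqF.
  rewrite re /th /cmp_err -/e2 /cmpC.
  have p1 := mulr_ge0 (mulr_ge0 L0 r0) Sd0.
  have p2 := mulr_ge0 (mulr_ge0 (mulr_ge0 L0 nD0) rr) k0.
  have p3 := mulr_ge0 (mulr_ge0 (mulr_ge0 L0 (addr_ge0 nD0 ler01)) rr) (sqrtr_ge0 Phi).
  by nra.
have := step_energy_sup (B := A) (X := X) G0 cmpC0 r0 k0 th0 small _ HY.
move=> /(_ (fun g => HP _)) H; apply: le_trans H _.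
have V0 : 0 <= \sum_i vr (X i) by apply: sumr_ge0 => i _; exact: vr_ge0.
have hP : avg (fun g => \sum_i X i g ^+ 2) <= Phi by apply: avg_le => // g; exact: HP.
have eC0 : 0 <= eC A cmpC by exact: eC_ge0.
have sP : Num.sqrt Phi ^+ 2 = Phi by exact: sqr_sqrtr.
pose w := cmp_err eta eta' M r; rewrite -/w in err0 *.
have q1 : 2 * nA * Num.sqrt Phi * th <= r ^+ 2 * (nA * (Phi + w ^+ 2)).
  rewrite /th -/w; have -> : 2 * nA * Num.sqrt Phi * (r ^+ 2 * w) = r ^+ 2 * (nA * (2 * Num.sqrt Phi * w)) by ring.
  rewrite ler_wpM2l// ler_wpM2l//; have := sqr_ge0 (Num.sqrt Phi - w).
  have -> : (Num.sqrt Phi - w) ^+ 2 = Phi + w ^+ 2 - 2 * Num.sqrt Phi * w by rewrite -{2}sP; ring.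
  lra.
have q2 : 3 * nA * th ^+ 2 <= r ^+ 2 * (3 * nA * w ^+ 2).
  rewrite /th -/w; have -> : 3 * nA * (r ^+ 2 * w) ^+ 2 = r ^+ 2 * (r ^+ 2 * (3 * nA * w ^+ 2)) by ring.
  rewrite ler_wpM2l// ler_piMl ?mulr_ge0 ?sqr_ge0//.
  by rewrite expr_le1.
have q3 : 0 <= eC A cmpC * (r ^+ 2 * w ^+ 2) by rewrite !mulr_ge0 ?sqr_ge0.
have q4 : 0 <= r ^+ 2 * (nA * kap ^+ 2) by rewrite !mulr_ge0 ?sqr_ge0.
have q5 : 0 <= r ^+ 2 * (nA * Phi) by rewrite !mulr_ge0.
rewrite /cmpK -/nA.
have -> : (eC A cmpC + 4 * nA) * r ^+ 2 * (Phi + kap ^+ 2 + w ^+ 2) =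
  eC A cmpC * (r ^+ 2 * (kap ^+ 2 + Phi)) + eC A cmpC * (r ^+ 2 * w ^+ 2)
  + 4 * (r ^+ 2 * (nA * Phi)) + 4 * (r ^+ 2 * (nA * kap ^+ 2)) + 4 * (r ^+ 2 * (nA * w ^+ 2)) by ring.
have q6 : r ^+ 2 * (nA * (Phi + w ^+ 2)) = r ^+ 2 * (nA * Phi) + r ^+ 2 * (nA * w ^+ 2) by ring.
have q7 : r ^+ 2 * (3 * nA * w ^+ 2) = 3 * (r ^+ 2 * (nA * w ^+ 2)) by ring.
rewrite q6 in q1; rewrite q7 in q2.
lra.
Qed.

Section Iteration.
Variables (T s0 : R) (b : R -> I -> pt R I -> R) (s : R -> I -> D -> pt R I -> R).
Hypothesis bL : forall x l q, s0 <= x <= T -> `|b x l q| <= L.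
Hypothesis sL : forall x l k q, s0 <= x <= T -> `|s x l k q| <= L.
Hypothesis s00 : 0 <= s0.

(** The properties are uniform over times and points of one slice but come without rates: the step
    size is chosen afterwards, and the constants may depend on the slice. *)
Record tame (u us : R -> A -> pt R I -> R) (u1 : R -> A -> I -> pt R I -> R)
    (u2 : R -> A -> I -> I -> pt R I -> R) : Prop := Tame {
  tm_UD0 : forall x i, s0 <= x <= T -> UD (u x i) (u1 x i);
  tm_UD1 : forall x i l, s0 <= x <= T -> UD (u1 x i l) (u2 x i l);
  tm_bdd : exists2 M, 0 <= M & forall x i l m p, s0 <= x <= T -> `|u2 x i l m p| <= M;
  tm_mod : forall eta, 0 < eta -> exists2 dl, 0 < dl & forall x i l m p v, s0 <= x <= T -> nrm1 v <= dl ->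
    `|u2 x i l m (padd p v) - u2 x i l m p| <= eta;
  tm_time : forall eta, 0 < eta -> exists2 dl, 0 < dl & forall x h i p, s0 <= x - h -> x <= T ->
    0 <= h <= dl -> `|u (x - h) i p - u x i p + h * us x i p| <= eta * h }.

Variables (u us : R -> A -> pt R I -> R) (u1 : R -> A -> I -> pt R I -> R)
  (u2 : R -> A -> I -> I -> pt R I -> R) (gam : R -> A -> pt R I -> R) (Q : R).
Hypothesis tm : tame u us u1 u2.
Hypothesis Q0 : 0 <= Q.
Hypothesis sT : s0 < T.
Hypothesis uT : forall i p, u T i p = 0.
Hypothesis ueq : forall x i p, s0 <= x <= T -> us x i p = - (\sum_l b x l p * u1 x i l p
     + 2^-1 * (\sum_l \sum_m (\sum_k s x l k p * s x m k p) * u2 x i l m p) + gam x i p).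
Hypothesis Hgam : forall x i p, s0 <= x <= T ->
  `|gam x i p| <= L * (Num.sqrt (Q * expR (3 * cmpK * (T - x))) + \sum_i' \sum_k `|\sum_l s x l k p * u1 x i' l p|).

Lemma comparison p : \sum_i u s0 i p ^+ 2 <= 2^-1 * Q * expR (3 * cmpK * (T - s0)).
Proof.
have K0 : 0 <= cmpK by rewrite addr_ge0 ?mulr_ge0 ?eC_ge0.
have [M M0 HM] := tm_bdd tm.
apply/ler_addgt0Pr => e e0.
pose eK := expR (cmpK * T); have eK0 : 0 < eK by exact: expR_gt0.
(* The admissible error per unit of time, so small that its accumulated effect, [w ^+ 2] times at
   most [eK], stays below e. *)
pose w : R := Num.min 1 (e / eK).
have w0 : 0 < w by rewrite lt_min ltr01 divr_gt0.
have w2 : w ^+ 2 * eK <= e.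
  apply: (@le_trans _ _ (w * eK)).
    by rewrite ler_wpM2r ?(ltW eK0)// expr2 ler_piMl ?(ltW w0)// ge_min lexx.
  by rewrite -ler_pdivlMr// ge_min lexx orbT.
pose c1 := cl ^+ 2 + 1.
pose c2 := nI * (nI * (L * L * M)) + L * (nA * (nD * (`|E| * (M * cl ^+ 2)))) + 1.
have c1p : 0 < c1 by rewrite ltr_wpDl ?sqr_ge0.
have c2p : 0 < c2.
  have h1 : 0 <= nI * (nI * (L * L * M)) by do !apply: mulr_ge0.
  have h2 : 0 <= L * (nA * (nD * (`|E| * (M * cl ^+ 2)))).
    by do ?apply: mulr_ge0 => //; rewrite ?sqr_ge0.
  by rewrite ltr_wpDl// addr_ge0.
have w3 : 0 < w / 3 by rewrite divr_gt0.
pose eta := w / 3 / c1; have eta0 : 0 < eta by rewrite divr_gt0.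
have [dx dx0 Hx] := tm_mod tm eta0.
have [dt dt0 Ht] := tm_time tm w3.
pose c3 := 24 * nA ^+ 2 * cmpC ^+ 2 + 1.
have c3p : 0 < c3.
  have h1 := sqr_ge0 nA; have h2 := sqr_ge0 cmpC; have := mulr_ge0 h1 h2.
  by rewrite /c3 -mulrA => h3; lra.
(* Besides 1, the entries make the errors linear in r at most [w / 3], keep displacements within the
   modulus of the second derivatives, keep the time step within that of the time expansion, and
   satisfy the smallness condition of the energy estimate. *)
pose rmax := Num.min (Num.min 1 (w / 3 / c2)) (Num.min (Num.min 1 (dx / (cl + 1))) (Num.min dt (c3^-1))).
have cl1 : 0 < cl + 1 by rewrite ltr_wpDl.
have rm0 : 0 < rmax.
  have k1 : 0 < w / 3 / c2 by exact: divr_gt0.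
  have k2 : 0 < dx / (cl + 1) by exact: divr_gt0.
  have k3 : 0 < c3^-1 by rewrite invr_gt0.
  by rewrite /rmax !lt_min ltr01 k1 k2 dt0 k3.
have rm1 : rmax <= 1 by rewrite !ge_min lexx.
have rm2 : rmax <= w / 3 / c2 by rewrite !ge_min lexx !orbT.
have rm3 : rmax <= dx / (cl + 1) by rewrite !ge_min lexx !orbT.
have rm4 : rmax <= dt by rewrite !ge_min lexx !orbT.
have rm5 : rmax <= c3^-1 by rewrite !ge_min lexx !orbT.
have TS : 0 < T - s0 by rewrite subr_gt0.
pose n := (Num.truncn ((T - s0) / rmax ^+ 2)).+1.
have n0 : 0 < n%:R :> R by rewrite ltr0n.
pose h := (T - s0) / n%:R; have h0 : 0 < h by rewrite divr_gt0.
have hr : h <= rmax ^+ 2.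
  rewrite /h ler_pdivrMr// -ler_pdivrMl ?exprn_gt0// mulrC.
  by apply: ltW; apply: truncnS_gt.
pose r := Num.sqrt h; have r2 : r ^+ 2 = h by rewrite sqr_sqrtr// ltW.
have r0 : 0 < r by rewrite sqrtr_gt0.
have rrm : r <= rmax by rewrite -[leRHS](ger0_norm (ltW rm0)) -(sqrtr_sqr rmax) ler_wsqrtr.
have r01 : 0 < r <= 1 by rewrite r0 (le_trans rrm).
have hrm : h <= rmax by apply: le_trans hr _; rewrite expr2 ler_piMl// ltW.
have err : cmp_err eta (w / 3) M r <= w.
  have a1 : eta * cl ^+ 2 <= w / 3.
    by rewrite /eta mulrAC ler_pdivrMr// ler_wpM2l ?(ltW w3)// lerDl.
  have a2 : c2 * r <= w / 3 by rewrite mulrC -ler_pdivlMr// (le_trans rrm).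
  have r00 := ltW r0.
  have -> : cmp_err eta (w / 3) M r = w / 3 + eta * cl ^+ 2 + (c2 * r - r).
    by rewrite /cmp_err /c2; ring.
  lra.
have err0 : 0 <= cmp_err eta (w / 3) M r.
  have e1 := ltW eta0; have e2 := ltW w3; have e3 := ltW r0.
  rewrite /cmp_err; do !apply: addr_ge0 => //; do ?apply: mulr_ge0 => //; rewrite ?sqr_ge0//.
  all: do ?apply: mulr_ge0 => //; rewrite ?sqr_ge0//.
  all: do ?apply: mulr_ge0 => //; rewrite ?sqr_ge0//.
  all: do ?apply: mulr_ge0 => //; rewrite ?sqr_ge0//.
pose tau (j : nat) := T - j%:R * h.
have nh : n%:R * h = T - s0 by rewrite /h mulrCA mulfV ?mulr1// gt_eqF.
have tauI j : (j <= n)%N -> s0 <= tau j <= T.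
  move=> jn; have : j%:R * h <= n%:R * h by rewrite ler_wpM2r ?(ltW h0)// ler_nat.
  have : 0 <= j%:R * h by rewrite mulr_ge0// ltW.
  by rewrite nh /tau => a1 a2; apply/andP; split; lra.
have tauS j : tau j.+1 = tau j - h by rewrite /tau -natr1; ring.
(* The squared bound [kap ^+ 2] of the diagonal equals 2 y, so one step increases y by at most
   [cmpK * h] times 3 y: this is the exponent [3 * cmpK]. As the terminal values vanish, y may start
   at half of Q, which is the gain of the factor 1/2. The accumulated errors are collected in z. *)
pose y j := 2^-1 * Q * expR (3 * cmpK * (j%:R * h)).
pose z j := w ^+ 2 * ((1 + cmpK * h) ^+ j - 1).
have key j : (j <= n)%N -> forall q, \sum_i u (tau j) i q ^+ 2 <= y j + z j.
  elim: j => [_ q|j IH jn q].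
    rewrite big1 => [|i _]; last by rewrite /tau mul0r subr0 uT expr0n.
    by rewrite /z expr0 subrr mulr0 addr0 /y !mulr_ge0// ltW// expR_gt0.
  have jn' := ltnW jn; have tI := tauI j jn'; have tI' := tauI _ jn.
  have kE : Num.sqrt (Q * expR (3 * cmpK * (T - tau j))) ^+ 2 = 2 * y j.
    rewrite sqr_sqrtr; last by rewrite mulr_ge0// ltW// expR_gt0.
    have -> : T - tau j = j%:R * h by rewrite /tau; ring.
    by rewrite /y; field.
  have st := @comparison_step r M (Num.sqrt (Q * expR (3 * cmpK * (T - tau j)))) (y j + z j) eta (w / 3)
    (fun l => b (tau j) l q) (fun l k => s (tau j) l k q) q (u (tau j)) (u1 (tau j)) (u2 (tau j))
    (fun i => gam (tau j) i q) (fun i => u (tau j.+1) i q).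
  apply: le_trans (st r01 _ _ M0 (sqrtr_ge0 _) (ltW eta0) (ltW w3) _ _ _ _ _ _ _ (IH jn')) _.
  - by move=> l; exact: bL.
  - by move=> l k; exact: sL.
  - rewrite r2; apply: (@le_trans _ _ (c3 * h)); first by rewrite ler_wpM2r ?(ltW h0)// /c3 lerDl.
    by rewrite mulrC -ler_pdivlMr// mul1r (le_trans hrm).
  - by move=> i; exact: (tm_UD0 tm).
  - by move=> i l; exact: (tm_UD1 tm).
  - by move=> i l m q'; exact: HM.
  - move=> v i l m hv; apply: Hx => //; apply: le_trans hv _.
    apply: (@le_trans _ _ ((cl + 1) * r)); first by rewrite ler_wpM2r ?(ltW r0)// lerDl.
    by rewrite mulrC -ler_pdivlMr// (le_trans rrm).
  - by move=> i; exact: Hgam.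
  - move=> i; rewrite r2 tauS.
    have ht : `|u (tau j - h) i q - u (tau j) i q + h * us (tau j) i q| <= w / 3 * h.
      apply: Ht; first by rewrite -tauS; case/andP: tI'.
        by case/andP: tI.
      by rewrite (ltW h0) (le_trans hrm).
    by rewrite ueq// mulrN in ht; rewrite [leRHS]mulrC.
  rewrite kE r2.
  have q1 : cmpK * h * cmp_err eta (w / 3) M r ^+ 2 <= cmpK * h * w ^+ 2.
    apply: ler_wpM2l; first exact: mulr_ge0 K0 (ltW h0).
    by rewrite lerXn2r ?nnegrE// ltW.
  have yS : y j * (1 + 3 * cmpK * h) <= y j.+1.
    have -> : y j.+1 = y j * expR (3 * cmpK * h).
      by rewrite /y -[in RHS]mulrA -expRD; congr (_ * expR _); rewrite -natr1; ring.
    by rewrite ler_wpM2l ?expR_ge1Dx// /y !mulr_ge0// ltW// expR_gt0.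
  have zS : z j.+1 = z j + cmpK * h * (z j + w ^+ 2) by rewrite /z (exprS (1 + cmpK * h)); ring.
  rewrite zS; move: q1 yS; set err2 := cmp_err _ _ _ _ ^+ 2.
  have -> : cmpK * h * (y j + z j + 2 * y j + err2) =
    y j * (3 * cmpK * h) + cmpK * h * z j + cmpK * h * err2 by ring.
  by rewrite !mulrDr !mulr1; lra.
have := key n (leqnn n) p.
have -> : tau n = s0 by rewrite /tau nh; ring.
rewrite /y nh => H; apply: le_trans H _; rewrite lerD2l; apply: le_trans w2.
rewrite ler_wpM2l ?sqr_ge0//; apply: (@le_trans _ _ ((1 + cmpK * h) ^+ n)); first by rewrite lerBlDr lerDl.
have := @pow_le_exp R cmpK r T n n K0; rewrite r2 nh; apply => //.
by rewrite lerBlDr lerDl.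
Qed.

End Iteration.
End Comparison.

(** * Uniqueness *)

Lemma nnsup_ge0 (R : realType) (A : set \bar R) : (0 <= nnsup A)%E.
Proof. by apply: ereal_sup_ubound; left. Qed.

Lemma nnsup_bound (R : realType) (A : set \bar R) : (nnsup A < +oo)%E ->
  exists2 c : R, 0 <= c & forall r, A r -> (r <= c%:E)%E.
Proof.
move=> h; have h0 := nnsup_ge0 A; exists (fine (nnsup A)); first exact: fine_ge0.
move=> r Ar; rewrite fineK; last by rewrite ge0_fin_numE.
by apply: ereal_sup_ubound; right.
Qed.

(** * Slices of a solution in the given Hoelder class *)

Section RegularSlice.
Variables (R : realType) (n m : nat) (S T alpha : R) (phi : R -> 'cV[R]_n -> 'cV[R]_m).
Hypothesis a01 : 0 < alpha < 1.
Hypothesis ST : S < T.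
Hypothesis reg : C2holder S T phi alpha.
Hypothesis phic : {within [set p : R * 'cV[R]_n | p.1 \in `[S, T]], continuous (fun p => phi p.1 p.2)}.

Definition of_pt (q : pt R 'I_n) : 'cV[R]_n := \col_a q a.

Let hd : has_derivatives S T phi. Proof. by case: reg. Qed.

Lemma regular_bounds : exists2 c : R, 0 <= c &
  [/\ forall s x i j l, S <= s <= T -> `|hess (phi s) x i j l| <= c,
      forall s x x' i j l, S <= s <= T -> 0 < enorm (x - x') <= 1 ->
        `|hess (phi s) x i j l - hess (phi s) x' i j l| <= c * enorm (x - x') `^ alpha &
      forall s s' x i, S <= s <= T -> S <= s' <= T ->
        `|fs S T phi s x i 0 - fs S T phi s' x i 0| <= c * `|s - s'| `^ (alpha / 2)].
Proof.
case: reg => _; rewrite /norm_2holder /norm_2 /norm_1 /holder.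
set n0 := norm_sup _ _ phi; set n1 := norm_sup _ _ (fx phi).
set n2 := norm_sup _ _ (fs S T phi); set n3 := norm_sup _ _ (fxx phi).
set h1 := holder_s _ _ (fs S T phi) _; set h2 := holder_x _ _ (fs S T phi) _.
set h3 := holder_s _ _ (fxx phi) _; set h4 := holder_x _ _ (fxx phi) _.
set h5 := holder_s _ _ (fx phi) _.
have [p0 p1 p2] : [/\ (0 <= n0)%E, (0 <= n1)%E & (0 <= n2)%E] by split; exact: nnsup_ge0.
have [p3 p4 p5] : [/\ (0 <= n3)%E, (0 <= h1)%E & (0 <= h2)%E] by split; exact: nnsup_ge0.
have [p6 p7 p8] : [/\ (0 <= h3)%E, (0 <= h4)%E & (0 <= h5)%E] by split; exact: nnsup_ge0.
(* Finiteness of the full norm is passed down to the single seminorms, from the outermost sum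
   inwards. *)
have addoo (a c : \bar R) : (0 <= a)%E -> (0 <= c)%E -> (a + c < +oo)%E -> (a < +oo)%E /\ (c < +oo)%E.
  by move=> a0 c0 h; split; apply: le_lt_trans h; rewrite ?leeDl ?leeDr.
have q1 : (0 <= n0 + n1)%E by exact: adde_ge0.
have q2 : (0 <= n0 + n1 + n2)%E by exact: adde_ge0.
have q3 : (0 <= n0 + n1 + n2 + n3)%E by exact: adde_ge0.
have q4 : (0 <= n0 + n1 + n2 + n3 + (h1 + h2))%E by rewrite !adde_ge0.
have q5 : (0 <= n0 + n1 + n2 + n3 + (h1 + h2) + (h3 + h4))%E by rewrite !adde_ge0.
move=> /(addoo _ _ q5 p8)[/(addoo _ _ q4 (adde_ge0 p6 p7))[/(addoo _ _ q3 (adde_ge0 p4 p5))[/(addoo _ _ q2 p3)[_ f3]]]].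
move=> /(addoo _ _ p4 p5)[g1 _] /(addoo _ _ p6 p7)[_ g4] _.
have [c3 c30 H3] := nnsup_bound f3; have [c1 c10 H1] := nnsup_bound g1; have [c4 c40 H4] := nnsup_bound g4.
have [F FE] : exists F, F = fxx phi by exists (fxx phi).
have fxxE s x i j l : hess (phi s) x i j l = F s x i (mxvec_index j l).
  by rewrite FE /fxx /d2 mxE mxvecE.
rewrite /n3 /h4 -FE in H3 H4; clear n3 h4 p3 p7 q3 q4 q5 f3 g4 FE.
exists (c3 + c1 + c4); first by rewrite !addr_ge0.
split.
- move=> s x i j l sT; rewrite fxxE; apply: le_trans (coord_le_enorm _ _ _) _.
  have := H3 (enorm (F s x))%:E; rewrite lee_fin => h.
  by apply: le_trans (h _) _; [exists s, x; rewrite in_itv /= | rewrite -addrA lerDl addr_ge0].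
- move=> s x x' i j l sT xx.
  rewrite (congr2 (fun a e : R => a - e) (fxxE s x i j l) (fxxE s x' i j l)).
  have := H4 (enorm (F s x - F s x') / enorm (x - x') `^ alpha)%:E; rewrite lee_fin => h.
  have xp : 0 < enorm (x - x') `^ alpha by apply: powR_gt0; case/andP: xx.
  have := h _; rewrite ler_pdivrMr// => h'.
  apply: (@le_trans _ _ (enorm (F s x - F s x'))).
    by have := coord_le_enorm (F s x - F s x') i (mxvec_index j l); rewrite !mxE.
  apply: le_trans (h' _) _; first by exists s, x, x'; rewrite in_itv /=.
  by rewrite ler_wpM2r ?(ltW xp)// lerDr addr_ge0.
- move=> s s' x i sT sT'; have [->|ss] := eqVneq s s'.
    by rewrite subrr normr0 mulr_ge0 ?addr_ge0 ?powR_ge0.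
  have := H1 (enorm (fs S T phi s x - fs S T phi s' x) / `|s - s'| `^ (alpha / 2))%:E; rewrite lee_fin => h.
  have sp : 0 < `|s - s'| `^ (alpha / 2) by apply: powR_gt0; rewrite normr_gt0 subr_eq0.
  have := h _; rewrite ler_pdivrMr// => h'.
  apply: (@le_trans _ _ (enorm (fs S T phi s x - fs S T phi s' x))).
    by have := coord_le_enorm (fs S T phi s x - fs S T phi s' x) i 0; rewrite !mxE.
  apply: le_trans (h' _) _; first by exists s, s', x; rewrite !in_itv /=.
  by rewrite ler_wpM2r ?(ltW sp)// addrAC lerDr addr_ge0.
Qed.

Let u x i q : R := phi x (of_pt q) i 0.
Let us x i q : R := fs S T phi x (of_pt q) i 0.
Let u1 x i a q : R := fx phi x (of_pt q) i a.
Let u2 x i a a' q : R := hess (phi x) (of_pt q) i a' a.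

Lemma of_pt_line q y j : of_pt (padd q (pscale y (unit_pt R j))) = of_pt q + y *: dir R j.
Proof.
apply/colP => a; rewrite !mxE /padd /pscale /unit_pt !eqxx andbT.
by rewrite eq_sym.
Qed.

Lemma has_dder_entry (h : 'cV[R]_n -> 'cV[R]_m) q j i : derivable h (of_pt q) (dir R j) ->
  has_dder (fun y : R => h (of_pt (padd q (pscale y (unit_pt R j)))) i 0) 0 1 ('D_(dir R j) h (of_pt q) i 0).
Proof.
move=> /derivableP /has_dderP H e e0; have [dl dl0 Hd] := H e e0; exists dl => // y hy.
rewrite add0r !of_pt_line scale0r addr0 [y *: 1]mulr1.
apply: le_trans (Hd y hy); set M := (X in _ <= `|X|).
have -> : h (of_pt q + y *: dir R j) i 0 - h (of_pt q) i 0 - y * 'D_(dir R j) h (of_pt q) i 0 = M i 0.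
  by rewrite /M; move: ('D_(dir R j) h (of_pt q)) => DD; rewrite !mxE.
exact: coord_le_norm.
Qed.

Lemma slice_partials x i : S <= x <= T -> has_partials (u x i) (u1 x i).
Proof.
move=> xT q j; have [] := hd (of_pt q) (s := x); first by rewrite in_itv.
move=> _ [d1 _].
by have := has_dder_entry i (d1 j); rewrite /u1 /fx /jac mxE.
Qed.

Lemma slice_partials2 x i l : S <= x <= T -> has_partials (u1 x i l) (u2 x i l).
Proof.
move=> xT q j; have [] := hd (of_pt q) (s := x); first by rewrite in_itv.
move=> _ [_ d2].
have := has_dder_entry i (d2 j l); rewrite /u2 /hess mxE.
suff -> : u1 x i l = fun q => 'D_(dir R l) (phi x) (of_pt q) i 0 by [].
by apply/funext => q'; rewrite /u1 /fx /jac mxE.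
Qed.

Lemma of_pt_sub q v : of_pt (padd q v) - of_pt q = of_pt v.
Proof. by apply/colP => a; rewrite !mxE /padd addrC addKr. Qed.

Lemma enorm_of_pt v : enorm (of_pt v) <= nrm1 v * (n * 1)%:R.
Proof.
apply: enorm_le => [|i j]; first exact: nrm1_ge0.
by rewrite ord1 mxE; apply: (le_sum_term (a := fun j => `|v j|)).
Qed.

Lemma time_derive_entry s q i : S < s < T -> is_derive s 1 (fun s : R => u s i q) (us s i q).
Proof.
move=> /andP[Ss sT]; have sI : S <= s <= T by rewrite !ltW.
have [] := hd (of_pt q) (s := s); first by rewrite in_itv.
move=> dd _.
have cv : dquot (phi^~ (of_pt q)) s @ within `[S, T] s^' --> fs S T phi s (of_pt q).
  by rewrite /fs /derive_in ST; exact: dd.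
apply/has_dderP => e e0; move/cvgrPdist_le: cv => /(_ e e0).
rewrite /within /dnbhs /within /= => /nbhs_ballP[d /= d0 Hd].
exists (Num.min d (Num.min (s - S) (T - s))); first by rewrite !lt_min d0 !subr_gt0 Ss.
move=> h; rewrite !lt_min => /and3P[h1 h2 h3].
have [->|hn] := eqVneq h 0.
  by rewrite scale0r addr0 subrr sub0r scale0r normrN normr0 mulr0.
have hE : s + h *: 1 = s + h by rewrite [h *: 1]mulr1.
move: h2 h3; rewrite !ltr_norml => /andP[h2 h2'] /andP[h3 h3'].
have hI : S <= s + h <= T by apply/andP; split; lra.
have := Hd (s + h); rewrite -ball_normE /= opprD addrA subrr sub0r normrN in_itv /=.
move=> /(_ h1 _ hI); rewrite -subr_eq0 addrC addKr => /(_ hn).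
rewrite hE => hh.
have key (V : 'cV[R]_m) : u (s + h) i q - u s i q - h * V i 0 =
    - (h * (V - dquot (phi^~ (of_pt q)) s (s + h)) i 0).
  by rewrite /dquot /u !mxE (addrC s) addrK; field.
rewrite [h *: _]/(h * _) /us key.
rewrite normrN normrM mulrC ler_wpM2r//; apply: le_trans hh; exact: coord_le_norm.
Qed.

Lemma time_continuous q i x y : S <= x -> y <= T ->
  {within `[x, y], continuous (fun s : R => u s i q)}.
Proof.
move=> Sx yT; apply/subspace_continuousP => s; rewrite /= in_itv /= => /andP[xs sy].
have sI : S <= s <= T by rewrite (le_trans Sx)// (le_trans sy).
move/subspace_continuousP: phic => /(_ (s, of_pt q)); rewrite /= in_itv /= => /(_ sI) cv.
apply/cvgrPdist_le => e e0; move/cvgrPdist_le: cv => /(_ e e0).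
rewrite /within /= => /nbhs_ballP[d /= d0 Hd]; apply/nbhs_ballP; exists d => //= s' hs'.
rewrite in_itv /= => /andP[xs' sy'].
have := Hd (s', of_pt q); rewrite -ball_normE /=.
rewrite in_itv /= (le_trans Sx xs') (le_trans sy' yT) => H.
apply: le_trans (H _ _) => //.
  by have := coord_le_norm (phi s (of_pt q) - phi s' (of_pt q)) i 0; rewrite !mxE.
rewrite prod_normE /= subrr normr0 gt_max d0 andbT.
by move: hs'; rewrite -ball_normE.
Qed.

(** The expansion in time comes from the mean value theorem on [x - h, x], which asks for
    derivatives inside and continuity up to the end points. Hoelder continuity of the time
    derivative makes the remainder uniform. *)
Lemma slice_tame : tame T S u us u1 u2.
Proof.
have [c c0 [B2 BH BT]] := regular_bounds; have /andP[a0 a1] := a01.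
have c1 : 0 < c + 1 by rewrite ltr_wpDl.
have md eta : 0 < eta -> exists2 dl, 0 < dl & forall x i l m p v, S <= x <= T -> nrm1 v <= dl ->
    `|u2 x i l m (padd p v) - u2 x i l m p| <= eta.
  move=> e0; pose e1 := eta / (c + 1); have e10 : 0 < e1 by rewrite divr_gt0.
  have p0 : 0 < e1 `^ alpha^-1 by exact: powR_gt0.
  have n1 : 0 < (n * 1)%:R + 1 :> R by rewrite ltr_wpDl.
  (* The minimum with 1 is due to the seminorm in x, which only compares points at distance at most
     1. *)
  exists (Num.min 1 (e1 `^ alpha^-1) / ((n * 1)%:R + 1)); first by rewrite divr_gt0// lt_min ltr01.
  move=> x i l k p v xT hv.
  have n0 := nrm1_ge0 v.
  have hw : enorm (of_pt v) <= Num.min 1 (e1 `^ alpha^-1).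
    apply: le_trans (enorm_of_pt v) _; move: hv; rewrite ler_pdivlMr// => hv.
    by apply: le_trans hv; rewrite ler_wpM2l// lerDl.
  have w0 := enorm_ge0 (of_pt v).
  have [z|z] := eqVneq (enorm (of_pt v)) 0.
    have -> : padd p v = p.
      apply/funext => a; have := coord_le_enorm (of_pt v) a 0; rewrite z mxE normr_le0 => /eqP v0.
      by rewrite /padd v0 addr0.
    by rewrite subrr normr0 ltW.
  have h := BH x (of_pt (padd p v)) (of_pt p) i k l xT; rewrite of_pt_sub in h.
  apply: le_trans (h _) _.
    by rewrite lt_neqAle eq_sym z w0 (le_trans hw)// ge_min lexx.
  have k1 : enorm (of_pt v) `^ alpha <= e1.
    have <- : (e1 `^ alpha^-1) `^ alpha = e1 by rewrite -powRrM mulVf ?lt0r_neq0// powRr1// ltW.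
    apply: ge0_ler_powR; rewrite ?nnegrE ?powR_ge0//; first exact: ltW.
    by apply: le_trans hw _; rewrite ge_min lexx orbT.
  apply: (@le_trans _ _ (c * e1)); first by rewrite ler_wpM2l.
  by rewrite /e1 mulrCA ger_pMr// ler_pdivrMr// mul1r lerDl.
split.
- move=> x i xT; apply: partials_UD (slice_partials i xT) _ => e e0.
  exists (e / (3 * c + 1)); first by rewrite divr_gt0// ltr_wpDl// mulr_ge0.
  move=> p v j hv; apply: le_trans (partials_lip (C := c) (slice_partials2 i j xT) _ p v) _.
    by move=> a q; exact: B2.
  apply: (@le_trans _ _ ((3 * c + 1) * nrm1 v)); first by rewrite ler_wpM2r ?nrm1_ge0// lerDl.
  by rewrite mulrC -ler_pdivlMr// ltr_wpDl// mulr_ge0.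
- move=> x i l xT; apply: partials_UD (slice_partials2 i l xT) _ => e e0.
  by have [dl dl0 H] := md e e0; exists dl => // p v j hv; exact: H.
- by exists c => // x i l k p xT; exact: B2.
- exact: md.
- move=> eta e0; pose e1 := eta / (c + 1); have e10 : 0 < e1 by rewrite divr_gt0.
  have b0 : 0 < alpha / 2 by rewrite divr_gt0.
  exists (e1 `^ (alpha / 2)^-1); first exact: powR_gt0.
  move=> x h i q Sx xT /andP[h0 hd'].
  have [->|hn] := eqVneq h 0; first by rewrite subr0 subrr add0r mul0r normr0 mulr0.
  have hp : 0 < h by rewrite lt_neqAle eq_sym hn.
  have lt1 : x - h < x by rewrite ltrBlDr ltrDl.
  have dI s : s \in `]x - h, x[ -> is_derive s 1 (fun s : R => u s i q) (us s i q).
    by rewrite in_itv /= => /andP[s1 s2]; apply: time_derive_entry; apply/andP; split; lra.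
  have [y yI E] := MVT lt1 dI (@time_continuous q i (x - h) x Sx xT).
  move: yI; rewrite in_itv /= => /andP[y1 y2].
  have -> : u (x - h) i q - u x i q + h * us x i q = h * (us x i q - us y i q).
    have -> : u (x - h) i q = u x i q - us y i q * (x - (x - h)) by rewrite -E; ring.
    by ring.
  rewrite normrM (ger0_norm h0) mulrC ler_wpM2r//.
  apply: le_trans (BT _ _ _ _ _ _) _; try by apply/andP; split; lra.
  apply: (@le_trans _ _ (c * e1)); last by rewrite /e1 mulrCA ger_pMr// ler_pdivrMr// mul1r lerDl.
  rewrite ler_wpM2l//.
  have <- : (e1 `^ (alpha / 2)^-1) `^ (alpha / 2) = e1.
    by rewrite -powRrM mulVf ?lt0r_neq0// powRr1// ltW.
  apply: ge0_ler_powR; rewrite ?nnegrE ?powR_ge0//; first exact: ltW.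
  by apply: le_trans hd'; rewrite ger0_norm; lra.
Qed.

End RegularSlice.

Lemma UD_sub (R : realType) (J : finType) (f g : pt R J -> R) (f' g' : J -> pt R J -> R) :
  UD f f' -> UD g g' -> UD (fun p => f p - g p) (fun j p => f' j p - g' j p).
Proof.
move=> Hf Hg e e0; have e2 : 0 < e / 2 by rewrite divr_gt0.
have [d1 d10 H1] := Hf _ e2; have [d2 d20 H2] := Hg _ e2.
exists (Num.min d1 d2); first by rewrite lt_min d10.
move=> p v; rewrite le_min => /andP[h1 h2].
have -> : f (padd p v) - g (padd p v) - (f p - g p) - \sum_j v j * (f' j p - g' j p) =
    (f (padd p v) - f p - \sum_j v j * f' j p) - (g (padd p v) - g p - \sum_j v j * g' j p).
  rewrite (eq_bigr (fun j => v j * f' j p - v j * g' j p)) => [|j _]; last by rewrite mulrBr.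
  by rewrite sumrB; ring.
apply: le_trans (ler_normB _ _) _; apply: le_trans (lerD (H1 _ _ h1) (H2 _ _ h2)) _.
by rewrite -mulrDl -splitr.
Qed.

Lemma tame_sub (R : realType) (I A : finType) (T s0 : R) u us u1 u2 v vs v1 v2 :
  @tame R I A T s0 u us u1 u2 -> tame T s0 v vs v1 v2 ->
  tame T s0 (fun x i p => u x i p - v x i p) (fun x i p => us x i p - vs x i p)
    (fun x i l p => u1 x i l p - v1 x i l p) (fun x i l k p => u2 x i l k p - v2 x i l k p).
Proof.
case=> a1 a2 [M M0 a3] a4 a5 [b1 b2 [N N0 b3] b4 b5]; split.
- by move=> x i xT; apply: UD_sub; [exact: a1 | exact: b1].
- by move=> x i l xT; apply: UD_sub; [exact: a2 | exact: b2].
- exists (M + N); first exact: addr_ge0.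
  move=> x i l k p xT; apply: le_trans (ler_normB _ _) _.
  by apply: lerD; [exact: a3 | exact: b3].
- move=> e e0; have e2 : 0 < e / 2 by rewrite divr_gt0.
  have [d1 d10 H1] := a4 _ e2; have [d2 d20 H2] := b4 _ e2.
  exists (Num.min d1 d2); first by rewrite lt_min d10.
  move=> x i l k p w xT; rewrite le_min => /andP[h1 h2].
  have -> : u2 x i l k (padd p w) - v2 x i l k (padd p w) - (u2 x i l k p - v2 x i l k p) =
    (u2 x i l k (padd p w) - u2 x i l k p) - (v2 x i l k (padd p w) - v2 x i l k p) by ring.
  apply: le_trans (ler_normB _ _) _; rewrite [leRHS]splitr.
  by apply: lerD; [exact: H1 | exact: H2].
- move=> e e0; have e2 : 0 < e / 2 by rewrite divr_gt0.
  have [d1 d10 H1] := a5 _ e2; have [d2 d20 H2] := b5 _ e2.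
  exists (Num.min d1 d2); first by rewrite lt_min d10.
  move=> x h i p xs xT /andP[h0]; rewrite le_min => /andP[h1 h2].
  have -> : u (x - h) i p - v (x - h) i p - (u x i p - v x i p) + h * (us x i p - vs x i p) =
    (u (x - h) i p - u x i p + h * us x i p) - (v (x - h) i p - v x i p + h * vs x i p) by ring.
  apply: le_trans (ler_normB _ _) _; rewrite [e]splitr mulrDl.
  by apply: lerD; [apply: H1 | apply: H2] => //; rewrite h0.
Qed.

Lemma tame_mono (R : realType) (I A : finType) (T s0 s1 : R) u us u1 u2 : s0 <= s1 ->
  @tame R I A T s0 u us u1 u2 -> tame T s1 u us u1 u2.
Proof.
move=> s01 [a1 a2 [M M0 a3] a4 a5].
have dom x : s1 <= x <= T -> s0 <= x <= T by move=> /andP[h ->]; rewrite (le_trans s01 h).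
split.
- by move=> x i /dom; exact: a1.
- by move=> x i l /dom; exact: a2.
- by exists M => // x i l k p /dom; exact: a3.
- by move=> e /a4[d d0 H]; exists d => // x i l k p v /dom; exact: H.
- by move=> e /a5[d d0 H]; exists d => // x h i p xs; apply: H; exact: le_trans xs.
Qed.

Section DataBounds.
Variables (R : realType) (n m d : nat) (T : R).
Variables (b : R -> 'cV[R]_n -> 'cV[R]_n) (sigma : R -> 'cV[R]_n -> 'M[R]_(n, d)).
Variables (psi : R -> 'cV[R]_n -> 'cV[R]_n -> 'cV[R]_m)
  (g : R -> R -> 'cV[R]_n -> 'cV[R]_n -> 'cV[R]_m -> 'M[R]_(m, d) -> 'cV[R]_m).
Hypothesis d0 : (0 < d)%N.
Hypothesis T0 : 0 < T.

Record data_bound (L : R) : Prop := DataBound {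
  db_b : forall s x a, 0 <= s <= T -> `|b s x a 0| <= L;
  db_s : forall s x a c, 0 <= s <= T -> `|sigma s x a c| <= L;
  db_g : forall t s xi x y z i, 0 <= t -> t <= s <= T -> `|g t s xi x y z i 0| <= L;
  db_g_lip : forall t s xi x y y' z z' i, 0 <= t -> t <= s <= T ->
    `|g t s xi x y z i 0 - g t s xi x y' z' i 0| <=
      L * (\sum_j `|y j 0 - y' j 0| + \sum_j \sum_c `|z j c - z' j c|) }.

Definition mk_args (xi x : 'cV[R]_n) (y : 'cV[R]_m) (z : 'M[R]_(m, d)) : pt R (args n m d) :=
  fun c => match c with
  | inl (inl (inl a)) => xi a 0 | inl (inl (inr a)) => x a 0
  | inl (inr j) => y j 0 | inr jc => z jc.1 jc.2 end.

Lemma lim_gE t s xi x y z i : 0 <= t -> t <= s <= T ->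
  lim_g T g s t i (mk_args xi x y z) = g t s xi x y z i 0.
Proof.
move=> t0 /andP[ts sT]; rewrite /lim_g (min_idPl ts) !clamp_id ?t0 ?sT ?(le_trans ts)// ?(le_trans t0)//.
congr (g _ _ _ _ _ _ _ _).
- by apply/colP => a; rewrite mxE.
- by apply/colP => a; rewrite mxE.
- by apply/colP => a; rewrite mxE.
- by apply/matrixP => a c; rewrite mxE.
Qed.

(** The bounds are inherited from the shrunk data by passing to the limit. Thus they hold up to the
    boundary of the time domain, where [Cb] offers no derivatives. *)
Lemma smooth_data_bound : smooth_b T 4 b -> smooth_sigma T 4 sigma -> smooth_psi T 4 psi ->
  smooth_g T 4 g -> exists2 L, 0 <= L & data_bound L.
Proof.
move=> Hb Hs Hp Hg; have [[L L0 ld] _] := data_limit d0 T0 Hb Hs Hp Hg.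
exists L => //; split.
- move=> s x a sT; have := ld_b ld s (inr a) (mk_state 0 x).
  by rewrite /lim_b x_of_mk clamp_id.
- move=> s x a c sT; have := ld_s ld s (inr a) c (mk_state 0 x).
  by rewrite /lim_sigma x_of_mk clamp_id.
- move=> t s xi x y z i t0 ts; rewrite -lim_gE//; exact: (ld_f ld).
- move=> t s xi x y y' z z' i t0 ts; rewrite -!lim_gE//.
  have := ld_f_lip ld s s t i (mk_args xi x y z) (mk_args xi x y' z').
  rewrite subrr normr0 add0r; congr (_ <= L * _).
  rewrite /nrm1 !big_sumType /= [X in X + _ + _ + _]big1 => [|a _]; last by rewrite subrr normr0.
  rewrite [X in 0 + X + _ + _]big1 => [|a _]; last by rewrite subrr normr0.
  by rewrite !add0r; congr (_ + _); rewrite pair_bigA.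
Qed.

End DataBounds.

Section Uniqueness.
Variables (R : realType) (n m d : nat) (T alpha L : R).
Variables (b : R -> 'cV[R]_n -> 'cV[R]_n) (sigma : R -> 'cV[R]_n -> 'M[R]_(n, d)).
Variables (psi : R -> 'cV[R]_n -> 'cV[R]_n -> 'cV[R]_m)
  (g : R -> R -> 'cV[R]_n -> 'cV[R]_n -> 'cV[R]_m -> 'M[R]_(m, d) -> 'cV[R]_m).
Hypothesis d0 : (0 < d)%N.
Hypothesis a01 : 0 < alpha < 1.
Hypothesis L0 : 0 <= L.
Hypothesis db : data_bound T b sigma g L.
Variables (Theta Theta' : R -> R -> 'cV[R]_n -> 'cV[R]_n -> 'cV[R]_m).
Hypothesis reg : regular_solution T b sigma psi g alpha Theta.
Hypothesis reg' : regular_solution T b sigma psi g alpha Theta'.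

(** Large enough for two purposes: [2 * L] bounds the difference of two values of g, and the factor
    [m%:R + 1] allows for the sum of the diagonal differences over the components. *)
Let Lc : R := (2 * L + 1) * (m%:R + 1).
Let lam : R := 3 * cmpK 'I_m 'I_d Lc.
Let m0 : 0 <= m%:R :> R. Proof. exact: ler0n. Qed.
Let Lc1 : 1 <= Lc.
Proof. by rewrite /Lc; have := m0; have := mulr_ge0 L0 m0; have := L0 => *; rewrite !mulrDr !mulrDl; lra. Qed.
Let LLc : 2 * L <= Lc.
Proof. by rewrite /Lc; have := m0; have := mulr_ge0 L0 m0; have := L0 => *; rewrite !mulrDr !mulrDl; lra. Qed.

Let close (Q : R) := forall t s xi x, 0 <= t -> t <= s -> s < T ->
  \sum_i (Theta t s xi x i 0 - Theta' t s xi x i 0) ^+ 2 <= Q * expR (lam * (T - s)).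

Let slice_eq Th t xi x s i : regular_solution T b sigma psi g alpha Th -> 0 <= t -> t < T -> t <= s <= T ->
  fs t T (slice Th t xi) s x i 0 = - (\sum_a b s x a 0 * fx (slice Th t xi) s x i a
     + 2^-1 * (\sum_a \sum_a' (\sum_c sigma s x a c * sigma s x a' c) * hess (slice Th t xi s) x i a' a)
     + along sigma g Th t xi s x i 0).
Proof.
move=> [[_ eqn _] _] t0 tT /andP[ts sT].
have := eqn t s xi x; cbv zeta => /(_ (And3 t0 ts sT) tT) /(congr1 (fun v : 'cV[R]_m => v i 0)).
have mE (u v w y : 'cV[R]_m) : (u + 2^-1 *: v + w + y) i 0 = u i 0 + 2^-1 * v i 0 + w i 0 + y i 0.
  by rewrite !mxE.
rewrite mE quadE [(0 : 'cV_m) i 0]mxE.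
have -> : (fx (slice Th t xi) s x *m b s x) i 0 = \sum_a b s x a 0 * fx (slice Th t xi) s x i a.
  by rewrite mxE; apply: eq_bigr => a _; rewrite mulrC.
move: (fs _ _ _ _ _ _ _) (\sum_a b s x a 0 * _) (\sum_a _) (along _ _ _ _ _ _ _ _ _) => p1 p2 p3 p4.
by lra.
Qed.

Let compare (Q : R) t s0 xi : 0 <= Q -> 0 <= t -> t <= s0 -> s0 < T ->
  (forall x i p, s0 <= x <= T ->
    `|along sigma g Theta t xi x (of_pt p) i 0 - along sigma g Theta' t xi x (of_pt p) i 0| <=
     Lc * (Num.sqrt (Q * expR (lam * (T - x))) + \sum_i' \sum_k `|\sum_l sigma x (of_pt p) l k *
       (fx (slice Theta t xi) x (of_pt p) i' l - fx (slice Theta' t xi) x (of_pt p) i' l)|)) ->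
  forall x, \sum_i (Theta t s0 xi x i 0 - Theta' t s0 xi x i 0) ^+ 2 <= 2^-1 * Q * expR (lam * (T - s0)).
Proof.
move=> Q0 t0 ts sT Hg x; have tT : t < T by exact: le_lt_trans sT.
have tT' : 0 <= t < T by rewrite t0.
have tI : t \in `[0, T] by rewrite in_itv /= t0 ltW.
have dom y : s0 <= y <= T -> 0 <= y <= T by move=> /andP[h ->]; rewrite (le_trans t0)// (le_trans ts).
have dom' y : s0 <= y <= T -> t <= y <= T by move=> /andP[h ->]; rewrite (le_trans ts h).
have LLc' : L <= Lc by apply: le_trans LLc; have := L0; lra.
have tame_of Th : regular_solution T b sigma psi g alpha Th -> tame T s0
    (fun y i q => slice Th t xi y (of_pt q) i 0) (fun y i q => fs t T (slice Th t xi) y (of_pt q) i 0)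
    (fun y i a q => fx (slice Th t xi) y (of_pt q) i a)
    (fun y i a a' q => hess (slice Th t xi y) (of_pt q) i a' a).
  move=> [[h _ _] h']; apply: tame_mono ts _; apply: (slice_tame a01 tT (h' t xi tT')).
  by case: (h t xi tI).
have tm := tame_sub (tame_of _ reg) (tame_of _ reg').
have H := @comparison R 'I_n 'I_m 'I_d _ (@noise R d) (Num.sqrt d%:R) Lc (noise_card d0)
  (@noise_bound R d) (@noise_mean R d) (noise_cov R d0) Lc1 T s0
  (fun y a q => b y (of_pt q) a 0) (fun y a c q => sigma y (of_pt q) a c) _ _ (le_trans t0 ts)
  _ _ _ _ (fun y i q => along sigma g Theta t xi y (of_pt q) i 0 - along sigma g Theta' t xi y (of_pt q) i 0)
  Q tm Q0 sT.
have -> : x = of_pt (fun a => x a 0) by apply/colP => a; rewrite mxE.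
apply: H.
- by move=> y l q yT; apply: le_trans LLc'; apply: (db_b db); exact: dom.
- by move=> y l k q yT; apply: le_trans LLc'; apply: (db_s db); exact: dom.
- move=> i p; case: reg => [[_ _ tc] _]; case: reg' => [[_ _ tc'] _].
  by rewrite /slice tc// tc'// subrr.
- move=> y i p yT; have yt := dom' y yT; rewrite !slice_eq//.
  rewrite [X in _ = - (X + _ + _)](eq_bigr (fun l => b y (of_pt p) l 0 * fx (slice Theta t xi) y (of_pt p) i l
    - b y (of_pt p) l 0 * fx (slice Theta' t xi) y (of_pt p) i l)) => [|l _]; last by rewrite mulrBr.
  rewrite sumrB.
  have fin (u v w u' v' w' z : R) : z = v - v' ->
      - (u + 2^-1 * v + w) - - (u' + 2^-1 * v' + w') = - (u - u' + 2^-1 * z + (w - w')).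
    by move=> ->; ring.
  have e2 : \sum_l \sum_k (\sum_c sigma y (of_pt p) l c * sigma y (of_pt p) k c) *
      (hess (slice Theta t xi y) (of_pt p) i k l - hess (slice Theta' t xi y) (of_pt p) i k l) =
    \sum_l \sum_k (\sum_c sigma y (of_pt p) l c * sigma y (of_pt p) k c) * hess (slice Theta t xi y) (of_pt p) i k l
    - \sum_l \sum_k (\sum_c sigma y (of_pt p) l c * sigma y (of_pt p) k c) * hess (slice Theta' t xi y) (of_pt p) i k l.
    by rewrite -sumrB; apply: eq_bigr => l _; rewrite -sumrB; apply: eq_bigr => k _; rewrite mulrBr.
  exact: fin e2.
- exact: Hg.
Qed.

(** Solutions are bounded on each slice, but the class provides no bound uniform in (t, xi), so the
    difference on the diagonal is not controlled beforehand. The induction starts because g is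
    bounded: whatever the diagonal values are, the two generators differ by at most [2 * L]. *)
Let close1 : close 1.
Proof.
move=> t s xi x t0 ts sT; have e0 : 0 <= expR (lam * (T - s)) by exact/ltW/expR_gt0.
apply: le_trans (compare (Q := 1) (xi := xi) ler01 t0 ts sT _ x) _; last by rewrite mulr1 mul1r; lra.
move=> y i p /andP[sy yT].
have yt : t <= y <= T by rewrite (le_trans ts).
have e1 : 1 <= Num.sqrt (1 * expR (lam * (T - y))).
  have lam0 : 0 <= lam * (T - y).
    rewrite mulr_ge0 ?subr_ge0// /lam mulr_ge0// /cmpK addr_ge0 ?mulr_ge0 ?ler0n// eC_ge0//.
    by rewrite /cmpC mulr_ge0 ?addr_ge0 ?ler0n// (le_trans ler01).
  by rewrite -{1}(@sqrtr1 R) ler_wsqrtr// mul1r -{1}(@expR0 R) ler_expR.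
apply: (@le_trans _ _ (2 * L)).
  rewrite mulr2n mulrDl mul1r; apply: le_trans (ler_normB _ _) _; apply: lerD; exact: (db_g db).
apply: (@le_trans _ _ (Lc * 1)); first by rewrite mulr1.
have L3 : 0 <= Lc by apply: le_trans Lc1.
rewrite ler_wpM2l//; apply: le_trans e1 _; rewrite lerDl.
by apply: sumr_ge0 => i' _; apply: sumr_ge0.
Qed.

Let close_half Q : 0 <= Q -> close Q -> close (2^-1 * Q).
Proof.
move=> Q0 H t s xi x t0 ts sT; apply: (compare Q0 t0 ts sT).
move=> y i p /andP[sy yT]; have yt : t <= y <= T by rewrite (le_trans ts).
have y0 : 0 <= y by rewrite (le_trans t0)// (le_trans ts).
apply: le_trans (db_g_lip db _ _ _ _ _ _ _ t0 yt) _.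
set X := Num.sqrt _; have X0 : 0 <= X by exact: sqrtr_ge0.
have h1 : \sum_j `|Theta y y (of_pt p) (of_pt p) j 0 - Theta' y y (of_pt p) (of_pt p) j 0| <= m%:R * X.
  have -> : m%:R = #|'I_m|%:R :> R by rewrite card_ord.
  (* At y = T, which [close] leaves out, both solutions equal the terminal data. *)
  apply: sum_le_const => j; have [yT'|yT'] := ltP y T; last first.
    have -> : y = T by apply/eqP; rewrite eq_le yT.
    have TT : T \in `[0, T] by rewrite in_itv /= lexx (le_trans y0).
    case: reg => [[_ _ tc] _]; case: reg' => [[_ _ tc'] _].
    by rewrite tc// tc'// subrr normr0.
  rewrite -sqrtr_sqr ler_wsqrtr//; apply: le_trans (H y y _ _ y0 (lexx y) yT').
  exact: (le_sum_sqr (fun j => Theta y y (of_pt p) (of_pt p) j 0 - Theta' y y (of_pt p) (of_pt p) j 0)).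
set Z := (Z in _ <= _ * (_ + Z)); have Z0 : 0 <= Z by apply: sumr_ge0 => i' _; apply: sumr_ge0.
have -> : \sum_j \sum_c `|(fx (slice Theta t xi) y (of_pt p) *m sigma y (of_pt p)) j c -
    (fx (slice Theta' t xi) y (of_pt p) *m sigma y (of_pt p)) j c| = Z.
  apply: eq_bigr => j _; apply: eq_bigr => c _; rewrite !mxE -sumrB; congr `|_|.
  by apply: eq_bigr => a _; ring.
have L2 := L0; apply: (@le_trans _ _ (L * (m%:R * X + Z))); first by rewrite ler_wpM2l// lerD2r.
have q1 := mulr_ge0 m0 X0; have q2 := mulr_ge0 m0 Z0.
apply: (@le_trans _ _ ((2 * L + 1) * ((m%:R + 1) * (X + Z)))); last by rewrite /Lc mulrA.
by apply: ler_pM => //; [exact: addr_ge0 | lra | rewrite mulrDl mul1r mulrDr; lra].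
Qed.

Theorem regular_unique t s xi x : Delta T (t, s) -> Theta' t s xi x = Theta t s xi x.
Proof.
case=> /= t0 ts sT; have [sT'|sT'] := ltP s T; last first.
  have -> : s = T by apply/eqP; rewrite eq_le sT.
  have tI : t \in `[0, T] by rewrite in_itv /= t0 (le_trans ts).
  case: reg => [[_ _ tc] _]; case: reg' => [[_ _ tc'] _].
  by rewrite tc// tc'.
have cl k : close (2^-1 ^+ k).
  elim: k => [|k IH]; first by rewrite expr0; exact: close1.
  by rewrite exprS; apply: close_half => //; rewrite exprn_ge0// invr_ge0.
have z : \sum_i (Theta t s xi x i 0 - Theta' t s xi x i 0) ^+ 2 <= 0.
  have e0 : 0 < expR (lam * (T - s)) by exact: expR_gt0.
  have lim : (fun k => 2^-1 ^+ k * expR (lam * (T - s))) @ \oo --> 0.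
    rewrite -(mul0r (expR (lam * (T - s)))); apply: cvgMl; apply: cvg_expr.
    by rewrite ger0_norm; lra.
  apply: (ler_cvg_to (cvg_cst _) lim); apply: nearW => k.
  exact: cl.
apply/colP => i; apply/eqP; rewrite eq_sym -subr_eq0 -sqrf_eq0 eq_le sqr_ge0 andbT.
apply: le_trans z; exact: (le_sum_sqr (fun i => Theta t s xi x i 0 - Theta' t s xi x i 0)).
Qed.

End Uniqueness.

(** * The theorem *)

Section NormBounds.
Variables (R : realType) (n : nat).
Local Open Scope ereal_scope.

Lemma norm_sup_le0 (p q : nat) (S T : R) (f : R -> 'cV[R]_n -> 'M[R]_(p, q)) : norm_sup S T f <= 0 ->
  forall s x, (S <= s <= T)%R -> f s x = 0%R.
Proof.
move=> h s x sT; have : (enorm (f s x))%:E <= 0.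
  apply: le_trans h; apply: ereal_sup_ubound; right.
  by exists s, x; split => //; rewrite in_itv.
rewrite lee_fin => h0; apply/matrixP => i j; apply/eqP; rewrite mxE -normr_le0.
by apply: le_trans h0; exact: coord_le_enorm.
Qed.

Lemma norm_2holder_ge_sup (m : nat) (S T : R) (f : R -> 'cV[R]_n -> 'cV[R]_m) alpha :
  norm_sup S T f <= norm_2holder S T f alpha.
Proof.
rewrite /norm_2holder /norm_2 /norm_1 /holder -!addeA leeDl//.
by repeat apply: adde_ge0; exact: nnsup_ge0.
Qed.

Lemma norm_2holder_ge0 (m : nat) (S T : R) (f : R -> 'cV[R]_n -> 'cV[R]_m) alpha :
  0 <= norm_2holder S T f alpha.
Proof. by apply: le_trans (norm_2holder_ge_sup _ _ _ _); exact: nnsup_ge0. Qed.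

Lemma norm_holder_ge_sup (p q : nat) (S T : R) (f : R -> 'cV[R]_n -> 'M[R]_(p, q)) alpha :
  norm_sup S T f <= norm_holder S T f alpha.
Proof. by rewrite /norm_holder /holder leeDl// adde_ge0// nnsup_ge0. Qed.

Lemma sup_txi_le (T : R) (F : R -> 'cV[R]_n -> \bar R) (c : \bar R) :
  (forall t xi, (0 <= t <= T)%R -> F t xi <= c) -> sup_txi T F <= c.
Proof. by move=> h; apply: ge_ereal_sup => r [t [xi [tT ->]]]; apply: h; rewrite in_itv in tT. Qed.

Lemma le_sup_txi (T : R) (F : R -> 'cV[R]_n -> \bar R) t xi : (0 <= t <= T)%R -> F t xi <= sup_txi T F.
Proof. by move=> tT; apply: ereal_sup_ubound; exists t, xi; rewrite in_itv. Qed.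

End NormBounds.

(** The system sees g only along [Theta] itself. Therefore a vanishing right-hand side of the
    stability estimate already turns [Theta] into a solution of the second system. *)
Lemma regular_ext (R : realType) (n m d : nat) (T alpha : R) b (sigma : R -> 'cV[R]_n -> 'M[R]_(n, d))
    psi psi' g g' (Theta : R -> R -> 'cV[R]_n -> 'cV[R]_n -> 'cV[R]_m) :
  (forall t xi x, 0 <= t <= T -> psi t xi x = psi' t xi x) ->
  (forall t s xi x, 0 <= t -> t <= s <= T -> along sigma g Theta t xi s x = along sigma g' Theta t xi s x) ->
  regular_solution T b sigma psi g alpha Theta -> regular_solution T b sigma psi' g' alpha Theta.
Proof.
move=> hp hg [[h1 h2 h3] h4]; split=> //; split=> // [t s xi x D tT|t xi x tT].
  have := h2 t s xi x D tT; cbv zeta; case: D => /= t0 ts sT.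
  by rewrite hg ?ts.
by rewrite h3// hp//; rewrite in_itv in tT.
Qed.

Theorem theorem5p2 (R : realType) (n m d : nat) (T alpha : R) :
  (0 < n)%N -> (0 < m)%N -> (0 < d)%N -> 0 < T -> 0 < alpha < 1 ->
  exists k : nat, (0 < k)%N /\
  forall (b : R -> 'cV[R]_n -> 'cV[R]_n)
         (sigma : R -> 'cV[R]_n -> 'M[R]_(n, d))
         (psi : R -> 'cV[R]_n -> 'cV[R]_n -> 'cV[R]_m)
         (g : R -> R -> 'cV[R]_n -> 'cV[R]_n -> 'cV[R]_m -> 'M[R]_(m, d) ->
              'cV[R]_m),
  smooth_b T k b -> smooth_sigma T k sigma ->
  smooth_psi T k psi -> smooth_g T k g ->
  elliptic T sigma ->
  exists Theta : R -> R -> 'cV[R]_n -> 'cV[R]_n -> 'cV[R]_m,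
  [/\ regular_solution T b sigma psi g alpha Theta,
      (forall Theta', regular_solution T b sigma psi g alpha Theta' ->
        forall t s xi x, Delta T (t, s) -> Theta' t s xi x = Theta t s xi x),
      (exists2 K : R, 0 < K &
        (sup_txi T (fun t xi => norm_2holder t T (slice Theta t xi) alpha)
         <= K%:E * (1 + sup_txi T (fun t xi =>
                          norm_2holder_x (psi t xi) alpha)))%E) &
      (forall (psi' : R -> 'cV[R]_n -> 'cV[R]_n -> 'cV[R]_m)
              (g' : R -> R -> 'cV[R]_n -> 'cV[R]_n -> 'cV[R]_m ->
                    'M[R]_(m, d) -> 'cV[R]_m)
              (Theta' : R -> R -> 'cV[R]_n -> 'cV[R]_n -> 'cV[R]_m),
        smooth_psi T k psi' -> smooth_g T k g' ->
        regular_solution T b sigma psi' g' alpha Theta' ->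
        exists2 K : R, 0 < K &
        (sup_txi T (fun t xi =>
           norm_2holder t T
             (fun s x => (slice Theta t xi s x - slice Theta' t xi s x)%R)
             alpha)
         <= K%:E * sup_txi T (fun t xi =>
              norm_2holder_x (fun x => (psi t xi x - psi' t xi x)%R) alpha
              + norm_holder t T
                  (fun s x => (along sigma g Theta t xi s x
                               - along sigma g' Theta t xi s x)%R)
                  alpha))%E)].
Proof.
(* Four derivatives are what [Cb_jets] requires of the data. *)
move=> n0 m0 d0 T0 a01; exists 4; split=> // b sigma psi g Hb Hs Hp Hg _.
have [Th0 cs [K nf]] := nice_solution_exists d0 T0 Hb Hs Hp Hg.
have nr := nice_family_regular T0 a01 nf.
have reg : regular_solution T b sigma psi g alpha Th0.
  by split=> // t xi /andP[t0 tT]; case: (nr t xi); rewrite ?t0 ?(ltW tT).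
exists Th0; split=> //.
- move=> Th' reg' t s xi x D; have [L L0 db] := smooth_data_bound d0 T0 Hb Hs Hp Hg.
  exact: (regular_unique d0 a01 L0 db reg reg').
- pose B := norm_factor n m (1 + T) * K; exists (`|B| + 1); first by rewrite ltr_wpDl.
  apply: (@le_trans _ _ B%:E); first by apply: sup_txi_le => t xi /(nr t xi)[].
  have s0 : (0 <= sup_txi T (fun t xi => norm_2holder_x (psi t xi) alpha))%E.
    apply: le_trans (le_sup_txi (t := 0) _ 0 _); first exact: norm_2holder_ge0.
    by rewrite lexx ltW.
  apply: (@le_trans _ _ ((`|B| + 1)%:E * 1)%E).
    by rewrite mule1 lee_fin; have := ler_norm B; lra.
  by apply: lee_wpmul2l; [rewrite lee_fin addr_ge0 | rewrite leeDl].
move=> psi' g' Th' Hp' Hg' reg'.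
have [Th cs' [K' nf']] := nice_solution_exists d0 T0 Hb Hs Hp' Hg'.
have regh : regular_solution T b sigma psi' g' alpha Th.
  by split=> // t xi /andP[t0 tT]; case: (nice_family_regular T0 a01 nf' (t := t) xi); rewrite ?t0 ?(ltW tT).
have [L' L0' db'] := smooth_data_bound d0 T0 Hb Hs Hp' Hg'.
pose D t xi (s : R) (x : 'cV[R]_n) := slice Th0 t xi s x - slice Th' t xi s x.
(* Uniform bounds are known for constructed solutions only. By uniqueness [Th'] agrees on the
   triangle with the solution [Th] constructed for the second data, and the bounds of the difference
   are transferred. *)
have Dn t xi : 0 <= t <= T -> exists phis P H, nice t T (K + K') (D t xi) phis P H.
  move=> tT; have [p1 [p2 [p3 h]]] := nf t xi tT; have [q1 [q2 [q3 h']]] := nf' t xi tT.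
  do 3!eexists; apply: (nice_ext (nice_sub h h')) => s x /andP[ts sT]; rewrite /D; congr (_ - _).
  by apply: (regular_unique d0 a01 L0' db' regh reg'); split=> //=; case/andP: tT.
pose B := norm_factor n m (1 + T) * (K + K').
have bound : (sup_txi T (fun t xi => norm_2holder t T (D t xi) alpha) <= B%:E)%E.
  apply: sup_txi_le => t xi tT; have [p1 [p2 [p3 h]]] := Dn t xi tT.
  by apply: (nice_norm h) => //; case/andP: tT => t0 _; lra.
set rhs := sup_txi T (fun t xi => (norm_2holder_x _ _ + _)%E).
have [rhs0|rhs0] := ltP 0%E rhs.
  (* The supremum on the right may be infinite; any positive real number below it serves to define
     the constant. *)
  have [c c0 crhs] : exists2 c : R, 0 < c & (c%:E <= rhs)%E.
    move: rhs0; case: (rhs) => [r||//]; first by exists r.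
    by exists 1 => //; rewrite leey.
  exists ((`|B| + 1) / c); first by rewrite divr_gt0// ltr_wpDl.
  apply: le_trans bound _; apply: (@le_trans _ _ (((`|B| + 1) / c)%:E * c%:E)%E).
    by rewrite -EFinM divfK ?gt_eqF// lee_fin; have := ler_norm B; lra.
  by apply: lee_wpmul2l => //; rewrite lee_fin divr_ge0 ?addr_ge0// ltW.
(* All terms are nonnegative, so each of them vanishes, and the sup norm contained in each gives
   pointwise equality. *)
have terms t xi : 0 <= t <= T ->
    (forall x, psi t xi x = psi' t xi x) /\
    (forall s x, t <= s <= T -> along sigma g Th0 t xi s x = along sigma g' Th0 t xi s x).
  move=> tT; have := le_trans (le_sup_txi _ xi tT) rhs0.
  set A1 := norm_2holder_x _ _; set A2 := norm_holder _ _ _ _ => A12.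
  have A10 : (0 <= A1)%E by exact: norm_2holder_ge0.
  have A20 : (0 <= A2)%E by apply: le_trans (norm_holder_ge_sup _ _ _ _); exact: nnsup_ge0.
  have A2le : (A2 <= A1 + A2)%E by rewrite leeDr.
  split=> [x|s x sT]; apply/eqP; rewrite -subr_eq0; apply/eqP.
    have h : (norm_sup 0 1 (fun (_ : R) x => psi t xi x - psi' t xi x)%R <= 0)%E.
      apply: le_trans (norm_2holder_ge_sup _ _ _ alpha) _; apply: le_trans A12.
      by rewrite leeDl.
    by apply: (norm_sup_le0 h (s := 0)); rewrite lexx ler01.
  have h := le_trans (norm_holder_ge_sup _ _ _ _) (le_trans A2le A12).
  exact: (norm_sup_le0 h).
exists 1 => //; apply: (@le_trans _ _ 0%E); last first.
  rewrite mul1e; apply: le_trans (le_sup_txi (t := 0) _ 0 _); last by rewrite lexx ltW.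
  by apply: adde_ge0; [exact: norm_2holder_ge0 | apply: le_trans (norm_holder_ge_sup _ _ _ _); exact: nnsup_ge0].
have reg2 : regular_solution T b sigma psi' g' alpha Th0.
  apply: (regular_ext _ _ reg) => [t xi x tT|t s xi x t0 ts].
    by case: (terms t xi tT).
  have tT : 0 <= t <= T by rewrite t0; case/andP: ts => h; exact: le_trans.
  by case: (terms t xi tT) => _; apply.
apply: sup_txi_le => t xi tT.
have z : nice t T 0 (D t xi) (fun _ _ => 0) (fun _ _ => 0) (fun _ _ _ => 0).
  apply: (nice_ext (nice_zero _ _ _ _)) => s x /andP[ts sT]; rewrite /D /slice.
  rewrite (regular_unique d0 a01 L0' db' reg2 reg') ?subrr//.
  by split=> //=; case/andP: tT.
have := nice_norm z (_ : 1 <= 1 + T) (_ : T - t <= 1 + T) a01.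
by rewrite mulr0; apply; case/andP: tT => t0 _; lra.
Qed.
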